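(* Let $(M,c,\sigma)$ be Poincar\'e--Einstein, $k\in\{0,1,\dots,\lfloor\frac{n-1}2\rfloor\}$, and let $A_\Sigma\in\Gamma\mathcal E^k\Sigma[2k-n]$, $\phi_\Sigma\in\Gamma\mathcal E^{k-1}\Sigma[2k-n-2]$ (given in a scale $g\in c$) satisfy $\boldsymbol\delta_\Sigma A_\Sigma=0=\boldsymbol\delta_\Sigma\phi_\Sigma$. Let $A_0\in\Gamma\mathcal E^kM[2k-n]$ be an extension satisfying the mixed Dirichlet--Neumann conditions $$A_0|_\Sigma=A_\Sigma,\qquad \big[\nabla_\nu\big(\iota(\nu)A_0\big)\big]\big|_\Sigma=-\phi_\Sigma ,$$ and let $q_WA_0\in\Gamma\mathcal T^kM[k-n]$. Then, with $h_0=2k-n+1$, $$\mathcal A=\,:\!K^{h_0}(z)\!:\,q_WA_0$$ is an order $\ell=\infty$ solution of the tractor Proca problem with leading term $q_WA_0$: for every $\ell$ there is $$\mathcal A^{(\ell)}=q_WA_0+\sigma\mathcal A_1+\sigma^2\mathcal A_2+\cdots+O(\sigma^{\ell+1}),\qquad \mathcal A_i\in\Gamma\mathcal T^kM[k-n-i],$$ agreeing modulo $O(\sigma^{\ell+1})$ with the truncation of $:\!K^{h_0}(z)\!:$ at order $z^\ell$ applied to $q_WA_0$, such that $y\mathcal A^{(\ell)}=O(\sigma^\ell)$ and $\mathscr I^\star\mathcal A^{(\ell)}=\widehat{\mathscr D}^\star\mathcal A^{(\ell)}=\mathscr X^\star\mathcal A^{(\ell)}=0$.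
   Context: Conformal conventions. $M$ is a smooth manifold of dimension $d=n+1\ge3$ with boundary $\Sigma$ and conformal class $c$; $c_\Sigma$ is the induced class on $\Sigma$. $\mathcal EM[w]$: conformal densities of weight $w$ (families $\mu_g$, $g\in c$, with $\mu_{\Omega^2g}=\Omega^w\mu_g$); each scale $g\in c$ trivialises them; indices are moved with the conformal metric $\boldsymbol g$. $\mathcal E^kM[w]=\Lambda^kT^*M\otimes\mathcal EM[w]$. In a scale $g$: $\varepsilon,\iota$ are exterior/interior multiplication, $\mathbf d=\varepsilon(\nabla)$, $\boldsymbol\delta=\iota(\nabla)$, $\boldsymbol\Delta=\mathbf d\boldsymbol\delta+\boldsymbol\delta\mathbf d$; $\mathrm{Ric}=(d-2)P+Jg$, $J=P^a{}_a$, and $\mathbb P$ is the endomorphism $P^a{}_b$ extended to forms as a derivation. Forms on $\Sigma$ are identified with forms along $\Sigma$ annihilated by $\iota(\nu)$. Poincar\'e--Einstein: $\sigma\in\Gamma\mathcal EM[1]$ is positive in the interior, vanishes exactly on $\Sigma$ with $\nabla\sigma\ne0$ there, and $g^o=\sigma^{-2}\boldsymbol g$ satisfies $\mathrm{Ric}(g^o)=-n g^o$. In a scale $g$: $\nu=\nabla\sigma$, $\rho=-\frac1d(\nabla^a\nabla_a\sigma+J\sigma)$. $O(\sigma^\alpha)$ means $\sigma^\alpha$ times a smooth section. Tractor forms. For $g\in c$, $\mathcal T^kM[w]\cong\mathcal E^{k-1}M[w+k]\oplus\mathcal E^kM[w+k]\oplus\mathcal E^{k-2}M[w+k-2]\oplus\mathcal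 E^{k-1}M[w+k-2]$; sections are $\mathcal F=(F^+,F,F^{+-},F^-)$ (north, west, east, south slots). Under $\hat g=\Omega^2g$, $\Upsilon=\mathbf d\log\Omega$: $\hat F^+=F^+$, $\hat F=F+\varepsilon(\Upsilon)F^+$, $\hat F^{+-}=F^{+-}-\iota(\Upsilon)F^+$, $\hat F^-=F^-+\frac12(\varepsilon(\Upsilon)\iota(\Upsilon)-\iota(\Upsilon)\varepsilon(\Upsilon))F^+-\iota(\Upsilon)F-\varepsilon(\Upsilon)F^{+-}$. Invariant operators on $\mathcal T^kM[w]$: $\mathscr X^\star\mathcal F=(0,F^+,0,F^{+-})$; $\mathscr I^\star\mathcal F=(-\iota(\nu)F^+-\sigma F^{+-},\ \rho F^++\iota(\nu)F+\sigma F^-,\ \iota(\nu)F^{+-},\ \rho F^{+-}-\iota(\nu)F^-)$; $\mathscr D:\Gamma\mathcal T^kM[w]\to\Gamma\mathcal T^{k+1}M[w-1]$ with slots north: $(d+2w-2)\big((w+k)F-\mathbf dF^+\big)$; west: $(d+2w-2)\mathbf dF$; east: $\big(\boldsymbol\Delta+(w+k-2)(J-2\mathbb P)\big)F^+-2\boldsymbol\delta F+(d+2w)\big(\mathbf dF^{+-}+(w+k-2)F^-\big)$; south: $[J-2\mathbb P,\mathbf d]F^+-\big(\boldsymbol\Delta+(w+k)(J-2\mathbb P)\big)F-(d+2w)\mathbf dF^-$. $y:=-(\mathscr I^\star\mathscr D+\mathscr D\mathscr I^\star):\Gamma\mathcal T^kM[w]\to\Gamma\mathcal T^kM[w-1]$;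 $x$ is multiplication by $\sigma$. On $\ker\mathscr X^\star$, $\widehat{\mathscr D}^\star(0,A,0,\phi)=(0,\ \boldsymbol\delta A+(d+w-k)\phi,\ 0,\ -\boldsymbol\delta\phi)$. Western insertion: for $w\ne k-d$ and $A\in\Gamma\mathcal E^kM[w+k]$, $q_W(A)=(0,A,0,-\frac1{d+w-k}\boldsymbol\delta A)\in\Gamma\mathcal T^kM[w]$ (so here, with $w=k-n$, $q_WA_0=(0,A_0,0,-\boldsymbol\delta A_0)$). Solution generating operator. $:\!z^j\!:\ =x^jy^j$ and $K^{h_0}(z)=\sum_{j\ge0}\frac{z^j}{j!\,(h_0-2)(h_0-3)\cdots(h_0-j-1)}$ (term $1$ for $j=0$).
   Formalization: The exact constraints I*A = D̂*A = X*A = 0 are proved on one open neighbourhood of Σ (the same for all ℓ), not on all of M; globally they fail, e.g. k=1 on the hyperbolic 4-ball with A_Σ=0 and φ_Σ a nonzero constant, by the divergence theorem. *)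

(* Defs.v *)
From HB Require Import structures.
From mathcomp Require Import all_boot all_order all_algebra.
From mathcomp Require Import all_classical all_reals all_analysis.
Set Implicit Arguments.
Unset Strict Implicit.
Unset Printing Implicit Defensive.
Import Order.TTheory GRing.Theory Num.Theory.
Import numFieldNormedType.Exports.
Local Open Scope classical_set_scope.
Local Open Scope ring_scope.

(* "the" x such that P x; every use below is a description whose value is
   unique, or is used only through expressions independent of the choice *)
Definition such_that (T : Type) (x0 : T) (P : set T) : T :=
  match pselect (exists x, P x) with
  | left h => projT1 (cid h)
  | right _ => x0
  end.

Definition partial (R : realType) (n : nat) (i : 'I_n.+1)
    (f : 'rV[R]_n.+1 -> R) : 'rV[R]_n.+1 -> R :=
  fun x => 'D_(delta_mx ord0 i) f x.

Definition smooth_on (R : realType) (n : nat) (O : set 'rV[R]_n.+1)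
    (f : 'rV[R]_n.+1 -> R) : Prop :=
  forall (s : seq 'I_n.+1) (x : 'rV[R]_n.+1), O x ->
    let h := foldr (@partial R n) f s in
    {for x, continuous h} /\
    forall i : 'I_n.+1, derivable h x (delta_mx ord0 i).

Definition half_space (R : realType) (n : nat) : set 'rV[R]_n.+1 :=
  [set x | 0 <= x ord0 ord0].

(* f is smooth on D when read through phi : D -> half-space; at boundary points
   this means, as usual, local extendability to an open subset of R^(n+1) *)
Definition smooth_through (R : realType) (n : nat) (T : Type) (D : set T)
    (phi : T -> 'rV[R]_n.+1) (f : T -> R) : Prop :=
  forall p, D p -> exists (O : set 'rV[R]_n.+1) (F : 'rV[R]_n.+1 -> R),
    [/\ open O, O (phi p), smooth_on O F &
        forall q, D q -> O (phi q) -> f q = F (phi q)].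

(* [bmanifold R n]: smooth manifolds with boundary of dimension n.+1, given by
   an atlas of half-space charts *)
Record bmanifold (R : realType) (n : nat) := BManifold {
  carrier :> topologicalType;
  chart_index : Type;
  dom : chart_index -> set carrier;
  chart : chart_index -> carrier -> 'rV[R]_n.+1;
  carrier_hausdorff : hausdorff_space carrier;
  carrier_second_countable : @second_countable carrier;
  dom_open : forall i, open (dom i);
  dom_cover : forall p, exists i, dom i p;
  chart_half : forall i p, dom i p -> half_space (chart i p);
  chart_inj : forall i, {in dom i &, injective (chart i)};
  chart_continuous : forall i O, open O -> open (dom i `&` chart i @^-1` O);
  chart_open : forall i V, open V -> V `<=` dom i ->
    exists2 O, open O & chart i @` V = O `&` @half_space R n;
  chart_transition : forall i j a,
    smooth_through (dom i `&` dom j) (chart i) (fun q => chart j q ord0 a)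
}.

Definition boundary (R : realType) (n : nat) (M : bmanifold R n) : set M :=
  [set p | exists i, dom i p /\ chart i p ord0 ord0 = 0].
Arguments boundary {R n} M _.

(* Vector fields are derivations of the algebra of smooth functions, and tensor
   fields are C^oo-multilinear maps.  The linearity conditions are stated
   relationally ("whenever h = a f + g pointwise"), so that no algebra structure
   on the type of smooth functions has to be built.  The generality is needed
   to treat uniformly a manifold, its interior and its boundary. *)

Record smooth_space (R : realType) := SmoothSpace {
  pt :> Type;
  smooth : set (pt -> R);
  smooth_cst : forall a : R, smooth (fun=> a)
}.

Lemma smooth_on_cst (R : realType) (n : nat) (O : set 'rV[R]_n.+1) (a : R) :
  smooth_on O (fun=> a).
Proof.
move=> s x _ /=.
have [b ->] : exists b : R, foldr (@partial R n) (fun=> a) s = fun=> b.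
  elim: s => [|i s [b IHs]] /=; first by exists a.
  by exists 0; rewrite IHs; apply/funext => y; rewrite /partial derive_cst.
by split; [exact: cst_continuous|move=> i; exact: derivable_cst].
Qed.

Lemma manifold_smooth_cst (R : realType) (n : nat) (M : bmanifold R n) (a : R) :
  [set f : M -> R | forall i, smooth_through (dom i) (chart i) f] (fun=> a).
Proof.
move=> i p _; exists setT, (fun=> a).
by split=> //; [exact: openT|exact: smooth_on_cst].
Qed.

Definition manifold_space (R : realType) (n : nat) (M : bmanifold R n) :
    smooth_space R :=
  SmoothSpace (@manifold_smooth_cst R n M).
Coercion manifold_space : bmanifold >-> smooth_space.

(* the smooth functions on a subset E of M are those which locally extend to
   smooth functions on M; used for E = boundary and E = interior *)
Definition sub_smooth (R : realType) (n : nat) (M : bmanifold R n) (E : set M) :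
    set ({p : M | E p} -> R) :=
  [set f | forall p : {p : M | E p}, exists (W : set M) (F : M -> R),
    [/\ open W, W (sval p), @smooth R M F &
        forall q : {p : M | E p}, W (sval q) -> f q = F (sval q)]].

Lemma sub_smooth_cst (R : realType) (n : nat) (M : bmanifold R n) (E : set M)
  (a : R) : @sub_smooth R n M E (fun=> a).
Proof.
move=> p; exists setT, (fun=> a).
by split=> //; [exact: openT|exact: smooth_cst].
Qed.

Definition sub_space (R : realType) (n : nat) (M : bmanifold R n) (E : set M) :
    smooth_space R :=
  SmoothSpace (@sub_smooth_cst R n M E).

Definition bdry (R : realType) (n : nat) (M : bmanifold R n) : smooth_space R :=
  sub_space (boundary M).

Definition interior_space (R : realType) (n : nat) (M : bmanifold R n) :
    smooth_space R :=
  sub_space (~` boundary M).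

Section Calculus.
Context {R : realType}.
Implicit Types S : smooth_space R.

Definition sfun S := {f : S -> R | smooth f}.
Definition sfun_val S (f : sfun S) : S -> R := sval f.
Local Coercion sfun_val : sfun >-> Funclass.

Record vfield S := VField {
  vf :> sfun S -> sfun S;
  vf_linear : forall (a : R) (f g h : sfun S),
    (forall p, h p = a * f p + g p) -> forall p, vf h p = a * vf f p + vf g p;
  vf_leibniz : forall f g h : sfun S, (forall p, h p = f p * g p) ->
    forall p, vf h p = f p * vf g p + vf f p * g p
}.

Definition sfun0 S : sfun S := exist _ (fun=> 0) (smooth_cst S 0).

Lemma vf0_linear S (a : R) (f g h : sfun S) :
  (forall p, h p = a * f p + g p) ->
  forall p, sfun0 S p = a * sfun0 S p + sfun0 S p.
Proof. by move=> _ p; rewrite /sfun_val /= mulr0 addr0. Qed.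

Lemma vf0_leibniz S (f g h : sfun S) : (forall p, h p = f p * g p) ->
  forall p, sfun0 S p = f p * sfun0 S p + sfun0 S p * g p.
Proof. by move=> _ p; rewrite /sfun_val /= mulr0 mul0r addr0. Qed.

Definition vf0 S : vfield S := VField (@vf0_linear S) (@vf0_leibniz S).

(* X u, for u smooth *)
Definition der S (X : vfield S) (u : S -> R) : S -> R :=
  match pselect (smooth u) with
  | left h => X (exist _ u h)
  | right _ => fun=> 0
  end.

(* Z = f X + Y *)
Definition lincomb S (f : sfun S) (X Y Z : vfield S) : Prop :=
  forall (h : sfun S) (p : S), Z h p = f p * X h p + Y h p.

Definition lie S (X Y : vfield S) : vfield S :=
  such_that (vf0 S) [set Z : vfield S | forall (f : sfun S) (p : S),
    Z f p = X (Y f) p - Y (X f) p].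

(* Lists of vector fields of arbitrary length are taken as arguments, and a form
   of degree k vanishes on the lists of length other than k; forms of negative
   degree are therefore zero. *)
Definition dform S := seq (vfield S) -> S -> R.

Definition is_form S (k : int) (A : dform S) : Prop :=
  [/\ forall s, smooth (A s),
      forall s, (size s)%:Z != k -> forall p, A s p = 0,
      forall s1 s2 s3 X p, A (s1 ++ X :: s2 ++ X :: s3) p = 0 &
      forall s1 s2 f X Y Z p, lincomb f X Y Z ->
        A (s1 ++ Z :: s2) p = f p * A (s1 ++ X :: s2) p + A (s1 ++ Y :: s2) p].

Definition fmul S (u : S -> R) (A : dform S) : dform S := fun s p => u p * A s p.

Definition replace S (s : seq (vfield S)) (i : nat) (Y : vfield S) :=
  take i s ++ Y :: drop i.+1 s.

Definition remove S (s : seq (vfield S)) (i : nat) := take i s ++ drop i.+1 s.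

(* iota(X) *)
Definition inter S (X : vfield S) (A : dform S) : dform S :=
  fun s => A (X :: s).

(* epsilon(theta), where theta is a 1-form seen as a function of one field *)
Definition exter S (theta : vfield S -> S -> R) (A : dform S) : dform S :=
  fun s p => \sum_(i < size s)
    (-1) ^+ i * theta (tnth (in_tuple s) i) p * A (remove s i) p.

Definition metric S := vfield S -> vfield S -> S -> R.

Definition is_metric S (g : metric S) : Prop :=
  [/\ forall X Y, smooth (g X Y),
      forall X Y p, g X Y p = g Y X p,
      forall f X Y Z W p, lincomb f X Y Z ->
        g Z W p = f p * g X W p + g Y W p &
      forall (X : vfield S) p, (exists f : sfun S, X f p != 0) -> 0 < g X X p].

Definition is_levi_civita S (g : metric S)
    (D : vfield S -> vfield S -> vfield S) : Prop :=
  [/\ forall f X Y Z W, lincomb f X Y Z ->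
        lincomb f (D X W) (D Y W) (D Z W),
      forall f (X Y Z W : vfield S), lincomb f X Y Z ->
        forall (h : sfun S) p,
        D W Z h p = f p * D W X h p + W f p * X h p + D W Y h p,
      forall (X Y : vfield S) (f : sfun S) p,
        D X Y f p - D Y X f p = X (Y f) p - Y (X f) p &
      forall X Y Z p,
        der X (g Y Z) p = g (D X Y) Z p + g Y (D X Z) p].

Definition levi_civita S (g : metric S) : vfield S -> vfield S -> vfield S :=
  such_that (fun _ _ => vf0 S) (is_levi_civita g).

(* vector fields whose values at p form a g-orthonormal basis of T_p; d is the
   dimension of the space *)
Definition frame_at S (d : nat) (g : metric S) (p : S) : 'I_d -> vfield S :=
  such_that (fun=> vf0 S) [set e | forall i j, g (e i) (e j) p = (i == j)%:R].

(* g^{ab} B_{ab} *)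
Definition trace S (d : nat) (g : metric S)
    (B : vfield S -> vfield S -> S -> R) : S -> R :=
  fun p => \sum_(a < d) B (frame_at g p a) (frame_at g p a) p.

Definition grad S (g : metric S) (u : S -> R) : vfield S :=
  such_that (vf0 S) [set Z | forall X p, g Z X p = der X u p].

(* nabla^a nabla_a u *)
Definition laplacian S (d : nat) (g : metric S) (u : S -> R) : S -> R :=
  trace d g (fun X Y p =>
    der X (der Y u) p - der (levi_civita g X Y) u p).

(* R(X,Y)Z = D_X D_Y Z - D_Y D_X Z - D_[X,Y] Z, paired with W *)
Definition riem S (g : metric S) (X Y Z W : vfield S) : S -> R :=
  let D := levi_civita g in
  fun p => g (D X (D Y Z)) W p - g (D Y (D X Z)) W p - g (D (lie X Y) Z) W p.

Definition ric S (d : nat) (g : metric S) (X Y : vfield S) : S -> R :=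
  trace d g (fun E E' => riem g E X Y E').

(* Taking the trace of Ric = (d-2) P + J g with J = P^a_a gives
   J = Sc / (2 (d-1)). *)
Definition Jcurv S (d : nat) (g : metric S) : S -> R :=
  fun p => trace d g (ric d g) p / (2 * (d%:R - 1)).

Definition schouten S (d : nat) (g : metric S) (X Y : vfield S) : S -> R :=
  fun p => (ric d g X Y p - Jcurv d g p * g X Y p) / (d%:R - 2).

Definition nabla S (g : metric S) (X : vfield S) (A : dform S) : dform S :=
  fun s p => der X (A s) p - \sum_(i < size s)
    A (replace s i (levi_civita g X (tnth (in_tuple s) i))) p.

(* epsilon(nabla) *)
Definition fd S (g : metric S) (A : dform S) : dform S :=
  fun s p => \sum_(i < size s)
    (-1) ^+ i * nabla g (tnth (in_tuple s) i) A (remove s i) p.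

(* iota(nabla); note that there is no sign in this divergence *)
Definition fdelta S (d : nat) (g : metric S) (A : dform S) : dform S :=
  fun s => trace d g (fun X Y => nabla g X A (Y :: s)).

Definition fDelta S (d : nat) (g : metric S) (A : dform S) : dform S :=
  fd g (fdelta d g A) + fdelta d g (fd g A).

(* the endomorphism P^a_b extended to forms as a derivation *)
Definition Pform S (d : nat) (g : metric S) (A : dform S) : dform S :=
  fun s p => \sum_(i < size s)
    trace d g (fun X Y q =>
      schouten d g X (tnth (in_tuple s) i) q * A (replace s i Y) q) p.

(* J - 2 P *)
Definition JP S (d : nat) (g : metric S) (A : dform S) : dform S :=
  fmul (Jcurv d g) A - Pform d g A *+ 2.

Definition positive_smooth S (Om : S -> R) : Prop :=
  smooth Om /\ forall p, 0 < Om p.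

(* Omega^2 g *)
Definition rescale S (Om : S -> R) (g : metric S) : metric S :=
  fun X Y p => Om p ^+ 2 * g X Y p.

Definition conformal_class S (c : set (metric S)) : Prop :=
  exists2 g0, is_metric g0 &
    c = [set g | exists2 Om, positive_smooth Om & g = rescale Om g0].

(* Sections of density bundles are families indexed by the metrics; only their
   values on the metrics of c matter. *)
Definition density_section S (c : set (metric S)) (w : int)
    (mu : metric S -> S -> R) : Prop :=
  (forall g, c g -> smooth (mu g)) /\
  forall g Om, c g -> positive_smooth Om ->
    forall p, mu (rescale Om g) p = Om p ^ w * mu g p.

Definition form_section S (c : set (metric S)) (k w : int)
    (A : metric S -> dform S) : Prop :=
  (forall g, c g -> is_form k (A g)) /\
  forall g Om, c g -> positive_smooth Om ->
    A (rescale Om g) = fmul (fun p => Om p ^ w) (A g).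

(* (north, west, east, south) *)
Definition slots S : Type := (dform S * dform S * dform S * dform S)%type.
Definition north S (F : slots S) : dform S := F.1.1.1.
Definition west S (F : slots S) : dform S := F.1.1.2.
Definition east S (F : slots S) : dform S := F.1.2.
Definition south S (F : slots S) : dform S := F.2.

Definition tractor S := metric S -> slots S.

(* Sections of T^k M[w].  Each slot is a form of the weight of the
   corresponding summand, so that the powers of Omega below are those of its
   trivialisations in the scales g and Omega^2 g. *)
Definition tractor_section S (c : set (metric S)) (k w : int)
    (F : tractor S) : Prop :=
  (forall g, c g ->
    [/\ is_form (k - 1) (north (F g)), is_form k (west (F g)),
        is_form (k - 2) (east (F g)) & is_form (k - 1) (south (F g))]) /\
  forall g Om, c g -> positive_smooth Om ->
    let u := fun p => ln (Om p) in
    let eps := exter (fun X => der X u) in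
    let iot := inter (grad g u) in
    let: (Fp, F0, Fpm, Fm) := F g in
    F (rescale Om g) =
      (fmul (fun p => Om p ^ (w + k)) Fp,
       fmul (fun p => Om p ^ (w + k)) (F0 + eps Fp),
       fmul (fun p => Om p ^ (w + k - 2)) (Fpm - iot Fp),
       fmul (fun p => Om p ^ (w + k - 2))
         (Fm + fmul (fun=> 2^-1) (eps (iot Fp) - iot (eps Fp))
          - iot F0 - eps Fpm)).

Definition tmul S (u : S -> R) (F : slots S) : slots S :=
  (fmul u (north F), fmul u (west F), fmul u (east F), fmul u (south F)).

(* The constraints I* A = D^* A = X* A = 0 are required to hold exactly on a
   neighbourhood U of the boundary only.  They make the field sigma^{-1} A
   divergence-free, and the flux of phi_Sigma through the boundary obstructs
   solving them on all of M: take k = 1, M the hyperbolic ball and phi_Sigma a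
   nonzero constant. *)
Definition vanishes_on S (U : set S) (F : slots S) : Prop :=
  forall s p, U p -> [/\ north F s p = 0, west F s p = 0,
                         east F s p = 0 & south F s p = 0].

Definition Xstar S (F : tractor S) : tractor S :=
  fun g => let: (Fp, F0, Fpm, Fm) := F g in (0, Fp, 0, Fpm).

Section Operators.
Variables (S : smooth_space R) (d : nat) (sigma : metric S -> S -> R).

Definition nu (g : metric S) : vfield S := grad g (sigma g).

Definition rho (g : metric S) : S -> R :=
  fun p => - (laplacian d g (sigma g) p + Jcurv d g p * sigma g p) / d%:R.

Definition Istar (F : tractor S) : tractor S :=
  fun g => let: (Fp, F0, Fpm, Fm) := F g in
    (- inter (nu g) Fp - fmul (sigma g) Fpm,
     fmul (rho g) Fp + inter (nu g) F0 + fmul (sigma g) Fm,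
     inter (nu g) Fpm,
     fmul (rho g) Fpm - inter (nu g) Fm).

(* D on T^k M[w] *)
Definition Dop (k w : int) (F : tractor S) : tractor S :=
  fun g => let: (Fp, F0, Fpm, Fm) := F g in
    let d' : int := d%:Z in
    ((F0 *~ (w + k) - fd g Fp) *~ (d' + 2 * w - 2),
     fd g F0 *~ (d' + 2 * w - 2),
     fDelta d g Fp + JP d g Fp *~ (w + k - 2) - fdelta d g F0 *+ 2
       + (fd g Fpm + Fm *~ (w + k - 2)) *~ (d' + 2 * w),
     (JP d g (fd g Fp) - fd g (JP d g Fp))
       - (fDelta d g F0 + JP d g F0 *~ (w + k))
       - fd g Fm *~ (d' + 2 * w)).

(* y : T^k M[w] -> T^k M[w-1]; the second D acts on T^{k-1} M[w] *)
Definition yop (k w : int) (F : tractor S) : tractor S :=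
  - (Istar (Dop k w F) + Dop (k - 1) w (Istar F)).

Fixpoint ypow (j : nat) (k w : int) (F : tractor S) : tractor S :=
  if j is j'.+1 then yop k (w - j'%:Z) (ypow j' k w F) else F.

Definition xop (F : tractor S) : tractor S := fun g => tmul (sigma g) (F g).

(* only used on the kernel of Xstar *)
Definition Dhatstar (k w : int) (F : tractor S) : tractor S :=
  fun g => let: (_, A, _, phi) := F g in
    (0, fdelta d g A + phi *~ (d%:Z + w - k), 0, - fdelta d g phi).

(* western insertion of A, a k-form of weight w + k *)
Definition qW (k w : int) (A : metric S -> dform S) : tractor S :=
  fun g => (0, A g, 0,
            - fmul (fun=> ((d%:Z + w - k)%:~R)^-1) (fdelta d g (A g))).

Definition Kcoef (h0 : R) (j : nat) : R :=
  ((j`!)%:R * \prod_(2 <= i < j.+2) (h0 - i%:R))^-1.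

(* the truncation of :K^{h0}(z): at order z^l, acting on T^k M[w] *)
Definition Ktrunc (h0 : R) (l : nat) (k w : int) (F : tractor S) : tractor S :=
  fun g => \sum_(j < l.+1)
    tmul (fun=> Kcoef h0 j) (iter j xop (ypow j k w F) g).

(* the section F of T^k M[w] is O(sigma^m) *)
Definition bigO_sigma (c : set (metric S)) (k w : int) (m : nat)
    (F : tractor S) : Prop :=
  exists2 B, tractor_section c k (w - m%:Z) B &
    forall g, c g -> F g = iter m xop B g.

End Operators.

Section Restriction.
Variables (n : nat) (M : bmanifold R n).

(* a field on M with the same value as X at the point p of E *)
Definition lift_at (E : set M) (p : sub_space E) (X : vfield (sub_space E)) :
    vfield M :=
  such_that (vf0 M) [set Y : vfield M |
    forall (f : sfun M) (h : sfun (sub_space E)),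
      (forall q, h q = f (sval q)) -> X h p = Y f (sval p)].

Definition restrict_metric (E : set M) (g : metric M) : metric (sub_space E) :=
  fun X Y p => g (lift_at p X) (lift_at p Y) (sval p).

Definition pullback (E : set M) (A : dform M) : dform (sub_space E) :=
  fun s p => A (map (lift_at p) s) (sval p).

Definition bdry_metric (g : metric M) : metric (bdry M) :=
  @restrict_metric (boundary M) g.

Definition bdry_class (c : set (metric M)) : set (metric (bdry M)) :=
  bdry_metric @` c.

(* B restricted to the boundary (as a section of forms on M along it) is the
   form beta on the boundary, the latter being identified with a form along the
   boundary annihilated by iota(N) *)
Definition restricts_to (N : vfield M) (B : dform M) (beta : dform (bdry M)) :
    Prop :=
  @pullback (boundary M) B = beta /\
  forall s p, boundary M p -> inter N B s p = 0.

(* g^o = sigma^{-2} g on the interior *)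
Definition interior_metric (sigma : metric M -> M -> R) (g : metric M) :
    metric (interior_space M) :=
  fun X Y p => (sigma g (sval p)) ^- 2 * @restrict_metric (~` boundary M) g X Y p.

Definition poincare_einstein (c : set (metric M))
    (sigma : metric M -> M -> R) : Prop :=
  [/\ conformal_class c,
      density_section c 1 sigma,
      forall g p, c g -> ~ boundary M p -> 0 < sigma g p,
      forall g p, c g -> boundary M p ->
        sigma g p = 0 /\ exists X : vfield M, der X (sigma g) p != 0 &
      forall g X Y p, c g ->
        ric n.+1 (interior_metric sigma g) X Y p
        = - n%:R * interior_metric sigma g X Y p].

End Restriction.

End Calculus.

(* Main.v *)
Require Import Defs.
From mathcomp Require Import all_boot all_order all_algebra.
From mathcomp Require Import all_classical all_reals all_analysis.
From mathcomp Require Import ring lra zify.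
Import Order.TTheory GRing.Theory Num.Theory.
Import numFieldNormedType.Exports.
Import Defs.
Local Open Scope classical_set_scope.
Local Open Scope ring_scope.
Set Implicit Arguments.
Unset Strict Implicit.
Unset Printing Implicit Defensive.
Local Coercion sfun_val : sfun >-> Funclass.

(** y and multiplication by sigma generate sl(2): y :K_l(z): F is a multiple of
    sigma^l y^(l+1) F, and :K_l(z): sigma C one of sigma^(l+1) y^l C.  Hence, modulo
    O(sigma^(l+1)), :K(z): q only depends on q along Sigma, and q may be replaced by
    q' = q_W (A0 - sigma gamma) with gamma = 0 on Sigma.  In a scale in which sigma = 1 the
    constraints I* = D^* = X* = 0 say that the tractor is (0, A, 0, 0) with delta A = 0,
    which y preserves.  It remains to choose gamma so that q' satisfies them near Sigma:
    delta gamma = (delta A0 - iota(nu) A0 / sigma) / sigma.  The Einstein equation, the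
    boundary conditions and delta_Sigma A_Sigma = delta_Sigma phi_Sigma = 0 make the right
    hand side smooth, divergence-free, and tangential on Sigma; the equation is solved by
    integrating in the normal direction. *)

(** The tractor q_W A0 violates the constraints off the boundary: they amount to iota(nu) A = sigma
    delta A, which fails for a general extension A0. Replacing A0 by A0 - sigma gamma changes the
    south slot by delta(sigma gamma) = iota(nu) gamma + sigma delta gamma, so that gamma = 0 on
    Sigma makes q and q' agree there in the south slot as well as in the west one. Every order can
    be reached because h0 = d + 2w = 2k - n + 1 <= 0 for k <= (n - 1)/2, hence no factor h0 - i with
    i >= 2 vanishes. The equation for gamma has to hold near Sigma only, which avoids the flux
    obstruction on all of M. Its solutions are found chart by chart, and a cut-off changes their
    divergence; the gluing therefore corrects the remaining error again and again instead of using a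
    partition of unity. Vector fields are derivations and tensors are multilinear maps on them, so
    local statements are obtained by multiplying with bump functions. M, its interior and Sigma
    share this calculus through [regular]. *)

Lemma such_thatP (T : Type) (x0 : T) (P : set T) :
  (exists x, P x) -> P (such_that x0 P).
Proof. by move=> h; rewrite /such_that; case: pselect => // h'; case: (cid h'). Qed.

(* A smooth_space carries no topology: the sets on which a smooth function does not
   vanish play the role of the open sets. *)
Definition nearby (R : realType) (S : smooth_space R) (p : S) (P : S -> Prop) :=
  exists2 chi : sfun S, sfun_val chi p != 0 & forall q, sfun_val chi q != 0 -> P q.

(** The second clause makes [E] a frame at [q]: a derivation is determined there by its values on
    the coordinates. For derivations of smooth functions this is a theorem, obtained from Taylor's
    formula in a chart. *)
Definition coords (R : realType) (S : smooth_space R) (d : nat)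
    (x : 'I_d -> S -> R) (E : 'I_d -> vfield S) (q : S) :=
  (forall i j, der (E i) (x j) q = (i == j)%:R) /\
  (forall X u, der X u q = \sum_i der X (x i) q * der (E i) u q).

(** Ring and sheaf properties of the smooth functions. They stand apart from [regular] because
    [regular] is derived from charts by arguments that already use them. *)
Record preregular (R : realType) (S : smooth_space R) : Prop := Preregular {
  smD : forall f g : S -> R, smooth f -> smooth g -> smooth (fun p => f p + g p);
  smM : forall f g : S -> R, smooth f -> smooth g -> smooth (fun p => f p * g p);
  sm_local : forall f : S -> R,
    (forall p, exists2 h : S -> R, smooth h & nearby p (fun q => f q = h q)) -> smooth f
}.

(** What M, its interior and its boundary have in common, [d] being the dimension. Local inverse
    square roots serve twice: they normalise vectors in the Gram-Schmidt process, and they yield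
    reciprocals. *)
Record regular (R : realType) (S : smooth_space R) (d : nat) : Prop := Regular {
  reg_pre :> preregular S;
  sm_ln : forall f : S -> R, smooth f -> (forall p, 0 < f p) ->
    smooth (fun p => ln (f p));
  sm_isqrt : forall (f : S -> R) p, smooth f -> 0 < f p ->
    exists2 h : S -> R, smooth h & nearby p (fun q => 0 < h q /\ h q ^+ 2 * f q = 1);
  has_coords : forall p, exists (x : 'I_d -> S -> R) (E : 'I_d -> vfield S),
    (forall i, smooth (x i)) /\ nearby p (coords x E)
}.

(** * Smooth functions and vector fields *)

Section Der.
Context {R : realType}.
Implicit Types S : smooth_space R.

Lemma sfun_sm S (f : sfun S) : smooth (f : S -> R).
Proof. by case: f. Qed.

Lemma derE S (X : vfield S) (u : S -> R) (h : smooth u) : der X u = X (exist _ u h).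
Proof.
rewrite /der; case: pselect => // h'; congr (sfun_val (vf X (exist _ u _))).
exact: Prop_irrelevance.
Qed.

Lemma vfE S (X : vfield S) (f : sfun S) : X f = der X f :> (S -> R).
Proof. by case: f => u h; rewrite derE. Qed.

Lemma der_sm S (X : vfield S) u : smooth (der X u).
Proof.
have [h|h] := pselect (smooth u); first by rewrite derE; exact: sfun_sm.
rewrite /der; case: pselect => // _; exact: smooth_cst.
Qed.

Lemma der_ns S (X : vfield S) u : ~ smooth u -> der X u = fun=> 0.
Proof. by rewrite /der; case: pselect. Qed.

Lemma der_lin S (X : vfield S) a f g h : smooth f -> smooth g -> smooth h ->
  (forall p, h p = a * f p + g p) -> forall p, der X h p = a * der X f p + der X g p.
Proof. by move=> hf hg hh e p; rewrite !derE; apply: vf_linear. Qed.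

Lemma lincombE S (f : sfun S) (X Y Z : vfield S) :
  lincomb f X Y Z <-> forall u p, der Z u p = f p * der X u p + der Y u p.
Proof.
split=> [h u p|h u p]; last by rewrite !vfE h.
have [su|nu] := pselect (smooth u); first by rewrite !derE h.
by rewrite !der_ns // mulr0 addr0.
Qed.

End Der.

Section Reg.
Context {R : realType} {S : smooth_space R}.
Hypothesis rg : preregular S.
Implicit Types (X Y Z W : vfield S) (u v f : S -> R) (p q : S).

Lemma smN f : smooth f -> smooth (fun p => - f p).
Proof.
move=> sf; have := smM rg (smooth_cst S (-1)) sf.
by congr smooth; apply/funext => p; rewrite mulN1r.
Qed.
Lemma smB f g : smooth f -> smooth g -> smooth (fun p => f p - g p).
Proof. by move=> sf sg; apply: (smD rg) => //; apply: smN. Qed.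
Lemma sm_sum (I : Type) (r : seq I) (F : I -> S -> R) :
  (forall i, smooth (F i)) -> smooth (fun p => \sum_(i <- r) F i p).
Proof.
move=> sF; elim: r => [|i r IH].
  by under eq_fun do rewrite big_nil; exact: smooth_cst.
by under eq_fun do rewrite big_cons; apply: (smD rg).
Qed.
Lemma smX f n : smooth f -> smooth (fun p => f p ^+ n).
Proof.
move=> sf; elim: n => [|n IH]; first exact: smooth_cst.
by under eq_fun do rewrite exprS; apply: (smM rg).
Qed.

Lemma nearby_sub p P : nearby p P -> P p.
Proof. by case=> c c0 h; exact: h. Qed.
Lemma nearbyW p (P Q : S -> Prop) : (forall q, P q -> Q q) -> nearby p P -> nearby p Q.
Proof. by move=> h [c c0 k]; exists c => // q cq; apply: h; exact: k. Qed.
Lemma nearbyI p (P Q : S -> Prop) : nearby p P -> nearby p Q -> nearby p (fun q => P q /\ Q q).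
Proof.
move=> [c c0 h] [e e0 k].
exists (exist _ _ (smM rg (sfun_sm c) (sfun_sm e))); rewrite /sfun_val /=.
  by rewrite mulf_neq0.
by move=> q; rewrite mulf_eq0 negb_or => /andP[? ?]; split; [exact: h|exact: k].
Qed.
Lemma nearbyT p (P : S -> Prop) : (forall q, P q) -> nearby p P.
Proof. by move=> h; exists (exist _ _ (smooth_cst S 1)) => //; rewrite /sfun_val /= oner_neq0. Qed.
Lemma nearby_nearby p P : nearby p P -> nearby p (fun q => nearby q P).
Proof. by move=> [c c0 h]; exists c => // q cq; exists c. Qed.
Lemma nearby_neq0 p u : smooth u -> u p != 0 -> nearby p (fun q => u q != 0).
Proof. by move=> su up; exists (exist _ u su). Qed.
Lemma nearby_fin (I : finType) p (P : I -> S -> Prop) :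
  (forall i, nearby p (P i)) -> nearby p (fun q => forall i, P i q).
Proof.
move=> h; suff : nearby p (fun q => forall i, i \in enum I -> P i q).
  by apply: nearbyW => q k i; apply: k; rewrite mem_enum.
elim: (enum I) => [|i r IH]; first exact: nearbyT.
apply: nearbyW (nearbyI (h i) IH) => q [h1 h2] j; rewrite inE => /orP[/eqP->//|]; exact: h2.
Qed.

Lemma derD X u v p : smooth u -> smooth v ->
  der X (fun q => u q + v q) p = der X u p + der X v p.
Proof.
move=> su sv; rewrite (@der_lin _ _ X 1 u v) ?mul1r //; first exact: (smD rg).
by move=> q; rewrite mul1r.
Qed.
Lemma derM X u v p : smooth u -> smooth v ->
  der X (fun q => u q * v q) p = u p * der X v p + der X u p * v p.
Proof.
move=> su sv; have suv := smM rg su sv; rewrite !derE.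
exact: (@vf_leibniz _ _ X (exist _ _ su) (exist _ _ sv) (exist _ _ suv)).
Qed.
Lemma der_cst X a p : der X (fun=> a) p = 0.
Proof.
have s1 := smooth_cst S 1; have s0 := smooth_cst S 0.
have h1 : der X (fun=> 1) p = 0.
  have := derM X p s1 s1; rewrite (_ : (fun _ => _ * _) = fun=> 1); last by apply/funext => q; rewrite mulr1.
  by rewrite mul1r mulr1 => e; apply: (@addrI _ (der X (fun=> 1) p)); rewrite addr0 -e.
have h0 : der X (fun=> 0) p = 0.
  have := derD X p s0 s0; rewrite (_ : (fun _ => _ + _) = fun=> 0); last by apply/funext => q; rewrite addr0.
  by move=> e; apply: (@addrI _ (der X (fun=> 0) p)); rewrite addr0 -e.
have e : forall q : S, a = a * 1 + 0 by move=> q; rewrite mulr1 addr0.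
by rewrite (der_lin X s1 s0 (smooth_cst S a) e) h1 h0 mulr0 addr0.
Qed.
Lemma derZ X a u p : smooth u -> der X (fun q => a * u q) p = a * der X u p.
Proof. by move=> su; rewrite derM ?der_cst ?mul0r ?addr0 //; exact: smooth_cst. Qed.
Lemma derN X u p : smooth u -> der X (fun q => - u q) p = - der X u p.
Proof. by move=> su; under eq_fun do rewrite -mulN1r; rewrite derZ // mulN1r. Qed.
Lemma derB X u v p : smooth u -> smooth v ->
  der X (fun q => u q - v q) p = der X u p - der X v p.
Proof. by move=> su sv; rewrite derD ?derN //; apply: smN. Qed.
Lemma der_sum X (I : Type) (r : seq I) (F : I -> S -> R) p :
  (forall i, smooth (F i)) ->
  der X (fun q => \sum_(i <- r) F i q) p = \sum_(i <- r) der X (F i) p.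
Proof.
move=> sF; elim: r => [|i r IH].
  by under eq_fun do rewrite big_nil; rewrite der_cst big_nil.
under eq_fun do rewrite big_cons; rewrite big_cons derD ?IH //; exact: sm_sum.
Qed.

(** Leibniz rule for the product c (u - v), which vanishes identically when c is the function
    witnessing [nearby]. *)
Lemma der_near X u v p : smooth u -> smooth v -> nearby p (fun q => u q = v q) ->
  der X u p = der X v p.
Proof.
move=> su sv [c c0 h]; apply/eqP; rewrite -subr_eq0 -derB //; apply/eqP.
have e : (fun q => c q * (u q - v q)) = fun=> 0.
  apply/funext => q; have [->|cq] := eqVneq (c q) 0; first by rewrite mul0r.
  by rewrite (h q cq) subrr mulr0.
have := der_cst X 0 p; rewrite -e derM; [|exact: sfun_sm|exact: smB].
by rewrite (h p c0) subrr mulr0 addr0 => /eqP; rewrite mulf_eq0 (negbTE c0) => /eqP.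
Qed.
Lemma der_near0 X u p : smooth u -> nearby p (fun q => u q = 0) -> der X u p = 0.
Proof. by move=> su h; rewrite (der_near X su (smooth_cst S 0) h) der_cst. Qed.

End Reg.

Section Inverse.
Context {R : realType} {S : smooth_space R} {d : nat}.
Hypothesis rg : regular S d.
Implicit Types (X Y Z W : vfield S) (u v f : S -> R) (p q : S).

(** If h is an inverse square root of u^2, then h^2 u is the reciprocal of u, whatever the sign of
    u. *)
Lemma nearby_inv p u : smooth u -> u p != 0 ->
  exists2 h, smooth h & nearby p (fun q => u q != 0 /\ h q = (u q)^-1).
Proof.
move=> su up; have su2 := smM rg su su.
have [|h sh nh] := @sm_isqrt _ _ _ rg (fun q => u q * u q) p su2.
  by rewrite -expr2 exprn_even_gt0.
exists (fun q => h q ^+ 2 * u q); first by apply: (smM rg) => //; exact: (smX rg).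
apply: nearbyW (nearbyI rg nh (nearby_neq0 su up)) => q [[hq e] uq]; split => //.
by apply: (mulIf uq); rewrite mulVf // -mulrA.
Qed.

Lemma smV u : smooth u -> (forall p, u p != 0) -> smooth (fun p => (u p)^-1).
Proof.
move=> su up; apply: (sm_local rg) => p; have [h sh nh] := nearby_inv su (up p).
by exists h => //; apply: nearbyW nh => q [].
Qed.
Lemma derV X u p : smooth u -> (forall p, u p != 0) ->
  der X (fun p => (u p)^-1) p = - (u p)^-2 * der X u p.
Proof.
move=> su up; have sv := smV su up.
have := der_cst rg X 1 p; under eq_fun => q do rewrite -(mulVf (up q)).
rewrite (derM rg) // => /eqP; rewrite addrC addr_eq0 => /eqP e.
apply: (mulIf (up p)); rewrite e -!mulNr; field; exact: up.
Qed.
Lemma smXz u (n : int) : smooth u -> (forall p, u p != 0) -> smooth (fun p => u p ^ n).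
Proof.
by move=> su up; case: n => n; [exact: (smX rg)|apply: smV; [exact: (smX rg)|move=> p; rewrite expf_neq0]].
Qed.

End Inverse.

Section Fields.
Context {R : realType} {S : smooth_space R} {d : nat}.
Hypothesis rg : regular S d.
Implicit Types (X Y Z W : vfield S) (u v f : S -> R) (p q : S).

Lemma mkvf_ex (F : (S -> R) -> S -> R) :
  (forall u, smooth u -> smooth (F u)) ->
  (forall a f g p, smooth f -> smooth g ->
     F (fun q => a * f q + g q) p = a * F f p + F g p) ->
  (forall f g p, smooth f -> smooth g ->
     F (fun q => f q * g q) p = f p * F g p + F f p * g p) ->
  exists X, forall u, smooth u -> der X u = F u.
Proof.
move=> sF lF pF.
pose V (f : sfun S) : sfun S := exist _ (F f) (sF _ (sfun_sm f)).
have h1 : forall (a : R) (f g h : sfun S), (forall p, h p = a * f p + g p) ->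
    forall p, V h p = a * V f p + V g p.
  move=> a f g h e p; rewrite /V /sfun_val /= -/(sfun_val) -lF; try exact: sfun_sm.
  by congr (F _ p); apply/funext.
have h2 : forall f g h : sfun S, (forall p, h p = f p * g p) ->
    forall p, V h p = f p * V g p + V f p * g p.
  move=> f g h e p; rewrite /V {1 3 5}/sfun_val /= -pF; try exact: sfun_sm.
  by congr (F _ p); apply/funext.
by exists (VField h1 h2) => u su; rewrite derE.
Qed.

(** Taken by choice, so that a field can be defined by its action without carrying proofs; [mkvfE]
    recovers the action once the three conditions are checked. *)
Definition mkvf (F : (S -> R) -> S -> R) : vfield S :=
  such_that (vf0 S) [set X | forall u, smooth u -> der X u = F u].

Lemma mkvfE (F : (S -> R) -> S -> R) :
  (forall u, smooth u -> smooth (F u)) ->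
  (forall a f g p, smooth f -> smooth g ->
     F (fun q => a * f q + g q) p = a * F f p + F g p) ->
  (forall f g p, smooth f -> smooth g ->
     F (fun q => f q * g q) p = f p * F g p + F f p * g p) ->
  forall u, smooth u -> der (mkvf F) u = F u.
Proof. by move=> h1 h2 h3; apply: (such_thatP (vf0 S) (mkvf_ex h1 h2 h3)). Qed.

Lemma der_vf0 u p : der (vf0 S) u p = 0.
Proof. by rewrite /der; case: pselect. Qed.

Definition vfL (f : S -> R) X Y : vfield S := mkvf (fun u p => f p * der X u p + der Y u p).

Lemma der_vfL f X Y u p : smooth f -> der (vfL f X Y) u p = f p * der X u p + der Y u p.
Proof.
move=> sf; have [su|nu] := pselect (smooth u); last first.
  by rewrite !der_ns // mulr0 addr0.
rewrite /vfL mkvfE //.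
- by move=> v sv; apply: (smD rg); [apply: (smM rg) => //|]; exact: der_sm.
- move=> a v w q sv sw; rewrite !(derD rg) ?(derZ rg) //; try by apply: (smM rg) => //; exact: smooth_cst.
  by ring.
- by move=> v w q sv sw; rewrite !(derM rg) //; ring.
Qed.

Fixpoint vfsum (I : Type) (r : seq I) (c : I -> S -> R) (E : I -> vfield S) :=
  if r is i :: r' then vfL (c i) (E i) (vfsum r' c E) else vf0 S.

Lemma der_vfsum (I : Type) (r : seq I) c (E : I -> vfield S) u p :
  (forall i, smooth (c i)) ->
  der (vfsum r c E) u p = \sum_(i <- r) c i p * der (E i) u p.
Proof.
move=> sc; elim: r => [|i r IH] /=; first by rewrite big_nil der_vf0.
by rewrite big_cons der_vfL // IH.
Qed.

Definition clin (T : vfield S -> S -> R) := forall (f : sfun S) X Y Z p,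
  lincomb f X Y Z -> T Z p = f p * T X p + T Y p.

Lemma clinP T : clin T -> forall f X Y Z p, smooth f ->
  (forall u q, der Z u q = f q * der X u q + der Y u q) -> T Z p = f p * T X p + T Y p.
Proof.
move=> hT f X Y Z p sf h; apply: (hT (exist _ f sf)).
by apply/lincombE => u q; rewrite h.
Qed.
Lemma clinL T f X Y p : clin T -> smooth f -> T (vfL f X Y) p = f p * T X p + T Y p.
Proof. by move=> hT sf; apply: clinP => // u q; rewrite der_vfL. Qed.
Lemma clin0 T p : clin T -> T (vf0 S) p = 0.
Proof.
move=> hT; have := @clinP T hT (fun=> 1) (vf0 S) (vf0 S) (vf0 S) p (smooth_cst S 1).
rewrite mul1r => e; apply: (@addrI _ (T (vf0 S) p)); rewrite addr0 -e // => u q.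
by rewrite !der_vf0 mulr0 addr0.
Qed.
Lemma clin_vfsum T (I : Type) (r : seq I) c (E : I -> vfield S) p :
  clin T -> (forall i, smooth (c i)) ->
  T (vfsum r c E) p = \sum_(i <- r) c i p * T (E i) p.
Proof.
move=> hT sc; elim: r => [|i r IH] /=; first by rewrite big_nil clin0.
by rewrite big_cons clinL // IH.
Qed.
Lemma clin_ext T X Y p : clin T -> (forall u q, der X u q = der Y u q) -> T X p = T Y p.
Proof.
move=> hT h; rewrite (@clinP T hT (fun=> 0) X Y X p (smooth_cst S 0)) ?mul0r ?add0r // => u q.
by rewrite mul0r add0r.
Qed.
(** Tensoriality. The expansion of X in the frame E is only valid near p; multiplied by the bump
    function c it becomes an identity of global fields, to which C^oo-linearity applies, and c p can
    be cancelled. *)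
Lemma clin_expand T x (E : 'I_d -> vfield S) X p : clin T -> (forall i, smooth (x i)) ->
  nearby p (coords x E) -> T X p = \sum_i der X (x i) p * T (E i) p.
Proof.
move=> hT sx [c c0 h]; apply: (mulfI c0).
have -> : c p * T X p = T (vfL c X (vf0 S)) p.
  by rewrite clinL ?clin0 ?addr0 //; exact: sfun_sm.
have sc i : smooth (fun q => c q * der X (x i) q).
  by apply: (smM rg); [exact: sfun_sm|exact: der_sm].
rewrite (@clin_ext T _ (vfsum (enum 'I_d) (fun i q => c q * der X (x i) q) E)) //.
  by rewrite clin_vfsum // big_enum /= mulr_sumr; apply: eq_bigr => i _; rewrite mulrA.
move=> u q; rewrite der_vfL ?der_vfsum ?der_vf0 ?addr0 //; last exact: sfun_sm.
have [->|cq] := eqVneq (c q) 0; first by rewrite mul0r big1 // => i _; rewrite !mul0r.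
have [_ hX] := h _ cq; rewrite (hX X u) big_enum /= mulr_sumr.
by apply: eq_bigr => i _; rewrite mulrA.
Qed.
Lemma clin_at T X Y p : clin T -> (forall u, der X u p = der Y u p) -> T X p = T Y p.
Proof.
move=> hT h; have [x [E [sx nx]]] := has_coords rg p.
by rewrite !(clin_expand _ hT sx nx); apply: eq_bigr => i _; rewrite h.
Qed.
Lemma clin_lin T a X Y Z p : clin T -> (forall u, der Z u p = a * der X u p + der Y u p) ->
  T Z p = a * T X p + T Y p.
Proof.
move=> hT h; rewrite -(@clinL T (fun=> a) X Y p hT (smooth_cst S a)).
by apply: clin_at => // u; rewrite der_vfL //; exact: smooth_cst.
Qed.
Lemma clin_sum_at T (I : finType) (c : I -> R) (E : I -> vfield S) Z p : clin T ->
  (forall u, der Z u p = \sum_i c i * der (E i) u p) -> T Z p = \sum_i c i * T (E i) p.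
Proof.
move=> hT h; rewrite (@clin_at T Z (vfsum (enum I) (fun i _ => c i) E)) //.
  by rewrite clin_vfsum ?big_enum // => i; exact: smooth_cst.
by move=> u; rewrite h der_vfsum ?big_enum // => i; exact: smooth_cst.
Qed.
Lemma clin_der u : clin (fun X => der X u).
Proof. by move=> f X Y Z p /lincombE ->. Qed.

(** * Metrics and the Levi-Civita connection *)

Section Metric.
Variable g : metric S.
Hypothesis mg : is_metric g.

Lemma g_sm X Y : smooth (g X Y). Proof. by case: mg. Qed.
Lemma g_sym X Y p : g X Y p = g Y X p. Proof. by case: mg. Qed.
Lemma g_clinl Y : clin (fun X => g X Y).
Proof. by case: mg => _ _ h _ f X Z W p /h. Qed.
Lemma g_clinr X : clin (g X).
Proof. by move=> f Y Z W p h; rewrite !(g_sym X); apply: g_clinl h. Qed.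
Lemma g_pos X p u : der X u p != 0 -> 0 < g X X p.
Proof.
have [su|nu] := pselect (smooth u); last by rewrite der_ns ?eqxx.
by case: mg => _ _ _ h ux; apply: h; exists (exist _ u su); rewrite vfE.
Qed.
Lemma g_nondeg X Y p : (forall Z, g X Z p = g Y Z p) -> forall u, der X u p = der Y u p.
Proof.
move=> h u; apply/eqP; rewrite -subr_eq0; apply/negP => /negP n0.
have s1 := smooth_cst S (-1).
pose W := vfL (fun=> -1) Y X.
have hW : forall v, der W v p = -1 * der Y v p + der X v p by move=> v; rewrite der_vfL.
have : 0 < g W W p.
  by apply: (@g_pos _ _ u); rewrite hW mulN1r addrC.
by rewrite (clin_lin (@g_clinl W) hW) /= h mulN1r addNr ltxx.
Qed.

Definition onb (e : 'I_d -> vfield S) (q : S) := forall i j, g (e i) (e j) q = (i == j)%:R.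

(** The coordinate fields are orthonormalised in their order, so that e_a is a combination of E_0,
    ..., E_a with positive last coefficient. The induction is on the number m of fields already
    treated. *)
Lemma gram_schmidt p x E : (forall i, smooth (x i)) -> nearby p (coords x E) ->
  exists e : 'I_d -> vfield S, nearby p (fun q => onb e q /\
    forall a : 'I_d, (forall j : 'I_d, (a < j)%N -> der (e a) (x j) q = 0) /\ 0 < der (e a) (x a) q).
Proof.
move=> sx nx.
suff /(_ d (leqnn d)) [e he] : forall m, (m <= d)%N -> exists e : 'I_d -> vfield S, nearby p (fun q =>
   (forall a b : 'I_d, (a < m)%N -> (b < m)%N -> g (e a) (e b) q = (a == b)%:R) /\
   forall a : 'I_d, (a < m)%N -> (forall j : 'I_d, (a < j)%N -> der (e a) (x j) q = 0) /\ 0 < der (e a) (x a) q).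
  exists e; apply: nearbyW he => q [h1 h2]; split; first by move=> a b; apply: h1.
  by move=> a; apply: h2.
elim=> [|m IH] md; first by exists E; apply: nearbyT.
have [e he] := IH (ltnW md); pose i0 : 'I_d := Ordinal md.
(* E_m minus its projections on the first m fields; the factor (a < m) turns the sum over all
   indices into the sum over those. Since v(x_m) = 1 near p, v is nonzero and can be normalised. *)
pose v := vfL (fun=> 1) (E i0) (vfsum (enum 'I_d) (fun a q => (a < m)%N%:R * - g (E i0) (e a) q) e).
have sc (a : 'I_d) : smooth (fun q => (a < m)%N%:R * - g (E i0) (e a) q).
  by apply: (smM rg); [exact: smooth_cst|apply: (smN rg); exact: g_sm].
have s1 := smooth_cst S 1.
have dv u q : der v u q = der (E i0) u q - \sum_(a < d | (a < m)%N) g (E i0) (e a) q * der (e a) u q.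
  rewrite der_vfL // mul1r der_vfsum // big_enum /= -sumrN [in RHS]big_mkcond /=.
  by congr (_ + _); apply: eq_bigr => a _; case: ifP => _; rewrite ?mul1r ?mulNr ?mul0r.
have gv w q : g v w q = g (E i0) w q - \sum_(a < d | (a < m)%N) g (E i0) (e a) q * g (e a) w q.
  rewrite (clinL _ _ _ (@g_clinl w)) // mul1r (clin_vfsum _ _ _ (@g_clinl w)) // big_enum /= -sumrN [in RHS]big_mkcond /=.
  by congr (_ + _); apply: eq_bigr => a _; case: ifP => _; rewrite ?mul1r ?mulNr ?mul0r.
have hv : nearby p (fun q => der v (x i0) q = 1 /\ forall j : 'I_d, (m < j)%N -> der v (x j) q = 0).
  apply: nearbyW (nearbyI rg nx he) => q [[hx _] [_ he2]]; split=> [|j mj].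
    rewrite dv hx eqxx big1 ?subr0 // => a am.
    by rewrite ((he2 a am).1 i0 am) mulr0.
  have -> : der v (x j) q = 0; last by [].
  rewrite dv hx (_ : (i0 == j) = false); last by apply: contraTF mj => /eqP <-; rewrite ltnn.
  rewrite big1 ?subr0 //.
  by move=> a am; rewrite ((he2 a am).1 j (ltn_trans am mj)) mulr0.
have [|h sh nh] := @sm_isqrt _ _ _ rg (g v v) p (g_sm v v).
  by apply: (@g_pos _ _ (x i0)); have [-> _] := nearby_sub hv; rewrite oner_neq0.
exists (fun a => if a == i0 then vfL h v (vf0 S) else e a).
apply: nearbyW (nearbyI rg (nearbyI rg nh hv) he) => q [[[h0 hh] [v1 v2]] [e1 e2]].
have ai (a : 'I_d) : (a < m.+1)%N -> (a == i0) || (a < m)%N.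
  by rewrite ltnS leq_eqVlt -val_eqE.
have gve (b : 'I_d) : (b < m)%N -> g v (e b) q = 0.
  move=> bm; rewrite gv (bigD1 b) //= e1 // eqxx mulr1 big1 ?addr0 ?subrr // => a /andP[am ab].
  by rewrite e1 // (negbTE ab) mulr0.
have gh w : g (vfL h v (vf0 S)) w q = h q * g v w q.
  by rewrite (clinL _ _ _ (@g_clinl w)) // (clin0 _ (@g_clinl w)) addr0.
split=> [a b /ai + /ai|a /ai].
  have [->|a0] := eqVneq a i0; have [->|b0] := eqVneq b i0 => //= am bm.
  - by rewrite gh g_sym gh mulrA -expr2 hh.
  - by rewrite gh gve // mulr0.
  - by rewrite g_sym gh gve // mulr0 (negbTE a0).
  - exact: e1.
have [->|a0] := eqVneq a i0 => /= am; last exact: e2.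
split=> [j mj|]; rewrite der_vfL // der_vf0 addr0; first by rewrite v2 ?mulr0.
by rewrite v1 mulr1.
Qed.

(** If M is the matrix of e in the frame E and G the Gram matrix of E, orthonormality reads M (G
    M^T) = 1. For square matrices this implies (G M^T) M = 1, which is the expansion of every field
    in e. *)
Lemma onb_complete e q : onb e q -> forall X u,
  der X u q = \sum_a g X (e a) q * der (e a) u q.
Proof.
move=> oe X u; have [x [E [sx nx]]] := has_coords rg q.
have [hx hX] := nearby_sub nx.
pose M : 'M[R]_d := \matrix_(a, i) der (e a) (x i) q.
pose G : 'M[R]_d := \matrix_(i, j) g (E i) (E j) q.
have gE Y Z : g Y Z q = \sum_i \sum_j der Y (x i) q * der Z (x j) q * G i j.
  rewrite (clin_expand _ (@g_clinl Z) sx nx); apply: eq_bigr => i _.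
  rewrite (clin_expand _ (@g_clinr _) sx nx) mulr_sumr; apply: eq_bigr => j _.
  by rewrite !mxE mulrA.
have MGM : M *m (G *m M^T) = 1%:M.
  apply/matrixP => a b; rewrite !mxE -oe gE; apply: eq_bigr => i _.
  by rewrite !mxE mulr_sumr; apply: eq_bigr => j _; rewrite !mxE; ring.
have /mulmx1C GMM := MGM.
pose xi : 'rV[R]_d := \row_i der X (x i) q.
pose ui : 'cV[R]_d := \col_i der (E i) u q.
have -> : der X u q = (xi *m ui) 0 0.
  by rewrite mxE hX; apply: eq_bigr => i _; rewrite !mxE.
rewrite -[xi]mulmx1 -GMM -!mulmxA mulmxA mulmxA mxE; apply: eq_bigr => a _.
congr (_ * _); last by rewrite mxE hX; apply: eq_bigr => i _; rewrite !mxE.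
rewrite gE !mxE exchange_big /=; apply: eq_bigr => j _.
by rewrite !mxE mulr_suml; apply: eq_bigr => i _; rewrite !mxE; ring.
Qed.

Lemma onb_ex p : exists e, nearby p (onb e).
Proof.
have [x [E [sx nx]]] := has_coords rg p; have [e he] := gram_schmidt sx nx.
by exists e; apply: nearbyW he => q [].
Qed.
Lemma frame_onb p : onb (frame_at g p) p.
Proof.
apply: (@such_thatP _ (fun=> vf0 S) [set e | forall i j, g (e i) (e j) p = (i == j)%:R]).
by have [e /nearby_sub he] := onb_ex p; exists e.
Qed.
Lemma onb_lin T e X q : clin T -> onb e q -> T X q = \sum_a g X (e a) q * T (e a) q.
Proof. by move=> hT oe; apply: clin_sum_at => // u; apply: onb_complete. Qed.

Definition blin (B : vfield S -> vfield S -> S -> R) :=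
  (forall Y, clin (fun X => B X Y)) /\ (forall X, clin (B X)).

Lemma trace_onb B e q : blin B -> onb e q -> trace d g B q = \sum_a B (e a) (e a) q.
Proof.
move=> [hl hr] oe; rewrite /trace; set f := frame_at g q.
have of_ : onb f q := frame_onb q.
under eq_bigr => a _ do rewrite (onb_lin _ (hl _) oe).
under eq_bigr => a _ do under eq_bigr => b _ do rewrite (onb_lin (f a) (hr _) oe) mulr_sumr.
rewrite exchange_big /=; apply: eq_bigr => b _; rewrite exchange_big /=.
rewrite (bigD1 b) //= [X in _ + X]big1 ?addr0 => [|c cb].
  under eq_bigr => a _ do rewrite mulrA (g_sym (f a)).
  rewrite -mulr_suml -(onb_lin (e b) (@g_clinr (e b)) of_) /= ?oe ?eqxx ?mul1r //.
under eq_bigr => a _ do rewrite mulrA (g_sym (f a)).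
rewrite -mulr_suml.
have -> : \sum_a g (e b) (f a) q * g (f a) (e c) q = g (e b) (e c) q.
  by rewrite (onb_lin (e b) (@g_clinl (e c)) of_).
by rewrite oe eq_sym (negbTE cb) mul0r.
Qed.

(** The frame in the definition of [trace] is chosen point by point, without continuity. Near each
    point it can be replaced by one smooth orthonormal frame, since the trace does not depend on the
    frame. *)
Lemma trace_sm B : blin B -> (forall X Y, smooth (B X Y)) -> smooth (trace d g B).
Proof.
move=> hB sB; apply: (sm_local rg) => p; have [e he] := onb_ex p.
exists (fun q => \sum_a B (e a) (e a) q); first exact: (sm_sum rg).
by apply: nearbyW he => q; apply: trace_onb.
Qed.

Definition sharp (T : vfield S -> S -> R) : vfield S :=
  mkvf (fun u => trace d g (fun X Y p => T X p * der Y u p)).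

Lemma blinM T U : clin T -> clin U -> blin (fun X Y p => T X p * U Y p).
Proof.
move=> hT hU; split=> [Y|X] f Z W V p h; first by rewrite (hT _ _ _ _ _ h); ring.
by rewrite (hU _ _ _ _ _ h); ring.
Qed.

Lemma der_sharp T e u p : clin T -> (forall X, smooth (T X)) -> smooth u -> onb e p ->
  der (sharp T) u p = \sum_a T (e a) p * der (e a) u p.
Proof.
move=> hT sT su oe; have hb v := blinM hT (@clin_der v).
rewrite /sharp mkvfE ?(trace_onb (hb u) oe) //.
- by move=> v sv; apply: trace_sm => // X Y; apply: (smM rg) => //; exact: der_sm.
- move=> a v w q sv sw; rewrite !(trace_onb (hb _) (frame_onb q)) mulr_sumr -big_split /=.
  apply: eq_bigr => i _; rewrite (derD rg) ?(derZ rg) //; first by ring.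
  by apply: (smM rg) => //; exact: smooth_cst.
- move=> v w q sv sw; rewrite !(trace_onb (hb _) (frame_onb q)) mulr_sumr mulr_suml -big_split /=.
  by apply: eq_bigr => i _; rewrite (derM rg) //; ring.
Qed.

Lemma g_sharp T X p : clin T -> (forall X, smooth (T X)) -> g (sharp T) X p = T X p.
Proof.
move=> hT sT; have of_ := frame_onb p; rewrite (onb_lin X hT of_).
have -> : g (sharp T) X p = \sum_(a < d) T (frame_at g p a) p * g (frame_at g p a) X p.
  apply: (@clin_sum_at (fun Y => g Y X)); first exact: g_clinl.
  move=> u; have [su|nu] := pselect (smooth u); first exact: der_sharp.
  by rewrite der_ns // big1 // => a _; rewrite der_ns ?mulr0.
by apply: eq_bigr => a _; rewrite mulrC g_sym.
Qed.

Lemma g_grad u X p : g (grad g u) X p = der X u p.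
Proof.
move: X p; apply: (@such_thatP _ (vf0 S) [set Z | forall X p, g Z X p = der X u p]).
exists (sharp (fun X => der X u)) => X p; apply: g_sharp; first exact: clin_der.
by move=> Y; exact: der_sm.
Qed.

Lemma der_of_g X Y Z W (a b c : R) p :
  (forall V, g X V p = a * g Y V p + b * g Z V p + c * g W V p) ->
  forall u, der X u p = a * der Y u p + b * der Z u p + c * der W u p.
Proof.
move=> h u; rewrite !(onb_complete (frame_onb p)) !mulr_sumr -!big_split /=.
by apply: eq_bigr => i _; rewrite h; ring.
Qed.
Lemma clin3 T X Y Z W (a b c : R) p : clin T ->
  (forall u, der X u p = a * der Y u p + b * der Z u p + c * der W u p) ->
  T X p = a * T Y p + b * T Z p + c * T W p.
Proof.
move=> hT h.
pose V := vfL (fun=> a) Y (vfL (fun=> b) Z (vfL (fun=> c) W (vf0 S))).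
have sc r := smooth_cst S r.
rewrite (@clin_at T X V) //; first by rewrite !clinL // clin0 //; ring.
by move=> u; rewrite h !der_vfL // der_vf0; ring.
Qed.

Lemma der_lie X Y u p : der (lie X Y) u p = der X (der Y u) p - der Y (der X u) p.
Proof.
have [su|nu] := pselect (smooth u); last first.
  by rewrite !(der_ns _ nu) !(der_cst rg) subrr.
pose P := [set Z : vfield S | forall (f : sfun S) (p : S), Z f p = X (Y f) p - Y (X f) p].
suff : P (such_that (vf0 S) P).
  move=> /(_ (exist _ u su) p); rewrite !vfE /sfun_val /= => ->.
  by congr (der X _ p - der Y _ p); apply/funext => q; rewrite vfE.
apply: such_thatP; exists (mkvf (fun v q => der X (der Y v) q - der Y (der X v) q)) => f q.
rewrite !vfE mkvfE ?(vfE Y) ?(vfE X) //; last exact: sfun_sm.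
- by move=> v sv; apply: (smB rg); exact: der_sm.
- move=> a v w r sv sw.
  have e V r' : der V (fun q => a * v q + w q) r' = a * der V v r' + der V w r'.
    rewrite (derD rg) ?(derZ rg) //; apply: (smM rg) => //; exact: smooth_cst.
  rewrite (_ : der Y (fun q => a * v q + w q) = fun r => a * der Y v r + der Y w r); last exact/funext.
  rewrite (_ : der X (fun q => a * v q + w q) = fun r => a * der X v r + der X w r); last exact/funext.
  rewrite !(derD rg) ?(derZ rg) //; try exact: der_sm; try (apply: (smM rg); [exact: smooth_cst|exact: der_sm]).
  by ring.
- move=> v w r sv sw.
  have e V r' : der V (fun q => v q * w q) r' = v r' * der V w r' + der V v r' * w r' by exact: (derM rg).
  rewrite (_ : der Y (fun q => v q * w q) = fun r => v r * der Y w r + der Y v r * w r); last exact/funext.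
  rewrite (_ : der X (fun q => v q * w q) = fun r => v r * der X w r + der X v r * w r); last exact/funext.
  rewrite !(derD rg) ?(derM rg) //; try exact: der_sm; try by apply: (smM rg) => //; exact: der_sm.
  by ring.
Qed.

(** [lincomb] with a bare function as coefficient and [der] in place of the action on smooth
    functions; it is the form in which fields such as X f and f themselves can be used as
    coefficients. *)
Definition hlin (f : S -> R) X Y Z := smooth f /\ forall u q, der Z u q = f q * der X u q + der Y u q.
Lemma clinH T f X Y Z q : clin T -> hlin f X Y Z -> T Z q = f q * T X q + T Y q.
Proof. by move=> hT [sf h]; apply: clinP. Qed.
Lemma der_hlin f X Y Z (T : vfield S -> S -> R) W q : clin T -> (forall X, smooth (T X)) ->
  hlin f X Y Z ->
  der W (T Z) q = der W f q * T X q + f q * der W (T X) q + der W (T Y) q.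
Proof.
move=> hT sT h; have [sf _] := h.
rewrite (_ : T Z = fun r => f r * T X r + T Y r); last by apply/funext => r; apply: clinH.
rewrite (derD rg) ?(derM rg) //; [ring|exact: (smM rg)].
Qed.
Lemma lie_hlinr f X Y Z W u q : hlin f X Y Z ->
  der (lie W Z) u q = f q * der (lie W X) u q + der W f q * der X u q + 1 * der (lie W Y) u q.
Proof.
move=> h; have [sf e] := h; rewrite !der_lie e.
rewrite (@der_hlin f X Y Z (fun X => der X u) W q (@clin_der u)) //; first by ring.
by move=> ?; exact: der_sm.
Qed.
Lemma lie_hlinl f X Y Z W u q : hlin f X Y Z ->
  der (lie Z W) u q = f q * der (lie X W) u q + (- der W f q) * der X u q + 1 * der (lie Y W) u q.
Proof.
move=> h; have := lie_hlinr W u q h; rewrite !der_lie => e.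
have -> : der Z (der W u) q - der W (der Z u) q = - (der W (der Z u) q - der Z (der W u) q) by ring.
by rewrite e; ring.
Qed.

Definition koszul X Y Z p : R := 2^-1 * (der X (g Y Z) p + der Y (g X Z) p - der Z (g X Y) p
  + g (lie X Y) Z p - g (lie X Z) Y p - g (lie Y Z) X p).

Lemma koszul_sm X Y Z : smooth (koszul X Y Z).
Proof.
apply: (smM rg); first exact: smooth_cst.
do 2 (apply: (smB rg); last exact: g_sm); apply: (smD rg); last exact: g_sm.
by apply: (smB rg); [apply: (smD rg)|]; exact: der_sm.
Qed.

Lemma koszul_hlin f X Y Z : hlin f X Y Z -> forall V W q,
  [/\ koszul Z V W q = f q * koszul X V W q + koszul Y V W q,
      koszul V Z W q = f q * koszul V X W q + der V f q * g X W q + koszul V Y W q &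
      koszul V W Z q = f q * koszul V W X q + koszul V W Y q].
Proof.
move=> h V W q; have [sf e] := h.
have dl A B : der A (g Z B) q = der A f q * g X B q + f q * der A (g X B) q + der A (g Y B) q.
  by apply: (der_hlin (T := fun X => g X B)) => // [|U]; [exact: g_clinl|exact: g_sm].
have dr A B : der A (g B Z) q = der A f q * g B X q + f q * der A (g B X) q + der A (g B Y) q.
  by apply: (der_hlin (T := g B)) => // [|U]; [exact: g_clinr|exact: g_sm].
have ll A B : g (lie Z A) B q = f q * g (lie X A) B q + (- der A f q) * g X B q + 1 * g (lie Y A) B q.
  by apply: (clin3 (T := fun X => g X B)) => [|u]; [exact: g_clinl|exact: lie_hlinl].
have lr A B : g (lie A Z) B q = f q * g (lie A X) B q + der A f q * g X B q + 1 * g (lie A Y) B q.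
  by apply: (clin3 (T := fun X => g X B)) => [|u]; [exact: g_clinl|exact: lie_hlinr].
have gl A : g Z A q = f q * g X A q + g Y A q by apply: (clinH q (@g_clinl A)).
have gr A : g A Z q = f q * g A X q + g A Y q by apply: (clinH q (@g_clinr A)).
by split; rewrite /koszul ?dl ?dr ?ll ?lr ?gl ?gr ?e ?(g_sym V X) ?(g_sym W X); field.
Qed.

Lemma lincomb_hlin (f : sfun S) X Y Z : lincomb f X Y Z -> hlin f X Y Z.
Proof. by move/lincombE => h; split=> //; exact: sfun_sm. Qed.
Lemma koszul_clin X Y : clin (koszul X Y).
Proof. by move=> f Z W V p /lincomb_hlin h; have [_ _ ->] := koszul_hlin h X Y p. Qed.

Lemma lc_ex : is_levi_civita g (fun X Y => sharp (koszul X Y)).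
Proof.
have gK X Y Z p : g (sharp (koszul X Y)) Z p = koszul X Y Z p.
  by apply: g_sharp; [exact: koszul_clin|move=> ?; exact: koszul_sm].
split.
- move=> f X Y Z W /lincomb_hlin h; apply/lincombE => u p.
  rewrite (@der_of_g _ (sharp (koszul X W)) (sharp (koszul Y W)) (vf0 S) (f p) 1 0) ?mul1r ?mul0r ?addr0 // => V.
  by rewrite !gK mul0r addr0 mul1r; have [-> _ _] := koszul_hlin h W V p.
- move=> f X Y Z W /lincomb_hlin h v p; rewrite !vfE.
  rewrite (@der_of_g _ (sharp (koszul W X)) X (sharp (koszul W Y)) (f p) (der W f p) 1) ?mul1r // => V.
  by rewrite !gK mul1r; have [_ -> _] := koszul_hlin h W V p.
- move=> X Y f p; rewrite !vfE -der_lie.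
  have e := @der_of_g (lie X Y) (sharp (koszul X Y)) (sharp (koszul Y X)) (vf0 S) 1 (-1) 0 p.
  rewrite e ?mul1r ?mulN1r ?mul0r ?addr0 // => V.
  rewrite mul0r !gK /koszul.
  have -> : g (lie Y X) V p = - g (lie X Y) V p.
    have := @clin3 (fun X => g X V) (lie Y X) (lie X Y) (vf0 S) (vf0 S) (-1) 0 0 p (@g_clinl V).
    rewrite mulN1r !mul0r !addr0; apply => u; rewrite !der_lie; ring.
  rewrite (_ : g Y X = g X Y); last by apply/funext => q; rewrite g_sym.
  by field.
- move=> X Y Z p; rewrite gK (g_sym Y) gK /koszul.
  rewrite (_ : g Z Y = g Y Z); last by apply/funext => q; rewrite g_sym.
  have -> : g (lie Z Y) X p = - g (lie Y Z) X p.
    have := @clin3 (fun A => g A X) (lie Z Y) (lie Y Z) (vf0 S) (vf0 S) (-1) 0 0 p (@g_clinl X).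
    rewrite mulN1r !mul0r !addr0; apply => u; rewrite !der_lie; ring.
  by field.
Qed.

Lemma lcP : is_levi_civita g (levi_civita g).
Proof. by apply: (@such_thatP _ (fun _ _ => vf0 S)); eexists; exact: lc_ex. Qed.

Lemma lc_tor X Y u p : der (levi_civita g X Y) u p - der (levi_civita g Y X) u p = der (lie X Y) u p.
Proof.
have [su|nu] := pselect (smooth u); last by rewrite !der_ns // subrr.
have [_ _ h _] := lcP; have := h X Y (exist _ u su) p; rewrite !vfE der_lie /sfun_val /= => ->.
by congr (der X _ p - der Y _ p); apply/funext => q; rewrite vfE.
Qed.
Lemma lc_met X Y Z p : der X (g Y Z) p =
  g (levi_civita g X Y) Z p + g Y (levi_civita g X Z) p.
Proof. by have [_ _ _ h] := lcP. Qed.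
Lemma lcL f X Y Z W u p : hlin f X Y Z ->
  der (levi_civita g Z W) u p = f p * der (levi_civita g X W) u p + der (levi_civita g Y W) u p.
Proof.
move=> [sf e]; have [h _ _ _] := lcP.
have /h : lincomb (exist _ f sf) X Y Z by apply/lincombE.
by move=> /(_ W)/lincombE ->.
Qed.
Lemma lcR f X Y Z W u p : hlin f X Y Z ->
  der (levi_civita g W Z) u p = f p * der (levi_civita g W X) u p + der W f p * der X u p
     + der (levi_civita g W Y) u p.
Proof.
move=> [sf e]; have [su|nu] := pselect (smooth u); last by rewrite !(der_ns _ nu); ring.
have [_ h _ _] := lcP.
have /h : lincomb (exist _ f sf) X Y Z by apply/lincombE.
by move=> /(_ W (exist _ u su) p); rewrite !vfE.
Qed.
(** This is the uniqueness of the Levi-Civita connection: the Koszul formula holds for whichever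
    connection [levi_civita] has chosen. *)
Lemma lc_koszul X Y Z p : g (levi_civita g X Y) Z p = koszul X Y Z p.
Proof.
rewrite /koszul !lc_met.
have e A B C : g (lie A B) C p = g (levi_civita g A B) C p - g (levi_civita g B A) C p.
  have := @clin3 (fun X => g X C) (lie A B) (levi_civita g A B) (levi_civita g B A) (vf0 S) 1 (-1) 0 p (@g_clinl C).
  rewrite mul1r mulN1r mul0r addr0; apply => u; rewrite -lc_tor; ring.
by rewrite !e !(g_sym Y (levi_civita _ _ _)) !(g_sym X (levi_civita _ _ _)); field.
Qed.

End Metric.
End Fields.

(** * Differential forms *)

Section Forms.
Context {R : realType} {S : smooth_space R} {d : nat}.
Hypothesis rg : regular S d.
Implicit Types (X Y Z W : vfield S) (u v f : S -> R) (p q : S) (k : int) (A B : dform S).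
Implicit Types (s : seq (vfield S)).

Lemma clin_app (T : vfield S -> S -> R) (f : sfun S) X Y Z p : clin T ->
  lincomb f X Y Z -> T Z p = f p * T X p + T Y p.
Proof. by move=> hT; apply: hT. Qed.

Lemma clin2 T X Y Z (a b : R) p : clin T ->
  (forall u, der X u p = a * der Y u p + b * der Z u p) -> T X p = a * T Y p + b * T Z p.
Proof.
move=> hT h; rewrite (@clin3 _ _ _ rg T X Y Z (vf0 S) a b 0 p hT) ?mul0r ?addr0 // => u.
by rewrite h mul0r addr0.
Qed.
Lemma der_locst X u a p : smooth u -> nearby p (fun q => u q = a) -> der X u p = 0.
Proof. by move=> su h; rewrite (der_near rg X su (smooth_cst S a) h) (der_cst rg). Qed.

Lemma dfP A B : (forall s p, A s p = B s p) -> A = B.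
Proof. by move=> h; apply/funext => s; apply/funext => p. Qed.

Lemma form_sm k A s : is_form k A -> smooth (A s). Proof. by case. Qed.
Lemma form_deg k A s p : is_form k A -> (size s)%:Z != k -> A s p = 0.
Proof. by case=> _ h _ _ /h. Qed.
Lemma form_alt k A s1 s2 s3 X p : is_form k A -> A (s1 ++ X :: s2 ++ X :: s3) p = 0.
Proof. by case. Qed.
Lemma form_clin k A s1 s2 : is_form k A -> clin (fun X => A (s1 ++ X :: s2)).
Proof. by case=> _ _ _ h f X Y Z p; apply: h. Qed.
Lemma form_clin0 k A s : is_form k A -> clin (fun X => A (X :: s)).
Proof. by move=> /(form_clin nil s). Qed.
Lemma form_neg k A : k < 0 -> is_form k A -> A = 0.
Proof.
move=> k0 hA; apply: dfP => s p; apply: (form_deg _ hA).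
by apply: contraTneq k0 => <-.
Qed.

Lemma form_swap k A s1 s2 X Y p : is_form k A ->
  A (s1 ++ X :: Y :: s2) p = - A (s1 ++ Y :: X :: s2) p.
Proof.
move=> hA; pose W := vfL (fun=> 1) X Y; have s1' := smooth_cst S 1.
have := form_alt s1 nil s2 W p hA; rewrite cat0s.
rewrite (clinL rg _ _ _ (form_clin s1 (W :: s2) hA) s1') //=.
have e Z : A (s1 ++ Z :: W :: s2) p = A (s1 ++ Z :: X :: s2) p + A (s1 ++ Z :: Y :: s2) p.
  have := clinL rg X Y p (form_clin (s1 ++ [:: Z]) s2 hA) s1'.
  by rewrite -!catA /= mul1r.
rewrite mul1r !e (form_alt s1 nil s2 X p hA) (form_alt s1 nil s2 Y p hA).
by rewrite add0r addr0 => /eqP; rewrite addr_eq0 => /eqP.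
Qed.
Lemma form_move k A s1 s2 X p : is_form k A ->
  A (s1 ++ X :: s2) p = (-1) ^+ size s1 * A (X :: s1 ++ s2) p.
Proof.
move=> hA; elim/last_ind: s1 s2 => [|s1 Y IH] s2; first by rewrite expr0 mul1r.
rewrite -cats1 -!catA /= (form_swap _ _ _ _ _ hA) IH size_cat addn1 exprS; ring.
Qed.

(** The criterion behind the inductions on the degree: it is enough to treat the contractions inter
    X B and the first two arguments, since a repeated argument can be moved to the front at the cost
    of a sign. *)
Lemma form_of_inter k B :
  (forall X, is_form (k - 1) (inter X B)) -> (forall s, clin (fun X => B (X :: s))) ->
  (forall X s p, B (X :: X :: s) p = 0) -> smooth (B [::]) ->
  (k != 0 -> forall p, B [::] p = 0) -> is_form k B.
Proof.
move=> hi hl ha s0 d0; split.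
- by move=> [//|X s]; apply: form_sm (hi X).
- move=> [|X s] sk p; first by apply: d0; rewrite eq_sym.
  by apply: (form_deg p (hi X) (s := s)); apply: contraNneq sk => e; rewrite /= -addn1 PoszD e subrK.
- move=> [|Y s1] s2 s3 X p /=; last exact: (form_alt s1 s2 s3 X p (hi Y)).
  have := form_move s2 s3 X p (hi X); rewrite /inter => ->.
  by rewrite ha mulr0.
- move=> [|Y s1] s2 f X Z W p h /=; first exact: hl h.
  exact: (clin_app p (form_clin s1 s2 (hi Y)) h).
Qed.

Lemma form0 k : is_form k (0 : dform S).
Proof.
split=> // [s|s1 s2 f X Y Z p _]; first exact: smooth_cst.
by rewrite /GRing.zero /= mulr0 addr0.
Qed.
Lemma formD k A B : is_form k A -> is_form k B -> is_form k (A + B).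
Proof.
move=> hA hB; split=> [s|s sk p|s1 s2 s3 X p|s1 s2 f X Y Z p h].
- by apply: (smD rg); [exact: form_sm hA|exact: form_sm hB].
- by rewrite /= (_ : (A + B) s p = A s p + B s p) // (form_deg _ hA) // (form_deg _ hB) // addr0.
- by rewrite (_ : (A + B) _ p = A (s1 ++ X :: s2 ++ X :: s3) p + B (s1 ++ X :: s2 ++ X :: s3) p) // (form_alt _ _ _ _ _ hA) (form_alt _ _ _ _ _ hB) addr0.
- have E s : (A + B) s p = A s p + B s p by [].
  rewrite !E (clin_app p (form_clin s1 s2 hA) h) (clin_app p (form_clin s1 s2 hB) h); ring.
Qed.
Lemma formM k u A : smooth u -> is_form k A -> is_form k (fmul u A).
Proof.
move=> su hA; split=> [s|s sk p|s1 s2 s3 X p|s1 s2 f X Y Z p h]; rewrite /fmul.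
- by apply: (smM rg) => //; exact: form_sm hA.
- by rewrite (form_deg _ hA) // mulr0.
- by rewrite (form_alt _ _ _ _ _ hA) mulr0.
- by rewrite (clin_app p (form_clin s1 s2 hA) h); ring.
Qed.
Lemma formN k A : is_form k A -> is_form k (- A).
Proof.
move=> hA; have -> : - A = fmul (fun=> -1) A.
  by apply: dfP => s p; rewrite /fmul mulN1r.
by apply: formM => //; exact: smooth_cst.
Qed.
Lemma formB k A B : is_form k A -> is_form k B -> is_form k (A - B).
Proof. by move=> hA hB; apply: formD => //; apply: formN. Qed.
Lemma dfMzE A (n : int) s p : (A *~ n) s p = A s p *~ n.
Proof.
have natE m : (A *+ m) s p = A s p *+ m.
  by elim: m => [|m IH]; rewrite ?mulr0n // !mulrS -IH.
case: n => n; rewrite ?NegzE; first exact: natE.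
by rewrite !mulrNz -!pmulrn -natE.
Qed.
Lemma dfMnE A (n : nat) s p : (A *+ n) s p = A s p *+ n.
Proof. exact: (dfMzE A n). Qed.
Lemma formMz k A (n : int) : is_form k A -> is_form k (A *~ n).
Proof.
move=> hA; have -> : A *~ n = fmul (fun=> n%:~R) A.
  by apply: dfP => s p; rewrite dfMzE /fmul mulrzl.
by apply: formM => //; exact: smooth_cst.
Qed.
Lemma formMn k A (n : nat) : is_form k A -> is_form k (A *+ n).
Proof. exact: (formMz (Posz n)). Qed.
Lemma form_inter k A X : is_form k A -> is_form (k - 1) (inter X A).
Proof.
move=> hA; split=> [s|s sk p|s1 s2 s3 Y p|s1 s2 f Y Z W p h]; rewrite /inter.
- exact: form_sm hA.
- by apply: (form_deg p hA); apply: contraNneq sk => <-; rewrite /= -addn1 PoszD addrK.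
- exact: (form_alt (X :: s1) s2 s3 Y p hA).
- exact: (clin_app p (form_clin (X :: s1) s2 hA) h).
Qed.
Lemma form_anti k A X Y s p : is_form k A -> A (X :: Y :: s) p = - A (Y :: X :: s) p.
Proof. by move=> hA; apply: (form_swap nil s X Y p hA). Qed.
Lemma form_diag k A X s p : is_form k A -> A (X :: X :: s) p = 0.
Proof. by move=> hA; apply: (form_alt nil nil s X p hA). Qed.

(** Degrees are integers and forms of negative degree vanish, so an induction starts below zero and
    functions are reached from degree -1. *)
Lemma degree_ind (P : int -> Prop) : (forall k, k < 0 -> P k) ->
  (forall n : nat, P (n%:Z - 1) -> P n%:Z) -> forall k, P k.
Proof.
move=> h0 h1 [n|n]; last exact: h0.
by elim: n => [|n IH]; apply: h1; [exact: h0|rewrite -addn1 PoszD addrK].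
Qed.

(** Common shape of epsilon(theta), of d and, on forms, of the action [dact] of an endomorphism.
    [alt_cons] is the recursion on which the inductions over the list of arguments rest. *)
Definition alt (T : vfield S -> dform S) : dform S := fun s p =>
  \sum_(i < size s) (-1) ^+ i * T (tnth (in_tuple s) i) (remove s i) p.

Lemma alt_nil T p : alt T [::] p = 0. Proof. by rewrite /alt big_ord0. Qed.
Lemma alt_cons T X s p : alt T (X :: s) p = T X s p - alt (fun Y => inter X (T Y)) s p.
Proof.
rewrite /alt big_ord_recl expr0 mul1r; congr (_ + _); first by rewrite /remove /= drop0.
rewrite -sumrN; apply: eq_bigr => i _.
by rewrite !(tnth_nth X) /= /bump /= exprS mulN1r mulNr.
Qed.
Lemma eq_alt T U s p : (forall X s, T X s p = U X s p) -> alt T s p = alt U s p.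
Proof. by move=> h; apply: eq_bigr => i _; rewrite h. Qed.
Lemma alt_lin (a b : R) T U s p :
  alt (fun X s p => a * T X s p + b * U X s p) s p = a * alt T s p + b * alt U s p.
Proof. by rewrite /alt !mulr_sumr -big_split /=; apply: eq_bigr => i _; ring. Qed.
Lemma alt_sum (I : Type) (r : seq I) (T : I -> vfield S -> dform S) s p :
  alt (fun X s p => \sum_(i <- r) T i X s p) s p = \sum_(i <- r) alt (T i) s p.
Proof.
by rewrite /alt exchange_big /=; apply: eq_bigr => j _; rewrite mulr_sumr.
Qed.

Lemma alt_form k T : (forall X, is_form k (T X)) -> (forall s, clin (fun X => T X s)) ->
  is_form (k + 1) (alt T).
Proof.
move: k T; apply: degree_ind => [k k0|n IH] T hT lT.
  have -> : alt T = 0; last exact: form0.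
  by apply: dfP => s p; rewrite /alt big1 // => i _; rewrite (form_neg k0 (hT _)) mulr0.
have hi X Y : is_form (n%:Z - 1) (inter X (T Y)) by apply: form_inter.
have li X s : clin (fun Y => inter X (T Y) s) by move=> f Y Z W p h; apply: lT h.
apply: form_of_inter.
- move=> X; rewrite addrK (_ : inter X _ = T X - alt (fun Y => inter X (T Y))).
    by apply: formB; [exact: hT|have := IH _ (hi X) (li X); rewrite subrK].
  by apply: dfP => s p; rewrite /inter alt_cons.
- move=> s f X Y Z p h; rewrite !alt_cons (lT s f X Y Z p h).
  rewrite (_ : alt (fun Y0 => inter Z (T Y0)) s p = f p * alt (fun Y0 => inter X (T Y0)) s p + 1 * alt (fun Y0 => inter Y (T Y0)) s p); first by ring.
  rewrite -(alt_lin (f p) 1 (fun Y0 => inter X (T Y0)) (fun Y0 => inter Y (T Y0))).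
  by apply: eq_alt => W s'; rewrite mul1r; exact: (clin_app p (form_clin0 s' (hT W)) h).
- move=> X s p; rewrite !alt_cons /inter.
  rewrite (_ : alt _ s p = 0) ?subr0 ?subrr // /alt big1 // => i _.
  by rewrite (form_diag _ _ _ (hT _)) mulr0.
- by rewrite (_ : alt T [::] = fun=> 0); [exact: smooth_cst|apply/funext => p; rewrite alt_nil].
- by move=> _ p; rewrite alt_nil.
Qed.

Lemma exterE theta A : exter theta A = alt (fun X => fmul (theta X) A).
Proof. by apply: dfP => s p; apply: eq_bigr => i _; rewrite /fmul mulrA. Qed.
Lemma exter_form k theta A : clin theta -> (forall X, smooth (theta X)) ->
  is_form k A -> is_form (k + 1) (exter theta A).
Proof.
move=> lt st hA; rewrite exterE; apply: alt_form => [X|s f X Y Z p h]; first exact: formM.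
by rewrite /fmul (lt _ _ _ _ _ h); ring.
Qed.
Lemma exter_cons theta A X s p :
  exter theta A (X :: s) p = theta X p * A s p - exter theta (inter X A) s p.
Proof. by rewrite !exterE alt_cons. Qed.
Lemma exter_nil theta A p : exter theta A [::] p = 0.
Proof. by rewrite exterE alt_nil. Qed.
Lemma exter_lin theta (a b : R) A B C s p : (forall s, C s p = a * A s p + b * B s p) ->
  exter theta C s p = a * exter theta A s p + b * exter theta B s p.
Proof.
move=> h; rewrite !exterE -alt_lin; apply: eq_alt => X s'; rewrite /fmul h; ring.
Qed.
Lemma exter_linl t1 t2 t3 (a b : R) A s p : (forall X, t3 X p = a * t1 X p + b * t2 X p) ->
  exter t3 A s p = a * exter t1 A s p + b * exter t2 A s p.
Proof.
move=> h; rewrite !exterE -alt_lin; apply: eq_alt => X s'; rewrite /fmul h; ring.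
Qed.

Definition dact (Phi : vfield S -> vfield S) A : dform S := fun s p =>
  \sum_(i < size s) A (replace s i (Phi (tnth (in_tuple s) i))) p.
Lemma dact_nil Phi A p : dact Phi A [::] p = 0. Proof. by rewrite /dact big_ord0. Qed.
Lemma dact_cons Phi A X s p :
  dact Phi A (X :: s) p = A (Phi X :: s) p + dact Phi (inter X A) s p.
Proof.
rewrite /dact big_ord_recl; congr (_ + _); first by rewrite /replace /= drop0.
by apply: eq_bigr => i _; rewrite !(tnth_nth X).
Qed.
Lemma dact_lin Phi (a b : R) A B C s p : (forall s, C s p = a * A s p + b * B s p) ->
  dact Phi C s p = a * dact Phi A s p + b * dact Phi B s p.
Proof. by move=> h; rewrite /dact !mulr_sumr -big_split /=; apply: eq_bigr => i _. Qed.
Lemma dact_linl Phi Psi Xi (a b : R) k A s p : is_form k A ->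
  (forall X u, der (Xi X) u p = a * der (Phi X) u p + b * der (Psi X) u p) ->
  dact Xi A s p = a * dact Phi A s p + b * dact Psi A s p.
Proof.
move=> hA h; rewrite /dact !mulr_sumr -big_split /=; apply: eq_bigr => i _.
have := clin3 rg (W := vf0 S) (c := 0) (form_clin (take i s) (drop i.+1 s) hA) (X := Xi (tnth (in_tuple s) i)) (Y := Phi (tnth (in_tuple s) i)) (Z := Psi (tnth (in_tuple s) i)) (p := p) (a := a) (b := b).
by rewrite mul0r addr0; apply => u; rewrite h mul0r addr0.
Qed.

Lemma dact_alt Phi k A s p : is_form k A ->
  dact Phi A s p = alt (fun Y => inter (Phi Y) A) s p.
Proof.
elim: s k A => [|X s IH] k A hA; first by rewrite dact_nil alt_nil.
rewrite dact_cons alt_cons (IH _ _ (form_inter X hA)); congr (_ + _).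
have := @alt_lin (-1) 0 (fun Y => inter X (inter (Phi Y) A)) (fun Y => inter X (inter (Phi Y) A)) s p.
rewrite mul0r addr0 mulN1r => <-; apply: eq_alt => Y s'.
by rewrite /inter (form_anti _ _ _ _ hA); ring.
Qed.

(** Covers the covariant derivative (Phi = D X) and the Lie derivative (Phi = lie X) at once. The
    condition [conn] is the Leibniz rule of Phi which makes the result tensorial. *)
Definition gder X (Phi : vfield S -> vfield S) A : dform S := fun s p =>
  der X (A s) p - dact Phi A s p.
Lemma inter_gder X Phi k A Y s p : is_form k A ->
  gder X Phi A (Y :: s) p = gder X Phi (inter Y A) s p - A (Phi Y :: s) p.
Proof. by move=> hA; rewrite /gder dact_cons; rewrite /inter; ring. Qed.

Definition conn X (Phi : vfield S -> vfield S) := forall f Y Z W u p, hlin f Y Z W ->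
  der (Phi W) u p = f p * der (Phi Y) u p + der X f p * der Y u p + der (Phi Z) u p.

Lemma conn_clin X Phi T f Y Z W p : conn X Phi -> clin T -> hlin f Y Z W ->
  T (Phi W) p = f p * T (Phi Y) p + der X f p * T Y p + T (Phi Z) p.
Proof.
move=> hP hT h; have := @clin3 _ _ _ rg T (Phi W) (Phi Y) Y (Phi Z) (f p) (der X f p) 1 p hT.
by rewrite mul1r; apply => u; rewrite mul1r (hP _ _ _ _ _ _ h).
Qed.

Lemma gder_form X Phi k A : conn X Phi -> is_form k A -> is_form k (gder X Phi A).
Proof.
move=> hP; move: k A; apply: degree_ind => [k k0|n IH] A hA.
  have -> : gder X Phi A = 0; last exact: form0.
  apply: dfP => s p; rewrite /gder (form_neg k0 hA) (_ : (0 : dform S) s = fun=> 0) // (der_cst rg).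
  by rewrite /dact big1 ?subr0.
apply: form_of_inter.
- move=> Y; rewrite (_ : inter Y _ = gder X Phi (inter Y A) - inter (Phi Y) A).
    by apply: formB; [apply: IH|]; exact: form_inter.
  by apply: dfP => s p; rewrite /inter (inter_gder _ _ _ _ _ hA).
- move=> s f Y Z W p h; rewrite !(inter_gder _ _ _ _ _ hA).
  have hh := lincomb_hlin h.
  rewrite (conn_clin p hP (form_clin0 s hA) hh) /gder -/(inter _ _).
  rewrite (der_hlin rg X p (form_clin0 s hA) _ hh); last by move=> V; exact: form_sm hA.
  rewrite (@dact_lin Phi (f p) 1 (inter Y A) (inter Z A) (inter W A)) => [|s'].
    by rewrite /inter; ring.
  by rewrite mul1r; apply: (clin_app p (form_clin0 s' hA) h).
- move=> Y s p; rewrite (inter_gder _ _ _ _ _ hA) /gder dact_cons /inter.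
  rewrite (_ : A _ = fun=> 0); last by apply/funext => q; exact: form_diag hA.
  rewrite (der_cst rg) (_ : dact _ _ s p = 0); first by rewrite (form_anti _ _ _ _ hA); ring.
  by rewrite /dact big1 // => i _; exact: form_diag hA.
- rewrite (_ : gder X Phi A [::] = der X (A [::])); first exact: der_sm.
  by apply/funext => p; rewrite /gder dact_nil subr0.
- move=> n0 p; rewrite /gder dact_nil subr0 (_ : A [::] = fun=> 0) ?(der_cst rg) //.
  by apply/funext => q; rewrite (form_deg _ hA) // eq_sym.
Qed.

Lemma lie_conn X : conn X (lie X).
Proof. by move=> f Y Z W u p h; rewrite (lie_hlinr rg X u p h) mul1r. Qed.

Definition Lie X A : dform S := gder X (lie X) A.

Lemma Lie_lin X (a b : R) A B s p : smooth (A s) -> smooth (B s) ->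
  Lie X (fun s p => a * A s p + b * B s p) s p = a * Lie X A s p + b * Lie X B s p.
Proof.
move=> sA sB; rewrite /Lie /gder (@dact_lin _ a b A B) //.
rewrite (derD rg) ?(derZ rg) //; first by ring.
  by apply: (smM rg) => //; exact: smooth_cst.
by apply: (smM rg) => //; exact: smooth_cst.
Qed.
Lemma LieB X k A B s p : is_form k A -> is_form k B -> Lie X (A - B) s p = Lie X A s p - Lie X B s p.
Proof.
move=> hA hB; have := @Lie_lin X 1 (-1) A B s p (form_sm s hA) (form_sm s hB).
rewrite mul1r mulN1r => <-.
by congr (Lie X _ s p); apply: dfP => s' p'; rewrite mul1r mulN1r.
Qed.
Lemma inter_Lie X Y k A : is_form k A -> inter Y (Lie X A) = Lie X (inter Y A) - inter (lie X Y) A.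
Proof. by move=> hA; apply: dfP => s p; rewrite /inter /Lie (inter_gder _ _ _ _ _ hA). Qed.
Lemma Lie_form X k A : is_form k A -> is_form k (Lie X A).
Proof. by move=> hA; apply: gder_form => //; exact: lie_conn. Qed.

(** Induction on the arguments; the terms in which the bracket acts on the first argument cancel by
    the Jacobi identity. *)
Lemma Lie_comm X Y k A s p : is_form k A ->
  Lie X (Lie Y A) s p - Lie Y (Lie X A) s p = Lie (lie X Y) A s p.
Proof.
elim: s k A => [|Z s IH] k A hA.
  rewrite /Lie /gder !dact_nil !subr0 (der_lie rg).
  by congr (der X _ p - der Y _ p); apply/funext => q; rewrite dact_nil subr0.
have hXA := Lie_form X hA; have hYA := Lie_form Y hA; have hZA := form_inter Z hA.
have E V B : is_form k B -> Lie V B (Z :: s) p = Lie V (inter Z B) s p - B (lie V Z :: s) p.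
  by move=> hB; rewrite /Lie (inter_gder _ _ _ _ _ hB).
rewrite !E // !(inter_Lie _ _ hA).
rewrite (@LieB X (k - 1) (Lie Y (inter Z A)) (inter (lie Y Z) A)); [|exact: Lie_form|exact: form_inter].
rewrite (@LieB Y (k - 1) (Lie X (inter Z A)) (inter (lie X Z) A)); [|exact: Lie_form|exact: form_inter].
rewrite -(IH _ _ hZA).
have E2 V U : Lie V A (U :: s) p = Lie V (inter U A) s p - A (lie V U :: s) p.
  by rewrite -[LHS]/(inter U (Lie V A) s p) (inter_Lie _ _ hA).
rewrite !E2.
have J : A (lie (lie X Y) Z :: s) p = A (lie X (lie Y Z) :: s) p - A (lie Y (lie X Z) :: s) p.
  have := @clin3 _ _ _ rg _ (lie (lie X Y) Z) (lie X (lie Y Z)) (lie Y (lie X Z)) (vf0 S) 1 (-1) 0 p (form_clin0 s hA).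
  rewrite mul1r mulN1r mul0r addr0; apply => u.
  have D2 V U w : der (lie V U) w = fun q => der V (der U w) q - der U (der V w) q.
    by apply/funext => q; rewrite (der_lie rg).
  rewrite !(der_lie rg) !D2 !(derB rg) ?der_vf0; try exact: der_sm.
  by ring.
by rewrite J; ring.
Qed.

Section Metric.
Variable g : metric S.
Hypothesis mg : is_metric g.
Notation D := (levi_civita g).

Lemma lc_conn X : conn X (D X).
Proof. by move=> f Y Z W u p h; exact: (lcR rg mg). Qed.
Lemma nablaE X A : nabla g X A = gder X (D X) A. Proof. by []. Qed.
Lemma nabla_form X k A : is_form k A -> is_form k (nabla g X A).
Proof. by move=> hA; rewrite nablaE; apply: gder_form => //; exact: lc_conn. Qed.
Lemma nabla_clin k A s : is_form k A -> clin (fun X => nabla g X A s).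
Proof.
move=> hA f X Y Z p h; rewrite !nablaE /gder (clin_app p (@clin_der _ _ (A s)) h).
have hh := lincomb_hlin h.
rewrite (@dact_linl (D X) (D Y) (D Z) (f p) 1 k) //; first by ring.
by move=> W u; rewrite mul1r (lcL rg mg _ _ _ hh).
Qed.
Lemma nabla_cons X k A Y s p : is_form k A ->
  nabla g X A (Y :: s) p = nabla g X (inter Y A) s p - A (D X Y :: s) p.
Proof. by move=> hA; rewrite !nablaE (inter_gder _ _ _ _ _ hA). Qed.
Lemma nabla_lin X (a b : R) A B s p : smooth (A s) -> smooth (B s) ->
  nabla g X (fun s p => a * A s p + b * B s p) s p = a * nabla g X A s p + b * nabla g X B s p.
Proof.
move=> sA sB; rewrite !nablaE /gder (@dact_lin _ a b A B) //.
rewrite (derD rg) ?(derZ rg) //; first by ring.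
  by apply: (smM rg) => //; exact: smooth_cst.
by apply: (smM rg) => //; exact: smooth_cst.
Qed.

Lemma fdE A : fd g A = alt (fun X => nabla g X A). Proof. by []. Qed.
Lemma fd_form k A : is_form k A -> is_form (k + 1) (fd g A).
Proof.
move=> hA; rewrite fdE; apply: alt_form => [X|s]; first exact: nabla_form.
exact: nabla_clin hA.
Qed.
Lemma fd_nil A p : fd g A [::] p = 0. Proof. by rewrite fdE alt_nil. Qed.

Lemma torsion k A X s p : is_form k A ->
  nabla g X A s p + dact (fun Y => D Y X) A s p = Lie X A s p.
Proof.
move=> hA; rewrite nablaE /Lie /gder.
rewrite (@dact_linl (D X) (fun Y => D Y X) (lie X) 1 (-1) k) //; first by ring.
by move=> Y u; rewrite -(lc_tor rg mg) mul1r mulN1r.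
Qed.

(** Cartan's formula. By vanishing torsion, nabla_Z A differs from the Lie derivative by the action
    of X -> D X Z, which is the term left over by moving Z to the front of the alternating sum. *)
Lemma inter_fd k A Z : is_form k A -> inter Z (fd g A) = Lie Z A - fd g (inter Z A).
Proof.
move=> hA; apply: dfP => s p; rewrite (_ : (Lie Z A - _) s p = Lie Z A s p - fd g (inter Z A) s p) //.
rewrite -(torsion _ _ _ hA) /inter fdE alt_cons (dact_alt _ _ _ hA).
rewrite -[fd g (fun _ => _)]/(fd g (inter Z A)) fdE.
rewrite (@eq_alt (fun X => inter Z (nabla g X A)) (fun X s p => 1 * nabla g X (inter Z A) s p + (-1) * inter (D X Z) A s p)).
  by rewrite alt_lin; ring.
by move=> X s'; rewrite /inter (nabla_cons _ _ _ _ hA) /inter; ring.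
Qed.

Lemma fd_lin k (a b : R) A B C s p : is_form k A -> is_form k B ->
  (forall s p, C s p = a * A s p + b * B s p) -> fd g C s p = a * fd g A s p + b * fd g B s p.
Proof.
move=> hA hB hC; rewrite !fdE -alt_lin; apply: eq_alt => X s'.
rewrite (_ : C = fun s p => a * A s p + b * B s p) ?nabla_lin //; last exact: dfP.
  exact: form_sm hA.
exact: form_sm hB.
Qed.
Lemma fdB k A B : is_form k A -> is_form k B -> fd g (A - B) = fd g A - fd g B.
Proof.
move=> hA hB; apply: dfP => s p; rewrite (@fd_lin k 1 (-1) A B) // ?mul1r ?mulN1r // => s' p'.
by rewrite mul1r mulN1r.
Qed.

Lemma Lie_fd X k A s p : is_form k A -> Lie X (fd g A) s p = fd g (Lie X A) s p.
Proof.
elim: s k A => [|Y s IH] k A hA.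
  rewrite fd_nil /Lie /gder dact_nil subr0 (_ : fd g A [::] = fun=> 0) ?(der_cst rg) //.
  by apply/funext => q; rewrite fd_nil.
rewrite -[LHS]/(inter Y (Lie X (fd g A)) s p) -[RHS]/(inter Y (fd g (Lie X A)) s p).
have hY := form_inter Y hA; have hX := Lie_form X hA; have hL := form_inter (lie X Y) hA.
have hdY := fd_form hY; rewrite subrK in hdY.
rewrite (inter_Lie _ _ (fd_form hA)) !(inter_fd _ hA) (inter_fd _ hX) (inter_Lie _ _ hA).
rewrite (@fdB (k - 1)) //; last exact: Lie_form.
rewrite (_ : (Lie X (Lie Y A - fd g (inter Y A)) - (Lie (lie X Y) A - fd g (inter (lie X Y) A))) s p
  = Lie X (Lie Y A - fd g (inter Y A)) s p - (Lie (lie X Y) A s p - fd g (inter (lie X Y) A) s p)) //.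
rewrite (@LieB X k) //; last exact: Lie_form.
rewrite (IH _ _ hY) -(Lie_comm X Y s p hA).
rewrite (_ : (Lie Y (Lie X A) - (fd g (Lie X (inter Y A)) - fd g (inter (lie X Y) A))) s p
  = Lie Y (Lie X A) s p - (fd g (Lie X (inter Y A)) s p - fd g (inter (lie X Y) A) s p)) //.
by ring.
Qed.

(** By Cartan's formula iota(Y) d d A = L_Y d A - d L_Y A + d d iota(Y) A. The first two terms
    cancel by [Lie_fd], and the last one has a shorter list of arguments. *)
Lemma fd_fd k A : is_form k A -> fd g (fd g A) = 0.
Proof.
move=> hA; apply: dfP => s p; elim: s k A hA => [|Y s IH] k A hA; first by rewrite fd_nil.
have hY := form_inter Y hA; have hdY := fd_form hY; rewrite subrK in hdY.
rewrite -[LHS]/(inter Y (fd g (fd g A)) s p) (inter_fd _ (fd_form hA)) (inter_fd _ hA).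
rewrite (@fdB k) //; last exact: Lie_form.
rewrite (_ : (Lie Y (fd g A) - (fd g (Lie Y A) - fd g (fd g (inter Y A)))) s p =
  Lie Y (fd g A) s p - (fd g (Lie Y A) s p - fd g (fd g (inter Y A)) s p)) //.
by rewrite (Lie_fd _ _ _ hA) (IH _ _ hY) subr0 subrr.
Qed.

End Metric.
End Forms.

(** * The codifferential *)

Section Codiff.
Context {R : realType} {S : smooth_space R} {d : nat}.
Hypothesis rg : regular S d.
Implicit Types (X Y Z W : vfield S) (u v f : S -> R) (p q : S) (k : int) (A B : dform S).
Implicit Types (s : seq (vfield S)).
Variable g : metric S.
Hypothesis mg : is_metric g.
Notation D := (levi_civita g).

Lemma fdelta_blin k A s : is_form k A -> blin (fun X Y => nabla g X A (Y :: s)).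
Proof.
move=> hA; split=> [Y|X]; first exact: (nabla_clin rg mg _ hA).
exact: (form_clin0 s (nabla_form rg mg X hA)).
Qed.
Lemma fdelta_onb k A e s q : is_form k A -> onb g e q ->
  fdelta d g A s q = \sum_(a < d) nabla g (e a) A (e a :: s) q.
Proof. by move=> hA oe; rewrite /fdelta (trace_onb rg mg (fdelta_blin s hA) oe). Qed.
Lemma fdeltaE A s q : fdelta d g A s q =
  \sum_(a < d) nabla g (frame_at g q a) A (frame_at g q a :: s) q.
Proof. by []. Qed.

Lemma fdelta_form k A : is_form k A -> is_form (k - 1) (fdelta d g A).
Proof.
move=> hA; have hn X := nabla_form rg mg X hA.
split=> [s|s sk p|s1 s2 s3 Y p|s1 s2 f Y Z W p h].
- rewrite /fdelta; apply: (trace_sm rg mg (fdelta_blin s hA)) => X Y.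
  exact: form_sm (hn X).
- rewrite fdeltaE big1 // => a _; apply: (form_deg p (hn _)).
  by apply: contraNneq sk => <-; rewrite /= -addn1 PoszD addrK.
- rewrite fdeltaE big1 // => a _; exact: (form_alt (_ :: s1) s2 s3 Y p (hn _)).
- rewrite !fdeltaE mulr_sumr -big_split /=; apply: eq_bigr => a _.
  exact: (clin_app p (form_clin (frame_at g p a :: s1) s2 (hn _)) h).
Qed.
Lemma fdelta_lin k (a b : R) A B C s p : is_form k A -> is_form k B ->
  (forall s p, C s p = a * A s p + b * B s p) ->
  fdelta d g C s p = a * fdelta d g A s p + b * fdelta d g B s p.
Proof.
move=> hA hB hC; rewrite !fdeltaE !mulr_sumr -big_split /=; apply: eq_bigr => i _.
rewrite (_ : C = fun s p => a * A s p + b * B s p); last exact: dfP.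
by rewrite (nabla_lin rg); [|exact: form_sm hA|exact: form_sm hB].
Qed.

Lemma nabla_fmul X u k A s p : smooth u -> is_form k A ->
  nabla g X (fmul u A) s p = der X u p * A s p + u p * nabla g X A s p.
Proof.
move=> su hA; rewrite !nablaE /gder /fmul.
rewrite (derM rg _ _ su (form_sm s hA)) (@dact_lin _ _ (D X) (u p) 0 A A); first by ring.
by move=> s'; rewrite mul0r addr0.
Qed.
Lemma fd_fmul u k A s p : smooth u -> is_form k A ->
  fd g (fmul u A) s p = exter (fun X => der X u) A s p + u p * fd g A s p.
Proof.
move=> su hA; rewrite !fdE exterE.
have := @alt_lin _ _ 1 (u p) (fun X => fmul (der X u) A) (fun X => nabla g X A) s p.
rewrite mul1r => <-; rewrite /alt; apply: eq_bigr => i _.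
by rewrite (nabla_fmul _ _ _ su hA) mul1r.
Qed.
Lemma fdelta_fmul u k A s p : smooth u -> is_form k A ->
  fdelta d g (fmul u A) s p = A (grad g u :: s) p + u p * fdelta d g A s p.
Proof.
move=> su hA; rewrite !fdeltaE mulr_sumr.
rewrite (onb_lin rg mg (grad g u) (form_clin0 s hA) (frame_onb rg mg p)) -big_split /=.
by apply: eq_bigr => a _; rewrite (nabla_fmul _ _ _ su hA) (g_grad rg mg).
Qed.

Lemma hess_sym u X Y p : g (D X (grad g u)) Y p = g (D Y (grad g u)) X p.
Proof.
have e V W : g (D V (grad g u)) W p = der V (der W u) p - der (D V W) u p.
  have := lc_met rg mg V (grad g u) W p.
  rewrite (_ : g (grad g u) W = der W u); last by apply/funext => q; rewrite (g_grad rg mg).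
  by rewrite (g_grad rg mg) => ->; rewrite addrK.
rewrite !e; apply/eqP; rewrite -subr_eq0; apply/eqP.
have := lc_tor rg mg X Y u p; rewrite (der_lie rg).
set a := der (D X Y) u p; set b := der (D Y X) u p => h.
transitivity (der X (der Y u) p - der Y (der X u) p - (a - b)); first by ring.
by rewrite h subrr.
Qed.
Lemma hessE u X Y p : g (D X (grad g u)) Y p = der X (der Y u) p - der (D X Y) u p.
Proof.
have := lc_met rg mg X (grad g u) Y p.
rewrite (_ : g (grad g u) Y = der Y u); last by apply/funext => q; rewrite (g_grad rg mg).
by rewrite (g_grad rg mg) => ->; rewrite addrK.
Qed.

Lemma sym_anti k A (H : vfield S -> vfield S) e s p : is_form k A -> onb g e p ->
  (forall X Y, g (H X) Y p = g (H Y) X p) -> \sum_(a < d) A (H (e a) :: e a :: s) p = 0.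
Proof.
move=> hA oe hs.
pose c a b := g (H (e a)) (e b) p * A (e b :: e a :: s) p.
have -> : \sum_(a < d) A (H (e a) :: e a :: s) p = \sum_a \sum_b c a b.
  by apply: eq_bigr => a _; rewrite (onb_lin rg mg _ (form_clin0 _ hA) oe).
have : \sum_a \sum_b c a b = - \sum_a \sum_b c a b.
  rewrite {2}exchange_big /= -sumrN; apply: eq_bigr => a _; rewrite -sumrN.
  by apply: eq_bigr => b _; rewrite /c (form_anti rg _ _ _ _ hA) (hs (e b)) mulrN.
by move=> h; lra.
Qed.

(** The hypothesis says that the covariant derivative of Z is symmetric, as for gradients; its
    contraction with two slots of an alternating form is zero. *)
Lemma fdelta_inter Z k A s p : is_form k A -> (forall X Y p, g (D X Z) Y p = g (D Y Z) X p) ->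
  fdelta d g (inter Z A) s p = - fdelta d g A (Z :: s) p.
Proof.
move=> hA hs; rewrite !fdeltaE -sumrN; set e := frame_at g p.
transitivity (\sum_a (- nabla g (e a) A (e a :: Z :: s) p + A (D (e a) Z :: e a :: s) p)).
  apply: eq_bigr => a _.
  have := nabla_cons g (e a) Z (e a :: s) p hA => /eqP; rewrite eq_sym subr_eq => /eqP ->.
  by rewrite (form_anti rg _ _ _ _ (nabla_form rg mg _ hA)).
rewrite big_split /= [X in _ + X](@sym_anti k A (fun X => D X Z)) ?addr0 //.
exact: frame_onb.
Qed.

Lemma nabla_exter X (theta : vfield S -> S -> R) k A s p : clin theta ->
  (forall Y, smooth (theta Y)) -> is_form k A ->
  nabla g X (exter theta A) s p =
    exter (fun Y q => der X (theta Y) q - theta (D X Y) q) A s p + exter theta (nabla g X A) s p.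
Proof.
move=> lt st; elim: s k A => [|Y s IH] k A hA.
  rewrite !exter_nil addr0 nablaE /gder dact_nil subr0 (_ : exter theta A [::] = fun=> 0) ?(der_cst rg) //.
  by apply/funext => q; rewrite exter_nil.
have hE := exter_form rg lt st hA; have hY := form_inter Y hA; have hEY := exter_form rg lt st hY.
rewrite (nabla_cons _ _ _ _ _ hE) !exter_cons.
rewrite (_ : inter Y (exter theta A) = (fun s p => 1 * fmul (theta Y) A s p + (-1) * exter theta (inter Y A) s p)); last first.
  by apply: dfP => s' p'; rewrite /inter exter_cons /fmul mul1r mulN1r.
rewrite (nabla_lin rg); [|exact: form_sm (formM rg (st Y) hA)|exact: form_sm hEY].
rewrite (nabla_fmul _ _ _ (st Y) hA) (IH _ _ hY).
rewrite (@exter_lin _ _ theta 1 (-1) (nabla g X (inter Y A)) (inter (D X Y) A) (inter Y (nabla g X A))); first by ring.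
by move=> s'; rewrite [LHS](nabla_cons _ _ _ _ _ hA) mul1r mulN1r.
Qed.

Lemma exter_sum theta (I : Type) (r : seq I) (c : I -> R) (A : I -> dform S) B s p :
  (forall s, B s p = \sum_(i <- r) c i * A i s p) ->
  exter theta B s p = \sum_(i <- r) c i * exter theta (A i) s p.
Proof.
move=> h; rewrite /exter; under [RHS]eq_bigr => i _ do rewrite mulr_sumr.
rewrite exchange_big /=; apply: eq_bigr => j _; rewrite h mulr_sumr.
by apply: eq_bigr => i _; ring.
Qed.

Lemma fdelta_exter u k A s p : smooth u -> is_form k A ->
  fdelta d g (exter (fun X => der X u) A) s p =
    nabla g (grad g u) A s p + laplacian d g u p * A s p
    - dact (fun Y => D Y (grad g u)) A s p - exter (fun X => der X u) (fdelta d g A) s p.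
Proof.
move=> su hA; set th := fun X => der X u.
have lt : clin th := @clin_der _ _ u.
have st Y : smooth (th Y) by exact: der_sm.
have of_ := frame_onb rg mg p; rewrite fdeltaE; set e := frame_at g p in of_ *.
have hH X Y q : der X (th Y) q - th (D X Y) q = g (D X (grad g u)) Y q by rewrite hessE.
transitivity (\sum_a (g (D (e a) (grad g u)) (e a) p * A s p
   - exter (fun Y q => g (D (e a) (grad g u)) Y q) (inter (e a) A) s p
   + der (e a) u p * nabla g (e a) A s p - exter th (inter (e a) (nabla g (e a) A)) s p)).
  apply: eq_bigr => a _; rewrite (nabla_exter _ _ _ lt st hA) !exter_cons !hH addrA.
  congr (_ - _ + _ - _).
  by apply: eq_bigr => i _; rewrite hH.
rewrite !big_split /= !sumrN -mulr_suml.
have -> : laplacian d g u p = \sum_a g (D (e a) (grad g u)) (e a) p.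
  by apply: eq_bigr => a _; rewrite hessE.
have -> : nabla g (grad g u) A s p = \sum_a der (e a) u p * nabla g (e a) A s p.
  rewrite (onb_lin rg mg (grad g u) (nabla_clin rg mg s hA) of_).
  by apply: eq_bigr => a _; rewrite (g_grad rg mg).
have -> : dact (fun Y => D Y (grad g u)) A s p = \sum_a exter (fun Y q => g (D (e a) (grad g u)) Y q) (inter (e a) A) s p.
  rewrite (dact_alt rg _ _ _ hA) /alt /exter exchange_big /=; apply: eq_bigr => i _.
  rewrite {1}/inter (onb_lin rg mg _ (form_clin0 _ hA) of_) mulr_sumr; apply: eq_bigr => a _.
  by rewrite hess_sym /inter; ring.
have -> : exter th (fdelta d g A) s p = \sum_a exter th (inter (e a) (nabla g (e a) A)) s p.
  rewrite (@exter_sum th _ (index_enum 'I_d) (fun=> 1) (fun a => inter (e a) (nabla g (e a) A))).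
    by apply: eq_bigr => a _; rewrite mul1r.
  by move=> s'; rewrite fdeltaE; apply: eq_bigr => a _; rewrite mul1r.
by ring.
Qed.

Lemma lc_vf0 W u q : der (D W (vf0 S)) u q = 0.
Proof.
have h0 : hlin (fun=> 1) (vf0 S) (vf0 S) (vf0 S).
  by split; [exact: smooth_cst|move=> v r; rewrite !der_vf0 mulr0 addr0].
have := lcR rg mg W u q h0; rewrite (der_cst rg) der_vf0 mul1r mul0r addr0 => e.
by apply: (@addrI _ (der (D W (vf0 S)) u q)); rewrite addr0 -e.
Qed.
(** Two fields that agree near q need not be equal as global fields. Multiplied by the bump function
    c they have the same action everywhere, and the Leibniz rule of the connection recovers the
    derivatives at q. *)
Lemma lc_near X Y W u q : nearby q (fun r => forall v, der X v r = der Y v r) ->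
  der (D W X) u q = der (D W Y) u q.
Proof.
move=> [c c0 h]; have sc := sfun_sm c; apply: (mulfI c0).
have hX V : hlin c V (vf0 S) (vfL c V (vf0 S)).
  by split=> // v r; rewrite (der_vfL rg).
have e V : c q * der (D W V) u q = der (D W (vfL c V (vf0 S))) u q - der W c q * der V u q.
  by rewrite (lcR rg mg W u q (hX V)) lc_vf0; ring.
have e2 v r : der (vfL c X (vf0 S)) v r = der (vfL c Y (vf0 S)) v r.
  rewrite !(der_vfL rg) //; have [->|cr] := eqVneq (c r) 0; first by rewrite !mul0r.
  by rewrite (h r cr).
have h0 : hlin (fun=> 0) (vf0 S) (vfL c X (vf0 S)) (vfL c Y (vf0 S)).
  by split; [exact: smooth_cst|move=> v r; rewrite e2 der_vf0 mul0r add0r].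
rewrite !e (lcR rg mg W u q h0) (der_cst rg) !mul0r !add0r.
by rewrite (h q c0).
Qed.
Lemma nabla_near k X A B s p : is_form k A -> is_form k B ->
  nearby p (fun q => forall s, A s q = B s q) -> nabla g X A s p = nabla g X B s p.
Proof.
move=> hA hB h; rewrite !nablaE /gder.
rewrite (der_near rg X (form_sm s hA) (form_sm s hB)); last by apply: nearbyW h => q ->.
congr (_ - _); apply: eq_bigr => i _; exact: (nearby_sub h).
Qed.
Lemma fd_near k A B p : is_form k A -> is_form k B ->
  nearby p (fun q => forall s, A s q = B s q) -> nearby p (fun q => forall s, fd g A s q = fd g B s q).
Proof.
move=> hA hB /nearby_nearby; apply: nearbyW => q h s.
by apply: eq_bigr => i _; rewrite (nabla_near _ _ hA hB h).
Qed.
Lemma fdelta_near k A B p : is_form k A -> is_form k B ->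
  nearby p (fun q => forall s, A s q = B s q) ->
  nearby p (fun q => forall s, fdelta d g A s q = fdelta d g B s q).
Proof.
move=> hA hB /nearby_nearby; apply: nearbyW => q h s.
by rewrite !fdeltaE; apply: eq_bigr => i _; rewrite (nabla_near _ _ hA hB h).
Qed.

(* The frame e is triangular with respect to the coordinates, so that the density mu
   is a product of diagonal entries. *)
Section Coord.
Variables (p : S) (x : 'I_d -> S -> R) (E e : 'I_d -> vfield S).
Hypothesis sx : forall i, smooth (x i).
Definition adapted q := [/\ coords x E q, onb g e q &
  forall a : 'I_d, (forall j : 'I_d, (a < j)%N -> der (e a) (x j) q = 0) /\ 0 < der (e a) (x a) q].
Hypothesis ad : nearby p adapted.
(** Determinant of the triangular matrix e_a(x_i), that is, (det g(E_i, E_j))^(-1/2): the reciprocal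
    of the Riemannian density in these coordinates. *)
Definition mu (q : S) := \prod_a der (e a) (x a) q.

Lemma prod_sm (r : seq 'I_d) (F : 'I_d -> S -> R) : (forall i, smooth (F i)) ->
  smooth (fun q => \prod_(i <- r) F i q).
Proof.
move=> sF; elim: r => [|i r IH].
  by under eq_fun do rewrite big_nil; exact: smooth_cst.
by under eq_fun do rewrite big_cons; apply: (smM rg).
Qed.
Lemma mu_sm : smooth mu.
Proof. by apply: prod_sm => i; exact: der_sm. Qed.
Lemma der_prod X (r : seq 'I_d) (F : 'I_d -> S -> R) q : (forall i, smooth (F i)) ->
  (forall i, F i q != 0) ->
  der X (fun q => \prod_(i <- r) F i q) q = (\prod_(i <- r) F i q) * \sum_(i <- r) der X (F i) q / F i q.
Proof.
move=> sF F0; elim: r => [|i r IH].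
  by under eq_fun do rewrite big_nil; rewrite (der_cst rg) !big_nil mulr0.
under eq_fun do rewrite big_cons; rewrite !big_cons (derM rg) ?IH //; last exact: prod_sm.
by field; exact: F0.
Qed.

(** The divergence of a coordinate field is the logarithmic derivative of the density 1/mu. Since
    e_a has constant norm, the terms are - g([E_i, e_a], e_a), and by triangularity only the
    diagonal entries of the matrix e_a(x_j) contribute. *)
Lemma divE i : nearby p (fun q =>
  \sum_a g (D (e a) (E i)) (e a) q = - (mu q)^-1 * der (E i) mu q).
Proof.
move: (nearby_nearby ad); apply: nearbyW => q nq.
have [[hx hX] oe tr] := nearby_sub nq.
have M0 a : der (e a) (x a) q != 0 by rewrite gt_eqF //; case: (tr a).
rewrite /mu (@der_prod (E i) _ (fun a => der (e a) (x a))) //; last by move=> a; exact: der_sm.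
rewrite mulNr mulrA mulVf ?mul1r -?sumrN; last by apply/prodf_neq0 => a _; exact: M0.
have oD a : g (D (E i) (e a)) (e a) q = 0.
  have := lc_met rg mg (E i) (e a) (e a) q.
  rewrite (der_locst rg _ (g_sm mg _ _) (a := 1)); last first.
    by apply: nearbyW nq => r [_ oe' _]; rewrite oe' eqxx.
  by rewrite (g_sym mg (e a)) => h; lra.
apply: eq_bigr => a _.
have t : g (D (e a) (E i)) (e a) q = - g (lie (E i) (e a)) (e a) q.
  rewrite (clin2 rg (X := lie (E i) (e a)) (Y := D (E i) (e a)) (Z := D (e a) (E i)) (a := 1) (b := -1) (g_clinl mg (e a))).
    by rewrite oD; ring.
  by move=> u; rewrite -(lc_tor rg mg); ring.
rewrite t; congr (- _).
have lE u : der (lie (E i) (e a)) u q = \sum_j der (E i) (der (e a) (x j)) q * der (E j) u q.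
  rewrite hX; apply: eq_bigr => j _; congr (_ * _); rewrite (der_lie rg).
  rewrite (der_locst rg (e a) (a := (i == j)%:R)) ?subr0 //; first exact: der_sm.
  by apply: nearbyW nq => r [[-> _] _ _].
rewrite (clin_sum_at rg (g_clinl mg (e a)) lE).
(* The inverse of a triangular matrix is triangular. The induction on m >= d - b runs through b from
   the last index downwards. *)
have N0 m : forall (j b : 'I_d), (d - b <= m)%N -> (j < b)%N -> g (E j) (e b) q = 0.
  elim: m => [|m IHm] j b; first by rewrite leqn0 subn_eq0 leqNgt ltn_ord.
  move=> bm jb; have := hx j b; rewrite (onb_complete rg mg oe).
  rewrite (_ : (j == b) = false); last by apply: contraTF jb => /eqP ->; rewrite ltnn.
  rewrite (bigD1 b) //= [X in _ + X]big1 ?addr0 => [/eqP|c cb].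
    by rewrite mulf_eq0 (negbTE (M0 b)) orbF => /eqP.
  have [cb'|bc] := ltnP c b; first by rewrite ((tr c).1 b cb') mulr0.
  have bc' : (b < c)%N by rewrite ltn_neqAle bc andbT eq_sym.
  rewrite IHm ?mul0r //; last exact: ltn_trans bc'.
  by rewrite -ltnS (leq_trans _ bm) // ltn_sub2l // ltn_ord.
rewrite (bigD1 a) //= [X in _ + X]big1 ?addr0 => [|j ja].
  congr (_ * _); have := hx a a; rewrite (onb_complete rg mg oe) eqxx.
  rewrite (bigD1 a) //= [X in _ + X]big1 ?addr0 => [h|c ca].
    by apply: (mulIf (M0 a)); rewrite mulVf.
  have [c'|c'] := ltnP c a; first by rewrite ((tr c).1 a c') mulr0.
  by rewrite (N0 _ a c (leqnn _)) ?mul0r // ltn_neqAle c' andbT eq_sym.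
have [j'|j'] := ltnP j a; first by rewrite (N0 _ j a (leqnn _)) ?mulr0.
rewrite (der_near0 rg) ?mul0r //; first exact: der_sm.
apply: nearbyW nq => r [_ _ /(_ a) [h _]]; apply: h.
by rewrite ltn_neqAle j' andbT eq_sym.
Qed.

Notation Z := (fun i => grad g (x i)).

(** Gradients have symmetric covariant derivative, so the terms in which the connection acts on the
    arguments contract a symmetric with an alternating tensor and disappear. *)
Lemma fdelta_grads k A (J : seq 'I_d) q e' : is_form k A -> onb g e' q ->
  fdelta d g A (map Z J) q = \sum_(a < d) (der (e' a) (A (e' a :: map Z J)) q - A (D (e' a) (e' a) :: map Z J) q).
Proof.
move=> hA oe; rewrite (fdelta_onb _ hA oe).
transitivity (\sum_a (der (e' a) (A (e' a :: map Z J)) q - A (D (e' a) (e' a) :: map Z J) q -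
   \sum_(i < size (map Z J)) A (e' a :: replace (map Z J) i (D (e' a) (tnth (in_tuple (map Z J)) i))) q)).
  apply: eq_bigr => a _; rewrite nablaE /gder dact_cons /dact /inter opprD addrA.
  by congr (_ - _).
rewrite big_split /= sumrN exchange_big /= [X in _ - X]big1 ?subr0 // => i _.
have si : (i < size J)%N by apply: leq_trans (ltn_ord i) _; rewrite size_map.
have [j0 ->] : exists j, tnth (in_tuple (map Z J)) i = Z j.
  case: J i si => [|j J] i //= si; exists (nth j (j :: J) i).
  by rewrite (tnth_nth (Z j)) /= (nth_map j (Z j) (fun i => grad g (x i)) (s := j :: J)).
have hi := fun X => form_inter X hA.
transitivity (\sum_a (-1) ^+ i * - A (D (e' a) (Z j0) :: e' a :: take i (map Z J) ++ drop i.+1 (map Z J)) q).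
  apply: eq_bigr => a _; rewrite /replace.
  have := form_move rg (take i (map Z J)) (drop i.+1 (map Z J)) (D (e' a) (Z j0)) q (hi (e' a)).
  rewrite /inter => ->; rewrite (form_anti rg _ _ _ _ hA).
  by rewrite size_takel // ltnW.
rewrite -mulr_sumr sumrN (@sym_anti k A (fun X => D X (Z j0))) ?oppr0 ?mulr0 //.
by move=> X Y; exact: hess_sym.
Qed.

Lemma grads_expand r X u : coords x E r ->
  der X u r = \sum_i g X (E i) r * der (grad g (x i)) u r.
Proof.
move=> [hx hX].
have h v : der X v r = der (vfsum (enum 'I_d) (fun i _ => g X (E i) r) Z) v r.
  move: v; apply: (g_nondeg rg mg) => Y.
  rewrite (clin_vfsum rg _ _ _ (g_clinl mg Y)) ?big_enum /=; last by move=> i; exact: smooth_cst.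
  under eq_bigr => i _ do rewrite (g_grad rg mg) mulrC.
  by apply: (clin_sum_at rg (g_clinr mg X)) => u'; rewrite hX.
by rewrite h (der_vfsum rg) ?big_enum // => i; exact: smooth_cst.
Qed.

(** The classical formula mu d_i (mu^-1 A^{i...}): evaluation on gradients reads off contravariant
    components. As mu is invertible only near p, its reciprocal enters as a smooth function [nu]
    with nu mu = 1 nearby. The statement is uniform in the form, so that it can be applied to delta
    A as well as to A. *)
Lemma fdelta_coord : nearby p (fun q => forall k A (J : seq 'I_d) (nu : S -> R), is_form k A ->
  smooth nu -> nearby q (fun r => nu r * mu r = 1) ->
  fdelta d g A (map Z J) q = mu q * \sum_i der (E i) (fun r => nu r * A (Z i :: map Z J) r) q).
Proof.
have hdiv := nearby_fin rg divE.
apply: nearbyW (nearbyI rg hdiv (nearby_nearby ad)) => q [dv nq] k A J nu hA snu hnu.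
have [[hx hX] oe tr] := nearby_sub nq.
have snu' := nearby_sub hnu.
rewrite (fdelta_grads _ hA oe).
pose c i := A (Z i :: map Z J).
have sc i : smooth (c i) by exact: form_sm hA.
have cl := form_clin0 (map Z J) hA.
have AE X : nearby q (fun r => A (X :: map Z J) r = \sum_i g X (E i) r * c i r).
  by apply: nearbyW nq => r [cr _ _]; apply: (clin_sum_at rg cl) => u; exact: grads_expand.
have key a : der (e a) (A (e a :: map Z J)) q - A (D (e a) (e a) :: map Z J) q =
   \sum_i (g (D (e a) (E i)) (e a) q * c i q + g (e a) (E i) q * der (e a) (c i) q).
  rewrite (der_near rg _ (form_sm _ hA) _ (AE (e a))); last first.
    by apply: (sm_sum rg) => i; apply: (smM rg) => //; exact: g_sm.
  rewrite (nearby_sub (AE (D (e a) (e a)))) (der_sum rg) => [|i]; last by apply: (smM rg) => //; exact: g_sm.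
  rewrite -sumrB; apply: eq_bigr => i _.
  rewrite (derM rg _ _ (g_sm mg (e a) (E i)) (sc i)) (lc_met rg mg) (g_sym mg (e a) (D _ _)); ring.
under eq_bigr => a _ do rewrite key.
rewrite exchange_big /= mulr_sumr; apply: eq_bigr => i _.
rewrite big_split /= -mulr_suml dv.
have -> : \sum_a g (e a) (E i) q * der (e a) (c i) q = der (E i) (c i) q.
  by rewrite (onb_complete rg mg oe (E i)); apply: eq_bigr => a _; rewrite g_sym.
rewrite (derM rg _ _ snu (sc i)).
have m0 : mu q != 0 by apply/eqP => m0; move: snu'; rewrite m0 mulr0 => /eqP; rewrite eq_sym oner_eq0.
have nuE : nu q = (mu q)^-1 by apply: (mulIf m0); rewrite mulVf.
have : der (E i) (fun r => nu r * mu r) q = 0.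
  by apply: (der_locst rg _ _ hnu); apply: (smM rg) => //; exact: mu_sm.
rewrite (derM rg _ _ snu mu_sm) nuE => /eqP; rewrite addrC addr_eq0 => /eqP h.
have -> : der (E i) nu q = - (mu q)^-1 * der (E i) mu q / mu q.
  by rewrite mulNr h opprK mulfK.
by field.
Qed.

Lemma form_grads0 k B q : is_form k B -> coords x E q ->
  (forall J : seq 'I_d, B (map Z J) q = 0) -> forall s, B s q = 0.
Proof.
move=> hB cq h s; rewrite -[s]cats0 -[[::]]/(map Z [::]).
suff {s} H : forall s J, B (s ++ map Z J) q = 0 by exact: H.
elim/last_ind => [|s X IH] J; first exact: h.
rewrite -cats1 -catA /=.
rewrite (clin_sum_at rg (form_clin s (map Z J) hB) (c := fun i => g X (E i) q) (E := Z)).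
  by rewrite big1 // => i _; rewrite (IH (i :: J)) mulr0.
by move=> u; exact: grads_expand.
Qed.

Lemma coord_comm i j u q : nearby q (coords x E) -> smooth u ->
  der (E i) (der (E j) u) q = der (E j) (der (E i) u) q.
Proof.
move=> nq su; have [_ hX] := nearby_sub nq.
apply/eqP; rewrite -subr_eq0 -(der_lie rg) hX big1 // => l _.
have z a b : der (E a) (der (E b) (x l)) q = 0.
  by apply: (der_locst rg _ (der_sm _ _) (a := (b == l)%:R)); apply: nearbyW nq => r [].
by rewrite (der_lie rg) !z subrr mul0r.
Qed.
End Coord.

Lemma adapted_ex p : exists (x : 'I_d -> S -> R) (E e : 'I_d -> vfield S),
  (forall i, smooth (x i)) /\ nearby p (adapted x E e).
Proof.
have [x [E [sx nx]]] := has_coords rg p; have [e he] := gram_schmidt rg mg sx nx.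
by exists x, E, e; split=> //; apply: nearbyW (nearbyI rg nx he) => q [? []].
Qed.

Lemma mu_inv p x E e : (forall i, smooth (x i)) -> nearby p (adapted x E e) ->
  exists2 nu, smooth nu & nearby p (fun q => nu q * mu x e q = 1).
Proof.
move=> sx ad; have m0 : mu x e p != 0.
  have [_ _ tr] := nearby_sub ad; apply/prodf_neq0 => a _.
  by rewrite gt_eqF //; case: (tr a).
have [nu snu nnu] := nearby_inv rg (mu_sm x e) m0.
by exists nu => //; apply: nearbyW nnu => q [m h]; rewrite h mulVf.
Qed.

(** In coordinates the weights mu and mu^-1 between the two divergences cancel, and what remains is
    a double sum of commuting second derivatives of components antisymmetric in the two indices. *)
Lemma fdelta_fdelta k A : is_form k A -> fdelta d g (fdelta d g A) = 0.
Proof.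
move=> hA; apply: dfP => s p; have hd := fdelta_form hA.
have [x [E [e [sx ad]]]] := adapted_ex p.
have [nu snu hnu] := mu_inv sx ad.
have nc : nearby p (coords x E) by apply: nearbyW ad => q [].
suff H : forall s, fdelta d g (fdelta d g A) s p = 0 by exact: H.
apply: (form_grads0 (fdelta_form hd) (nearby_sub nc)) => J {s}.
have hc := fdelta_coord ad.
rewrite (nearby_sub hc _ _ J nu hd snu hnu).
pose a i j := A (grad g (x j) :: grad g (x i) :: map (fun i => grad g (x i)) J).
have sa i j : smooth (a i j) by exact: form_sm hA.
have sna i j : smooth (fun r => nu r * a i j r) by exact: (smM rg).
have -> : \sum_i der (E i) (fun r => nu r * fdelta d g A (grad g (x i) :: map (fun i => grad g (x i)) J) r) p
  = \sum_i \sum_j der (E i) (der (E j) (fun r => nu r * a i j r)) p.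
  apply: eq_bigr => i _; rewrite -(der_sum rg); last by move=> j; exact: der_sm.
  apply: (der_near rg).
  - by apply: (smM rg) => //; exact: form_sm hd.
  - by apply: (sm_sum rg) => j; exact: der_sm.
  - apply: nearbyW (nearbyI rg (nearbyI rg hc hnu) (nearby_nearby hnu)) => q [[h1 h2] h3].
    by rewrite (h1 _ _ (i :: J) nu hA snu h3) mulrA h2 mul1r.
apply/eqP; rewrite mulf_eq0; apply/orP; right; apply/eqP; set T := LHS.
suff : T = - T by move=> h; lra.
rewrite {2}/T exchange_big /= -sumrN; apply: eq_bigr => i _; rewrite -sumrN; apply: eq_bigr => j _.
rewrite (coord_comm i j nc) // -(derN rg); last exact: der_sm.
congr (der (E j) _ p); apply/funext => q; rewrite -(derN rg) //.
by congr (der (E i) _ q); apply/funext => r; rewrite /a (form_anti rg _ _ _ _ hA) mulrN.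
Qed.
End Codiff.

(** * Curvature and conformal change *)

Section Curvature.
Context {R : realType} {S : smooth_space R} {d : nat}.
Hypothesis rg : regular S d.
Implicit Types (X Y Z W V : vfield S) (u v f : S -> R) (p q : S) (k : int) (A B : dform S).
Implicit Types (s : seq (vfield S)).
Variable g : metric S.
Hypothesis mg : is_metric g.
Notation D := (levi_civita g).

Lemma lc_clin V u : clin (fun X => der (D X V) u).
Proof. by move=> f X Y Z p /lincomb_hlin h; rewrite (lcL rg mg _ _ _ h). Qed.
Lemma lc_hlinl f X Y Z V : hlin f X Y Z -> hlin f (D X V) (D Y V) (D Z V).
Proof. by move=> h; case: (h) => sf _; split=> // u p; rewrite (lcL rg mg _ _ _ h). Qed.
Lemma lc_hlinr f X Y Z V : hlin f X Y Z ->
  hlin f (D V X) (vfL (der V f) X (D V Y)) (D V Z).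
Proof.
move=> h; case: (h) => sf _; split=> // u p.
by rewrite (lcR rg mg _ _ _ h) (der_vfL rg) ?addrA //; exact: der_sm.
Qed.
Lemma vfL_hlin f X Y : smooth f -> hlin f X Y (vfL f X Y).
Proof. by move=> sf; split=> // u p; rewrite (der_vfL rg). Qed.

Lemma riemE X Y Z W p : riem g X Y Z W p =
  g (D X (D Y Z)) W p - g (D Y (D X Z)) W p - g (D (lie X Y) Z) W p.
Proof. by []. Qed.

Lemma gD3 X Y Z V W (a b c : R) p :
  (forall u, der X u p = a * der Y u p + b * der Z u p + c * der V u p) ->
  g X W p = a * g Y W p + b * g Z W p + c * g V W p.
Proof. exact: (clin3 rg (g_clinl mg W)). Qed.
Lemma gDlc3 U X Y Z V W (a b c : R) p :
  (forall u, der X u p = a * der Y u p + b * der Z u p + c * der V u p) ->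
  g (D X U) W p = a * g (D Y U) W p + b * g (D Z U) W p + c * g (D V U) W p.
Proof. by move=> h; apply: gD3 => u; apply: (clin3 rg (lc_clin U u)). Qed.
Lemma g_hlin f X Y Z W p : hlin f X Y Z -> g Z W p = f p * g X W p + g Y W p.
Proof. exact: (clinH p (g_clinl mg W)). Qed.
Lemma gD_hlin f X Y Z V W p : hlin f X Y Z ->
  g (D V Z) W p = f p * g (D V X) W p + der V f p * g X W p + g (D V Y) W p.
Proof.
move=> h; rewrite (g_hlin _ _ (lc_hlinr V h)) (g_hlin _ _ (vfL_hlin _ _ (der_sm _ _))).
by rewrite addrA.
Qed.

Lemma riem_sm X Y Z W : smooth (riem g X Y Z W).
Proof. by apply: (smB rg); [apply: (smB rg)|]; exact: g_sm. Qed.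
Lemma riem_anti X Y Z W p : riem g X Y Z W p = - riem g Y X Z W p.
Proof.
rewrite !riemE (@gDlc3 Z (lie X Y) (lie Y X) (vf0 S) (vf0 S) W (-1) 0 0 p); first by ring.
by move=> u; rewrite !(der_lie rg); ring.
Qed.
Lemma riem_clin1 Y Z W : clin (fun X => riem g X Y Z W).
Proof.
move=> f X1 X2 X p /lincomb_hlin h; rewrite !riemE.
rewrite (g_hlin _ _ (lc_hlinl _ h)) (gD_hlin _ _ _ (lc_hlinl Z h)).
rewrite (gDlc3 _ _ (fun u => lie_hlinl rg Y u p h)); ring.
Qed.
Lemma riem_clin2 X Z W : clin (fun Y => riem g X Y Z W).
Proof.
move=> f Y1 Y2 Y p h; rewrite !(riem_anti X) (clin_app p (riem_clin1 X Z W) h); ring.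
Qed.
Lemma riem_clin4 X Y Z : clin (riem g X Y Z).
Proof.
move=> f W1 W2 W p h; rewrite !riemE.
rewrite !(clin_app p (g_clinr mg _) h); ring.
Qed.
Lemma riem_clin3 X Y W : clin (fun Z => riem g X Y Z W).
Proof.
move=> f Z1 Z2 Z p /lincomb_hlin h; rewrite !riemE.
rewrite (gD_hlin _ _ _ (lc_hlinr Y h)) (gD_hlin _ _ _ (lc_hlinr X h)) (gD_hlin _ _ _ h).
rewrite !(gD_hlin _ _ _ (vfL_hlin _ _ (der_sm _ _))) (der_lie rg); ring.
Qed.
Lemma riem_blin X Y : blin (fun E E' => riem g E X Y E').
Proof. by split=> [Z|Z]; [exact: riem_clin1|exact: riem_clin4]. Qed.
Lemma ric_sm X Y : smooth (ric d g X Y).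
Proof. by apply: (trace_sm rg mg (riem_blin X Y)) => ? ?; exact: riem_sm. Qed.
Lemma ric_blin : blin (ric d g).
Proof.
split=> [Y|X] f Z1 Z2 Z p h; rewrite /ric /trace mulr_sumr -big_split /=; apply: eq_bigr => a _.
  exact: (clin_app p (riem_clin2 _ _ _) h).
exact: (clin_app p (riem_clin3 _ _ _) h).
Qed.
Lemma ric_onb e X Y p : onb g e p -> ric d g X Y p = \sum_(a < d) riem g (e a) X Y (e a) p.
Proof. by move=> oe; apply: (trace_onb rg mg (riem_blin X Y) oe). Qed.
Lemma J_sm : smooth (Jcurv d g).
Proof.
apply: (smM rg); last exact: smooth_cst.
by apply: (trace_sm rg mg ric_blin) => ? ?; exact: ric_sm.
Qed.
Lemma schouten_sm X Y : smooth (schouten d g X Y).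
Proof.
apply: (smM rg); last exact: smooth_cst.
apply: (smB rg); first exact: ric_sm.
by apply: (smM rg); [exact: J_sm|exact: g_sm].
Qed.
Lemma schouten_blin : blin (schouten d g).
Proof.
split=> [Y|X] f Z1 Z2 Z p h; rewrite /schouten.
  by rewrite (clin_app p (ric_blin.1 Y) h) (clin_app p (g_clinl mg Y) h); ring.
by rewrite (clin_app p (ric_blin.2 X) h) (clin_app p (g_clinr mg X) h); ring.
Qed.

Definition PS Y : vfield S := sharp (d := d) g (fun X => schouten d g X Y).
Lemma g_PS Y X p : g (PS Y) X p = schouten d g X Y p.
Proof.
apply: (g_sharp rg mg); first exact: schouten_blin.1.
by move=> Z; exact: schouten_sm.
Qed.
Lemma PS_hlin f X Y Z : hlin f X Y Z -> hlin f (PS X) (PS Y) (PS Z).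
Proof.
move=> h; case: (h) => sf _; split=> // u p.
rewrite (der_of_g rg mg (Y := PS X) (Z := PS Y) (W := vf0 S) (a := f p) (b := 1) (c := 0)); first by ring.
move=> V; rewrite !g_PS (clinH p (schouten_blin.2 V) h); ring.
Qed.

Lemma Pform_dact k A s p : is_form k A -> Pform d g A s p = dact PS A s p.
Proof.
move=> hA; apply: eq_bigr => i _; set T := fun Z => A (replace s i Z).
have cT : clin T := form_clin (take i s) (drop i.+1 s) hA.
have of_ := frame_onb rg mg p.
rewrite -/(T (PS _)) (onb_lin rg mg _ cT of_); apply: eq_bigr => a _.
by rewrite g_PS.
Qed.

Definition vlin (Phi : vfield S -> vfield S) := forall f X Y Z u p, hlin f X Y Z ->
  der (Phi Z) u p = f p * der (Phi X) u p + der (Phi Y) u p.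
Lemma vlin_clin Phi T : vlin Phi -> clin T -> clin (fun Y => T (Phi Y)).
Proof.
move=> hP hT f X Y Z p /lincomb_hlin h.
rewrite (clin2 rg (X := Phi Z) (Y := Phi X) (Z := Phi Y) (a := f p) (b := 1) hT); first by ring.
by move=> u; rewrite (hP _ _ _ _ _ _ h); ring.
Qed.
Lemma dact_form Phi k A : vlin Phi -> is_form k A -> is_form k (dact Phi A).
Proof.
move=> hP hA.
have -> : dact Phi A = alt (fun Y => inter (Phi Y) A) by apply: dfP => s p; exact: (dact_alt rg _ _ _ hA).
rewrite -[k](subrK 1); apply: (alt_form rg) => [X|s]; first exact: form_inter.
exact: (vlin_clin hP (form_clin0 s hA)).
Qed.
Lemma PS_vlin : vlin PS.
Proof. by move=> f X Y Z u p /PS_hlin [_ ->]. Qed.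
Lemma lc_vlin Z : vlin (fun X => D X Z).
Proof. by move=> f X Y V u p h; rewrite (lcL rg mg _ _ _ h). Qed.
Lemma Pform_form k A : is_form k A -> is_form k (Pform d g A).
Proof.
move=> hA; have -> : Pform d g A = dact PS A by apply: dfP => s p; exact: Pform_dact hA.
exact: dact_form PS_vlin hA.
Qed.
Lemma JP_form k A : is_form k A -> is_form k (JP d g A).
Proof.
move=> hA; rewrite /JP; apply: (formB rg); first exact: (formM rg J_sm hA).
by apply: (formMn rg); exact: Pform_form.
Qed.
Lemma JPE k A s p : is_form k A -> JP d g A s p = Jcurv d g p * A s p - 2 * dact PS A s p.
Proof.
move=> hA; rewrite -(Pform_dact _ _ hA) /JP.
rewrite (_ : (fmul (Jcurv d g) A - Pform d g A *+ 2) s p = fmul (Jcurv d g) A s p - (Pform d g A *+ 2) s p) //.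
by rewrite dfMnE /fmul mulr_natl.
Qed.

Lemma dact_id k A s p : is_form k A -> dact id A s p = k%:~R * A s p.
Proof.
move=> hA; have [/eqP e|e] := boolP ((size s)%:Z == k); last first.
  rewrite (form_deg _ hA e) mulr0 /dact big1 // => i _; apply: (form_deg _ hA).
  have si := ltn_ord i.
  by rewrite /replace size_cat /= size_drop size_takel ?(ltnW si) // -addSnnS subnKC.
rewrite /dact -e (eq_bigr (fun=> A s p)); first by rewrite sumr_const card_ord mulr_natl.
by move=> i _; rewrite /replace (tnth_nth (tnth (in_tuple s) i)) /= -drop_nth // cat_take_drop.
Qed.
Lemma dact_outer theta V k A s p : is_form k A -> smooth (theta V) ->
  (forall X, smooth (theta X)) ->
  dact (fun Y => vfL (theta Y) V (vf0 S)) A s p = exter theta (inter V A) s p.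
Proof.
move=> hA _ st; rewrite (dact_alt rg _ _ _ hA) exterE; apply: eq_alt => Y s'.
by rewrite /inter (clinL rg _ _ _ (form_clin0 s' hA)) // (clin0 _ (form_clin0 s' hA)) addr0.
Qed.
End Curvature.

(** Replaces the remaining derivatives and inner products by variables, leaving a polynomial
    identity. *)
Ltac atoms g := repeat match goal with
  | |- context [der ?A ?v ?q] => generalize (der A v q); intro
  | |- context [g ?A ?B ?q] => generalize (g A B q); intro
  end.

Lemma sum_enum (R : realType) (d : nat) (F : 'I_d -> R) : \sum_(a < d) F a = \sum_(a <- enum 'I_d) F a.
Proof. by rewrite big_enum. Qed.

(** * Connection, curvature and codifferential under g -> Omega^2 g *)

Section Conformal.
Context {R : realType} {S : smooth_space R} {d : nat}.
Hypothesis rg : regular S d.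
Implicit Types (X Y Z W V : vfield S) (v f : S -> R) (p q : S) (k : int) (A B : dform S).
Implicit Types (s : seq (vfield S)).
Variable g : metric S.
Hypothesis mg : is_metric g.
Variable Om : S -> R.
Hypothesis pOm : positive_smooth Om.
Let u := fun p => ln (Om p).
Hypothesis su : smooth u.
Hypothesis dOm : forall X p, der X Om p = Om p * der X u p.
Notation D := (levi_civita g).
Let gh := rescale Om g.
Notation Dh := (levi_civita gh).
Let Ups := grad g u.
Let s2 p := der Ups u p.

Lemma Om_gt0 p : 0 < Om p. Proof. by case: pOm. Qed.
Lemma Om_neq0 p : Om p != 0. Proof. by rewrite gt_eqF // Om_gt0. Qed.
Lemma Om_sm : smooth Om. Proof. by case: pOm. Qed.
Lemma OmX_sm (a : int) : smooth (fun p => Om p ^ a).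
Proof. apply: (smXz rg) Om_sm _ => p; exact: Om_neq0. Qed.

Lemma der_OmX X (a : int) p : der X (fun q => Om q ^ a) p = a%:~R * Om p ^ a * der X u p.
Proof.
have nat_case (n : nat) : der X (fun q => Om q ^+ n) p = n%:R * Om p ^+ n * der X u p.
  elim: n => [|n IH]; first by rewrite (der_cst rg) !mul0r.
  under eq_fun do rewrite exprS; rewrite (derM rg) ?IH ?dOm; [|exact: Om_sm|exact: (smX rg) Om_sm].
  by rewrite -[in RHS]natr1 exprS; ring.
case: a => n; first exact: nat_case.
rewrite NegzE -exprnN.
have -> : (fun q => Om q ^ (- n.+1%:Z)) = fun q => (Om q ^+ n.+1)^-1 by [].
rewrite (derV rg); [|exact: (smX rg) Om_sm|by move=> q; rewrite expf_neq0 ?Om_neq0].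
rewrite nat_case mulrNz -[n.+1%:~R]/(n.+1%:R); by field; rewrite ?expf_neq0 ?Om_neq0.
Qed.

Lemma mgh : is_metric gh.
Proof.
have [h1 h2 h3 h4] := mg; rewrite /gh /rescale; split=> [X Y|X Y p|f X Y Z W p h|X p h].
- by apply: (smM rg) => //; exact: (smX rg) Om_sm.
- by rewrite h2.
- by rewrite (h3 _ _ _ _ _ _ h); ring.
- by rewrite mulr_gt0 ?exprn_gt0 ?Om_gt0 //; exact: h4.
Qed.

(** The difference of the Levi-Civita connections of Omega^2 g and g, applied to X and Y. *)
Definition Cvf X Y : vfield S := vfL (der X u) Y (vfL (der Y u) X (vfL (fun p => - g X Y p) Ups (vf0 S))).
Lemma der_Cvf X Y v p : der (Cvf X Y) v p =
  der X u p * der Y v p + der Y u p * der X v p - g X Y p * der Ups v p.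
Proof.
rewrite /Cvf !(der_vfL rg) ?der_vf0; try exact: der_sm; first by ring.
exact: (smN rg) (g_sm mg _ _).
Qed.
Lemma T_Cvf T X Y p : clin T ->
  T (Cvf X Y) p = der X u p * T Y p + der Y u p * T X p - g X Y p * T Ups p.
Proof.
move=> hT; rewrite (clin3 rg (X := Cvf X Y) (Y := Y) (Z := X) (W := Ups) (a := der X u p) (b := der Y u p) (c := - g X Y p) hT); first by ring.
by move=> v; rewrite der_Cvf; ring.
Qed.

Lemma lc_rescale X Y v p : der (Dh X Y) v p = der (D X Y) v p + der (Cvf X Y) v p.
Proof.
have -> : der (D X Y) v p + der (Cvf X Y) v p = der (vfL (fun=> 1) (D X Y) (Cvf X Y)) v p.
  by rewrite (der_vfL rg) ?mul1r //; exact: smooth_cst.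
move: v; apply: (g_nondeg rg mgh) => Z.
rewrite (lc_koszul rg mgh) -[RHS]/(Om p ^+ 2 * g _ Z p).
rewrite (clinL rg _ _ _ (g_clinl mg Z)) ?mul1r; last exact: smooth_cst.
rewrite (T_Cvf _ _ _ (g_clinl mg Z)) (lc_koszul rg mg) /koszul (g_grad rg mg).
have dg (A B C : vfield S) : der A (gh B C) p = Om p ^+ 2 * (2 * der A u p * g B C p + der A (g B C) p).
  rewrite /gh /rescale (derM rg) ?(der_OmX A 2); [|exact: (smX rg) Om_sm|exact: g_sm].
  by rewrite -[Om p ^ 2]/(Om p ^+ 2) -[2%:~R]/(2%:R : R); ring.
rewrite !dg /gh /rescale.
by field.
Qed.

(** Cartan's formula expresses iota(Y) d by Lie derivatives and d on shorter lists, and no metric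
    occurs in a Lie derivative. *)
Lemma fd_rescale k A s p : is_form k A -> fd gh A s p = fd g A s p.
Proof.
elim: s k A => [|Y s IH] k A hA; first by rewrite !fd_nil.
rewrite -[LHS]/(inter Y (fd gh A) s p) -[RHS]/(inter Y (fd g A) s p).
rewrite (inter_fd rg mgh _ hA) (inter_fd rg mg _ hA).
by congr (_ - _); apply: IH (form_inter Y hA).
Qed.

Lemma onb_rescale e p : onb gh e p -> onb g (fun a : 'I_d => vfL Om (e a) (vf0 S)) p.
Proof.
move=> oe a b; rewrite -oe /gh /rescale.
rewrite (clinL rg _ _ _ (g_clinl mg _) Om_sm) (clin0 _ (g_clinl mg _)).
by rewrite (clinL rg _ _ _ (g_clinr mg _) Om_sm) (clin0 _ (g_clinr mg _)); ring.
Qed.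
Lemma trace_rescale (B : vfield S -> vfield S -> S -> R) p : blin B -> trace d gh B p = (Om p ^+ 2)^-1 * trace d g B p.
Proof.
move=> hB; have oe := frame_onb rg mgh p.
rewrite (trace_onb rg mgh hB oe) (trace_onb rg mg hB (onb_rescale oe)) mulr_sumr.
apply: eq_bigr => a _.
rewrite (clinL rg _ _ _ (hB.1 _) Om_sm) (clin0 _ (hB.1 _)).
rewrite (clinL rg _ _ _ (hB.2 _) Om_sm) (clin0 _ (hB.2 _)).
by field; exact: Om_neq0.
Qed.
Lemma grad_rescale v w p : der (grad gh v) w p = (Om p ^+ 2)^-1 * der (grad g v) w p.
Proof.
rewrite (der_of_g rg mg (Y := grad g v) (Z := vf0 S) (W := vf0 S) (a := (Om p ^+ 2)^-1) (b := 0) (c := 0)); first by ring.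
move=> V; rewrite (g_grad rg mg) !mul0r !addr0 -(g_grad rg mgh v V) /gh /rescale mulrA mulVf ?mul1r //.
by rewrite expf_neq0 ?Om_neq0.
Qed.

Notation eps := (exter (fun X => der X u)).
Notation iot := (inter Ups).

Lemma dact_Cvf X k A s p : is_form k A ->
  dact (Cvf X) A s p = k%:~R * der X u p * A s p + eps (inter X A) s p - exter (g X) (iot A) s p.
Proof.
move=> hA.
rewrite (dact_alt rg _ _ _ hA).
rewrite (@eq_alt _ _ _ (fun Y s q => der X u p * inter Y A s q + 1 * (1 * fmul (der Y u) (inter X A) s q + (-1) * fmul (g X Y) (iot A) s q))); last first.
  move=> Y s'; rewrite /inter (T_Cvf _ _ _ (form_clin0 s' hA)) /fmul; ring.
rewrite (alt_lin (der X u p) 1 (fun Y => inter Y A) (fun Y s q => 1 * fmul (der Y u) (inter X A) s q + (-1) * fmul (g X Y) (iot A) s q)) (alt_lin 1 (-1)) -!exterE.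
by rewrite -(dact_alt rg id _ _ hA) (dact_id _ _ hA); ring.
Qed.

Lemma nabla_rescale X k A s p : is_form k A ->
  nabla gh X A s p = nabla g X A s p - dact (Cvf X) A s p.
Proof.
move=> hA; rewrite !nablaE /gder (@dact_linl _ _ _ rg (D X) (Cvf X) (Dh X) 1 1 k) //; first by ring.
by move=> Y v; rewrite lc_rescale !mul1r.
Qed.

(** The difference tensor contributes three multiples of iota(Ups) A under the trace: -(k + 1), d
    and -(k - 1), which add up to d - 2k. *)
Lemma fdelta_rescale k A s p : is_form k A ->
  fdelta d gh A s p = (Om p ^+ 2)^-1 * (fdelta d g A s p + (d%:R - 2 * k%:~R) * iot A s p).
Proof.
move=> hA; rewrite /fdelta (trace_rescale _ (fdelta_blin rg mgh s hA)); congr (_ * _).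
have oe := frame_onb rg mg p.
rewrite (trace_onb rg mg (fdelta_blin rg mgh s hA) oe) (trace_onb rg mg (fdelta_blin rg mg s hA) oe).
set e := frame_at g p in oe *.
have hi := form_inter Ups hA.
have ib : \sum_a der (e a) u p * A (e a :: s) p = iot A s p.
  by rewrite /inter (onb_lin rg mg Ups (form_clin0 s hA) oe); apply: eq_bigr => a _; rewrite (g_grad rg mg).
have ic : \sum_a exter (g (e a)) (inter (e a) (iot A)) s p = (k%:~R - 1) * iot A s p.
  have -> : (k%:~R - 1 : R) = (k - 1)%:~R by rewrite intrB.
  rewrite -(dact_id _ _ hi) (dact_alt rg _ _ _ hi).
  transitivity (alt (fun Y s p => \sum_a fmul (g (e a) Y) (inter (e a) (iot A)) s p) s p).
    by rewrite alt_sum; apply: eq_bigr => a _; rewrite exterE.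
  apply: eq_alt => Y s'; rewrite [RHS](_ : _ = iot A (Y :: s') p) // (onb_lin rg mg Y (form_clin0 s' hi) oe).
  by apply: eq_bigr => a _; rewrite /fmul g_sym.
transitivity (\sum_a (nabla g (e a) A (e a :: s) p - (k%:~R + 1) * (der (e a) u p * A (e a :: s) p) + iot A s p
   - exter (g (e a)) (inter (e a) (iot A)) s p)).
  apply: eq_bigr => a _; rewrite (nabla_rescale _ _ _ hA) (dact_Cvf _ _ _ hA) !exter_cons oe eqxx.
  have -> : eps (inter (e a) (inter (e a) A)) s p = 0.
    by rewrite /exter big1 // => i _; rewrite /inter (form_diag _ _ _ hA) mulr0.
  by rewrite -[true%:R]/(1 : R) /inter; ring.
rewrite !big_split /= !sumrN -mulr_sumr ib ic sumr_const card_ord -mulr_natl; ring.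
Qed.

Lemma hess_def X Y p : g (D X Ups) Y p = der X (der Y u) p - der (D X Y) u p.
Proof. by rewrite /Ups (hessE rg mg). Qed.

Lemma gD2h V X Y W p :
  let s := s2 p in let a (B : vfield S) := der B u p in
  g (Dh V (Dh X Y)) W p = g (D V (D X Y)) W p + der V (der X u) p * g Y W p + a X * g (D V Y) W p
  + der V (der Y u) p * g X W p + a Y * g (D V X) W p
  - (g (D V X) Y p + g X (D V Y) p) * a W - g X Y p * g (D V Ups) W p
  + a V * (g (D X Y) W p + a X * g Y W p + a Y * g X W p - g X Y p * a W)
  + (der (D X Y) u p + 2 * a X * a Y - g X Y p * s) * g V W p
  - (g V (D X Y) p + a X * g V Y p + a Y * g V X p - g X Y p * a V) * a W.
Proof.
move=> s a.
(* [T] has the same action as [Dh X Y] but is another field; [lc_near] allows the exchange under the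
   outer derivative. *)
pose T := vfL (fun=> 1) (D X Y) (Cvf X Y).
have sc := smooth_cst S 1.
have hT v q : der (Dh X Y) v q = der T v q by rewrite lc_rescale /T (der_vfL rg) // mul1r.
have e1 : g (Dh V (Dh X Y)) W p = g (Dh V T) W p.
  rewrite (clin2 rg (X := Dh V (Dh X Y)) (Y := Dh V T) (Z := vf0 S) (a := 1) (b := 0) (g_clinl mg W)); first by ring.
  move=> v; rewrite (lc_near rg mgh (Y := T)); first by ring.
  by apply: nearbyT => q w; exact: hT.
rewrite e1.
have gT (B : vfield S) q : g T B q = g (D X Y) B q + der X u q * g Y B q + der Y u q * g X B q - g X Y q * der B u q.
  by rewrite (clinL rg _ _ _ (g_clinl mg B)) // (T_Cvf _ _ _ (g_clinl mg B)) (g_grad rg mg); ring.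
have Tu q : der T u q = der (D X Y) u q + 2 * der X u q * der Y u q - g X Y q * s2 q.
  by rewrite (der_vfL rg) // der_Cvf /s2; ring.
rewrite (clin2 rg (X := Dh V T) (Y := D V T) (Z := Cvf V T) (a := 1) (b := 1) (g_clinl mg W)); last first.
  by move=> v; rewrite lc_rescale; ring.
rewrite (T_Cvf _ _ _ (g_clinl mg W)) (g_grad rg mg) Tu (g_sym mg V T) !gT.
have sg := smN rg (g_sm mg X Y).
rewrite (gD_hlin rg mg _ _ _ (vfL_hlin rg _ _ sc)) (der_cst rg).
rewrite !(gD_hlin rg mg _ _ _ (vfL_hlin rg _ _ (der_sm _ _))) (gD_hlin rg mg _ _ _ (vfL_hlin rg _ _ sg)).
have z : g (D V (vf0 S)) W p = 0.
  rewrite (clin2 rg (X := D V (vf0 S)) (Y := vf0 S) (Z := vf0 S) (a := 0) (b := 0) (g_clinl mg W)); first by ring.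
  by move=> v; rewrite (lc_vf0 rg mg); ring.
rewrite z (derN rg) ?(lc_met rg mg V X Y); last exact: g_sm.
rewrite (g_grad rg mg) (g_sym mg (D X Y) V) (g_sym mg Y V) (g_sym mg X V) /a /s /s2.
by atoms g; ring.
Qed.

Lemma riem_rescale X Y Z W p :
  let H (A B : vfield S) := g (D A Ups) B p in let a (A : vfield S) := der A u p in let s := s2 p in
  riem gh X Y Z W p = Om p ^+ 2 * (riem g X Y Z W p + H X Z * g Y W p - H Y Z * g X W p
    - g Y Z p * H X W + g X Z p * H Y W + a Y * a Z * g X W p - a X * a Z * g Y W p
    - s * (g Y Z p * g X W p - g X Z p * g Y W p) + a W * (g Y Z p * a X - g X Z p * a Y)).
Proof.
move=> H a s; rewrite !riemE.
have E (A : vfield S) : gh A W p = Om p ^+ 2 * g A W p by [].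
rewrite !E !gD2h /=.
have Dl : g (Dh (lie X Y) Z) W p = g (D (lie X Y) Z) W p + der (lie X Y) u p * g Z W p
   + der Z u p * g (lie X Y) W p - g (lie X Y) Z p * der W u p.
  rewrite (clin2 rg (X := Dh (lie X Y) Z) (Y := D (lie X Y) Z) (Z := Cvf (lie X Y) Z) (a := 1) (b := 1) (g_clinl mg W)); last first.
    by move=> v; rewrite lc_rescale; ring.
  by rewrite (T_Cvf _ _ _ (g_clinl mg W)) (g_grad rg mg); ring.
have tor (B : vfield S) : g (lie X Y) B p = g (D X Y) B p - g (D Y X) B p.
  rewrite (clin2 rg (X := lie X Y) (Y := D X Y) (Z := D Y X) (a := 1) (b := -1) (g_clinl mg B)); first by ring.
  by move=> v; rewrite -(lc_tor rg mg); ring.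
rewrite Dl !tor (der_lie rg) /H !hess_def /a /s /s2.
rewrite (g_sym mg (D X Y)) (g_sym mg (D Y X)) (g_sym mg (D X Z)) (g_sym mg (D Y Z)) (g_sym mg Y X).
by atoms g; generalize (Om p); intro; ring.
Qed.

Lemma laplacian_onb v e p : onb g e p -> laplacian d g v p = \sum_(a < d) g (D (e a) (grad g v)) (e a) p.
Proof.
move=> oe; have hb : blin (fun X Y p => g (D X (grad g v)) Y p).
  split=> [Y|X]; last exact: g_clinr.
  exact: (vlin_clin rg (lc_vlin rg mg (grad g v)) (g_clinl mg Y)).
rewrite -(trace_onb rg mg hb oe); apply: eq_bigr => a _; by rewrite (hessE rg mg).
Qed.

Lemma ric_rescale X Y p : ric d gh X Y p = ric d g X Y p
  - (d%:R - 2) * (g (D X Ups) Y p - der X u p * der Y u p)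
  - (laplacian d g u p + (d%:R - 2) * s2 p) * g X Y p.
Proof.
rewrite /ric (trace_rescale _ (riem_blin rg mgh X Y)).
have oe := frame_onb rg mg p; set e := frame_at g p in oe *.
rewrite (trace_onb rg mg (riem_blin rg mgh X Y) oe) (trace_onb rg mg (riem_blin rg mg X Y) oe).
rewrite (laplacian_onb _ oe).
have tr T Z : clin T -> \sum_a g Z (e a) p * T (e a) p = T Z p.
  by move=> hT; rewrite (onb_lin rg mg Z hT oe).
have H1 : \sum_a g X (e a) p * g (D (e a) Ups) Y p = g (D X Ups) Y p.
  exact: (tr _ _ (vlin_clin rg (lc_vlin rg mg Ups) (g_clinl mg Y))).
have H2 : \sum_a g Y (e a) p * g (D X Ups) (e a) p = g (D X Ups) Y p.
  exact: (tr _ _ (g_clinr mg _)).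
have H3 : \sum_a g X (e a) p * der (e a) u p = der X u p by exact: (tr _ _ (@clin_der _ _ u)).
have H3' : \sum_a g Y (e a) p * der (e a) u p = der Y u p by exact: (tr _ _ (@clin_der _ _ u)).
have H4 : \sum_a der (e a) u p * der (e a) u p = s2 p.
  rewrite /s2 -(tr _ Ups (@clin_der _ _ u)); apply: eq_bigr => a _; by rewrite (g_grad rg mg).
have H5 : \sum_a g X (e a) p * g (e a) Y p = g X Y p by exact: (tr _ _ (g_clinl mg Y)).
(* The sums are separated for arbitrary summands, over a list, so that the geometric terms do not
   enter the algebra. *)
have key : forall (r h1 h2 l q1 q2 q3 q4 : 'I_d -> R) (H a1 G s3 a2 : R),
  \sum_a (r a + h1 a - H - G * l a + h2 a + a1 * a2 - a2 * q1 a - s3 * G + s3 * q2 a + G * q3 a - a1 * q4 a)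
  = \sum_a r a + \sum_a h1 a - d%:R * H - G * (\sum_a l a) + \sum_a h2 a + d%:R * (a1 * a2)
    - a2 * (\sum_a q1 a) - d%:R * (s3 * G) + s3 * (\sum_a q2 a) + G * (\sum_a q3 a) - a1 * (\sum_a q4 a).
  move=> r h1 h2 l q1 q2 q3 q4 H a1 G s3 a2; rewrite !sum_enum; have <- : (size (enum 'I_d))%:R = d%:R :> R by rewrite size_enum_ord.
  elim: (enum 'I_d) => [|a s IH]; rewrite ?big_nil ?big_cons /=; first by ring.
  by rewrite IH -natr1; ring.
transitivity (\sum_a ((riem g (e a) X Y (e a) p) + (g X (e a) p * g (D (e a) Ups) Y p)
   - g (D X Ups) Y p - g X Y p * g (D (e a) Ups) (e a) p + (g Y (e a) p * g (D X Ups) (e a) p)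
   + der X u p * der Y u p - der Y u p * (g X (e a) p * der (e a) u p)
   - s2 p * (g X Y p) + s2 p * (g X (e a) p * g (e a) Y p)
   + g X Y p * (der (e a) u p * der (e a) u p) - der X u p * (g Y (e a) p * der (e a) u p))).
  rewrite mulr_sumr; apply: eq_bigr => a _; rewrite riem_rescale /= oe eqxx.
  rewrite (g_sym mg (e a) Y) -[true%:R]/(1 : R) /s2.
  generalize (riem g (e a) X Y (e a) p) => r; atoms g; have := Om_neq0 p; generalize (Om p) => o o0.
  by field.
rewrite (key (fun a => riem g (e a) X Y (e a) p) (fun a => g X (e a) p * g (D (e a) Ups) Y p)
  (fun a => g Y (e a) p * g (D X Ups) (e a) p) (fun a => g (D (e a) Ups) (e a) p)
  (fun a => g X (e a) p * der (e a) u p) (fun a => g X (e a) p * g (e a) Y p)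
  (fun a => der (e a) u p * der (e a) u p) (fun a => g Y (e a) p * der (e a) u p)).
rewrite H1 H2 H3 H3' H4 H5 -/Ups.
by atoms g; generalize (s2 p) => s4; ring.
Qed.

Hypothesis d3 : (3 <= d)%N.
Lemma dn1 : (d%:R - 1 : R) != 0.
Proof. by rewrite subr_eq0 (eqr_nat R d 1); apply: contraTneq d3 => ->. Qed.
Lemma dn2 : (d%:R - 2 : R) != 0.
Proof. by rewrite subr_eq0 (eqr_nat R d 2); apply: contraTneq d3 => ->. Qed.

Lemma J_rescale p : Jcurv d gh p =
  (Om p ^+ 2)^-1 * (Jcurv d g p - laplacian d g u p - (d%:R / 2 - 1) * s2 p).
Proof.
have oe := frame_onb rg mg p.
rewrite /Jcurv (trace_rescale _ (ric_blin rg mgh)) (trace_onb rg mg (ric_blin rg mgh) oe).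
rewrite (trace_onb rg mg (ric_blin rg mg) oe); set e := frame_at g p in oe *.
have H4 : \sum_a der (e a) u p * der (e a) u p = s2 p.
  rewrite /s2 (onb_lin rg mg Ups (@clin_der _ _ u) oe); apply: eq_bigr => a _; by rewrite (g_grad rg mg).
have key : forall (r h q : 'I_d -> R) (c1 c2 : R),
  \sum_a (r a - c1 * (h a - q a) - c2) = \sum_a r a - c1 * (\sum_a h a - \sum_a q a) - d%:R * c2.
  move=> r h q c1 c2; rewrite !sum_enum; have <- : (size (enum 'I_d))%:R = d%:R :> R by rewrite size_enum_ord.
  elim: (enum 'I_d) => [|a s IH]; rewrite ?big_nil ?big_cons /=; first by ring.
  by rewrite IH -natr1; ring.
transitivity ((Om p ^+ 2)^-1 * (\sum_a (ric d g (e a) (e a) p - (d%:R - 2) * (g (D (e a) Ups) (e a) p - der (e a) u p * der (e a) u p)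
    - (laplacian d g u p + (d%:R - 2) * s2 p))) / (2 * (d%:R - 1))).
  congr (_ * _ / _); apply: eq_bigr => a _; rewrite ric_rescale oe eqxx.
  by rewrite -[true%:R]/(1 : R) mulr1.
rewrite (key (fun a => ric d g (e a) (e a) p) (fun a => g (D (e a) Ups) (e a) p) (fun a => der (e a) u p * der (e a) u p)).
rewrite H4 -(laplacian_onb _ oe).
generalize (\sum_a ric d g (e a) (e a) p) => r; generalize (laplacian d g u p) => l.
have := Om_neq0 p; generalize (Om p) => o o0; generalize (s2 p) => s3.
by field; rewrite dn1.
Qed.

Lemma schouten_rescale X Y p : schouten d gh X Y p =
  schouten d g X Y p - g (D X Ups) Y p + der X u p * der Y u p - 2^-1 * s2 p * g X Y p.
Proof.
rewrite /schouten ric_rescale J_rescale /gh /rescale.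
generalize (ric d g X Y p) => r; generalize (Jcurv d g p) => j; generalize (laplacian d g u p) => l.
have := Om_neq0 p; generalize (Om p) => o o0; generalize (s2 p) => s3; have := dn2.
by atoms g; generalize (d%:R : R) => D0 D2; field; rewrite o0 D2.
Qed.

Lemma Pform_rescale k A s p : is_form k A -> Pform d gh A s p = (Om p ^+ 2)^-1 *
  (Pform d g A s p - dact (fun Y => D Y Ups) A s p + eps (iot A) s p - 2^-1 * s2 p * k%:~R * A s p).
Proof.
move=> hA; rewrite (Pform_dact rg mgh _ _ hA) (Pform_dact rg mg _ _ hA).
have e1 : dact (PS (d:=d) gh) A s p = (Om p ^+ 2)^-1 *
   (dact (PS (d:=d) g) A s p - dact (fun Y => D Y Ups) A s p + dact (fun Y => vfL (der Y u) Ups (vf0 S)) A s p - 2^-1 * s2 p * dact id A s p).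
  rewrite (@dact_linl _ _ _ rg (PS (d:=d) g) (fun Y => vfL (fun=> -1) (D Y Ups) (vfL (der Y u) Ups (vfL (fun q => - 2^-1 * s2 p) Y (vf0 S)))) (PS (d:=d) gh) (Om p ^+ 2)^-1 (Om p ^+ 2)^-1 k) //.
    rewrite (@dact_linl _ _ _ rg (fun Y => D Y Ups) (fun Y => vfL (der Y u) Ups (vfL (fun q => - 2^-1 * s2 p) Y (vf0 S))) (fun Y => vfL (fun=> -1) (D Y Ups) (vfL (der Y u) Ups (vfL (fun q => - 2^-1 * s2 p) Y (vf0 S)))) (-1) 1 k) //; last first.
      by move=> Y v; rewrite (der_vfL rg) ?mul1r //; exact: smooth_cst.
    rewrite (@dact_linl _ _ _ rg (fun Y => vfL (der Y u) Ups (vf0 S)) id (fun Y => vfL (der Y u) Ups (vfL (fun q => - 2^-1 * s2 p) Y (vf0 S))) 1 (- 2^-1 * s2 p) k) //; first by ring.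
    move=> Y v; rewrite !(der_vfL rg) ?der_vf0; try exact: der_sm; try exact: smooth_cst; ring.
  move=> Y v; rewrite -mulrDr.
  rewrite (der_of_g rg mgh (X := PS (d:=d) gh Y) (Y := PS (d:=d) g Y) (Z := vfL (fun=> -1) (D Y Ups) (vfL (der Y u) Ups (vfL (fun q => - 2^-1 * s2 p) Y (vf0 S)))) (W := vf0 S) (a := (Om p ^+ 2)^-1) (b := (Om p ^+ 2)^-1) (c := 0)); first by ring.
  move=> V; rewrite (g_PS rg mgh) /gh /rescale (g_PS rg mg) schouten_rescale.
  rewrite !(clinL rg _ _ _ (g_clinl mg V)); try exact: smooth_cst; try exact: der_sm.
  rewrite (clin0 _ (g_clinl mg V)) (g_grad rg mg) (hess_sym rg mg _ V Y) (g_sym mg V Y).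
  by field; exact: Om_neq0.
rewrite e1 (dact_outer rg s p hA) ?(dact_id _ _ hA) ?mulrA //; by move=> *; exact: der_sm.
Qed.

Lemma JP_rescale k A s p : is_form k A -> JP d gh A s p = (Om p ^+ 2)^-1 *
  (JP d g A s p - (laplacian d g u p + (d%:R / 2 - 1 - k%:~R) * s2 p) * A s p
   + 2 * dact (fun Y => D Y Ups) A s p - 2 * eps (iot A) s p).
Proof.
move=> hA.
have E h : JP d h A s p = Jcurv d h p * A s p - 2 * Pform d h A s p.
  by rewrite /JP -[LHS]/(fmul (Jcurv d h) A s p - (Pform d h A *+ 2) s p) dfMnE /fmul mulr_natl.
rewrite !E (Pform_rescale _ _ hA) J_rescale; field; exact: Om_neq0.
Qed.

End Conformal.

(** * Tractor forms *)

Section Words.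
Context {R : realType} {S : smooth_space R} {d : nat}.
Hypothesis rg : regular S d.
Implicit Types (X Y Z W V : vfield S) (v f : S -> R) (p q : S) (k j b : int) (A B : dform S).
Implicit Types (s : seq (vfield S)).
Variable g : metric S.
Hypothesis mg : is_metric g.
Variable Om : S -> R.
Hypothesis pOm : positive_smooth Om.
Let u := fun p => ln (Om p).
Hypothesis su : smooth u.
Hypothesis dOm : forall X p, der X Om p = Om p * der X u p.
Hypothesis d3 : (3 <= d)%N.
Notation D := (levi_civita g).
Notation gh := (rescale Om g).
Notation Ups := (grad g u).
Notation eps := (exter (fun X => der X u)).
Notation iot := (inter Ups).
Notation H := (dact (fun Y => D Y Ups)).
Notation lap := (laplacian d g u).
Notation s2 := (fun p => der Ups u p).
Notation dl := (fdelta d g).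
Notation dd := (fd g).
Notation Q := (JP d g).

Lemma lap_sm : smooth lap.
Proof.
have hb : blin (fun X Y p => g (D X Ups) Y p).
  split=> [Y|X]; last exact: g_clinr.
  exact: (vlin_clin rg (lc_vlin rg mg Ups) (g_clinl mg Y)).
rewrite (_ : lap = trace d g (fun X Y p => g (D X Ups) Y p)).
  by apply: (trace_sm rg mg hb) => X Y; exact: g_sm.
by apply/funext => p; apply: eq_bigr => a _; rewrite (hessE rg mg).
Qed.
Lemma s2_sm : smooth s2. Proof. exact: der_sm. Qed.

Lemma iot_form k A : is_form k A -> is_form (k - 1) (iot A). Proof. exact: form_inter. Qed.
Lemma eps_form k A : is_form k A -> is_form (k + 1) (eps A).
Proof. by apply: (exter_form rg) => [|X]; [exact: clin_der|exact: der_sm]. Qed.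
Lemma H_form k A : is_form k A -> is_form k (H A).
Proof. by move=> hA; apply: (dact_form rg _ hA); exact: (lc_vlin rg mg). Qed.

Lemma eps_lin (a c : R) A B C s p : (forall s, C s p = a * A s p + c * B s p) ->
  eps C s p = a * eps A s p + c * eps B s p.
Proof. exact: exter_lin. Qed.

Lemma eps_eps k A s p : is_form k A -> eps (eps A) s p = 0.
Proof.
elim: s k A => [|X s IH] k A hA; first by rewrite exter_nil.
rewrite exter_cons (@eps_lin (der X u p) (-1) A (eps (inter X A)) (inter X (eps A))) ?(IH _ _ (form_inter X hA)) => [|s'].
  by ring.
by rewrite /inter exter_cons; ring.
Qed.
Lemma iot_eps A s p : iot (eps A) s p = s2 p * A s p - eps (iot A) s p.
Proof. by rewrite {1}/inter exter_cons. Qed.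

Lemma dd_eps k A s p : is_form k A -> dd (eps A) s p = - eps (dd A) s p.
Proof.
move=> hA; have hd := fd_form rg mg hA.
have e1 : eps A = (fun s p => 1 * dd (fmul u A) s p + (-1) * fmul u (dd A) s p).
  by apply: dfP => s' p'; rewrite (fd_fmul rg g _ _ su hA) /fmul; ring.
have hu := fd_form rg mg (formM rg su hA).
rewrite e1 (fd_lin rg g _ _ hu (formM rg su hd) (C := fun s p => 1 * dd (fmul u A) s p + (-1) * fmul u (dd A) s p) (a := 1) (b := -1)) //.
rewrite (fd_fd rg mg (formM rg su hA)) (fd_fmul rg g _ _ su hd) (fd_fd rg mg hA).
by rewrite -[(0 : dform S) s p]/(0 : R); ring.
Qed.

(** [fdelta_exter] with nabla_Ups rewritten as L_Ups - H (vanishing torsion) and L_Ups as d iota +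
    iota d (Cartan); this is why H appears twice. *)
Lemma dl_eps k A s p : is_form k A -> dl (eps A) s p =
  dd (iot A) s p + iot (dd A) s p - 2 * H A s p + lap p * A s p - eps (dl A) s p.
Proof.
move=> hA; rewrite (fdelta_exter rg mg _ _ su hA).
have := congr1 (fun B : dform S => B s p) (inter_fd rg mg Ups hA).
rewrite /= -[(Lie _ _ - _) s p]/(Lie Ups A s p - dd (iot A) s p) -(torsion rg mg _ _ _ hA).
by move=> ->; ring.
Qed.
Lemma dact_exter Phi (theta : vfield S -> S -> R) k A s p : vlin Phi -> clin theta -> is_form k A ->
  dact Phi (exter theta A) s p = exter (fun X => theta (Phi X)) A s p + exter theta (dact Phi A) s p.
Proof.
move=> hP ht; elim: s k A => [|X s IH] k A hA; first by rewrite !exter_nil dact_nil addr0.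
rewrite dact_cons !exter_cons.
rewrite (@dact_lin _ _ Phi (theta X p) (-1) A (exter theta (inter X A)) (inter X (exter theta A))) => [|s']; last first.
  by rewrite /inter exter_cons; ring.
rewrite (IH _ _ (form_inter X hA)).
rewrite (@exter_lin _ _ theta 1 1 (inter (Phi X) A) (dact Phi (inter X A)) (inter X (dact Phi A))); first by ring.
by move=> s'; rewrite [LHS]dact_cons !mul1r.
Qed.
(** H acts as a derivation, and the Hessian of u applied to Ups is half the differential of |Ups|^2;
    that differential is written here as a commutator of d with multiplication by s2. *)
Lemma H_eps k A s p : is_form k A ->
  H (eps A) s p = eps (H A) s p + 2^-1 * (dd (fmul s2 A) s p - s2 p * dd A s p).
Proof.
move=> hA; rewrite (dact_exter _ _ (lc_vlin rg mg Ups) (@clin_der _ _ u) hA).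
rewrite (fd_fmul rg g _ _ s2_sm hA).
rewrite (@exter_linl _ _ (fun X => der (D X Ups) u) (fun X => der (D X Ups) u) (fun X => der X s2) 2 0); first by field.
move=> X; have -> : s2 = g Ups Ups by apply/funext => q; rewrite (g_grad rg mg).
by rewrite (lc_met rg mg) (g_sym mg (D X Ups)) (g_grad rg mg); ring.
Qed.

Lemma der_Omw X b p : der X (fun q => Om q ^ b) p = b%:~R * Om p ^ b * der X u p.
Proof. exact: (der_OmX rg pOm dOm). Qed.
Lemma Omw_sm b : smooth (fun p => Om p ^ b).
Proof. exact: (OmX_sm rg pOm). Qed.
Lemma Omw2 b p : Om p ^ b = Om p ^+ 2 * Om p ^ (b - 2).
Proof. by rewrite -[Om p ^+ 2]/(Om p ^ 2%:Z) -expfzDr ?(Om_neq0 pOm) // addrC subrK. Qed.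

Lemma fdW b k A : is_form k A ->
  fd gh (fmul (fun p => Om p ^ b) A) =
  fmul (fun p => Om p ^ b) (fun s p => 1 * dd A s p + b%:~R * eps A s p).
Proof.
move=> hA; apply: dfP => s p.
rewrite (fd_rescale rg mg pOm _ _ (formM rg (Omw_sm b) hA)) (fd_fmul rg g _ _ (Omw_sm b) hA).
rewrite (exter_linl (t1 := fun X => der X u) (t2 := fun X => der X u) (a := b%:~R * Om p ^ b) (b := 0)); last first.
  by move=> X; rewrite der_Omw; ring.
by rewrite /fmul; ring.
Qed.
Lemma deltaW b k A : is_form k A ->
  fdelta d gh (fmul (fun p => Om p ^ b) A) =
  fmul (fun p => Om p ^ (b - 2)) (fun s p => 1 * dl A s p + (d%:R + b%:~R - 2 * k%:~R) * iot A s p).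
Proof.
move=> hA; apply: dfP => s p.
rewrite (fdelta_rescale rg mg pOm dOm _ _ (formM rg (Omw_sm b) hA)) (fdelta_fmul rg mg _ _ (Omw_sm b) hA).
have -> : A (grad g (fun q => Om q ^ b) :: s) p = b%:~R * Om p ^ b * iot A s p.
  rewrite (clin2 rg (form_clin0 s hA) (Y := Ups) (Z := vf0 S) (a := b%:~R * Om p ^ b) (b := 0)); first by rewrite /inter; ring.
  move=> v; rewrite (der_of_g rg mg (Y := Ups) (Z := vf0 S) (W := vf0 S) (a := b%:~R * Om p ^ b) (b := 0) (c := 0)); first by ring.
  by move=> V; rewrite !(g_grad rg mg) der_Omw; ring.
rewrite [inter _ (fmul _ A) s p](_ : _ = Om p ^ b * iot A s p) // /fmul (Omw2 b).
generalize (Om p ^ (b - 2)) (Om_neq0 pOm p); generalize (Om p) => o o' o0.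
by field.
Qed.
Lemma QW b k A s p : is_form k A -> JP d gh (fmul (fun p => Om p ^ b) A) s p =
  Om p ^ (b - 2) * (Q A s p - (lap p + (d%:R / 2 - 1 - k%:~R) * s2 p) * A s p
    + 2 * H A s p - 2 * eps (iot A) s p).
Proof.
move=> hA; have hB := formM rg (Omw_sm b) hA.
rewrite (JP_rescale rg mg pOm dOm d3 _ _ hB).
have fE B : fmul (fun p => Om p ^ b) B s p = Om p ^ b * B s p by [].
rewrite !(JPE rg mg _ _ hB) !(JPE rg mg _ _ hA) fE.
rewrite !(@dact_lin _ _ _ (Om p ^ b) 0 A A (fmul (fun p => Om p ^ b) A)); try by move=> s'; rewrite /fmul; ring.
rewrite (@eps_lin (Om p ^ b) 0 (iot A) (iot A) (inter Ups (fmul (fun p => Om p ^ b) A)) s p); last first.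
  by move=> s'; rewrite [LHS](_ : _ = Om p ^ b * iot A s' p) //; ring.
rewrite (Omw2 b); generalize (Om p ^ (b - 2)) (Om_neq0 pOm p); generalize (Om p) => o o' o0.
by field.
Qed.

Lemma lin_form (a c : R) k A B : is_form k A -> is_form k B ->
  is_form k (fun s p => a * A s p + c * B s p).
Proof.
move=> hA hB; have -> : (fun s p => a * A s p + c * B s p) = fmul (fun=> a) A + fmul (fun=> c) B by [].
by apply: (formD rg); apply: (formM rg) => //; exact: smooth_cst.
Qed.

Lemma fDeltaE h A s p : fDelta d h A s p = fd h (fdelta d h A) s p + fdelta d h (fd h A) s p.
Proof. by []. Qed.

Lemma DeltaW b k A s p : is_form k A ->
  let c := d%:R + b%:~R - 2 * k%:~R : R in
  fDelta d gh (fmul (fun p => Om p ^ b) A) s p =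
  Om p ^ (b - 2) * (fDelta d g A s p - 2 * eps (dl A) s p + (b%:~R + c) * dd (iot A) s p
    + (b%:~R + c - 2) * iot (dd A) s p - 2 * b%:~R * H A s p + b%:~R * lap p * A s p
    + (c - 2) * b%:~R * s2 p * A s p + (2 * b%:~R - 2 * c) * eps (iot A) s p).
Proof.
move=> hA c.
have hd := fdelta_form rg mg hA; have hi := iot_form hA; have he := eps_form hA; have hf := fd_form rg mg hA.
rewrite !fDeltaE (deltaW _ hA) (fdW _ hA) (fdW _ (lin_form _ _ hd hi)) (deltaW _ (lin_form _ _ hf he)).
rewrite /fmul (fd_lin rg g _ _ hd hi (fun _ _ => erefl)) (fdelta_lin rg g _ _ hf he (fun _ _ => erefl)).
rewrite (@eps_lin 1 (d%:R + b%:~R - 2 * k%:~R) (dl A) (iot A) _ s p (fun _ => erefl)) (dl_eps _ _ hA) -/c.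
have -> : iot (fun s0 p0 => 1 * dd A s0 p0 + b%:~R * eps A s0 p0) s p = iot (dd A) s p + b%:~R * iot (eps A) s p.
  by rewrite /inter; ring.
rewrite iot_eps !intrD /c -[1%:~R]/(1 : R) -[(-2)%:~R]/(- 2%:R : R).
by generalize (Om p ^ (b - 2)) => o; ring.
Qed.

Lemma iot_linE (a c : R) A B s p : iot (fun s p => a * A s p + c * B s p) s p = a * iot A s p + c * iot B s p.
Proof. by []. Qed.

(** Formal linear combinations of forms, through which the operators are distributed over several
    terms at once in the computation of the south slot. *)
Definition lc (l : seq (R * dform S)) : dform S := fun s p => \sum_(x <- l) x.1 * x.2 s p.
Lemma lcE l s p : lc l s p = \sum_(x <- l) x.1 * x.2 s p. Proof. by []. Qed.
Fixpoint smf (l : seq (R * dform S)) : Prop :=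
  if l is x :: l' then (forall s, smooth (x.2 s)) /\ smf l' else True.
Lemma lc_sm l s : smf l -> smooth (lc l s).
Proof.
elim: l => [|x l IH] /=.
  move=> _; rewrite (_ : lc [::] s = fun=> 0); first exact: smooth_cst.
  by apply/funext => p; rewrite lcE big_nil.
move=> [hx hl]; rewrite (_ : lc (x :: l) s = fun p => x.1 * x.2 s p + lc l s p); last first.
  by apply/funext => p; rewrite !lcE big_cons.
by apply: (smD rg); [apply: (smM rg); [exact: smooth_cst|exact: hx]|exact: IH].
Qed.
Lemma op_lc (T : dform S -> dform S) l s p :
  (forall (a c : R) A B, (forall s, smooth (A s)) -> (forall s, smooth (B s)) ->
     T (fun s p => a * A s p + c * B s p) s p = a * T A s p + c * T B s p) ->
  smf l -> T (lc l) s p = \sum_(x <- l) x.1 * T x.2 s p.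
Proof.
move=> hT; have s0 (s' : seq (vfield S)) : smooth ((0 : dform S) s') by exact: smooth_cst.
have T0 : T 0 s p = 0.
  have := hT 0 0 _ _ s0 s0; rewrite !mul0r addr0 => <-; congr (T _ s p).
  by apply: dfP => s' p'; rewrite !mul0r addr0.
elim: l => [|x l IH] /=.
  by move=> _; rewrite big_nil (_ : lc [::] = 0) //; apply: dfP => s' p'; rewrite lcE big_nil.
move=> [hx hl]; rewrite big_cons -IH // -[T (lc l) s p]mul1r -hT //; last by move=> s'; exact: lc_sm.
by congr (T _ s p); apply: dfP => s' p'; rewrite lcE big_cons mul1r.
Qed.
Lemma dd_lc l s p : smf l -> dd (lc l) s p = \sum_(x <- l) x.1 * dd x.2 s p.
Proof.
apply: (op_lc (T := dd)) => a c A B sA sB; rewrite !fdE -alt_lin; apply: eq_alt => X s'.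
by rewrite (nabla_lin rg).
Qed.
Lemma dl_lc l s p : smf l -> dl (lc l) s p = \sum_(x <- l) x.1 * dl x.2 s p.
Proof.
apply: (op_lc (T := dl)) => a c A B sA sB; rewrite !fdeltaE !mulr_sumr -big_split /=.
by apply: eq_bigr => i _; rewrite (nabla_lin rg).
Qed.
Lemma eps_lc l s p : smf l -> eps (lc l) s p = \sum_(x <- l) x.1 * eps x.2 s p.
Proof. by apply: (op_lc (T := fun A => eps A)) => a c A B _ _; apply: eps_lin. Qed.
Lemma iot_lc l s p : smf l -> iot (lc l) s p = \sum_(x <- l) x.1 * iot x.2 s p.
Proof. by []. Qed.
Lemma H_lc l s p : smf l -> H (lc l) s p = \sum_(x <- l) x.1 * H x.2 s p.
Proof. by apply: (op_lc (T := fun A => H A)) => a c A B _ _; apply: dact_lin. Qed.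
Lemma Q_lc k l s p : smf l -> foldr (fun x P => is_form k x.2 /\ P) True l ->
  is_form k (lc l) -> Q (lc l) s p = \sum_(x <- l) x.1 * Q x.2 s p.
Proof.
move=> sl fl hl; rewrite (JPE rg mg _ _ hl) lcE.
rewrite (op_lc (T := fun A => dact (PS (d := d) g) A)) //; last by move=> a c A B _ _; apply: dact_lin.
elim: l fl {sl hl} => [|x l IH] /=; first by move=> _; rewrite !big_nil; ring.
move=> [hx hl]; rewrite !big_cons -IH // (JPE rg mg _ _ hx); ring.
Qed.

Section Slots.
Variables (k w : int) (N W E F : dform S).
Hypotheses (hN : is_form (k - 1) N) (hW : is_form k W) (hE : is_form (k - 2) E) (hF : is_form (k - 1) F).
Notation a := (w + k).
Notation wt b := (fun p => Om p ^ b).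
Notation dR := (d%:R : R).
Notation wR := (w%:~R : R).

(** [hatW], [hatE] and [hatF] are the slots of the tractor transformation law without the powers of
    Omega. [hatF] is assembled from two-term combinations, the shape to which [lin_form] applies. *)
Definition hatW : dform S := fun s p => 1 * W s p + 1 * eps N s p.
Definition hatE : dform S := fun s p => 1 * E s p + (-1) * iot N s p.
Definition hatF0 : dform S := fun s p => 1 * eps (iot N) s p + (- 2^-1) * fmul s2 N s p.
Definition hatF1 : dform S := fun s p => 1 * iot W s p + 1 * eps E s p.
Definition hatF2 : dform S := fun s p => 1 * F s p + 1 * hatF0 s p.
Definition hatF : dform S := fun s p => 1 * hatF2 s p + (-1) * hatF1 s p.

Lemma hNk : is_form k (eps N). Proof. by have := eps_form hN; rewrite subrK. Qed.
Lemma hatW_form : is_form k hatW. Proof. by apply: lin_form => //; exact: hNk. Qed.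
Lemma iotN_form : is_form (k - 2) (iot N).
Proof. by have := iot_form hN; rewrite -addrA. Qed.
Lemma hatE_form : is_form (k - 2) hatE. Proof. by apply: lin_form => //; exact: iotN_form. Qed.
Lemma epsE2 B : is_form (k - 2) B -> is_form (k - 1) (eps B).
Proof. by move/eps_form; rewrite -addrA. Qed.
Lemma sN_form : is_form (k - 1) (fmul s2 N). Proof. exact: (formM rg s2_sm hN). Qed.
Lemma hatF0_form : is_form (k - 1) hatF0.
Proof. by apply: lin_form; [exact: epsE2 iotN_form|exact: sN_form]. Qed.
Lemma hatF1_form : is_form (k - 1) hatF1.
Proof. by apply: lin_form; [exact: iot_form hW|exact: epsE2]. Qed.
Lemma hatF2_form : is_form (k - 1) hatF2.
Proof. by apply: lin_form => //; exact: hatF0_form. Qed.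
Lemma hatF_form : is_form (k - 1) hatF.
Proof. by apply: lin_form; [exact: hatF2_form|exact: hatF1_form]. Qed.

(** In the four lemmas from [north_W] to [south_W] the left side comes from a slot of D F in the
    scale Omega^2 g and the right side from the transformation law of D F in the scale g; together
    they are the conformal invariance of D. The factor d + 2w - 2 of the north and west slots is
    left out. *)
Lemma north_W s p :
  (fmul (wt a) hatW *~ a - fd gh (fmul (wt a) N)) s p = Om p ^ a * (a%:~R * W s p - dd N s p).
Proof.
rewrite -[LHS]/((fmul (wt a) hatW *~ a) s p - fd gh (fmul (wt a) N) s p) dfMzE -mulrzl (fdW a hN).
by rewrite /fmul /hatW; generalize (Om p ^ a) => o; ring.
Qed.

Lemma west_W s p : fd gh (fmul (wt a) hatW) s p = Om p ^ a * (dd W s p + a%:~R * eps W s p - eps (dd N) s p).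
Proof.
rewrite (fdW a hatW_form) /fmul (fd_lin rg g s p hW hNk (fun _ _ => erefl)).
rewrite (@eps_lin 1 1 W (eps N) _ s p (fun _ => erefl)) (eps_eps _ _ hN) (dd_eps _ _ hN).
by generalize (Om p ^ a) => o; ring.
Qed.

Lemma east_W s p :
  fDelta d gh (fmul (wt a) N) s p + (a - 2)%:~R * JP d gh (fmul (wt a) N) s p
  - 2 * fdelta d gh (fmul (wt a) hatW) s p
  + (dR + 2 * wR) * (fd gh (fmul (wt (a - 2)) hatE) s p + (a - 2)%:~R * fmul (wt (a - 2)) hatF s p)
  = Om p ^ (a - 2) * (
   (fDelta d g N s p + (a - 2)%:~R * Q N s p - 2 * dl W s p + (dR + 2 * wR) * (dd E s p + (a - 2)%:~R * F s p))
   - (dR + 2 * wR - 2) * (a%:~R * iot W s p - iot (dd N) s p)).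
Proof.
rewrite (DeltaW a _ _ hN) (QW a _ _ hN) (deltaW a hatW_form) (fdW (a - 2) hatE_form).
rewrite {1 2 3}/fmul (fdelta_lin rg g s p hW hNk (fun _ _ => erefl)) (dl_eps _ _ hN).
rewrite (fd_lin rg g s p hE iotN_form (fun _ _ => erefl)).
rewrite (@eps_lin 1 (-1) E (iot N) hatE s p (fun _ => erefl)).
rewrite /fmul [iot hatW s p](iot_linE 1 1) iot_eps /hatF /hatF2 /hatF1 /hatF0 /fmul.
by generalize (Om p ^ (w + k - 2)) => o; field.
Qed.

Lemma lapN_form : is_form (k - 1) (fmul lap N). Proof. exact: (formM rg lap_sm hN). Qed.

(* The slot where the conformal variation of [[J - 2P, d]] cancels that of the
   Laplacian: both sides are expanded into words in d, delta, eps, iota and H. *)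
Lemma south_W s p :
  (JP d gh (fd gh (fmul (wt a) N)) s p - fd gh (JP d gh (fmul (wt a) N)) s p)
  - (fDelta d gh (fmul (wt a) hatW) s p + a%:~R * JP d gh (fmul (wt a) hatW) s p)
  - (dR + 2 * wR) * fd gh (fmul (wt (a - 2)) hatF) s p
  = Om p ^ (a - 2) * (
   ((Q (dd N) s p - dd (Q N) s p) - (fDelta d g W s p + a%:~R * Q W s p) - (dR + 2 * wR) * dd F s p)
   + 0
   - (dR + 2 * wR - 2) * iot (dd W) s p
   + (dR + 2 * wR - 2) * (2^-1 * (a%:~R * (eps (iot W) s p - iot (eps W) s p) - (eps (iot (dd N)) s p - iot (eps (dd N)) s p)))
   - (eps (fDelta d g N) s p + (a - 2)%:~R * eps (Q N) s p - 2 * eps (dl W) s p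
       + (dR + 2 * wR) * (eps (dd E) s p + (a - 2)%:~R * eps F s p))).
Proof.
have hdN : is_form k (dd N) by have := fd_form rg mg hN; rewrite subrK.
have hdlN := fdelta_form rg mg hN; rewrite -addrA in hdlN.
have heN := hNk; have hiN := iotN_form; have hsN := sN_form; have hlN := lapN_form.
have hHN := H_form hN; have hiW := iot_form hW; have heE := epsE2 hE.
have heiN := epsE2 hiN; have hdiN : is_form (k - 1) (dd (iot N)).
  by have := fd_form rg mg hiN; rewrite -addrA.
have hidN := iot_form hdN; have hedlN := epsE2 hdlN; have hQN := JP_form rg mg hN.
have hdlW := fdelta_form rg mg hW; have hdW := fd_form rg mg hW.
have hedN := eps_form hdN; have hddlN : is_form (k - 1) (dd (dl N)).
  by have := fd_form rg mg hdlN; rewrite -addrA.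
pose M : dform S := lc [:: (1, dd N); (a%:~R, eps N)].
have hM : is_form k M.
  by have := lin_form 1 a%:~R hdN heN; congr is_form; apply: dfP => s' p'; rewrite /M lcE !big_cons big_nil /= addr0.
have ME : fd gh (fmul (wt a) N) = fmul (wt a) M.
  by rewrite (fdW a hN); congr fmul; apply: dfP => s' p'; rewrite /M lcE !big_cons big_nil /= addr0.
pose c1 : R := dR / 2 - 1 - (k - 1)%:~R.
pose B : dform S := lc [:: (1, Q N); (-1, fmul lap N); (- c1, fmul s2 N); (2, H N); (-2, eps (iot N))].
have hB : is_form (k - 1) B.
  have l1 := lin_form 1 (-1) hQN hlN; have l2 := lin_form (- c1) 2 hsN hHN.
  have l3 := lin_form 1 1 l1 l2; have l4 := lin_form 1 (-2) l3 heiN.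
  by move: l4; congr is_form; apply: dfP => s' p'; rewrite /B lcE !big_cons big_nil /=; ring.
have BE : JP d gh (fmul (wt a) N) = fmul (wt (a - 2)) B.
  apply: dfP => s' p'; rewrite (QW a _ _ hN) /fmul /B lcE !big_cons big_nil /= /fmul -/c1; ring.
have WE : hatW = lc [:: (1, W); (1, eps N)].
  by apply: dfP => s' p'; rewrite lcE !big_cons big_nil /= addr0.
have FE : hatF = lc [:: (1, F); (1, eps (iot N)); (- 2^-1, fmul s2 N); (-1, iot W); (-1, eps E)].
  by apply: dfP => s' p'; rewrite lcE !big_cons big_nil /= /hatF /hatF2 /hatF1 /hatF0; ring.
have eiE : iot (eps N) = lc [:: (1, fmul s2 N); (-1, eps (iot N))].
  by apply: dfP => s' p'; rewrite lcE !big_cons big_nil /= iot_eps /fmul; ring.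
have esN A s' : eps (fmul s2 A) s' p = s2 p * eps A s' p.
  by rewrite (@eps_lin (s2 p) 0 A A); [ring|move=> s''; rewrite /fmul; ring].
have elN A s' : eps (fmul lap A) s' p = lap p * eps A s' p.
  by rewrite (@eps_lin (lap p) 0 A A); [ring|move=> s''; rewrite /fmul; ring].
have sm2 (A1 A2 : dform S) x y k1 k2 : is_form k1 A1 -> is_form k2 A2 -> smf [:: (x, A1); (y, A2)].
  by move=> h1 h2; do 2 (split=> [s'|]; first by apply: form_sm; eassumption).
have ee0 A k1 s' : is_form k1 A -> eps (eps A) s' p = 0 by exact: eps_eps.
have eieN : eps (iot (eps N)) s p = s2 p * eps N s p.
  rewrite eiE eps_lc; last exact: (sm2 _ _ _ _ _ _ hsN heiN).
  by rewrite !big_cons big_nil /= esN (ee0 _ _ _ hiN); ring.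
have dleN : dl (eps N) = lc [:: (1, dd (iot N)); (1, iot (dd N)); (-2, H N); (1, fmul lap N); (-1, eps (dl N))].
  by apply: dfP => s' p'; rewrite lcE !big_cons big_nil /= (dl_eps _ _ hN) /fmul; ring.
have smdl : smf [:: (1, dd (iot N)); (1, iot (dd N)); (-2, H N); (1, fmul lap N); (-1, eps (dl N))].
  by do 5 (split=> [s'|]; first by apply: form_sm; eassumption).
have ddeN : dd (eps N) = lc [:: (-1, eps (dd N))].
  by apply: dfP => s' p'; rewrite lcE !big_cons big_nil /= (dd_eps _ _ hN); ring.
have smde : smf [:: (-1, eps (dd N))] by split=> [s'|//]; exact: form_sm hedN.
have z0 s' : (0 : dform S) s' p = 0 by [].
have w1 : dd (dl (eps N)) s p = dd (iot (dd N)) s p - 2 * dd (H N) s p + dd (fmul lap N) s p + eps (dd (dl N)) s p.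
  rewrite dleN dd_lc // !big_cons big_nil /= (fd_fd rg mg hiN) z0 (dd_eps _ _ hdlN); ring.
have w2 : dl (dd (eps N)) s p = - (dd (iot (dd N)) s p - 2 * H (dd N) s p + lap p * dd N s p - eps (dl (dd N)) s p).
  rewrite ddeN dl_lc // !big_cons big_nil /= (dl_eps _ _ hdN) (fd_fd rg mg hN).
  by rewrite [iot 0 s p](_ : _ = 0) //; ring.
have w3 : eps (dl (eps N)) s p = eps (dd (iot N)) s p + eps (iot (dd N)) s p - 2 * eps (H N) s p + lap p * eps N s p.
  rewrite dleN eps_lc // !big_cons big_nil /= elN (ee0 _ _ _ hdlN); ring.
have w4 : dd (iot (eps N)) s p = dd (fmul s2 N) s p + eps (dd (iot N)) s p.
  rewrite eiE dd_lc; last exact: (sm2 _ _ _ _ _ _ hsN heiN).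
  rewrite !big_cons big_nil /= (dd_eps _ _ hiN); ring.
have w5 : iot (dd (eps N)) s p = - (s2 p * dd N s p - eps (iot (dd N)) s p).
  rewrite ddeN iot_lc // !big_cons big_nil /= iot_eps; ring.
have smW := sm2 _ _ 1 1 _ _ hW heN.
have L2 (T : dform S -> dform S) x y A1 A2 s' p' :
   T (lc [:: (x, A1); (y, A2)]) s' p' = \sum_(z <- [:: (x, A1); (y, A2)]) z.1 * T z.2 s' p' ->
   T (lc [:: (x, A1); (y, A2)]) s' p' = lc [:: (x, T A1); (y, T A2)] s' p'.
  by move=> ->; rewrite lcE !big_cons !big_nil.
have dlW' : dl hatW = lc [:: (1, dl W); (1, dl (eps N))].
  by apply: dfP => s' p'; rewrite WE; apply: (L2 dl); exact: dl_lc.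
have ddW' : dd hatW = lc [:: (1, dd W); (1, dd (eps N))].
  by apply: dfP => s' p'; rewrite WE; apply: (L2 dd); exact: dd_lc.
have iotW' : iot hatW = lc [:: (1, iot W); (1, iot (eps N))].
  by apply: dfP => s' p'; rewrite WE; apply: (L2 (fun A => iot A)); exact: iot_lc.
have hdle := fdelta_form rg mg heN; have hdde := fd_form rg mg heN; have hieN := iot_form heN.
have smdlW := sm2 _ _ 1 1 _ _ hdlW hdle; have smddW := sm2 _ _ 1 1 _ _ hdW hdde.
have smiW := sm2 _ _ 1 1 _ _ hiW hieN; have smM' := sm2 _ _ 1 a%:~R _ _ hdN heN.
have smF : smf [:: (1, F); (1, eps (iot N)); (- 2^-1, fmul s2 N); (-1, iot W); (-1, eps E)].
  by do 5 (split=> [s'|]; first by apply: form_sm; eassumption).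
have smB : smf [:: (1, Q N); (-1, fmul lap N); (- c1, fmul s2 N); (2, H N); (-2, eps (iot N))].
  by do 5 (split=> [s'|]; first by apply: form_sm; eassumption).
have QM : Q M s p = Q (dd N) s p + a%:~R * Q (eps N) s p.
  by rewrite (Q_lc (k := k)) // !big_cons big_nil /=; ring.
have QW' : Q hatW s p = Q W s p + Q (eps N) s p.
  rewrite WE (Q_lc (k := k)) // -?WE ?big_cons ?big_nil /=; [ring|exact: hatW_form].
have HM : H M s p = H (dd N) s p + a%:~R * H (eps N) s p.
  by rewrite H_lc // !big_cons big_nil /=; ring.
have HW : H hatW s p = H W s p + H (eps N) s p.
  by rewrite WE H_lc // !big_cons big_nil /=; ring.
have iM : iot M = lc [:: (1, iot (dd N)); (a%:~R, iot (eps N))].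
  by apply: dfP => s' p'; apply: (L2 (fun A => iot A)); exact: iot_lc.
have eiM : eps (iot M) s p = eps (iot (dd N)) s p + a%:~R * (s2 p * eps N s p).
  rewrite iM eps_lc ?big_cons ?big_nil /= ?eieN; [ring|exact: (sm2 _ _ _ _ _ _ hidN hieN)].
have MEv : M s p = dd N s p + a%:~R * eps N s p by rewrite /M lcE !big_cons big_nil /=; ring.
have WEv : hatW s p = W s p + eps N s p by rewrite WE lcE !big_cons big_nil /=; ring.
rewrite ME (QW a _ _ hM) BE (fdW (a - 2) hB) (DeltaW a _ _ hatW_form) (QW a _ _ hatW_form) (fdW (a - 2) hatF_form).
rewrite QM HM eiM MEv QW' HW WEv /fmul.
rewrite fDeltaE dlW' ddW' iotW' !dd_lc // !dl_lc // !eps_lc // iot_lc // FE dd_lc // eps_lc //.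
rewrite !(big_cons, big_nil) /= w1 w2 w3 w4 w5 eieN ?esN ?elN ?esN ?(ee0 _ _ _ hiN) ?(ee0 _ _ _ hE).
rewrite ?(dd_eps _ _ hiN) ?(dd_eps _ _ hE) ?iot_eps.
rewrite !fDeltaE.

have -> : eps (fDelta d g N) s p = eps (dd (dl N)) s p + eps (dl (dd N)) s p.
  by rewrite (@eps_lin 1 1 (dd (dl N)) (dl (dd N))) ?mul1r // => s'; rewrite fDeltaE !mul1r.
rewrite /c1 (H_eps s p hN).
generalize (Om p ^ (w + k - 2)) => o.
by field.
Qed.
End Slots.
End Words.

(** * The transformation law of tractor sections *)

Section Law.
Context {R : realType} {S : smooth_space R}.
Implicit Types (g : metric S) (k w : int) (F G : slots S) (p : S).

Lemma slotsP F G : north F = north G -> west F = west G -> east F = east G ->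
  south F = south G -> F = G.
Proof. by case: F => -[[? ?] ?] ?; case: G => -[[? ?] ?] ?; rewrite /north /west /east /south /= => -> -> -> ->. Qed.

Definition sform k F := [/\ is_form (k - 1) (north F), is_form k (west F),
  is_form (k - 2) (east F) & is_form (k - 1) (south F)].

(** The law of [tractor_section] written with projections instead of a match, so that it can be
    rewritten slot by slot. *)
Definition law (Om : S -> R) g k w F : slots S :=
  let u := fun p => ln (Om p) in
  let eps := exter (fun X => der X u) in
  let iot := inter (grad g u) in
  (fmul (fun p => Om p ^ (w + k)) (north F),
   fmul (fun p => Om p ^ (w + k)) (west F + eps (north F)),
   fmul (fun p => Om p ^ (w + k - 2)) (east F - iot (north F)),
   fmul (fun p => Om p ^ (w + k - 2))
     (south F + fmul (fun=> 2^-1) (eps (iot (north F)) - iot (eps (north F)))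
          - iot (west F) - eps (east F))).

Lemma tsP c k w (F : tractor S) : tractor_section c k w F <->
  (forall g, c g -> sform k (F g)) /\
  forall g Om, c g -> positive_smooth Om -> F (rescale Om g) = law Om g k w (F g).
Proof.
split=> -[h1 h2]; split=> [g cg|g Om cg pOm].
- exact: h1.
- by have := h2 g Om cg pOm; rewrite /law; case: (F g) => -[[? ?] ?] ?.
- exact: h1.
- by have := h2 g Om cg pOm; rewrite /law; case: (F g) => -[[? ?] ?] ?.
Qed.

Definition svan F p := forall s, [/\ north F s p = 0, west F s p = 0, east F s p = 0 & south F s p = 0].

Lemma lawE Om g k w F s p :
  let u := fun p => ln (Om p) in let Ups := grad g u in
  let eps := exter (fun X => der X u) in
  [/\ north (law Om g k w F) s p = Om p ^ (w + k) * north F s p,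
      west (law Om g k w F) s p = Om p ^ (w + k) * (west F s p + eps (north F) s p),
      east (law Om g k w F) s p = Om p ^ (w + k - 2) * (east F s p - north F (Ups :: s) p) &
      south (law Om g k w F) s p = Om p ^ (w + k - 2) * (south F s p + eps (inter Ups (north F)) s p
        - 2^-1 * der Ups u p * north F s p - west F (Ups :: s) p - eps (east F) s p)].
Proof.
move=> u Ups eps; split=> //.
rewrite -[LHS]/(Om p ^ (w + k - 2) * (south F s p + 2^-1 * (eps (inter Ups (north F)) s p - inter Ups (eps (north F)) s p) - west F (Ups :: s) p - eps (east F) s p)).
have -> : inter Ups (eps (north F)) s p = der Ups u p * north F s p - eps (inter Ups (north F)) s p by exact: exter_cons.
by field.
Qed.

Lemma exter0 th (A : dform S) s p : (forall s, A s p = 0) -> exter th A s p = 0.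
Proof. by move=> hA; rewrite /exter big1 // => i _; rewrite hA mulr0. Qed.

Lemma svan_law Om g k w F p : svan F p -> svan (law Om g k w F) p.
Proof.
move=> h s; have [-> -> -> ->] := lawE Om g k w F s p.
have hN s' : north F s' p = 0 by case: (h s').
have hW s' : west F s' p = 0 by case: (h s').
have hE s' : east F s' p = 0 by case: (h s').
have hS s' : south F s' p = 0 by case: (h s').
rewrite !hN !hW !hE !hS !exter0 // => [|s']; last by rewrite /inter hN.
by split; ring.
Qed.

Definition sadd (a : R) F G : slots S :=
  (fun s p => a * north F s p + north G s p, fun s p => a * west F s p + west G s p,
   fun s p => a * east F s p + east G s p, fun s p => a * south F s p + south G s p).
Lemma saddE a F G s p :
  [/\ north (sadd a F G) s p = a * north F s p + north G s p, west (sadd a F G) s p = a * west F s p + west G s p,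
   east (sadd a F G) s p = a * east F s p + east G s p & south (sadd a F G) s p = a * south F s p + south G s p].
Proof. by []. Qed.
Lemma tmulE (f : S -> R) F s p :
  [/\ north (tmul f F) s p = f p * north F s p, west (tmul f F) s p = f p * west F s p,
   east (tmul f F) s p = f p * east F s p & south (tmul f F) s p = f p * south F s p].
Proof. by []. Qed.
Lemma slots_eqP F G : (forall s p, [/\ north F s p = north G s p, west F s p = west G s p,
  east F s p = east G s p & south F s p = south G s p]) -> F = G.
Proof. by move=> h; apply: slotsP; apply: dfP => s p; case: (h s p). Qed.
End Law.

Section Inv.
Context {R : realType} {S : smooth_space R} {d : nat}.
Hypothesis rg : regular S d.
Hypothesis d3 : (3 <= d)%N.
(** The chain rule for the logarithm of a conformal factor. It is carried as a hypothesis until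
    charts prove it in [atlas_log_closed]. *)
Definition log_closed := forall Om : S -> R, positive_smooth Om ->
  smooth (fun p => ln (Om p)) /\ forall X p, der X Om p = Om p * der X (fun p => ln (Om p)) p.
Hypothesis lgc : log_closed.
Variable c : set (metric S).
Hypothesis cc : conformal_class c.
Variable sigma : metric S -> S -> R.
Hypothesis ds : density_section c 1 sigma.
Implicit Types (g : metric S) (k w : int) (F G : tractor S) (p : S) (X : vfield S) (A B : dform S).

Lemma posM (f h : S -> R) : positive_smooth f -> positive_smooth h -> positive_smooth (fun p => f p * h p).
Proof. by move=> [sf pf] [sh ph]; split; [exact: (smM rg)|move=> p; rewrite mulr_gt0]. Qed.
Lemma posV (f : S -> R) : positive_smooth f -> positive_smooth (fun p => (f p)^-1).
Proof.
move=> [sf pf]; split=> [|p]; last by rewrite invr_gt0.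
by apply: (smV rg) => // p; rewrite gt_eqF.
Qed.
Lemma rescaleM (f h : S -> R) g : rescale f (rescale h g) = rescale (fun p => f p * h p) g.
Proof. by apply/funext => X; apply/funext => Y; apply/funext => p; rewrite /rescale; ring. Qed.
Lemma c_metric g : c g -> is_metric g.
Proof.
case: cc => g0 m0 -> [Om pOm ->]; exact: (mgh rg m0 pOm).
Qed.
Lemma c_rescale g Om : c g -> positive_smooth Om -> c (rescale Om g).
Proof.
case: cc => g0 m0 -> [f pf ->] pOm; exists (fun p => Om p * f p); first exact: posM.
exact: rescaleM.
Qed.
Lemma c_rel g g' : c g -> c g' -> exists2 Om, positive_smooth Om & g' = rescale Om g.
Proof.
case: cc => g0 m0 -> [f pf ->] [f' pf' ->].
exists (fun p => f' p * (f p)^-1); first by apply: posM => //; exact: posV.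
rewrite rescaleM; apply/funext => X; apply/funext => Y; apply/funext => p.
by rewrite /rescale divfK // gt_eqF //; case: pf => _.
Qed.

(** Each slot transforms by the slots above it, so vanishing at a point does not depend on the
    scale. This is what allows an invariant identity to be checked in a convenient scale. *)
Lemma svan_all k w F p g g' : tractor_section c k w F -> c g -> c g' -> svan (F g) p -> svan (F g') p.
Proof.
move=> /tsP [_ hF] cg cg' h; have [Om pOm ->] := c_rel cg cg'.
by rewrite hF //; exact: svan_law.
Qed.

Lemma sigma_sm g : c g -> smooth (sigma g). Proof. by case: ds => h _ /h. Qed.
Lemma sigma_rescale g Om p : c g -> positive_smooth Om -> sigma (rescale Om g) p = Om p * sigma g p.
Proof. by case: ds => _ h cg /(h g Om cg) ->; rewrite expr1z. Qed.

Definition tadd (a : R) F G : tractor S := fun g => sadd a (F g) (G g).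

Lemma lin1_form (a : R) k A B : is_form k A -> is_form k B -> is_form k (fun s p => a * A s p + B s p).
Proof.
move=> hA hB; have -> : (fun s p => a * A s p + B s p) = fmul (fun=> a) A + B by [].
by apply: (formD rg) => //; apply: (formM rg) => //; exact: smooth_cst.
Qed.

Lemma ts_add a k w F G : tractor_section c k w F -> tractor_section c k w G ->
  tractor_section c k w (tadd a F G).
Proof.
move=> /tsP [f1 f2] /tsP [g1 g2]; apply/tsP; split=> [g cg|g Om cg pOm].
  by have [? ? ? ?] := f1 g cg; have [? ? ? ?] := g1 g cg; split; apply: lin1_form.
rewrite /tadd f2 // g2 //; set th := fun X => der X (fun p => ln (Om p)).
have L A B C s p : (forall s, C s p = a * A s p + B s p) -> exter th C s p = a * exter th A s p + exter th B s p.
  by move=> h; rewrite (@exter_lin _ _ th a 1 A B) ?mul1r // => s'; rewrite h mul1r.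
apply: slots_eqP => s p; have [-> -> -> ->] := lawE Om g k w (sadd a (F g) (G g)) s p.
have [-> -> -> ->] := saddE a (law Om g k w (F g)) (law Om g k w (G g)) s p.
have [-> -> -> ->] := lawE Om g k w (F g) s p; have [-> -> -> ->] := lawE Om g k w (G g) s p.
have [-> -> -> ->] := saddE a (F g) (G g) s p.
set Ups := grad g _; have [-> -> _ _] := saddE a (F g) (G g) (Ups :: s) p.
rewrite (L (north (F g)) (north (G g)) (north (sadd a (F g) (G g)))) //.
rewrite (L (east (F g)) (east (G g)) (east (sadd a (F g) (G g)))) //.
rewrite (L (inter Ups (north (F g))) (inter Ups (north (G g))) (inter Ups (north (sadd a (F g) (G g))))) //.
by split; ring.
Qed.

Lemma ts_x k w F : tractor_section c k w F -> tractor_section c k (w + 1) (xop sigma F).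
Proof.
move=> /tsP [f1 f2]; apply/tsP; split=> [g cg|g Om cg pOm].
  by have [? ? ? ?] := f1 g cg; split; apply: (formM rg) => //; exact: sigma_sm.
rewrite /xop f2 //; set th := fun X => der X (fun p => ln (Om p)).
have O0 p : Om p != 0 by rewrite gt_eqF //; case: pOm.
have e1 p : Om p ^ (w + 1 + k) = Om p * Om p ^ (w + k) by rewrite addrAC expfzDr // expr1z mulrC.
have e2 p : Om p ^ (w + 1 + k - 2) = Om p * Om p ^ (w + k - 2).
  by rewrite (_ : w + 1 + k - 2 = w + k - 2 + 1) ?expfzDr // ?expr1z 1?mulrC //; ring.
have L A B s p : (forall s, B s p = sigma g p * A s p) -> exter th B s p = sigma g p * exter th A s p.
  by move=> h; rewrite (@exter_lin _ _ th (sigma g p) 0 A A) ?mul0r ?addr0 // => s'; rewrite h mul0r addr0.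
apply: slots_eqP => s p; have [-> -> -> ->] := lawE Om g k (w + 1) (tmul (sigma g) (F g)) s p.
have [-> -> -> ->] := tmulE (sigma (rescale Om g)) (law Om g k w (F g)) s p.
have [-> -> -> ->] := lawE Om g k w (F g) s p.
have [-> -> -> ->] := tmulE (sigma g) (F g) s p.
set Ups := grad g _; have [-> -> _ _] := tmulE (sigma g) (F g) (Ups :: s) p.
rewrite (L (north (F g)) (north (tmul (sigma g) (F g)))) // (L (east (F g)) (east (tmul (sigma g) (F g)))) //.
rewrite (L (inter Ups (north (F g))) (inter Ups (north (tmul (sigma g) (F g))))) //.
rewrite sigma_rescale // e1 e2.
by split; ring.
Qed.

Lemma cD w : ((d%:Z + 2 * w - 2)%:~R : R) = d%:R + 2 * w%:~R - 2.
Proof. by rewrite !intrD !intrM. Qed.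
Lemma cD2 w : ((d%:Z + 2 * w)%:~R : R) = d%:R + 2 * w%:~R.
Proof. by rewrite !intrD !intrM. Qed.

Lemma DopE k w F g :
  [/\ forall s p, north (Dop d k w F g) s p = (d%:R + 2 * w%:~R - 2) * ((w + k)%:~R * west (F g) s p - fd g (north (F g)) s p),
   forall s p, west (Dop d k w F g) s p = (d%:R + 2 * w%:~R - 2) * fd g (west (F g)) s p,
   forall s p, east (Dop d k w F g) s p = fDelta d g (north (F g)) s p + (w + k - 2)%:~R * JP d g (north (F g)) s p
      - 2 * fdelta d g (west (F g)) s p + (d%:R + 2 * w%:~R) * (fd g (east (F g)) s p + (w + k - 2)%:~R * south (F g) s p) &
   forall s p, south (Dop d k w F g) s p = (JP d g (fd g (north (F g))) s p - fd g (JP d g (north (F g))) s p)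
      - (fDelta d g (west (F g)) s p + (w + k)%:~R * JP d g (west (F g)) s p) - (d%:R + 2 * w%:~R) * fd g (south (F g)) s p].
Proof.
rewrite /Dop; case: (F g) => -[[Fp F0] Fpm] Fm; split=> s p.
- rewrite -[LHS]/(((F0 *~ (w + k) - fd g Fp) *~ (d%:Z + 2 * w - 2)) s p) dfMzE -mulrzl cD.
  by rewrite -[X in _ * X = _]/((F0 *~ (w + k)) s p - fd g Fp s p) dfMzE mulrzl.
- by rewrite -[LHS]/((fd g F0 *~ (d%:Z + 2 * w - 2)) s p) dfMzE -mulrzl cD.
- have h1 := dfMzE (JP d g Fp) (w + k - 2) s p; have h2 := dfMnE (fdelta d g F0) 2 s p.
  have h3 := dfMzE (fd g Fpm + Fm *~ (w + k - 2)) (d%:Z + 2 * w) s p; have h4 := dfMzE Fm (w + k - 2) s p.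
  rewrite -[LHS]/(fDelta d g Fp s p + (JP d g Fp *~ (w + k - 2)) s p - (fdelta d g F0 *+ 2) s p
    + ((fd g Fpm + Fm *~ (w + k - 2)) *~ (d%:Z + 2 * w)) s p) h1 h2 h3.
  rewrite -[(fd g Fpm + Fm *~ (w + k - 2)) s p]/(fd g Fpm s p + (Fm *~ (w + k - 2)) s p) h4.
  rewrite -(mulr_natl (fdelta d g F0 s p)) -(mulrzl (JP d g Fp s p)) -(mulrzl (_ + _) (d%:Z + 2 * w)).
  by rewrite cD2 -(mulrzl (Fm s p)).
- have h1 := dfMzE (JP d g F0) (w + k) s p; have h2 := dfMzE (fd g Fm) (d%:Z + 2 * w) s p.
  rewrite -[LHS]/((JP d g (fd g Fp) s p - fd g (JP d g Fp) s p) - (fDelta d g F0 s p + (JP d g F0 *~ (w + k)) s p)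
     - (fd g Fm *~ (d%:Z + 2 * w)) s p) h1 h2.
  by rewrite -(mulrzl (fd g Fm s p)) cD2 -(mulrzl (JP d g F0 s p)).
Qed.

Lemma Dop_form k w F g : c g -> sform k (F g) -> sform (k + 1) (Dop d k w F g).
Proof.
move=> cg [hN hW hE hS]; have mg := c_metric cg.
have fdf k' A : is_form k' A -> is_form (k' + 1) (fd g A) by exact: (fd_form rg mg).
have fde k' A : is_form k' A -> is_form (k' - 1) (fdelta d g A) by exact: (fdelta_form rg mg).
have fN : is_form k (fd g (north (F g))) by have := fdf _ _ hN; rewrite subrK.
have fE : is_form (k - 1) (fd g (east (F g))) by have := fdf _ _ hE; rewrite -addrA.
have fS : is_form k (fd g (south (F g))) by have := fdf _ _ hS; rewrite subrK.
have lap k' A : is_form k' A -> is_form k' (fDelta d g A).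
  move=> hA; apply: (formD rg); first by have := fdf _ _ (fde _ _ hA); rewrite subrK.
  by have := fde _ _ (fdf _ _ hA); rewrite addrK.
have jp k' A : is_form k' A -> is_form k' (JP d g A) by exact: (JP_form rg mg).
have fJ : is_form k (fd g (JP d g (north (F g)))) by have := fdf _ _ (jp _ _ hN); rewrite subrK.
have e1 : k + 1 - 2 = k - 1 by ring.
rewrite /sform addrK e1; move: hN hW hE hS fN fE fS fJ; rewrite /Dop.
case: (F g) => -[[Fp F0] Fpm] Fm; rewrite /north /west /east /south /= => hN hW hE hS fN fE fS fJ.
split; do ?[exact: fdf | exact: fde | exact: lap | exact: jp | assumption
  | apply: (formMz rg) | apply: (formMn rg) | apply: (formB rg) | apply: (formD rg)].
Qed.

Lemma ts_D k w F : tractor_section c k w F -> tractor_section c (k + 1) (w - 1) (Dop d k w F).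
Proof.
move=> /tsP [f1 f2]; apply/tsP; split=> [g cg|g Om cg pOm]; first exact: Dop_form (f1 g cg).
have [su dOm] := lgc pOm; have mg := c_metric cg; have [hN hW hE hS] := f1 g cg.
have FE := f2 g Om cg pOm.
have [n1 w1 e1 s1] := DopE k w F (rescale Om g).
have [n2 w2 e2 s2] := DopE k w F g.
(* D raises the degree by one and lowers the weight by one, so source and target carry the same
   powers of Omega. *)
have ew : w - 1 + (k + 1) = w + k by ring.
have hn : north (F (rescale Om g)) = fmul (fun p => Om p ^ (w + k)) (north (F g)) by rewrite FE.
have hw : west (F (rescale Om g)) = fmul (fun p => Om p ^ (w + k)) (hatW Om (north (F g)) (west (F g))).
  by rewrite FE; apply: dfP => s p; have [_ -> _ _] := lawE Om g k w (F g) s p; rewrite /fmul /hatW; ring.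
have he : east (F (rescale Om g)) = fmul (fun p => Om p ^ (w + k - 2)) (hatE g Om (north (F g)) (east (F g))).
  by rewrite FE; apply: dfP => s p; have [_ _ -> _] := lawE Om g k w (F g) s p; rewrite /fmul /hatE /inter; ring.
have hs : south (F (rescale Om g)) = fmul (fun p => Om p ^ (w + k - 2)) (hatF g Om (north (F g)) (west (F g)) (east (F g)) (south (F g))).
  rewrite FE; apply: dfP => s p; have [_ _ _ ->] := lawE Om g k w (F g) s p.
  set ep := exter _; set U := grad _ _.
  rewrite -[RHS]/(Om p ^ (w + k - 2) * (1 * (1 * south (F g) s p + 1 * (1 * ep (inter U (north (F g))) s p + (- 2^-1) * (der U (fun p => ln (Om p)) p * north (F g) s p)))
     + (-1) * (1 * west (F g) (U :: s) p + 1 * ep (east (F g)) s p))).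
  by congr (_ * _); ring.
set th := fun X => der X (fun p => ln (Om p)).
have L2 (a b : R) A B C s p : (forall s, C s p = a * A s p + b * B s p) ->
   exter th C s p = a * exter th A s p + b * exter th B s p by exact: exter_lin.
apply: slots_eqP => s p; have [-> -> -> ->] := lawE Om g (k + 1) (w - 1) (Dop d k w F g) s p.
set Ups := grad g _; rewrite -/th ew n1 w1 e1 s1 hn hw he hs.
have eN : exter th (north (Dop d k w F g)) s p = (d%:R + 2 * w%:~R - 2) * ((w + k)%:~R * exter th (west (F g)) s p - exter th (fd g (north (F g))) s p).
  by rewrite (L2 ((d%:R + 2 * w%:~R - 2) * (w + k)%:~R) (- (d%:R + 2 * w%:~R - 2)) (west (F g)) (fd g (north (F g)))) => [|s']; [ring|rewrite n2; ring].
have eiN : exter th (inter Ups (north (Dop d k w F g))) s p =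
   (d%:R + 2 * w%:~R - 2) * ((w + k)%:~R * exter th (inter Ups (west (F g))) s p - exter th (inter Ups (fd g (north (F g)))) s p).
  rewrite (L2 ((d%:R + 2 * w%:~R - 2) * (w + k)%:~R) (- (d%:R + 2 * w%:~R - 2)) (inter Ups (west (F g))) (inter Ups (fd g (north (F g))))) => [|s']; first by ring.
  by rewrite {1}/inter n2 /inter; ring.
have eE : exter th (east (Dop d k w F g)) s p = exter th (fDelta d g (north (F g))) s p + (w + k - 2)%:~R * exter th (JP d g (north (F g))) s p
      - 2 * exter th (fdelta d g (west (F g))) s p + (d%:R + 2 * w%:~R) * (exter th (fd g (east (F g))) s p + (w + k - 2)%:~R * exter th (south (F g)) s p).
  pose A1 s p := 1 * fDelta d g (north (F g)) s p + (w + k - 2)%:~R * JP d g (north (F g)) s p.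
  pose A3 s p := 1 * fd g (east (F g)) s p + (w + k - 2)%:~R * south (F g) s p.
  pose A2 s p := (-2) * fdelta d g (west (F g)) s p + (d%:R + 2 * w%:~R) * A3 s p.
  rewrite (L2 1 1 A1 A2) => [|s']; last by rewrite e2 /A1 /A2 /A3; ring.
  rewrite (L2 1 (w + k - 2)%:~R (fDelta d g (north (F g))) (JP d g (north (F g))) A1) //.
  rewrite (L2 (-2) (d%:R + 2 * w%:~R) (fdelta d g (west (F g))) A3 A2) //.
  by rewrite (L2 1 (w + k - 2)%:~R (fd g (east (F g))) (south (F g)) A3) //; ring.
split.
- have := north_W rg mg pOm dOm w (west (F g)) hN s p.
  rewrite -[X in X = _ -> _]/((fmul (fun p0 => Om p0 ^ (w + k)) (hatW Om (north (F g)) (west (F g))) *~ (w + k)) s p - _ s p).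
  rewrite dfMzE -mulrzl => ->; rewrite n2; ring.
- rewrite (west_W rg mg pOm su dOm w hN hW) w2 eN; ring.
- rewrite (east_W rg mg pOm su dOm d3 w (south (F g)) hN hW hE) e2 n2 /inter; ring.
- rewrite (south_W rg mg pOm su dOm d3 w hN hW hE hS) s2 w2 n2 eiN eE !iot_eps.
  by generalize (Om p ^ (w + k - 2)) => o; rewrite /inter; field.
Qed.
End Inv.

(** * Conformal change of the Laplacian; invariance of I* *)

Section Lap.
Context {R : realType} {S : smooth_space R} {d : nat}.
Hypothesis rg : regular S d.
Implicit Types (X Y Z W V : vfield S) (v f : S -> R) (p q : S).
Variable g : metric S.
Hypothesis mg : is_metric g.
Notation D := (levi_civita g).

Definition hessian v X Y p := der X (der Y v) p - der (D X Y) v p.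

Lemma hess_blin v : blin (hessian v).
Proof.
have hb : blin (fun X Y p => g (D X (grad g v)) Y p).
  split=> [Y|X]; last exact: g_clinr.
  exact: (vlin_clin rg (lc_vlin rg mg _) (g_clinl mg Y)).
rewrite (_ : hessian v = fun X Y p => g (D X (grad g v)) Y p) //.
by apply/funext => X; apply/funext => Y; apply/funext => p; rewrite (hessE rg mg).
Qed.

Lemma laplacian_hess v e p : onb g e p -> laplacian d g v p = \sum_(a < d) hessian v (e a) (e a) p.
Proof. by move=> oe; rewrite -(trace_onb rg mg (hess_blin v) oe). Qed.

Lemma laplacian_sm v : smooth (laplacian d g v).
Proof.
apply: (trace_sm rg mg (hess_blin v)) => X Y.
by apply: (smB rg); exact: der_sm.
Qed.

Lemma sum_grad u v e p : onb g e p -> \sum_(a < d) der (e a) u p * der (e a) v p = der (grad g u) v p.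
Proof.
move=> oe; rewrite (onb_lin rg mg (grad g u) (clin_der v) oe).
by apply: eq_bigr => a _; rewrite (g_grad rg mg).
Qed.

Lemma sum_onb e p : onb g e p -> \sum_(a < d) g (e a) (e a) p = d%:R.
Proof.
by move=> oe; rewrite (eq_bigr (fun=> 1)) ?sumr_const ?card_ord // => a _; rewrite oe eqxx.
Qed.

End Lap.

Section LapRescale.
Context {R : realType} {S : smooth_space R} {d : nat}.
Hypothesis rg : regular S d.
Implicit Types (X Y Z W V : vfield S) (v f : S -> R) (p q : S).
Variable g : metric S.
Hypothesis mg : is_metric g.
Variable Om : S -> R.
Hypothesis pOm : positive_smooth Om.
Let u := fun p => ln (Om p).
Hypothesis su : smooth u.
Hypothesis dOm : forall X p, der X Om p = Om p * der X u p.
Notation Ups := (grad g u).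

Lemma hessian_rescale v X Y p :
  hessian (rescale Om g) v X Y p
  = hessian g v X Y p - (der X u p * der Y v p + der Y u p * der X v p - g X Y p * der Ups v p).
Proof.
by rewrite /hessian (lc_rescale rg mg pOm dOm) (der_Cvf rg mg); ring.
Qed.

Lemma laplacian_rescale v p :
  laplacian d (rescale Om g) v p = Om p ^- 2 * (laplacian d g v p + (d%:R - 2) * der Ups v p).
Proof.
have mh := mgh rg mg pOm; have oe := frame_onb rg mg p.
rewrite -[LHS]/(trace d (rescale Om g) (hessian (rescale Om g) v) p).
have hb := hess_blin rg mh v.
rewrite (trace_rescale rg mg pOm _ hb) (trace_onb rg mg hb oe).
congr (_ * _); under eq_bigr do rewrite hessian_rescale.
rewrite big_split /= -(laplacian_hess rg mg _ oe) sumrN; congr (_ + _).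
under eq_bigr do rewrite [X in X + _ - _]mulrC.
rewrite big_split /= big_split /= sumrN -mulr_suml (sum_onb oe).
have e1 := sum_grad rg mg u v oe.
have e2 : \sum_(a < d) der (frame_at g p a) v p * der (frame_at g p a) u p = der Ups v p.
  by rewrite -e1; apply: eq_bigr => a _; rewrite mulrC.
by rewrite e1 e2; ring.
Qed.

Lemma hessian_Om v X Y p : smooth v -> hessian g (fun q => Om q * v q) X Y p =
  Om p * (hessian g v X Y p + v p * hessian g u X Y p + der X u p * der Y v p + der Y u p * der X v p
    + v p * der X u p * der Y u p).
Proof.
move=> sv; have sO : smooth Om by case: pOm.
have dO Z : der Z Om = fun q => Om q * der Z u q by apply/funext => q; exact: dOm.
have e1 : der Y (fun q => Om q * v q) = fun q => Om q * der Y v q + Om q * (der Y u q * v q).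
  by apply/funext => q; rewrite (derM rg) // dO; ring.
rewrite /hessian e1 (derM rg) // (derD rg); last first.
- by apply: (smM rg) => //; apply: (smM rg) => //; exact: der_sm.
- by apply: (smM rg) => //; exact: der_sm.
rewrite (derM rg) // ?(derM rg X p sO) ?(derM rg X p _ sv) ?dO; try exact: der_sm; first by ring.
by apply: (smM rg) => //; exact: der_sm.
Qed.

Lemma laplacian_Om v p : smooth v -> laplacian d g (fun q => Om q * v q) p =
  Om p * (laplacian d g v p + v p * laplacian d g u p + 2 * der Ups v p + v p * der Ups u p).
Proof.
move=> sv; have oe := frame_onb rg mg p.
rewrite !(laplacian_hess rg mg _ oe); under eq_bigr do rewrite hessian_Om //.
rewrite -mulr_sumr; congr (_ * _).
rewrite -(sum_grad rg mg u v oe) -(sum_grad rg mg u u oe) !mulr_sumr -!big_split /=.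
by apply: eq_bigr => a _; ring.
Qed.
End LapRescale.

Section TsI.
Context {R : realType} {S : smooth_space R} {d : nat}.
Hypothesis rg : regular S d.
Hypothesis d3 : (3 <= d)%N.
Hypothesis lgc : log_closed (S := S).
Variable c : set (metric S).
Hypothesis cc : conformal_class c.
Variable sigma : metric S -> S -> R.
Hypothesis ds : density_section c 1 sigma.
Implicit Types (g : metric S) (k w : int) (F G : tractor S) (p : S) (X : vfield S) (A B : dform S).

Section At.
Variables (g : metric S) (Om : S -> R).
Hypotheses (cg : c g) (pOm : positive_smooth Om).
Let u := fun p => ln (Om p).
Notation Ups := (grad g u).

Lemma sigma_hat : sigma (rescale Om g) = fun p => Om p * sigma g p.
Proof. by apply/funext => p; exact: (sigma_rescale ds p cg pOm). Qed.

Lemma der_sigma_hat X p : der X (sigma (rescale Om g)) p = Om p * (der X (sigma g) p + sigma g p * der X u p).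
Proof.
have [su dOm] := lgc pOm; rewrite sigma_hat (derM rg) ?dOm; first by rewrite -/u; ring.
- by case: pOm.
- exact: (sigma_sm ds cg).
Qed.

(** Together with [sigma_hat] and [rho_hat] this is the transformation law of the scale tractor
    (sigma, nu, rho), and it makes I* invariant. *)
Lemma nu_hat v p : der (nu sigma (rescale Om g)) v p = (Om p)^-1 * der (nu sigma g) v p + (Om p)^-1 * sigma g p * der Ups v p.
Proof.
have mg := c_metric rg cc cg; have O0 : Om p != 0 by rewrite gt_eqF //; case: pOm.
rewrite /nu (grad_rescale rg mg pOm).
have gs a b : der (grad g a) b p = der (grad g b) a p by rewrite -!(g_grad rg mg) (g_sym mg).
rewrite gs der_sigma_hat (gs (sigma g)) (gs u) -/u.
by field.
Qed.

Lemma inter_nu_hat k A s p : is_form k A ->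
  A (nu sigma (rescale Om g) :: s) p = (Om p)^-1 * (A (nu sigma g :: s) p + sigma g p * A (Ups :: s) p).
Proof.
move=> hA; rewrite (clin2 rg (form_clin0 s hA) (fun v => nu_hat v p)); by ring.
Qed.

Lemma rho_hat p : rho d sigma (rescale Om g) p =
  (Om p)^-1 * (rho d sigma g p - der Ups (sigma g) p - 2^-1 * sigma g p * der Ups u p).
Proof.
have mg := c_metric rg cc cg; have O0 : Om p != 0 by rewrite gt_eqF //; case: pOm.
have [su dOm] := lgc pOm.
rewrite /rho (laplacian_rescale rg mg pOm dOm) (J_rescale rg mg pOm dOm d3) sigma_hat.
rewrite (laplacian_Om rg mg pOm dOm p (sigma_sm ds cg)) -sigma_hat der_sigma_hat -/u.
have d0 : d%:R != 0 :> R by rewrite pnatr_eq0; lia.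
generalize (laplacian d g (sigma g) p) (laplacian d g u p) (der Ups (sigma g) p) (der Ups u p)
  (sigma g p) (Jcurv d g p) (Om p) O0 => a b e f i j o o0.
by field; rewrite o0 d0.
Qed.
End At.

Lemma IstarE F g s p :
  [/\ north (Istar d sigma F g) s p = - north (F g) (nu sigma g :: s) p - sigma g p * east (F g) s p,
   west (Istar d sigma F g) s p = rho d sigma g p * north (F g) s p + west (F g) (nu sigma g :: s) p + sigma g p * south (F g) s p,
   east (Istar d sigma F g) s p = east (F g) (nu sigma g :: s) p &
   south (Istar d sigma F g) s p = rho d sigma g p * east (F g) s p - south (F g) (nu sigma g :: s) p].
Proof. by rewrite /Istar; case: (F g) => -[[Fp F0] Fpm] Fm; split. Qed.

Lemma rho_sm g : c g -> smooth (rho d sigma g).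
Proof.
move=> cg; have mg := c_metric rg cc cg.
rewrite (_ : rho d sigma g = fun p => (- d%:R^-1) * (laplacian d g (sigma g) p + Jcurv d g p * sigma g p)).
  apply: (smM rg); first exact: smooth_cst.
  apply: (smD rg); first exact: (laplacian_sm rg mg).
  by apply: (smM rg); [exact: (J_sm rg mg)|exact: (sigma_sm ds cg)].
by apply/funext => p; rewrite /rho; ring.
Qed.

Lemma Istar_form k F g : c g -> sform k (F g) -> sform (k - 1) (Istar d sigma F g).
Proof.
move=> cg; rewrite /sform /Istar; have srho := rho_sm cg; have ssg := sigma_sm ds cg.
have fi k' A : is_form k' A -> is_form (k' - 1) (inter (nu sigma g) A) by exact: form_inter.
case: (F g) => -[[Fp F0] Fpm] Fm [/= hN hW hE hS].
have e1 : k - 1 - 1 = k - 2 by ring.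
have e2 : k - 1 - 2 = k - 2 - 1 by ring.
rewrite e1 e2; split.
- by apply: (formB rg); [apply: (formN rg); rewrite -e1; exact: fi|exact: (formM rg)].
- by do 2?apply: (formD rg); [exact: (formM rg)|exact: fi|exact: (formM rg)].
- exact: fi.
- by apply: (formB rg); [exact: (formM rg)|rewrite -e1; exact: fi].
Qed.

Lemma ts_I k w F : tractor_section c k w F -> tractor_section c (k - 1) w (Istar d sigma F).
Proof.
move=> /tsP [f1 f2]; apply/tsP; split=> [g cg|g Om cg pOm]; first exact: Istar_form (f1 g cg).
have [su dOm] := lgc pOm; have mg := c_metric rg cc cg; have [hN hW hE hS] := f1 g cg.
have := f1 _ (c_rescale rg cc cg pOm); rewrite f2 // => -[gN gW gE gS].
set th := fun X => der X (fun p => ln (Om p)).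
have L (a b : R) A B C s p : (forall s, C s p = a * A s p + b * B s p) ->
   exter th C s p = a * exter th A s p + b * exter th B s p by exact: exter_lin.
apply: slots_eqP => s p; have O0 : Om p != 0 by rewrite gt_eqF //; case: pOm.
have [-> -> -> ->] := lawE Om g (k - 1) w (Istar d sigma F g) s p.
set Ups := grad g _; rewrite -/th.
have [-> -> -> ->] := IstarE F g s p; have [N' W' _ _] := IstarE F g (Ups :: s) p; rewrite N' W'.
have [-> -> -> ->] := IstarE F (rescale Om g) s p; rewrite f2 //.
rewrite (inter_nu_hat cg pOm s p gN) (inter_nu_hat cg pOm s p gW) (inter_nu_hat cg pOm s p gE) (inter_nu_hat cg pOm s p gS).
rewrite (rho_hat cg pOm) (sigma_rescale ds p cg pOm) -/Ups.
have [a1 _ a3 a4] := lawE Om g k w (F g) s p.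
have [b1 b2 b3 b4] := lawE Om g k w (F g) (nu sigma g :: s) p.
have [c1 c2 c3 c4] := lawE Om g k w (F g) (Ups :: s) p.
rewrite a1 a3 a4 b1 b2 b3 b4 c1 c2 c3 c4.
rewrite -/Ups -/th !exter_cons.
have e1 : Om p ^ (w + k) = Om p ^ (w + (k - 1)) * Om p by rewrite -[X in _ * X]expr1z -expfzDr //; congr (_ ^ _); ring.
have e2 : Om p ^ (w + k - 2) = Om p ^ (w + (k - 1) - 2) * Om p by rewrite -[X in _ * X]expr1z -expfzDr //; congr (_ ^ _); ring.
have e3 : Om p ^ (w + (k - 1)) = Om p ^ (w + (k - 1) - 2) * Om p * Om p.
  by rewrite -mulrA -expr2 -[_ ^+ 2]/(_ ^ 2) -expfzDr // subrK.
rewrite e1 e2 e3.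
have gN2 : north (F g) (Ups :: Ups :: s) p = 0 by exact: (form_diag Ups s p hN).
have gA : north (F g) (Ups :: nu sigma g :: s) p = - north (F g) (nu sigma g :: Ups :: s) p.
  exact: (form_anti rg _ _ s p hN).
have thn : th (nu sigma g) p = der Ups (sigma g) p.
  by rewrite /th -(g_grad rg mg) (g_sym mg) (g_grad rg mg).
have iE Z (A : dform S) : inter Z A s p = A (Z :: s) p by [].
rewrite (L (-1) (- sigma g p) (inter (nu sigma g) (north (F g))) (east (F g)) (north (Istar d sigma F g))); last first.
  by move=> s'; have [-> _ _ _] := IstarE F g s' p; rewrite /inter; ring.
rewrite (L (-1) (- sigma g p) (inter Ups (inter (nu sigma g) (north (F g)))) (inter Ups (east (F g))) (inter Ups (north (Istar d sigma F g)))); last first.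
  by move=> s'; rewrite /inter; have [-> _ _ _] := IstarE F g (Ups :: s') p; ring.
rewrite (L 1 0 (inter (nu sigma g) (east (F g))) (east (F g)) (east (Istar d sigma F g))); last first.
  by move=> s'; have [_ _ -> _] := IstarE F g s' p; rewrite /inter; ring.
have eA : exter th (inter Ups (inter (nu sigma g) (north (F g)))) s p = - exter th (inter (nu sigma g) (inter Ups (north (F g)))) s p.
  rewrite (L (-1) 0 (inter (nu sigma g) (inter Ups (north (F g)))) (east (F g))); first by ring.
  by move=> s'; rewrite /inter (form_anti rg _ _ s' p hN); ring.
rewrite eA gN2 gA thn.
have thU : th Ups p = der Ups (fun q => ln (Om q)) p by [].
rewrite !iE thU; move: (Om p ^ (w + (k - 1) - 2)) => o2; move: (Om p) O0 => o o0.
have wA : west (F g) (Ups :: nu sigma g :: s) p = - west (F g) (nu sigma g :: Ups :: s) p by exact: (form_anti rg _ _ s p hW).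
have wD : west (F g) (Ups :: Ups :: s) p = 0 by exact: (form_diag Ups s p hW).
have eD : exter th (inter Ups (inter Ups (north (F g)))) s p = 0.
  by apply: exter0 => s'; rewrite /inter (form_diag Ups s' p hN).
rewrite wA wD eD; split; by field.
Qed.
End TsI.

Section TsY.
Context {R : realType} {S : smooth_space R} {d : nat}.
Hypothesis rg : regular S d.
Hypothesis d3 : (3 <= d)%N.
Hypothesis lgc : log_closed (S := S).
Variable c : set (metric S).
Hypothesis cc : conformal_class c.
Variable sigma : metric S -> S -> R.
Hypothesis ds : density_section c 1 sigma.
Implicit Types (g : metric S) (k w : int) (F G : tractor S) (p : S).

Lemma slotsN (F : slots S) s p : [/\ north (- F) s p = - north F s p, west (- F) s p = - west F s p,
  east (- F) s p = - east F s p & south (- F) s p = - south F s p].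
Proof. by []. Qed.
Lemma slots0 s p : [/\ north (0 : slots S) s p = 0, west (0 : slots S) s p = 0,
  east (0 : slots S) s p = 0 & south (0 : slots S) s p = 0].
Proof. by []. Qed.
Lemma slotsD (F G : slots S) s p : [/\ north (F + G) s p = north F s p + north G s p, west (F + G) s p = west F s p + west G s p,
  east (F + G) s p = east F s p + east G s p & south (F + G) s p = south F s p + south G s p].
Proof. by []. Qed.

Lemma ts_opp k w F : tractor_section c k w F -> tractor_section c k w (- F).
Proof.
move=> hF; rewrite (_ : - F = tadd (-2) F F); first exact: (ts_add rg).
apply/funext => g; rewrite /tadd; apply: slots_eqP => s p.
have [-> -> -> ->] := saddE (-2) (F g) (F g) s p.
have [a1 a2 a3 a4] := slotsN (F g) s p.
by rewrite -[(- F) g]/(- (F g)) a1 a2 a3 a4; split; ring.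
Qed.

Lemma ts_zero k w : tractor_section c k w (0 : tractor S).
Proof.
apply/tsP; split=> [g cg|g Om cg pOm]; first by split; exact: form0.
apply: slots_eqP => s p; have [-> -> -> ->] := lawE Om g k w ((0 : tractor S) g) s p.
rewrite !exter0 // -[(0 : tractor S) (rescale Om g)]/(0 : slots S) -[(0 : tractor S) g]/(0 : slots S).
have [-> -> -> ->] := slots0 s p; have [-> -> _ _] := slots0 (grad g (fun q => ln (Om q)) :: s) p.
by split; ring.
Qed.

Lemma ts_addr k w F G : tractor_section c k w F -> tractor_section c k w G -> tractor_section c k w (F + G).
Proof.
move=> hF hG; rewrite (_ : F + G = tadd 1 F G); first exact: (ts_add rg).
apply/funext => g; rewrite /tadd; apply: slots_eqP => s p.
have [-> -> -> ->] := saddE 1 (F g) (G g) s p; rewrite !mul1r.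
by rewrite -[(F + G) g]/(F g + G g); split.
Qed.

Lemma ts_cst k w F (a : R) : tractor_section c k w F -> tractor_section c k w (fun g => tmul (fun=> a) (F g)).
Proof.
move=> hF; rewrite (_ : (fun g => _) = tadd (a - 1) F F); first exact: (ts_add rg).
apply/funext => g; rewrite /tadd; apply: slots_eqP => s p.
have [-> -> -> ->] := saddE (a - 1) (F g) (F g) s p; have [-> -> -> ->] := tmulE (fun=> a) (F g) s p.
by split; ring.
Qed.

Lemma ts_sum k w (I : Type) (r : seq I) (F : I -> tractor S) : (forall i, tractor_section c k w (F i)) ->
  tractor_section c k w (\sum_(i <- r) F i).
Proof. by move=> h; elim/big_ind: _ => //; [exact: ts_zero|exact: ts_addr]. Qed.

Lemma ts_y k w F : tractor_section c k w F -> tractor_section c k (w - 1) (yop d sigma k w F).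
Proof.
move=> hF; apply: ts_opp; apply: ts_addr.
  by have := ts_I rg d3 lgc cc ds (ts_D rg d3 lgc cc hF); rewrite addrK.
by have := ts_D rg d3 lgc cc (ts_I rg d3 lgc cc ds hF); rewrite subrK.
Qed.

Lemma ts_ypow k w F j : tractor_section c k w F -> tractor_section c k (w - j%:Z) (ypow d sigma j k w F).
Proof.
move=> hF; elim: j => [|j IH]; first by rewrite subr0.
by have := ts_y IH; rewrite -addrA -opprD -PoszD addn1.
Qed.

Lemma ts_xpow k w F j : tractor_section c k (w - j%:Z) F -> tractor_section c k w (iter j (xop sigma) F).
Proof.
elim: j w F => [|j IH] w F hF; first by rewrite /= -[w]subr0.
rewrite iterSr; apply: IH; rewrite (_ : w - j%:Z = w - j.+1%:Z + 1); last by lia.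
exact: (ts_x rg ds).
Qed.

Lemma ts_K (h : R) l k w F : tractor_section c k w F -> tractor_section c k w (Ktrunc d sigma h l k w F).
Proof.
move=> hF.
rewrite (_ : Ktrunc d sigma h l k w F = \sum_(j < l.+1) (fun g => tmul (fun=> Kcoef h j) (iter j (xop sigma) (ypow d sigma j k w F) g))).
  by apply: ts_sum => j; apply: ts_cst; apply: ts_xpow; exact: ts_ypow.
by apply/funext => g; rewrite fct_sumE.
Qed.
End TsY.

(** * Scales in which sigma = 1 *)

(* Near an interior point some scale of c has sigma = 1.  There nu = 0, P = - g / 2,
   J = - d / 2 and rho = 1 / 2; the conformally invariant identities are checked in
   such a scale and reach the boundary by density of the interior. *)
Section Unit.
Context {R : realType} {S : smooth_space R} {d : nat}.
Hypothesis rg : regular S d.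
Hypothesis d3 : (3 <= d)%N.
Hypothesis lgc : log_closed (S := S).
Variable c : set (metric S).
Hypothesis cc : conformal_class c.
Variable sigma : metric S -> S -> R.
Hypothesis ds : density_section c 1 sigma.
Hypothesis hE : forall g p, c g -> nearby p (fun q => sigma g q = 1) ->
  forall X Y, ric d g X Y p = - (d%:R - 1) * g X Y p.
Implicit Types (k w : int) (F G : tractor S) (X Y : vfield S) (A B C : dform S).

Section At.
Variables (g : metric S) (p : S).
Hypotheses (cg : c g) (h1 : nearby p (fun q => sigma g q = 1)).
Let mg : is_metric g := c_metric rg cc cg.
Notation nu := (nu sigma g).
Notation near P := (nearby p (fun q => forall s, P s q)).

(** Identities in a scale with sigma = 1 hold only near p and are differentiated again, so linearity
    is needed in a form which assumes and yields an identity near p. *)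
Lemma fd_nearlin k a b A B C : is_form k A -> is_form k B -> is_form k C ->
  near (fun s q => C s q = a * A s q + b * B s q) ->
  near (fun s q => fd g C s q = a * fd g A s q + b * fd g B s q).
Proof.
move=> hA hB hC h; pose C' : dform S := fun s p => a * A s p + b * B s p.
have hC' : is_form k C'.
  by apply: (formD rg); apply: (formM rg) => //; exact: smooth_cst.
have := fd_near rg g hC hC' h; apply: nearbyW => q hq s.
by rewrite hq; apply: (fd_lin rg g s q hA hB).
Qed.

Lemma fdelta_nearlin k a b A B C : is_form k A -> is_form k B -> is_form k C ->
  near (fun s q => C s q = a * A s q + b * B s q) ->
  near (fun s q => fdelta d g C s q = a * fdelta d g A s q + b * fdelta d g B s q).
Proof.
move=> hA hB hC h; pose C' : dform S := fun s p => a * A s p + b * B s p.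
have hC' : is_form k C'.
  by apply: (formD rg); apply: (formM rg) => //; exact: smooth_cst.
have := fdelta_near rg g hC hC' h; apply: nearbyW => q hq s.
by rewrite hq; apply: (fdelta_lin rg g s q hA hB).
Qed.

Lemma fDelta_form k A : is_form k A -> is_form k (fDelta d g A).
Proof.
move=> hA; apply: (formD rg).
  by have := fd_form rg mg (fdelta_form rg mg hA); rewrite subrK.
by have := fdelta_form rg mg (fd_form rg mg hA); rewrite addrK.
Qed.

Lemma fDelta_nearlin k a b A B C : is_form k A -> is_form k B -> is_form k C ->
  near (fun s q => C s q = a * A s q + b * B s q) ->
  near (fun s q => fDelta d g C s q = a * fDelta d g A s q + b * fDelta d g B s q).
Proof.
move=> hA hB hC h.
have n1 := fdelta_nearlin hA hB hC h; have n2 := fd_nearlin hA hB hC h.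
have m1 := fd_nearlin (fdelta_form rg mg hA) (fdelta_form rg mg hB) (fdelta_form rg mg hC) n1.
have m2 := fdelta_nearlin (fd_form rg mg hA) (fd_form rg mg hB) (fd_form rg mg hC) n2.
have := nearbyI rg m1 m2; apply: nearbyW => q [e1 e2] s.
rewrite -[LHS]/(fd g (fdelta d g C) s q + fdelta d g (fd g C) s q) e1 e2.
rewrite -[fDelta d g A s q]/(fd g (fdelta d g A) s q + fdelta d g (fd g A) s q).
rewrite -[fDelta d g B s q]/(fd g (fdelta d g B) s q + fdelta d g (fd g B) s q).
by ring.
Qed.

Lemma unit_der : nearby p (fun q => forall X, der X (sigma g) q = 0).
Proof.
have := nearby_nearby h1; apply: nearbyW => q hq X.
by rewrite (der_near rg X (sigma_sm ds cg) (smooth_cst S 1) hq) (der_cst rg).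
Qed.

Lemma unit_nu : nearby p (fun q => forall u, der nu u q = 0).
Proof.
have := unit_der; apply: nearbyW => q hq u.
by rewrite /Defs.nu -(g_grad rg mg) (g_sym mg) (g_grad rg mg).
Qed.

Lemma unit_inter k A : is_form k A -> near (fun s q => A (nu :: s) q = 0).
Proof.
move=> hA; have := unit_nu; apply: nearbyW => q hq s.
rewrite (clin2 rg (X := nu) (Y := nu) (Z := nu) (a := 0) (b := 0) (form_clin0 s hA)); first by ring.
by move=> u; rewrite hq; ring.
Qed.

Lemma unit_ric : nearby p (fun q => forall X Y, ric d g X Y q = - (d%:R - 1) * g X Y q).
Proof. have := nearby_nearby h1; apply: nearbyW => q hq X Y; exact: hE. Qed.

Lemma d1_neq0 : d%:R - 1 != 0 :> R.
Proof. by rewrite subr_eq0 -[1]/(1%:R) eqr_nat; lia. Qed.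
Lemma d2_neq0 : d%:R - 2 != 0 :> R.
Proof. by rewrite subr_eq0 -[2]/(2%:R) eqr_nat; lia. Qed.

Lemma unit_J : nearby p (fun q => Jcurv d g q = - d%:R / 2).
Proof.
have := unit_ric; apply: nearbyW => q hq; rewrite /Jcurv /trace.
rewrite (eq_bigr (fun=> - (d%:R - 1))); last first.
  by move=> a _; rewrite hq (frame_onb rg mg q) eqxx mulr1.
rewrite sumr_const card_ord -mulr_natr.
by field; exact: d1_neq0.
Qed.

Lemma unit_rho : nearby p (fun q => rho d sigma g q = 2^-1).
Proof.
have := nearbyI rg unit_J (nearbyI rg h1 (nearbyI rg unit_der (nearby_nearby unit_der))).
apply: nearbyW => q [eJ [es [ed en]]]; rewrite /rho eJ es.
rewrite (laplacian_hess rg mg _ (frame_onb rg mg q)) big1 => [|a _]; last first.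
  rewrite /hessian ed subr0; apply: (der_near0 rg); first exact: der_sm.
  by apply: nearbyW en => r hr; exact: hr.
have d0 : d%:R != 0 :> R by rewrite pnatr_eq0; lia.
by field.
Qed.

Lemma unit_JP k A : is_form k A -> near (fun s q => JP d g A s q = (k%:~R - d%:R / 2) * A s q).
Proof.
move=> hA; have := nearbyI rg unit_J unit_ric; apply: nearbyW => q [eJ er] s.
rewrite (JPE rg mg s q hA) eJ.
have -> : dact (PS (d := d) g) A s q = - 2^-1 * dact id A s q + 0 * dact id A s q.
  apply: (dact_linl rg s hA) => X u.
  rewrite (der_of_g rg mg (Y := X) (Z := vf0 S) (W := vf0 S) (a := - 2^-1) (b := 0) (c := 0)) => [|V].
    by rewrite !der_vf0; ring.
  rewrite (g_PS rg mg) /schouten er eJ (g_sym mg V).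
  by field; exact: d2_neq0.
by rewrite (dact_id _ _ hA); field.
Qed.

Lemma unit_Istar k F : sform k (F g) -> near (fun s q =>
  [/\ north (Istar d sigma F g) s q = - east (F g) s q,
      west (Istar d sigma F g) s q = 2^-1 * north (F g) s q + south (F g) s q,
      east (Istar d sigma F g) s q = 0 & south (Istar d sigma F g) s q = 2^-1 * east (F g) s q]).
Proof.
move=> [hN hW hE' hS]; have := nearbyI rg (nearbyI rg (unit_inter hN) (unit_inter hW))
  (nearbyI rg (nearbyI rg (unit_inter hE') (unit_inter hS)) (nearbyI rg h1 unit_rho)).
apply: nearbyW => q [[eN eW] [[eE eS] [es er]]] s.
have [-> -> -> ->] := IstarE sigma (d := d) F g s q.
by rewrite eN eW eE eS es er; split; ring.
Qed.

(** The scalar by which J - 2 P acts on k-forms where sigma = 1: J = - d / 2, and P = - g / 2 acts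
    on k-forms as - k / 2. *)
Definition qc (k : int) : R := k%:~R - d%:R / 2.

Lemma unit_dJP k A : is_form k A -> near (fun s q => fd g (JP d g A) s q = qc k * fd g A s q).
Proof.
move=> hA; have h : near (fun s q => JP d g A s q = qc k * A s q + 0 * A s q).
  by have := unit_JP hA; apply: nearbyW => q hq s; rewrite hq /qc; ring.
have := fd_nearlin hA hA (JP_form rg mg hA) h.
by apply: nearbyW => q hq s; rewrite hq; ring.
Qed.

Lemma unit_y k w F : sform k (F g) ->
  let N := north (F g) in let W := west (F g) in let E := east (F g) in let T := south (F g) in
  let a : R := (w + k)%:~R in let b : R := d%:R + 2 * w%:~R in
  let L : dform S := fun s q => fDelta d g N s q + (a - 2) * qc (k - 1) * N s q - 2 * fdelta d g W s q + b * (fd g E s q + (a - 2) * T s q) in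
  near (fun s q =>
  [/\ north (yop d sigma k w F g) s q = L s q - (b - 2) * ((a - 1) * (2^-1 * N s q + T s q) + fd g E s q),
      west (yop d sigma k w F g) s q = fDelta d g W s q + a * (qc k - 2^-1 * (b - 2)) * W s q - fd g N s q + 2 * fd g T s q,
      east (yop d sigma k w F g) s q = fDelta d g E s q + (a - 3) * qc (k - 2) * E s q + fdelta d g N s q + 2 * fdelta d g T s q
        - 2^-1 * b * (a - 3) * E s q &
      south (yop d sigma k w F g) s q = - 2^-1 * L s q + fd g E s q + 2^-1 * fDelta d g N s q + fDelta d g T s q
        + (a - 1) * qc (k - 1) * (2^-1 * N s q + T s q) + 2^-1 * b * fd g E s q]).
Proof.
move=> sF N W E T a b L; have [hN hW hE' hS] := sF.
have sI := Istar_form rg cc ds cg sF; have [iN iW iE iS] := sI.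
have sD := Dop_form rg cc w cg sF.
have uI := unit_Istar sF; have uID := unit_Istar sD.
have n1 : near (fun s q => north (Istar d sigma F g) s q = (-1) * E s q + 0 * E s q).
  by apply: nearbyW uI => q h s; have [-> _ _ _] := h s; rewrite /E /N /T; ring.
have n2 : near (fun s q => west (Istar d sigma F g) s q = 2^-1 * N s q + 1 * T s q).
  by apply: nearbyW uI => q h s; have [_ -> _ _] := h s; rewrite /E /N /T; ring.
have n3 : near (fun s q => east (Istar d sigma F g) s q = 0 * east (Istar d sigma F g) s q + 0 * east (Istar d sigma F g) s q).
  by apply: nearbyW uI => q h s; have [_ _ -> _] := h s; rewrite /E /N /T; ring.
have n4 : near (fun s q => south (Istar d sigma F g) s q = 2^-1 * E s q + 0 * E s q).
  by apply: nearbyW uI => q h s; have [_ _ _ ->] := h s; rewrite /E /N /T; ring.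
have k2 : k - 1 - 1 = k - 2 :> int by ring.
move: iN iS; rewrite k2 => iN iS.
have e1 := fd_nearlin hE' hE' iN n1.
have e2 := fd_nearlin hN hS iW n2.
have e3 := fDelta_nearlin hE' hE' iN n1.
have e4 := fdelta_nearlin hN hS iW n2.
have e5 := fd_nearlin iE iE iE n3.
have e6 := unit_JP iN.
have e7 := unit_dJP iN.
have iN1 : is_form (k - 1) (fd g (north (Istar d sigma F g))).
  by have := fd_form rg mg iN; rewrite (_ : k - 2 + 1 = k - 1) //; ring.
have e8 := unit_JP iN1.
have e9 := fDelta_nearlin hN hS iW n2.
have e10 := unit_JP iW.
have e11 := fd_nearlin hE' hE' iS n4.
have f1 := unit_JP hN; have f2 := unit_dJP hN; have f3 := unit_JP hW.
have hN1 : is_form k (fd g N) by have := fd_form rg mg hN; rewrite subrK.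
have f4 := unit_JP hN1.
have := nearbyI rg (nearbyI rg (nearbyI rg e1 e2) (nearbyI rg (nearbyI rg e3 e4) (nearbyI rg e5 e6)))
  (nearbyI rg (nearbyI rg (nearbyI rg e7 e8) (nearbyI rg e9 (nearbyI rg e10 e11)))
     (nearbyI rg (nearbyI rg (nearbyI rg f1 f2) (nearbyI rg f3 f4)) (nearbyI rg uI uID))).
apply: nearbyW => q [[[{}e1 {}e2] [[{}e3 {}e4] [{}e5 {}e6]]] [[[{}e7 {}e8] [{}e9 [{}e10 {}e11]]] [[[{}f1 {}f2] [{}f3 {}f4]] [{}uI {}uID]]]] s.
have [i1 i2 i3 i4] := uI s; have [j1 j2 j3 j4] := uID s.
have [d1 d2' d3' d4] := @DopE _ _ d k w F g.
have [c1 c2 c3 c4] := @DopE _ _ d (k - 1) w (Istar d sigma F) g.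
have [y1 y2 y3 y4] := slotsN (Istar d sigma (Dop d k w F) g + Dop d (k - 1) w (Istar d sigma F) g) s q.
have [z1 z2 z3 z4] := slotsD (Istar d sigma (Dop d k w F) g) (Dop d (k - 1) w (Istar d sigma F) g) s q.
rewrite -[yop _ _ _ _ _ g]/(- (Istar d sigma (Dop d k w F) g + Dop d (k - 1) w (Istar d sigma F) g)) y1 y2 y3 y4 z1 z2 z3 z4.
rewrite j1 j2 j3 j4 c1 c2 c3 c4 d1 d3' d4 e1 e2 e3 e4 e5 e6 e7 e8 e9 e10 e11 i1 i2 i4 f1 f2 f3 f4 e1.
rewrite -/N -/W -/E -/T /L /qc.
have ek j : (k - j)%:~R = k%:~R - j%:~R :> R by rewrite rmorphB.
have ewk j : (w + k - j)%:~R = a - j%:~R :> R by rewrite rmorphB.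
have ewk1 : (w + (k - 1))%:~R = a - 1 :> R by rewrite addrA rmorphB.
have ewk2 : (w + (k - 1) - 2)%:~R = a - 3 :> R by rewrite rmorphB /= ewk1; ring.
rewrite !ewk ewk2 !ewk1 !ek -/a -/b.
split; by field.
Qed.

Lemma near_ops k A B : is_form k A -> is_form k B -> near (fun s q => A s q = B s q) ->
  near (fun s q => [/\ A s q = B s q, fd g A s q = fd g B s q, fdelta d g A s q = fdelta d g B s q &
    fDelta d g A s q = fDelta d g B s q]).
Proof.
move=> hA hB h; have h' : near (fun s q => A s q = 1 * B s q + 0 * B s q).
  by apply: nearbyW h => q h s; rewrite h; ring.
have := nearbyI rg (nearbyI rg h (fd_nearlin hB hB hA h')) (nearbyI rg (fdelta_nearlin hB hB hA h') (fDelta_nearlin hB hB hA h')).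
apply: nearbyW => q [[e1 e2] [e3 e4]] s.
by rewrite e1 e2 e3 e4; split; ring.
Qed.

Lemma near_ops0 k A : is_form k A -> near (fun s q => A s q = 0) ->
  near (fun s q => [/\ A s q = 0, fd g A s q = 0, fdelta d g A s q = 0 & fDelta d g A s q = 0]).
Proof.
move=> hA h; have h' : near (fun s q => A s q = 0 * A s q + 0 * A s q).
  by apply: nearbyW h => q h s; rewrite h; ring.
have := nearbyI rg (nearbyI rg h (fd_nearlin hA hA hA h')) (nearbyI rg (fdelta_nearlin hA hA hA h') (fDelta_nearlin hA hA hA h')).
apply: nearbyW => q [[e1 e2] [e3 e4]] s.
by rewrite e1 e2 e3 e4; split; ring.
Qed.

(** Where sigma = 1, multiplication by sigma is the identity, so the commutator of y with sigma is
    the difference of the formulas for y in the weights w + 1 and w. *)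
Lemma sl2_unit k w F s : sform k (F g) ->
  [/\ north (yop d sigma k (w + 1) (xop sigma F) g) s p = north (yop d sigma k w F g) s p - (d%:R + 2 * w%:~R) * north (F g) s p,
      west (yop d sigma k (w + 1) (xop sigma F) g) s p = west (yop d sigma k w F g) s p - (d%:R + 2 * w%:~R) * west (F g) s p,
      east (yop d sigma k (w + 1) (xop sigma F) g) s p = east (yop d sigma k w F g) s p - (d%:R + 2 * w%:~R) * east (F g) s p &
      south (yop d sigma k (w + 1) (xop sigma F) g) s p = south (yop d sigma k w F g) s p - (d%:R + 2 * w%:~R) * south (F g) s p].
Proof.
move=> sF; have [hN hW hE' hS] := sF; have sg := sigma_sm ds cg.
have sX : sform k (xop sigma F g) by split; exact: (formM rg).
have [xN xW xE xS] := sX.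
have nx A : near (fun s q => fmul (sigma g) A s q = A s q).
  by apply: nearbyW h1 => q h s'; rewrite /fmul h mul1r.
have := nearbyI rg (nearbyI rg (nearbyI rg (near_ops xN hN (nx _)) (near_ops xW hW (nx _)))
  (nearbyI rg (near_ops xE hE' (nx _)) (near_ops xS hS (nx _)))) (nearbyI rg (unit_y w sF) (unit_y (w + 1) sX)).
move/nearby_sub => [[[oN oW] [oE oS]] [yF yX]].
have [-> -> -> ->] := yF s; have [-> -> -> ->] := yX s.
have [-> -> -> ->] := oN s; have [-> _ -> ->] := oW s; have [-> -> _ ->] := oE s; have [-> -> -> ->] := oS s.
have ek j : (k - j)%:~R = k%:~R - j%:~R :> R by rewrite rmorphB.
rewrite /qc !ek !rmorphD /=.
by split; field.
Qed.

(* The constraints I* F = D^* F = X* F = 0, read in a scale in which sigma = 1. *)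
Definition proca k F := sform k (F g) /\ near (fun s q =>
  [/\ north (F g) s q = 0, east (F g) s q = 0, south (F g) s q = 0 & fdelta d g (west (F g)) s q = 0]).

(** Here y acts on the west slot W as Delta + [kap], and delta Delta W = delta d delta W + delta
    delta d W = 0. Each term of the other slots contains delta W or a vanishing slot. *)
Lemma proca_y k w F : tractor_section c k w F -> proca k F -> proca k (yop d sigma k w F).
Proof.
move=> hF [sF h]; have [hN hW hE' hS] := sF.
have sY : sform k (yop d sigma k w F g).
  by have /tsP [h' _] := ts_y rg d3 lgc cc ds hF; exact: h'.
split=> //; have [yN yW yE yS] := sY.
have zN := near_ops0 hN (nearbyW (fun q h s => let: And4 a _ _ _ := h s in a) h).
have zE := near_ops0 hE' (nearbyW (fun q h s => let: And4 _ a _ _ := h s in a) h).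
have zS := near_ops0 hS (nearbyW (fun q h s => let: And4 _ _ a _ := h s in a) h).
have dW := fdelta_form rg mg hW.
have zD := near_ops0 dW (nearbyW (fun q h s => let: And4 _ _ _ a := h s in a) h).
have ddW : is_form k (fd g (fdelta d g (west (F g)))) by have := fd_form rg mg dW; rewrite subrK.
have zDD := near_ops0 ddW (nearbyW (fun q h s => let: And4 _ a _ _ := h s in a) zD).
have u := unit_y w sF.
pose kap : R := (w + k)%:~R * (qc k - 2^-1 * ((d%:R + 2 * w%:~R) - 2)).
have wE : near (fun s q => west (yop d sigma k w F g) s q = 1 * fDelta d g (west (F g)) s q + kap * west (F g) s q).
  have := nearbyI rg u (nearbyI rg zN zS); apply: nearbyW => q [hu [{}zN {}zS]] s.
  have [_ -> _ _] := hu s; have [_ -> _ _] := zN s; have [_ -> _ _] := zS s.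
  by rewrite /kap; ring.
have := nearbyI rg (nearbyI rg (nearbyI rg zN zE) (nearbyI rg zS zD)) (nearbyI rg u (nearbyI rg zDD (fdelta_nearlin (fDelta_form hW) hW yW wE))).
apply: nearbyW => q [[[{}zN {}zE] [{}zS {}zD]] [hu [{}zDD e]]] s.
have [-> _ -> ->] := hu s; rewrite e.
have [a1 a2 a3 a4] := zN s; have [b1 b2 b3 b4] := zE s; have [c1 c2 c3 c4] := zS s; have [d1 d2 d3' d4] := zD s.
have [_ _ z3 _] := zDD s.
have fD : fdelta d g (fDelta d g (west (F g))) s q = 0.
  have hW1 := fd_form rg mg hW.
  have hW2 : is_form k (fdelta d g (fd g (west (F g)))) by have := fdelta_form rg mg hW1; rewrite addrK.
  rewrite (fdelta_lin rg g s q ddW hW2 (a := 1) (b := 1)) ?z3 => [|s' q'].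
    by rewrite (fdelta_fdelta rg mg hW1) -[(0 : dform S) s q]/(0 : R); ring.
  by rewrite !mul1r.
by rewrite fD a1 a3 a4 b1 b2 b4 c1 c3 c4 d1; split; ring.
Qed.

Lemma proca_near k F G : sform k (G g) -> proca k F -> near (fun s q =>
  [/\ north (G g) s q = north (F g) s q, west (G g) s q = west (F g) s q,
      east (G g) s q = east (F g) s q & south (G g) s q = south (F g) s q]) -> proca k G.
Proof.
move=> sG [[hN hW hE' hS] h] h'; split=> //; have [gN gW gE gS] := sG.
have o := near_ops gW hW (nearbyW (fun q h s => let: And4 _ a _ _ := h s in a) h').
have := nearbyI rg (nearbyI rg h h') o; apply: nearbyW => q [[{}h {}h'] {}o] s.
have [-> _ -> ->] := h' s; have [_ _ -> _] := o s; exact: h.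
Qed.

Lemma proca_lin k (a : R) F G : proca k F -> proca k G -> proca k (tadd a F G).
Proof.
move=> [[hN hW hE' hS] h] [[gN gW gE gS] h'].
have sT : sform k (tadd a F G g) by split; exact: (lin1_form rg).
split=> //; have [_ tW _ _] := sT.
have e0 : near (fun s q => west (tadd a F G g) s q = a * west (F g) s q + 1 * west (G g) s q).
  by apply: nearbyT => q s; rewrite mul1r.
have := nearbyI rg (nearbyI rg h h') (fdelta_nearlin hW gW tW e0).
apply: nearbyW => q [[{}h {}h'] e] s; have [-> _ -> ->] := saddE a (F g) (G g) s q.
have [-> -> -> f4] := h s; have [-> -> -> g4] := h' s.
by rewrite e f4 g4; split; ring.
Qed.
End At.

Hypothesis hinv : forall (f : S -> R) p, smooth f -> 0 < f p ->
  exists2 Om, positive_smooth Om & nearby p (fun q => Om q * f q = 1).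
Hypothesis hdense : forall g p u, c g -> smooth u -> nearby p (fun q => 0 < sigma g q -> u q = 0) -> u p = 0.

Lemma unit_scale g p : c g -> 0 < sigma g p ->
  exists2 g', c g' & nearby p (fun q => sigma g' q = 1).
Proof.
move=> cg h; have [Om pOm hO] := hinv (sigma_sm ds cg) h.
exists (rescale Om g); first exact: (c_rescale rg cc).
by apply: nearbyW hO => q hq; rewrite (sigma_rescale ds).
Qed.

(** The operators act scale by scale. Since equalities of tractors are available only for metrics of
    c, arguments of y are exchanged one scale at a time. *)
Lemma yop_eq g k w F G : F g = G g -> yop d sigma k w F g = yop d sigma k w G g.
Proof.
move=> h; rewrite -[LHS]/(- (Istar d sigma (Dop d k w F) g + Dop d (k - 1) w (Istar d sigma F) g)).
rewrite -[RHS]/(- (Istar d sigma (Dop d k w G) g + Dop d (k - 1) w (Istar d sigma G) g)).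
by rewrite /Istar /Dop h.
Qed.

(** Vanishing is independent of the scale, every point with sigma > 0 has a scale of c with sigma =
    1 near it, and the remaining points are reached by [hdense]. *)
Lemma svan_tscale g p k w (F : tractor S) : tractor_section c k w F -> c g ->
  (forall g' q, c g' -> nearby q (fun r => sigma g' r = 1) -> svan (F g') q) -> svan (F g) p.
Proof.
move=> hF cg h; have /tsP [sF _] := hF; have [hN hW hE' hS] := sF g cg.
have hv q : 0 < sigma g q -> svan (F g) q.
  move=> hq; have [g' cg' n'] := unit_scale cg hq.
  exact: (svan_all rg cc hF cg' cg (h _ _ cg' n')).
move=> s; split; apply: (hdense cg).
- exact: (form_sm s hN).
- by apply: nearbyT => q /hv /(_ s) [].
- exact: (form_sm s hW).
- by apply: nearbyT => q /hv /(_ s) [].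
- exact: (form_sm s hE').
- by apply: nearbyT => q /hv /(_ s) [].
- exact: (form_sm s hS).
- by apply: nearbyT => q /hv /(_ s) [].
Qed.

Lemma sl2 g k w F : tractor_section c k w F -> c g ->
  yop d sigma k (w + 1) (xop sigma F) g = sadd (- (d%:R + 2 * w%:~R)) (F g) (tmul (sigma g) (yop d sigma k w F g)).
Proof.
move=> hF cg; pose G := tadd (-1) (tadd (- (d%:R + 2 * w%:~R)) F (xop sigma (yop d sigma k w F))) (yop d sigma k (w + 1) (xop sigma F)).
have hx := ts_x rg ds hF.
have hyx := ts_y rg d3 lgc cc ds hx; rewrite addrK in hyx.
have hxy := ts_x rg ds (ts_y rg d3 lgc cc ds hF); rewrite subrK in hxy.
have hG : tractor_section c k w G by do 2?apply: (ts_add rg).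
have h q : svan (G g) q.
  apply: (svan_tscale _ hG cg) => g' r cg' n'.
  have /tsP [sF _] := hF.
  move=> s; have [e1 e2 e3 e4] := sl2_unit cg' n' w s (sF g' cg').
  have s1 := nearby_sub n'.
  rewrite /G /tadd; have [-> -> -> ->] := saddE (-1) (sadd (- (d%:R + 2 * w%:~R)) (F g') (xop sigma (yop d sigma k w F) g')) (yop d sigma k (w + 1) (xop sigma F) g') s r.
  have [-> -> -> ->] := saddE (- (d%:R + 2 * w%:~R)) (F g') (xop sigma (yop d sigma k w F) g') s r.
  rewrite /xop; have [-> -> -> ->] := tmulE (sigma g') (yop d sigma k w F g') s r.
  by rewrite -/(xop sigma F) e1 e2 e3 e4 s1; split; ring.
apply: slots_eqP => s p; have := h p s; rewrite /G /tadd.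
have [-> -> -> ->] := saddE (-1) (sadd (- (d%:R + 2 * w%:~R)) (F g) (xop sigma (yop d sigma k w F) g)) (yop d sigma k (w + 1) (xop sigma F) g) s p.
have z (a b : R) : -1 * a + b = 0 -> b = a by move=> e; apply/eqP; rewrite -subr_eq0 -e; apply/eqP; ring.
by case=> /z-> /z-> /z-> /z->.
Qed.
End Unit.

(** * The solution generating operator *)

Section Kseries.
Context {R : realType} {S : smooth_space R} {d : nat}.
Hypothesis rg : regular S d.
Hypothesis d3 : (3 <= d)%N.
Hypothesis lgc : log_closed (S := S).
Variable c : set (metric S).
Hypothesis cc : conformal_class c.
Variable sigma : metric S -> S -> R.
Hypothesis ds : density_section c 1 sigma.
Hypothesis hE : forall g p, c g -> nearby p (fun q => sigma g q = 1) ->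
  forall X Y, ric d g X Y p = - (d%:R - 1) * g X Y p.
Hypothesis hinv : forall (f : S -> R) p, smooth f -> 0 < f p ->
  exists2 Om, positive_smooth Om & nearby p (fun q => Om q * f q = 1).
Hypothesis hdense : forall g p u, c g -> smooth u -> nearby p (fun q => 0 < sigma g q -> u q = 0) -> u p = 0.
Implicit Types (k w : int) (F G C : tractor S) (X Y : vfield S) (A B : dform S) (p q : S) (g : metric S).
Notation x := (xop sigma).
Notation y := (yop d sigma).

Lemma fDelta_lin g k (a b : R) A B (C : dform S) s p : is_metric g -> is_form k A -> is_form k B ->
  (forall s p, C s p = a * A s p + b * B s p) ->
  fDelta d g C s p = a * fDelta d g A s p + b * fDelta d g B s p.
Proof.
move=> mg hA hB h.
have n1 s' q := fdelta_lin rg g s' q hA hB h; have n2 s' q := fd_lin rg g s' q hA hB h.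
rewrite -[LHS]/(fd g (fdelta d g C) s p + fdelta d g (fd g C) s p).
rewrite (fd_lin rg g s p (fdelta_form rg mg hA) (fdelta_form rg mg hB) n1).
rewrite (fdelta_lin rg g s p (fd_form rg mg hA) (fd_form rg mg hB) n2).
rewrite -[fDelta d g A s p]/(fd g (fdelta d g A) s p + fdelta d g (fd g A) s p).
rewrite -[fDelta d g B s p]/(fd g (fdelta d g B) s p + fdelta d g (fd g B) s p).
by ring.
Qed.

Lemma JP_lin g k (a b : R) A B (C : dform S) s p : is_metric g -> is_form k A -> is_form k B -> is_form k C ->
  (forall s, C s p = a * A s p + b * B s p) ->
  JP d g C s p = a * JP d g A s p + b * JP d g B s p.
Proof.
move=> mg hA hB hC h.
by rewrite (JPE rg mg s p hA) (JPE rg mg s p hB) (JPE rg mg s p hC) (dact_lin _ s h) h; ring.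
Qed.

Lemma Dop_lin g k w (a : R) F G : c g -> sform k (F g) -> sform k (G g) ->
  Dop d k w (tadd a F G) g = sadd a (Dop d k w F g) (Dop d k w G g).
Proof.
move=> cg [hN hW hE' hS] [gN gW gE gS]; have mg := c_metric rg cc cg.
have [d1 d2 d3' d4] := @DopE _ _ d k w F g; have [e1 e2 e3 e4] := @DopE _ _ d k w G g.
have [f1 f2 f3 f4] := @DopE _ _ d k w (tadd a F G) g.
have n1 s p : north (tadd a F G g) s p = a * north (F g) s p + 1 * north (G g) s p by rewrite mul1r.
have n2 s p : west (tadd a F G g) s p = a * west (F g) s p + 1 * west (G g) s p by rewrite mul1r.
have n3 s p : east (tadd a F G g) s p = a * east (F g) s p + 1 * east (G g) s p by rewrite mul1r.
have n4 s p : south (tadd a F G g) s p = a * south (F g) s p + 1 * south (G g) s p by rewrite mul1r.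
have fN := lin1_form rg a hN gN; have fW := lin1_form rg a hW gW.
have fdN s p := fd_lin rg g s p hN gN n1.
apply: slots_eqP => s p; rewrite f1 f2 f3 f4.
have [-> -> -> ->] := saddE a (Dop d k w F g) (Dop d k w G g) s p.
rewrite d1 d2 d3' d4 e1 e2 e3 e4 n2 n4 fdN (fd_lin rg g s p hW gW n2).
rewrite (fDelta_lin s p mg hN gN n1) (JP_lin s mg hN gN fN (fun s => n1 s p)).
rewrite (fdelta_lin rg g s p hW gW n2) (fd_lin rg g s p hE' gE n3).
rewrite (JP_lin s mg (fd_form rg mg hN) (fd_form rg mg gN) (fd_form rg mg fN) (fun s => fdN s p)).
rewrite (fd_lin rg g s p (JP_form rg mg hN) (JP_form rg mg gN) (fun s p => JP_lin s mg hN gN fN (fun s => n1 s p))).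
rewrite (fDelta_lin s p mg hW gW n2) (JP_lin s mg hW gW fW (fun s => n2 s p)).
rewrite (fd_lin rg g s p hS gS n4).
by split; ring.
Qed.

Lemma Istar_lin g (a : R) F G : Istar d sigma (tadd a F G) g = sadd a (Istar d sigma F g) (Istar d sigma G g).
Proof.
apply: slots_eqP => s p; have [-> -> -> ->] := saddE a (Istar d sigma F g) (Istar d sigma G g) s p.
have [-> -> -> ->] := IstarE sigma (d := d) F g s p; have [-> -> -> ->] := IstarE sigma (d := d) G g s p.
have [-> -> -> ->] := IstarE sigma (d := d) (tadd a F G) g s p; rewrite /tadd.
have [a1 _ a3 a4] := saddE a (F g) (G g) s p; have [b1 b2 b3 b4] := saddE a (F g) (G g) (nu sigma g :: s) p.
by rewrite a1 a3 a4 b1 b2 b3 b4; split; ring.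
Qed.

Lemma yop_lin g k w (a : R) F G : c g -> sform k (F g) -> sform k (G g) ->
  y k w (tadd a F G) g = sadd a (y k w F g) (y k w G g).
Proof.
move=> cg sF sG.
have e1 : Istar d sigma (Dop d k w (tadd a F G)) g = sadd a (Istar d sigma (Dop d k w F) g) (Istar d sigma (Dop d k w G) g).
  rewrite -(Istar_lin g a (Dop d k w F) (Dop d k w G)).
  by rewrite /Istar /tadd (Dop_lin w a cg sF sG).
have e2 : Dop d (k - 1) w (Istar d sigma (tadd a F G)) g = sadd a (Dop d (k - 1) w (Istar d sigma F) g) (Dop d (k - 1) w (Istar d sigma G) g).
  rewrite -(Dop_lin w a cg (Istar_form rg cc ds cg sF) (Istar_form rg cc ds cg sG)).
  by rewrite /Dop /tadd (Istar_lin g a F G).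
rewrite -[LHS]/(- (Istar d sigma (Dop d k w (tadd a F G)) g + Dop d (k - 1) w (Istar d sigma (tadd a F G)) g)) e1 e2.
set P := Istar _ _ _ _; set P' := Istar _ _ _ _; set Q := Dop _ _ _ _ _; set Q' := Dop _ _ _ _ _.
apply: slots_eqP => s p; rewrite -[y k w F g]/(- (P + Q)) -[y k w G g]/(- (P' + Q')).
have [-> -> -> ->] := slotsN (sadd a P P' + sadd a Q Q') s p.
have [-> -> -> ->] := slotsD (sadd a P P') (sadd a Q Q') s p.
have [-> -> -> ->] := saddE a P P' s p; have [-> -> -> ->] := saddE a Q Q' s p.
have [-> -> -> ->] := saddE a (- (P + Q)) (- (P' + Q')) s p.
have [-> -> -> ->] := slotsN (P + Q) s p; have [-> -> -> ->] := slotsN (P' + Q') s p.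
have [-> -> -> ->] := slotsD P Q s p; have [-> -> -> ->] := slotsD P' Q' s p.
by split; ring.
Qed.

Lemma ts_sf g k w F : tractor_section c k w F -> c g -> sform k (F g).
Proof. by move=> /tsP [h _] /h. Qed.

Lemma tmul_sadd (f : S -> R) (a : R) (P Q : slots S) : tmul f (sadd a P Q) = sadd a (tmul f P) (tmul f Q).
Proof.
apply: slots_eqP => s p; have [-> -> -> ->] := tmulE f (sadd a P Q) s p.
have [-> -> -> ->] := saddE a P Q s p; have [-> -> -> ->] := saddE a (tmul f P) (tmul f Q) s p.
have [-> -> -> ->] := tmulE f P s p; have [-> -> -> ->] := tmulE f Q s p.
by split; ring.
Qed.
Lemma sadd_sadd (a b e : R) (P Q : slots S) : a + b = e -> sadd a P (sadd b P Q) = sadd e P Q.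
Proof.
move=> <-; apply: slots_eqP => s p; have [-> -> -> ->] := saddE a P (sadd b P Q) s p.
have [-> -> -> ->] := saddE b P Q s p; have [-> -> -> ->] := saddE (a + b) P Q s p.
by split; ring.
Qed.
Lemma sadd0 (P Q : slots S) : sadd 0 P Q = Q.
Proof. by apply: slots_eqP => s p; have [-> -> -> ->] := saddE 0 P Q s p; split; ring. Qed.
Lemma xpow_eq g j F G : F g = G g -> iter j x F g = iter j x G g.
Proof. by move=> h; elim: j => //= j IH; rewrite /xop IH. Qed.
Lemma xpow_tadd g j (a : R) F G : iter j x (tadd a F G) g = sadd a (iter j x F g) (iter j x G g).
Proof. by elim: j => //= j IH; rewrite {1}/xop IH tmul_sadd. Qed.
Lemma xpowx g j F : iter j x (x F) g = iter j.+1 x F g.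
Proof. by rewrite -iterSr. Qed.

(** The coefficient is the sum of d + 2 (w + i) over i < j, one term for each factor sigma that y
    passes. For j = 0 it is zero and [j.-1] is a dummy value. *)
Lemma y_xpow g k w F j : tractor_section c k w F -> c g ->
  y k (w + j%:Z) (iter j x F) g =
  sadd (- (j%:R * (d%:R + 2 * w%:~R + j%:R - 1))) (iter j.-1 x F g) (iter j x (y k w F) g).
Proof.
move=> hF cg; elim: j => [|j IH]; first by rewrite addr0 mul0r oppr0 sadd0.
have hx : tractor_section c k (w + j%:Z) (iter j x F) by apply: (ts_xpow rg d3 ds); rewrite addrK.
rewrite (_ : w + j.+1%:Z = w + j%:Z + 1) ?iterS; last by lia.
rewrite (sl2 rg d3 lgc cc ds hE hinv hdense hx cg) IH tmul_sadd.
have ew : (w + j%:Z)%:~R = w%:~R + j%:R :> R by rewrite rmorphD.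
have eS : (j.+1%:R : R) = j%:R + 1 by rewrite -natr1.
case: j IH hx ew eS => [|j] _ _ ew eS.
  by rewrite /= mul0r oppr0 sadd0; congr sadd; rewrite ew; ring.
rewrite -[tmul (sigma g) (iter j.+1.-1 x F g)]/(iter j.+1 x F g).
by apply: sadd_sadd; rewrite ew eS; ring.
Qed.

(** The mirror image of [y_xpow]: the coefficient is the sum of d + 2 (w - 1 - i) over i < j, one
    term for each factor y that passes sigma. *)
Lemma ypow_x g k w C j : tractor_section c k (w - 1) C -> c g ->
  ypow d sigma j k w (x C) g =
  sadd (- (j%:R * (d%:R + 2 * w%:~R - 1 - j%:R))) (ypow d sigma j.-1 k (w - 1) C g) (x (ypow d sigma j k (w - 1) C) g).
Proof.
move=> hC cg; elim: j => [|j IH]; first by rewrite mul0r oppr0 sadd0.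
pose G := tadd (- (j%:R * (d%:R + 2 * w%:~R - 1 - j%:R))) (ypow d sigma j.-1 k (w - 1) C) (x (ypow d sigma j k (w - 1) C)).
rewrite -[LHS]/(y k (w - j%:Z) (ypow d sigma j k w (x C)) g) (@yop_eq _ _ _ sigma g k _ _ G IH).
have h1 := ts_ypow rg d3 lgc cc ds j.-1 hC; have h2 := ts_ypow rg d3 lgc cc ds j hC.
rewrite /G yop_lin //; [|exact: (ts_sf h1)|exact: (ts_sf (ts_x rg ds h2))].
rewrite (_ : w - j%:Z = w - 1 - j%:Z + 1); last by ring.
rewrite (sl2 rg d3 lgc cc ds hE hinv hdense h2 cg).
have ew : (w - 1 - j%:Z)%:~R = w%:~R - 1 - j%:R :> R by rewrite !rmorphB.
have eS : (j.+1%:R : R) = j%:R + 1 by rewrite -natr1.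
case: j IH @G h1 h2 ew eS => [|j] _ _ _ _ ew eS.
  by rewrite mul0r oppr0 sadd0; congr sadd; rewrite ew; ring.
rewrite (_ : w - 1 - j.+1%:Z + 1 = w - 1 - j%:Z); last by lia.
rewrite -[y k (w - 1 - j%:Z) (ypow d sigma j.+1.-1 k (w - 1) C) g]/(ypow d sigma j.+1 k (w - 1) C g).
by apply: sadd_sadd; rewrite ew eS; ring.
Qed.

Lemma KtruncS g h l k w F : Ktrunc d sigma h l.+1 k w F g =
  sadd (Kcoef h l.+1) (iter l.+1 x (ypow d sigma l.+1 k w F) g) (Ktrunc d sigma h l k w F g).
Proof.
rewrite /Ktrunc big_ord_recr /=; apply: slots_eqP => s p.
set P := \sum_(_ < _) _; set Q := x _ g.
have [-> -> -> ->] := slotsD P (tmul (fun=> Kcoef h l.+1) Q) s p.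
have [-> -> -> ->] := saddE (Kcoef h l.+1) Q P s p; have [-> -> -> ->] := tmulE (fun=> Kcoef h l.+1) Q s p.
by split; ring.
Qed.
Lemma Ktrunc0 g h k w F : Ktrunc d sigma h 0 k w F g = F g.
Proof.
rewrite /Ktrunc big_ord1 /Kcoef big_geq // fact0 mulr1 invr1.
by apply: slots_eqP => s p; have [-> -> -> ->] := tmulE (fun=> 1) (F g) s p; split; ring.
Qed.

Lemma KcoefS (h : R) l : h - (l.+2)%:R != 0 -> Kcoef h l = Kcoef h l.+1 * ((l.+1)%:R * (h - (l.+2)%:R)).
Proof.
move=> h0; rewrite /Kcoef factS natrM [in RHS]big_nat_recr //=.
have l0 : (l.+1)%:R != 0 :> R by rewrite pnatr_eq0.
have q0 : (l`!)%:R != 0 :> R by rewrite pnatr_eq0 -lt0n fact_gt0.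
move: q0; move: (l`!)%:R => Q q0; set P := \prod_(_ <= _ < _) _.
have [->|P0] := eqVneq P 0; first by rewrite !(mul0r, mulr0, invr0).
move: (l.+1%:R) l0 (h - _) h0 => a a0 b b0.
by field; rewrite a0 b0 q0 P0.
Qed.

(** Telescoping: the commutator term of order l + 1 cancels what the orders up to l leave behind,
    which is the recursion [KcoefS] of the coefficients of K. The condition on d + 2w makes this
    recursion available at every order. *)
Lemma y_K g k w F l : tractor_section c k w F -> c g ->
  (forall i, (2 <= i)%N -> d%:R + 2 * w%:~R - i%:R != 0 :> R) ->
  y k w (Ktrunc d sigma (d%:R + 2 * w%:~R) l k w F) g =
  tmul (fun=> Kcoef (d%:R + 2 * w%:~R) l) (iter l x (ypow d sigma l.+1 k w F) g).
Proof.
move=> hF cg hh; set h : R := d%:R + 2 * w%:~R in hh *.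
elim: l => [|l IH].
  rewrite (@yop_eq _ _ _ sigma g k w _ F) ?Ktrunc0 //= subr0 /Kcoef big_geq // fact0 mulr1 invr1.
  by apply: slots_eqP => s p; have [-> -> -> ->] := tmulE (fun=> 1) (y k w F g) s p; split; ring.
pose G := iter l.+1 x (ypow d sigma l.+1 k w F).
have hy := ts_ypow rg d3 lgc cc ds l.+1 hF.
have hG : tractor_section c k w G by apply: (ts_xpow rg d3 ds).
rewrite (@yop_eq _ _ _ sigma g k w _ (tadd (Kcoef h l.+1) G (Ktrunc d sigma h l k w F)) (KtruncS _ _ _ _ _ _)).
rewrite yop_lin ?IH //; [|exact: (ts_sf hG)|exact: (ts_sf (ts_K rg d3 lgc cc ds h l hF))].
have := y_xpow l.+1 hy cg; rewrite subrK -/G => ->.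
rewrite (@KcoefS h l (hh _ _)) //.
have ew : (w - l.+1%:Z)%:~R = w%:~R - (l%:R + 1) :> R by rewrite !rmorphB /= -[l.+1%:~R]/(l.+1%:R) -natr1.
rewrite -[iter l.+1.-1 x _ g]/(iter l x (ypow d sigma l.+1 k w F) g).
rewrite -[iter l.+1 x (y _ _ _) g]/(iter l.+1 x (ypow d sigma l.+2 k w F) g).
set P := iter l x _ g; set Q := iter l.+1 x _ g.
apply: slots_eqP => s p; have [-> -> -> ->] := tmulE (fun=> Kcoef h l.+1) Q s p.
set a := - _; set b := Kcoef h l.+1 * _.
have [-> -> -> ->] := saddE (Kcoef h l.+1) (sadd a P Q) (tmul (fun=> b) P) s p.
have [-> -> -> ->] := saddE a P Q s p; have [-> -> -> ->] := tmulE (fun=> b) P s p.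
have ab : Kcoef h l.+1 * a + b = 0.
  by rewrite /a /b ew /h -(natr1 l) -(natr1 l.+1) -(natr1 l); ring.
by split; rewrite mulrDr addrAC mulrA -mulrDl ab; ring.
Qed.

(** The same recursion, with the powers of y moved past sigma instead of y past the powers of
    sigma. *)
Lemma K_x g k w C l : tractor_section c k (w - 1) C -> c g ->
  (forall i, (2 <= i)%N -> d%:R + 2 * w%:~R - i%:R != 0 :> R) ->
  Ktrunc d sigma (d%:R + 2 * w%:~R) l k w (x C) g =
  tmul (fun=> Kcoef (d%:R + 2 * w%:~R) l) (iter l.+1 x (ypow d sigma l k (w - 1) C) g).
Proof.
move=> hC cg hh; set h : R := d%:R + 2 * w%:~R in hh *.
elim: l => [|l IH].
  rewrite Ktrunc0 /Kcoef big_geq // fact0 mulr1 invr1 /=.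
  by apply: slots_eqP => s p; have [-> -> -> ->] := tmulE (fun=> 1) (x C g) s p; split; ring.
rewrite KtruncS IH (@KcoefS h l (hh _ _)) //.
have e := ypow_x l.+1 hC cg.
set a := - _ in e; set Q0 := ypow d sigma l.+1.-1 k (w - 1) C in e.
set Q1 := ypow d sigma l.+1 k (w - 1) C in e *.
rewrite (@xpow_eq g l.+1 _ (tadd a Q0 (x Q1)) e) xpow_tadd xpowx.
rewrite -[ypow d sigma l k (w - 1) C]/Q0.
set P := iter l.+1 x Q0 g; set Q := iter l.+2 x Q1 g; set b := Kcoef h l.+1 * _.
apply: slots_eqP => s p; have [-> -> -> ->] := tmulE (fun=> Kcoef h l.+1) Q s p.
have [-> -> -> ->] := saddE (Kcoef h l.+1) (sadd a P Q) (tmul (fun=> b) P) s p.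
have [-> -> -> ->] := saddE a P Q s p; have [-> -> -> ->] := tmulE (fun=> b) P s p.
have ab : Kcoef h l.+1 * a + b = 0.
  by rewrite /a /b /h -(natr1 l.+1) -(natr1 l); ring.
by split; rewrite mulrDr addrAC mulrA -mulrDl ab; ring.
Qed.

(** The vanishing of the north and east slots is X* F = 0, and the last two equations are D^* F = 0.
    Everything is required near p, because the constraints are differentiated when the scale
    changes. *)
Definition constr k w F g p := nearby p (fun q => svan (Istar d sigma F g) q /\ forall s,
  [/\ north (F g) s q = 0, east (F g) s q = 0,
      fdelta d g (west (F g)) s q + (d%:R + w%:~R - k%:~R) * south (F g) s q = 0 &
      fdelta d g (south (F g)) s q = 0]).

(** For vanishing north and east slots delta W changes by (d + w - k) iota(Ups) W and the south slot
    by - iota(Ups) W, so the first divergence equation is invariant. The change of the second one is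
    the first one contracted with Ups. *)
Lemma constr_rescale k w F g Om p : tractor_section c k w F -> c g -> positive_smooth Om ->
  constr k w F g p -> constr k w F (rescale Om g) p.
Proof.
move=> hF cg pOm h; have [su dOm] := lgc pOm; have mg := c_metric rg cc cg.
have cg' := c_rescale rg cc cg pOm.
have [hN hW hE' hS] := ts_sf hF cg; have [gN gW gE gS] := ts_sf hF cg'.
have sI := ts_I rg d3 lgc cc ds hF.
have /tsP [_ FE] := hF; have {}FE := FE g Om cg pOm.
pose U := grad g (fun q => ln (Om q)).
have o1 (e : int) : smooth (fun q => Om q ^ e).
  by apply: (smXz rg); [case: pOm|move=> q; rewrite gt_eqF //; case: pOm].
pose T2 : dform S := fun s q => 1 * south (F g) s q + (-1) * west (F g) (U :: s) q.
have hT2 : is_form (k - 1) T2.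
  apply: (formD rg); apply: (formM rg) => //; try exact: smooth_cst.
  exact: (form_inter U hW).
have nW : nearby p (fun q => forall s, west (F (rescale Om g)) s q = fmul (fun q => Om q ^ (w + k)) (west (F g)) s q).
  apply: nearbyW h => q [_ h] s; rewrite FE; have [_ -> _ _] := lawE Om g k w (F g) s q.
  by rewrite (@exter0 _ _ _ (north (F g))) ?addr0 // => s'; have [] := h s'.
have nS : nearby p (fun q => forall s, south (F (rescale Om g)) s q = fmul (fun q => Om q ^ (w + k - 2)) T2 s q).
  apply: nearbyW h => q [_ h] s; rewrite FE; have [_ _ _ ->] := lawE Om g k w (F g) s q.
  have [-> _ _ _] := h s.
  rewrite (@exter0 _ _ _ (inter _ (north (F g)))) => [|s']; last by have [] := h (grad g (fun q => ln (Om q)) :: s').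
  rewrite (@exter0 _ _ _ (east (F g))) => [|s']; last by have [] := h s'.
  by rewrite /fmul /T2 /U; ring.
have dW := fdelta_near rg (rescale Om g) gW (formM rg (o1 _) hW) nW.
have dS := fdelta_near rg (rescale Om g) gS (formM rg (o1 _) hT2) nS.
have := nearbyI rg h (nearbyI rg dW (nearbyI rg dS nS)).
apply: nearbyW => q [[hI hc] [{}dW [{}dS {}nS]]]; split; first exact: (svan_all rg cc sI cg cg' hI).
have O0 : Om q != 0 by rewrite gt_eqF //; case: pOm.
have cN s : north (F g) s q = 0 by have [] := hc s.
have cE s : east (F g) s q = 0 by have [] := hc s.
have cW s : fdelta d g (west (F g)) s q + (d%:R + w%:~R - k%:~R) * south (F g) s q = 0 by have [] := hc s.
have cS s : fdelta d g (south (F g)) s q = 0 by have [] := hc s.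
move=> s; rewrite dW dS nS (deltaW rg mg pOm dOm _ hW) (deltaW rg mg pOm dOm _ hT2) FE.
have [-> _ -> _] := lawE Om g k w (F g) s q; rewrite !cN !cE /fmul -/U.
have diff : fdelta d g T2 s q = fdelta d g (south (F g)) s q + fdelta d g (west (F g)) (U :: s) q.
  rewrite (fdelta_lin rg g s q hS (form_inter U hW) (a := 1) (b := -1)) //.
  by rewrite (fdelta_inter rg mg s q hW (fun X Y q' => hess_sym rg mg _ X Y q')); ring.
have T2U : inter U T2 s q = south (F g) (U :: s) q.
  by rewrite /inter /T2 (form_diag U s q hW); ring.
rewrite T2U diff cS /T2 /inter.
have := cW s; have := cW (U :: s).
have ewk (e : int) : (w + k - e)%:~R = w%:~R + k%:~R - e%:~R :> R by rewrite rmorphB rmorphD.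
have ek : (k - 1)%:~R = k%:~R - 1 :> R by rewrite rmorphB.
rewrite ewk ek rmorphD /= => c1 c2.
have c1' : fdelta d g (west (F g)) (U :: s) q = - ((d%:R + w%:~R - k%:~R) * south (F g) (U :: s) q).
  by apply/eqP; rewrite -addr_eq0 c1.
have c2' : fdelta d g (west (F g)) s q = - ((d%:R + w%:~R - k%:~R) * south (F g) s q).
  by apply/eqP; rewrite -addr_eq0 c2.
by rewrite c1' c2'; split; ring.
Qed.

Lemma constr_c k w F g g' p : tractor_section c k w F -> c g -> c g' -> constr k w F g p -> constr k w F g' p.
Proof. by move=> hF cg cg'; have [Om pOm ->] := c_rel rg cc cg cg'; exact: constr_rescale. Qed.

(** With nu = 0, sigma = 1 and a vanishing north slot, the west slot of I* F is the south slot of F;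
    once this is zero, the divergence equation says delta W = 0. *)
Lemma constr_proca k w F g p : tractor_section c k w F -> c g -> nearby p (fun q => sigma g q = 1) ->
  constr k w F g p -> proca (d := d) g p k F.
Proof.
move=> hF cg n1 h; have sF := ts_sf hF cg; split=> //.
have := nearbyI rg h (unit_Istar rg d3 cc ds hE cg n1 sF).
apply: nearbyW => q [[hI hc] u] s.
have [_ hw _ _] := hI s; have [_ u2 _ _] := u s; have [e1 e2 e3 e4] := hc s.
have T0 : south (F g) s q = 0 by move: hw; rewrite u2 e1 mulr0 add0r.
by move: e3; rewrite T0 mulr0 addr0.
Qed.

Lemma proca_constr k w F g p : tractor_section c k w F -> c g -> nearby p (fun q => sigma g q = 1) ->
  proca (d := d) g p k F -> constr k w F g p.
Proof.
move=> hF cg n1 [sF h]; have [hN hW hE' hS] := sF.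
have oS := near_ops0 rg cc cg hS (nearbyW (fun q h s => let: And4 _ _ a _ := h s in a) h).
have := nearbyI rg (nearbyI rg h oS) (unit_Istar rg d3 cc ds hE cg n1 sF).
apply: nearbyW => q [[{}h {}oS] u]; split=> s.
  have [-> -> -> ->] := u s; have [-> -> -> _] := h s; split; ring.
by have [-> -> -> ->] := h s; have [_ _ -> _] := oS s; split; ring.
Qed.

(** Where sigma = 1 the truncation is a linear combination of powers of y applied to F, and y
    preserves the condition. *)
Lemma proca_K h l k w F g p : tractor_section c k w F -> c g -> nearby p (fun q => sigma g q = 1) ->
  proca (d := d) g p k F -> proca (d := d) g p k (Ktrunc d sigma h l k w F).
Proof.
move=> hF cg n1 pF.
have py j : proca (d := d) g p k (ypow d sigma j k w F).
  elim: j => [|j IH] //; apply: (proca_y rg d3 lgc cc ds hE cg n1 _ IH).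
  exact: (ts_ypow rg d3 lgc cc ds j hF).
have px j i : proca (d := d) g p k (iter j x (ypow d sigma i k w F)).
  apply: (proca_near rg cc cg _ (py i)).
    have hx : tractor_section c k (w - i%:Z + j%:Z) (iter j x (ypow d sigma i k w F)).
      by apply: (ts_xpow rg d3 ds); rewrite addrK; exact: (ts_ypow rg d3 lgc cc ds i hF).
    exact: (ts_sf hx).
  elim: j => [|j IH]; first by apply: nearbyT.
  have := nearbyI rg IH n1; apply: nearbyW => q [{}IH s1] s.
  rewrite -[iter j.+1 x (ypow d sigma i k w F) g]/(tmul (sigma g) (iter j x (ypow d sigma i k w F) g)).
  have [-> -> -> ->] := tmulE (sigma g) (iter j x (ypow d sigma i k w F) g) s q.
  by have [-> -> -> ->] := IH s; rewrite s1 !mul1r.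
elim: l => [|l IH].
  by apply: (proca_near rg cc cg _ pF); [rewrite Ktrunc0; exact: (ts_sf hF)|apply: nearbyT => q s; rewrite Ktrunc0].
have := proca_lin rg (Kcoef h l.+1) (px l.+1 l.+1) IH.
move=> pT; apply: (proca_near rg cc cg _ pT); first by have [] := pT; rewrite /tadd -KtruncS.
by apply: nearbyT => q s; rewrite KtruncS.
Qed.

Lemma K_constr h l k w F g p : tractor_section c k w F -> c g -> 0 < sigma g p ->
  constr k w F g p -> constr k w (Ktrunc d sigma h l k w F) g p.
Proof.
move=> hF cg h0 hc; have [g' cg' n1] := unit_scale rg cc ds hinv cg h0.
have hK := ts_K rg d3 lgc cc ds h l hF.
apply: (constr_c hK cg' cg); apply: (proca_constr hK cg' n1); apply: (proca_K _ _ hF cg' n1).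
exact: (constr_proca hF cg' n1 (constr_c hF cg cg' hc)).
Qed.

(** No scale of c has sigma = 1 near a boundary point. The constraints are transported to the
    truncation at the points near p with sigma > 0, and being smooth functions they vanish at p by
    density. *)
Lemma K_vanish h l k w F g g' p : tractor_section c k w F -> c g -> c g' -> constr k w F g p ->
  let K := Ktrunc d sigma h l k w F in svan (Istar d sigma K g') p /\ forall s,
  [/\ north (K g') s p = 0, east (K g') s p = 0,
      fdelta d g' (west (K g')) s p + (d%:R + w%:~R - k%:~R) * south (K g') s p = 0 &
      fdelta d g' (south (K g')) s p = 0].
Proof.
move=> hF cg cg' hc K; have hK := ts_K rg d3 lgc cc ds h l hF.
have mg := c_metric rg cc cg'.
have [hN hW hE' hS] := ts_sf hK cg'; have [iN iW iE iS] := ts_sf (ts_I rg d3 lgc cc ds hK) cg'.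
have n : nearby p (fun q => 0 < sigma g' q -> svan (Istar d sigma K g') q /\ forall s,
  [/\ north (K g') s q = 0, east (K g') s q = 0,
      fdelta d g' (west (K g')) s q + (d%:R + w%:~R - k%:~R) * south (K g') s q = 0 &
      fdelta d g' (south (K g')) s q = 0]).
  have := nearby_nearby (constr_c hF cg cg' hc); apply: nearbyW => q hq h0.
  exact: (nearby_sub (K_constr h l hF cg' h0 hq)).
have D u : smooth u -> (forall q, svan (Istar d sigma K g') q /\ (forall s,
  [/\ north (K g') s q = 0, east (K g') s q = 0,
      fdelta d g' (west (K g')) s q + (d%:R + w%:~R - k%:~R) * south (K g') s q = 0 &
      fdelta d g' (south (K g')) s q = 0]) -> u q = 0) -> u p = 0.
  by move=> su h'; apply: (hdense cg' su); apply: nearbyW n => q hq /hq /h'.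
split=> s; split.
- by apply: (D (north (Istar d sigma K g') s) (form_sm s iN)) => q [/(_ s) []].
- by apply: (D (west (Istar d sigma K g') s) (form_sm s iW)) => q [/(_ s) []].
- by apply: (D (east (Istar d sigma K g') s) (form_sm s iE)) => q [/(_ s) []].
- by apply: (D (south (Istar d sigma K g') s) (form_sm s iS)) => q [/(_ s) []].
- by apply: (D (north (K g') s) (form_sm s hN)) => q [_ /(_ s) []].
- by apply: (D (east (K g') s) (form_sm s hE')) => q [_ /(_ s) []].
- apply: (D (fun q => fdelta d g' (west (K g')) s q + (d%:R + w%:~R - k%:~R) * south (K g') s q)); last by move=> q [_ /(_ s) []].
  apply: (smD rg); first exact: (form_sm s (fdelta_form rg mg hW)).
  by apply: (smM rg); [exact: smooth_cst|exact: (form_sm s hS)].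
- by apply: (D (fdelta d g' (south (K g')) s) (form_sm s (fdelta_form rg mg hS))) => q [_ /(_ s) []].
Qed.
End Kseries.

Lemma fin_min (R : realType) (I : finType) (D : I -> R) (d0 : R) : 0 < d0 -> (forall i, 0 < D i) ->
  exists d, [/\ 0 < d, d <= d0 & forall i, d <= D i].
Proof.
move=> d00 hD; have H : forall s : seq I, exists d, [/\ 0 < d, d <= d0 & forall i, i \in s -> d <= D i].
  elim=> [|i s [d [dp dd hd]]]; first by exists d0.
  exists (Num.min d (D i)); rewrite lt_min dp hD ge_min dd; split=> // j.
  by rewrite inE ge_min => /orP [/eqP ->|/hd ->//]; rewrite lexx orbT.
by have [d [dp dd hd]] := H (enum I); exists d; split=> // i; apply: hd; rewrite mem_enum.
Qed.

Lemma is_deriveP (R : realType) (W : normedModType R) (f : W -> R) (x v : W) (a : R) : is_derive x v f a <->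
  forall e : R, 0 < e -> exists2 d : R, 0 < d & forall h : R, `|h| < d -> `|f (h *: v + x) - f x - h * a| <= e * `|h|.
Proof.
split=> [[df <-] e e0|H].
  have /cvgrPdist_le /(_ e e0) : (h^-1 *: ((f \o shift x) (h *: v) - f x)) @[h --> 0^'] --> 'D_v f x by exact: df.
  move=> /nbhs_ballP [d /= d0 hd]; exists d => // h hh.
  have [->|h0] := eqVneq h 0; first by rewrite scale0r add0r subrr mul0r subr0 normr0 mulr0.
  have := hd h; rewrite /ball /= sub0r normrN => /(_ hh h0).
  have -> : f (h *: v + x) - f x - h * 'D_v f x = - h * ('D_v f x - h^-1 * (f (h *: v + x) - f x)) by field.
  by rewrite normrM normrN mulrC => H; apply: ler_wpM2r.
have L : (h^-1 *: ((f \o shift x) (h *: v) - f x)) @[h --> 0^'] --> a.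
  apply/cvgrPdist_le => e e0; have [d d0 hd] := H e e0.
  apply/nbhs_ballP; exists d => //= h; rewrite /ball /= sub0r normrN => hh h0.
  have := hd h hh; have -> : f (h *: v + x) - f x - h * a = - h * (a - h^-1 *: (f (h *: v + x) - f x)).
    by rewrite -[h^-1 *: _]/(h^-1 * _); field.
  by rewrite normrM normrN mulrC ler_pM2r ?normr_gt0.
by split; [apply/cvg_ex; exists a|apply: cvg_lim].
Qed.

(** * Smooth functions on Euclidean space *)

Section SmoothOn.
Context {R : realType} {n : nat}.
Notation V := 'rV[R]_n.+1.
Implicit Types (f g h : V -> R) (x y v : V) (O : set V) (i j : 'I_n.+1).
Notation "'e_ i" := (delta_mx ord0 i : V) (at level 8, i at level 2, format "''e_' i").

Definition box x (d : R) y := forall i, `|y ord0 i - x ord0 i| < d.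

Lemma nbhs_box x (P : set V) : nbhs x P <-> exists2 d : R, 0 < d & forall y, box x d y -> P y.
Proof.
split=> [/nbhs_ballP [d /= d0 h]|[d d0 h]].
  exists d => // y hy; apply: h; split=> // i j; rewrite (ord1 i).
  by rewrite /ball /= distrC; exact: hy.
apply/nbhs_ballP; exists d => //= y [_ hy]; apply: h => i.
by have := hy ord0 i; rewrite /ball /= distrC.
Qed.

Lemma open_box O x : open O -> O x -> exists2 d : R, 0 < d & forall y, box x d y -> O y.
Proof. by move=> oO Ox; apply/nbhs_box; exact: open_nbhs_nbhs. Qed.

Lemma box_open x (d : R) : open [set y | box x d y].
Proof.
rewrite openE => y hy; apply/nbhs_box.
have [e e0 he] : exists2 e : R, 0 < e & forall i, e <= d - `|y ord0 i - x ord0 i|.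
  have [i|e [e0 _ he]] := @fin_min R _ (fun i => d - `|y ord0 i - x ord0 i|) 1 ltr01; last by exists e.
  by rewrite subr_gt0; exact: hy.
exists e => // z hz i; have := hz i; have := he i.
have := ler_normD (z ord0 i - y ord0 i) (y ord0 i - x ord0 i); rewrite addrA subrK; lra.
Qed.

Lemma continuousP f x : {for x, continuous f} <->
  forall e : R, 0 < e -> exists2 d : R, 0 < d & forall y, box x d y -> `|f y - f x| <= e.
Proof.
split=> [/cvgrPdist_le h e e0|h].
  by have /nbhs_box [d d0 hd] := h e e0; exists d => // y /hd; rewrite distrC.
move=> U /nbhs_ballP [e /= e0 hU]; have e20 : 0 < e / 2 by lra.
have [d d0 hd] := h _ e20; apply/nbhs_box; exists d => // y /hd hy; apply: hU.
by rewrite /ball /= distrC; lra.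
Qed.

Lemma so_cont O f x : smooth_on O f -> O x -> {for x, continuous f}.
Proof. by move=> h Ox; have [] := h [::] x Ox. Qed.
Lemma so_der O f x i : smooth_on O f -> O x -> is_derive x 'e_i f (partial i f x).
Proof. by move=> h Ox; have [_ hd] := h [::] x Ox; exact: derivableP (hd i). Qed.
Lemma so_partial O f i : smooth_on O f -> smooth_on O (partial i f).
Proof. by move=> h s x Ox; have := h (rcons s i) x Ox; rewrite foldr_rcons. Qed.
Lemma so_sub O O' f : O' `<=` O -> smooth_on O f -> smooth_on O' f.
Proof. by move=> h hf s x /h; exact: hf. Qed.

(** Smoothness by coinduction: a class of functions continuous on O and closed under partial
    derivatives on O consists of smooth functions. Derivatives need to agree with members of the
    class on O only. *)
Lemma so_coind O (P : set (V -> R)) : open O ->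
  (forall f, P f -> forall x, O x -> {for x, continuous f}) ->
  (forall f i, P f -> exists2 f', P f' & forall x, O x -> is_derive x 'e_i f (f' x)) ->
  forall f, P f -> smooth_on O f.
Proof.
move=> oO hc hd f Pf.
have H s : exists2 f', P f' & forall x, O x -> foldr (@partial R n) f s x = f' x.
  elim: s => [|i s [f' Pf' e]]; first by exists f.
  have [f'' Pf'' e'] := hd _ i Pf'; exists f'' => // x Ox.
  have nx : \forall y \near x, f' y = foldr (@partial R n) f s y.
    by have := open_nbhs_nbhs (conj oO Ox); apply: filterS => y /e.
  by rewrite /= /partial -(near_eq_derive _ nx); have [_ <-] := e' x Ox.
move=> s x Ox; have [f' Pf' e] := H s; split.
  apply/continuousP => e1 e10; have /continuousP /(_ e1 e10) [d d0 dd] := hc _ Pf' _ Ox.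
  have [d' d'0 dd'] := open_box oO Ox; exists (Num.min d d'); first by rewrite lt_min d0.
  move=> y hy; rewrite (e x Ox) (e y); first by apply: dd => i; apply: lt_le_trans (hy i) _; rewrite ge_min lexx.
  by apply: dd' => i; apply: lt_le_trans (hy i) _; rewrite ge_min lexx orbT.
move=> i; have nx : {near x, f' =1 foldr (@partial R n) f s}.
  by have := open_nbhs_nbhs (conj oO Ox); apply: filterS => y /e.
by apply: (near_eq_derivable nx); have [f'' _ /(_ x Ox) []] := hd _ i Pf'.
Qed.

(** The algebra generated by B. By [gen_smooth] it is enough that the derivatives of the generators
    lie in it; chain and quotient rules take this form. *)
Inductive gen (B : set (V -> R)) : (V -> R) -> Prop :=
| gen_base f : B f -> gen B f
| gen_cst (a : R) : gen B (fun=> a)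
| gen_add f g : gen B f -> gen B g -> gen B (fun x => f x + g x)
| gen_mul f g : gen B f -> gen B g -> gen B (fun x => f x * g x).

Lemma gen_smooth O B : open O -> (forall f, B f -> forall x, O x -> {for x, continuous f}) ->
  (forall f i, B f -> exists2 f', gen B f' & forall x, O x -> is_derive x 'e_i f (f' x)) ->
  forall f, gen B f -> smooth_on O f.
Proof.
move=> oO hc hd; apply: so_coind => // [f|f i].
  elim=> {f} [f /hc//|a x _|f g _ hf _ hg x Ox|f g _ hf _ hg x Ox].
  - exact: cst_continuous.
  - exact: (continuousD (hf x Ox) (hg x Ox)).
  - exact: (continuousM (hf x Ox) (hg x Ox)).
elim=> {f} [f /hd //|a|f g hf [f' gf' df] hg [g' gg' dg]|f g hf [f' gf' df] hg [g' gg' dg]].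
- by exists (fun=> 0); [exact: gen_cst|move=> x _; exact: is_derive_cst].
- exists (fun x => f' x + g' x); first exact: gen_add.
  by move=> x Ox; apply: is_deriveD; [exact: df|exact: dg].
- exists (fun x => f x * g' x + g x * f' x); first by apply: gen_add; exact: gen_mul.
  by move=> x Ox; apply: is_deriveM; [exact: df|exact: dg].
Qed.

Lemma gen_smooth_on O f : open O -> gen (smooth_on O) f -> smooth_on O f.
Proof.
move=> oO; apply: gen_smooth => // {}f => [hf x Ox|i hf]; first exact: (so_cont hf).
by exists (partial i f) => [|x Ox]; [apply: gen_base; exact: so_partial|exact: so_der hf Ox].
Qed.
Lemma so_add O f g : open O -> smooth_on O f -> smooth_on O g -> smooth_on O (fun x => f x + g x).
Proof. by move=> oO hf hg; apply: gen_smooth_on => //; apply: gen_add; exact: gen_base. Qed.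
Lemma so_mul O f g : open O -> smooth_on O f -> smooth_on O g -> smooth_on O (fun x => f x * g x).
Proof. by move=> oO hf hg; apply: gen_smooth_on => //; apply: gen_mul; exact: gen_base. Qed.
Lemma so_eq O f g : open O -> smooth_on O f -> (forall x, O x -> f x = g x) -> smooth_on O g.
Proof.
move=> oO hf e.
apply: (@so_coind O [set g | exists2 f, smooth_on O f & forall x, O x -> f x = g x]) => //; last by exists f.
  move=> {f g hf e} g [f hf e] x Ox; apply/continuousP => e1 e10.
  have /continuousP /(_ e1 e10) [d d0 dd] := so_cont hf Ox.
  have [d' d'0 dd'] := open_box oO Ox; exists (Num.min d d'); first by rewrite lt_min d0.
  move=> y hy; rewrite -!e //; first by apply: dd => i; apply: lt_le_trans (hy i) _; rewrite ge_min lexx.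
  by apply: dd' => i; apply: lt_le_trans (hy i) _; rewrite ge_min lexx orbT.
move=> {f g hf e} g i [f hf e]; exists (partial i f).
  by exists (partial i f); first exact: so_partial.
move=> x Ox; apply: near_eq_is_derive (so_der i hf Ox).
by have := open_nbhs_nbhs (conj oO Ox); apply: filterS => y /e.
Qed.

Lemma so_coord O i : open O -> smooth_on O (fun x => x ord0 i).
Proof.
move=> oO; apply: (@gen_smooth O [set f | f = fun x => x ord0 i]) => //; last exact: gen_base.
  by move=> f -> x _; exact: coord_continuous.
move=> f j ->; exists (fun=> (i == j)%:R); first exact: gen_cst.
move=> x _; apply/is_deriveP => e e0; exists 1 => // h _.
rewrite !mxE eqxx /= (_ : _ - _ = 0) ?normr0; last by ring.
by rewrite mulr_ge0 // ltW.
Qed.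

Lemma mvt_dir f (df : V -> R) i z (r : R) : (forall s, `|s| <= `|r| -> is_derive (z + s *: 'e_i) 'e_i f (df (z + s *: 'e_i))) ->
  exists2 s, `|s| <= `|r| & f (z + r *: 'e_i) - f z = r * df (z + s *: 'e_i).
Proof.
move=> h; pose F s := f (z + s *: 'e_i).
have hF (s : R) : `|s| <= `|r| -> is_derive s 1 F (df (z + s *: 'e_i)).
  move=> /h /is_deriveP H; apply/is_deriveP => e /H [d d0 hd]; exists d => // k /hd.
  have -> // : F (k *: 1 + s) = f (k *: 'e_i + (z + s *: 'e_i)).
  by rewrite /F -[k *: (1 : R)]/(k * 1) mulr1 scalerDl addrCA.
have cF (a b : R) : (forall s, s \in `[a, b] -> `|s| <= `|r|) -> {within `[a, b], continuous F}.
  move=> ab; apply: derivable_within_continuous => s hs.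
  by have [] := hF s (ab s hs).
have e0 : F 0 = f z by rewrite /F scale0r addr0.
have [r0|r0] := leP 0 r.
  have rr s : s \in `[0, r] -> `|s| <= `|r|.
    by rewrite in_itv /= => /andP [s0 sr]; rewrite !ger0_norm.
  have [||s hs] := @MVT_segment R F (fun s => df (z + s *: 'e_i)) 0 r r0; first by move=> s hs; apply: hF; apply: rr; exact: subset_itv_oo_cc.
    exact: cF rr.
  by rewrite e0 subr0 => ->; exists s; [exact: rr|rewrite mulrC].
have rr s : s \in `[r, 0] -> `|s| <= `|r|.
  by rewrite in_itv /= => /andP [s0 sr]; rewrite !ler0_norm ?lerN2 // ltW.
have [||s hs] := @MVT_segment R F (fun s => df (z + s *: 'e_i)) r 0 (ltW r0); first by move=> s hs; apply: hF; apply: rr; exact: subset_itv_oo_cc.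
  exact: cF rr.
rewrite e0 sub0r => e; exists s; first exact: rr.
by rewrite -[LHS]opprB -/(F r) e; ring.
Qed.

Definition mix x y (k : nat) : V := \row_j (if (j < k)%N then y ord0 j else x ord0 j).

(** Continuous partial derivatives imply differentiability: the increment is telescoped along the
    points [mix x y k], which change one coordinate at a time, with the mean value theorem on each
    segment. *)
Lemma C1_approx O f x : open O -> smooth_on O f -> O x -> forall e : R, 0 < e ->
  exists2 d : R, 0 < d & forall y, box x d y ->
  `|f y - f x - \sum_i partial i f x * (y ord0 i - x ord0 i)| <= e * \sum_i `|y ord0 i - x ord0 i|.
Proof.
move=> oO hf Ox e e0; have [d0 d00 hd0] := open_box oO Ox.
have /choice [D hD] : forall i, exists d : R, 0 < d /\ forall y, box x d y -> `|partial i f y - partial i f x| <= e.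
  by move=> i; have /continuousP /(_ e e0) [d ? ?] := so_cont (so_partial i hf) Ox; exists d.
have [i|d [dp dd0 dD]] := @fin_min R _ D d0 d00; first by case: (hD i).
exists d => // y hy.
have e1 : f y - f x = \sum_(k < n.+1) (f (mix x y k.+1) - f (mix x y k)).
  rewrite -(big_mkord predT (fun k => f (mix x y k.+1) - f (mix x y k))) telescope_sumr //.
  by congr (f _ - f _); apply/rowP => j; rewrite mxE ?ltn_ord.
rewrite e1 -sumrB; apply: le_trans (ler_norm_sum _ _ _) _; rewrite mulr_sumr; apply: ler_sum => k _.
have e2 : mix x y k.+1 = mix x y k + (y ord0 k - x ord0 k) *: 'e_k.
  apply/rowP => j; rewrite !mxE eqxx /= ltnS leq_eqVlt.
  have [->|jk] := eqVneq j k; first by rewrite eqxx ltnn mulr1 addrC subrK.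
  by rewrite -[(j : nat) == k]/(j == k) (negbTE jk) mulr0 addr0.
have bz s : `|s| <= `|y ord0 k - x ord0 k| -> box x d (mix x y k + s *: 'e_k).
  move=> hs j; rewrite !mxE eqxx /=; have [->|jk] := eqVneq j k.
    by rewrite ltnn mulr1 addrC addrK; exact: le_lt_trans hs (hy k).
  by rewrite mulr0 addr0; case: ifP => _; [exact: hy|rewrite subrr normr0].
rewrite e2; have [|s hs ->] := @mvt_dir f (partial k f) k (mix x y k) (y ord0 k - x ord0 k).
  by move=> s hs; apply: (so_der k hf); apply: hd0 => j; exact: lt_le_trans (bz s hs j) dd0.
rewrite mulrC -mulrBl normrM; apply: ler_wpM2r => //.
by have [_] := hD k; apply => j; exact: lt_le_trans (bz s hs j) (dD k).
Qed.
End SmoothOn.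

(** The generators are the smooth functions on O and the composites of smooth functions with g; by
    the chain rule, the derivative of a composite is a sum of products of such functions. *)
Lemma so_comp {R : realType} (n m : nat) (O : set 'rV[R]_n.+1) (O2 : set 'rV[R]_m.+1) F
    (g : 'I_m.+1 -> 'rV[R]_n.+1 -> R) : open O -> open O2 -> smooth_on O2 F ->
  (forall j, smooth_on O (g j)) -> (forall x, O x -> O2 (\row_j g j x)) ->
  smooth_on O (fun x => F (\row_j g j x)).
Proof.
move=> oO oO2 hF hg hO.
pose B f := smooth_on O f \/ exists2 F, smooth_on O2 F & f = fun x => F (\row_j g j x).
apply: (@gen_smooth R n O B) => // [f [hf|{}[{}F {}hF ->]] x Ox|f i [hf|{}[{}F {}hF ->]]|]; last by apply: gen_base; right; exists F.
- exact: (so_cont hf).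
- apply/continuousP => e e0; have /continuousP /(_ e e0) [d d0 hd] := so_cont hF (hO x Ox).
  have /choice [D hD] : forall j, exists d' : R, 0 < d' /\ forall y, box x d' y -> `|g j y - g j x| < d.
    move=> j; have d20 : 0 < d / 2 by lra.
    have /continuousP /(_ _ d20) [d' d'0 h] := so_cont (hg j) Ox.
    by exists d'; split=> // y /h; lra.
  have [j|d' [d'0 _ hd']] := @fin_min R _ D 1 ltr01; first by case: (hD j).
  exists d' => // y hy; apply: hd => j; rewrite !mxE; have [_] := hD j; apply => i.
  exact: lt_le_trans (hy i) (hd' j).
- by exists (partial i f) => [|x Ox]; [apply: gen_base; left; exact: so_partial|exact: (so_der i hf)].
exists (fun x => \sum_j partial j F (\row_j g j x) * partial i (g j) x).
  have : forall s, gen B (fun x => \sum_(j <- s) partial j F (\row_j g j x) * partial i (g j) x).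
    elim=> [|j s IH].
      by rewrite (_ : (fun x => _) = fun=> 0); [exact: gen_cst|apply/funext => x; rewrite big_nil].
    rewrite (_ : (fun x => _) = fun x => partial j F (\row_j g j x) * partial i (g j) x + \sum_(j <- s) partial j F (\row_j g j x) * partial i (g j) x); last by apply/funext => x; rewrite big_cons.
    apply: gen_add => //; apply: gen_mul; apply: gen_base; last by left; exact: so_partial.
    by right; exists (partial j F); first exact: so_partial.
  by apply.
move=> x Ox; apply/is_deriveP => e e0.
pose a j := partial i (g j) x.
pose M := \sum_j (`|a j| + 1).
have M0 : 0 <= M by apply: sumr_ge0 => j _; rewrite addr_ge0.
pose A := \sum_j `|partial j F (\row_j g j x)|.
have A0 : 0 <= A by apply: sumr_ge0 => j _.
(* [e1] controls the error of F along an increment of size at most M |h|, [e2] that of the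
   components g_j weighted by the derivatives of F; each contributes at most e |h| / 2. *)
pose e1 := e / (2 * (M + 1)); pose e2 := Num.min 1 (e / (2 * (A + 1))).
have e10 : 0 < e1 by rewrite divr_gt0 //; lra.
have e20 : 0 < e2 by rewrite lt_min ltr01 divr_gt0 //; lra.
have [d d0 hd] := C1_approx oO2 hF (hO x Ox) e10.
have /choice [D hD] : forall j, exists d' : R, 0 < d' /\ forall h, `|h| < d' ->
    `|g j (h *: delta_mx ord0 i + x) - g j x - h * a j| <= e2 * `|h|.
  by move=> j; have /is_deriveP /(_ _ e20) [d' ? ?] := so_der i (hg j) Ox; exists d'.
have dM : 0 < d / (M + 1) by rewrite divr_gt0 //; lra.
have [j|d1 [d10 d1d d1D]] := @fin_min R _ D _ dM; first by case: (hD j).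
exists d1 => // h hh.
have hg1 j : `|g j (h *: delta_mx ord0 i + x) - g j x - h * a j| <= e2 * `|h|.
  by have [_] := hD j; apply; exact: lt_le_trans hh (d1D j).
have hg2 j : `|g j (h *: delta_mx ord0 i + x) - g j x| <= (`|a j| + 1) * `|h|.
  have := ler_normD (g j (h *: delta_mx ord0 i + x) - g j x - h * a j) (h * a j); rewrite subrK normrM.
  have : e2 * `|h| <= 1 * `|h| by apply: ler_wpM2r => //; rewrite ge_min lexx.
  have := hg1 j; lra.
have aM j : `|a j| + 1 <= M.
  by rewrite /M (bigD1 j) //= lerDl; apply: sumr_ge0 => k _; rewrite addr_ge0.
have hb : box (\row_j g j x) d (\row_j g j (h *: delta_mx ord0 i + x)).
  move=> j; rewrite !mxE; apply: le_lt_trans (hg2 j) _.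
  have h1 : `|h| < d / (M + 1) by exact: lt_le_trans hh d1d.
  move: h1; rewrite ltr_pdivlMr; last lra.
  move=> h1; apply: le_lt_trans h1; rewrite mulrC; apply: ler_wpM2l => //; have := aM j; lra.
have := hd _ hb.
have -> : \sum_j partial j F (\row_j g j x) * ((\row_j g j (h *: delta_mx ord0 i + x)) ord0 j - (\row_j g j x) ord0 j)
   = \sum_j partial j F (\row_j g j x) * (g j (h *: delta_mx ord0 i + x) - g j x - h * a j) + h * \sum_j partial j F (\row_j g j x) * a j.
  by rewrite mulr_sumr -big_split /=; apply: eq_bigr => j _; rewrite !mxE; ring.
set P := F _ - F _; set Q := \sum_j _ * (_ - _ - _); set Z := h * _; set W := \sum_j `|_ - _|.
have hW : W <= M * `|h|.
  by rewrite /W /M mulr_suml; apply: ler_sum => j _; rewrite !mxE; exact: hg2.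
have hQ : `|Q| <= A * (e2 * `|h|).
  apply: le_trans (ler_norm_sum _ _ _) _; rewrite /A mulr_suml; apply: ler_sum => j _.
  by rewrite normrM; apply: ler_wpM2l.
move=> H; have := ler_normD (P - (Q + Z)) Q; have -> : P - (Q + Z) + Q = P - Z by ring.
have E1 : e1 * W <= e / 2 * `|h|.
  apply: le_trans (ler_wpM2l (ltW e10) hW) _; rewrite mulrA; apply: ler_wpM2r => //.
  rewrite /e1 mulrAC ler_pdivrMr; last lra.
  have -> : e / 2 * (2 * (M + 1)) = e * M + e by field.
  by lra.
have E2 : A * (e2 * `|h|) <= e / 2 * `|h|.
  rewrite mulrA; apply: ler_wpM2r => //.
  have : e2 <= e / (2 * (A + 1)) by rewrite ge_min lexx orbT.
  move=> h1; apply: le_trans (ler_wpM2l A0 h1) _; rewrite mulrA ler_pdivrMr; last lra.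
  have -> : e / 2 * (2 * (A + 1)) = A * e + e by field.
  by lra.
lra.
Qed.

(** * Exponential, reciprocal, logarithm and a flat function *)

Section OneVariable.
Context {R : realType}.
Implicit Types (phi psi : R -> R) (D : set R) (t : R).

Definition uni phi : 'rV[R]_1 -> R := fun y => phi (y ord0 ord0).

Lemma uni_smooth D (B : set (R -> R)) : open D ->
  (forall phi, B phi -> exists2 phi', gen [set F | exists2 psi, B psi & F = uni psi] (uni phi') &
     forall t, D t -> is_derive t 1 phi (phi' t)) ->
  forall phi, B phi -> smooth_on [set y : 'rV[R]_1 | D (y ord0 ord0)] (uni phi).
Proof.
move=> oD hB phi Bphi; set O := [set y : 'rV[R]_1 | D (y ord0 ord0)].
have oO : open O.
  have := @open_comp _ _ (fun y : 'rV[R]_1 => y ord0 ord0) D; apply => // y _; exact: coord_continuous.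
apply: (@gen_smooth R 0 O [set F | exists2 psi, B psi & F = uni psi]) => //; last by apply: gen_base; exists phi.
  move=> f [psi Bpsi ->] y Oy; have [psi' _ /(_ _ Oy) [dpsi _]] := hB psi Bpsi.
  apply: (@continuous_comp _ _ _ (fun y : 'rV[R]_1 => y ord0 ord0) psi); first exact: coord_continuous.
  by apply: differentiable_continuous; apply/derivable1_diffP.
move=> f i [psi Bpsi ->]; have [psi' gpsi' hpsi] := hB psi Bpsi.
exists (uni psi') => // y Oy; have /is_deriveP H := hpsi _ Oy.
apply/is_deriveP => e /H [d d0 hd]; exists d => // h /hd.
by rewrite /uni !mxE (ord1 i) eqxx /= mulr1 -[h *: (1 : R)]/(h * 1) mulr1.
Qed.

Section Comp.
Context {n : nat}.
Implicit Types (f : 'rV[R]_n.+1 -> R) (O : set 'rV[R]_n.+1).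

Lemma so_uni D phi O f : open O -> open D -> smooth_on [set y : 'rV[R]_1 | D (y ord0 ord0)] (uni phi) ->
  smooth_on O f -> (forall x, O x -> D (f x)) -> smooth_on O (fun x => phi (f x)).
Proof.
move=> oO oD hphi hf hD; rewrite (_ : (fun x => _) = fun x => uni phi (\row_(j < 1) f x)).
  apply: (so_comp oO _ hphi) => [|j //|x Ox]; last by rewrite /= mxE; exact: hD.
  by have := @open_comp _ _ (fun y : 'rV[R]_1 => y ord0 ord0) D; apply => // y _; exact: coord_continuous.
by apply/funext => x; rewrite /uni mxE.
Qed.

Lemma so_exp O f : open O -> smooth_on O f -> smooth_on O (fun x => expR (f x)).
Proof.
move=> oO hf; apply: (so_uni oO openT _ hf) => //.
apply: (@uni_smooth setT [set expR] openT) => // _ ->; exists expR.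
  by apply: gen_base; exists expR.
by move=> t _; exact: is_derive_expR.
Qed.

Let invd t : t != 0 -> is_derive t 1 (fun t => t^-1) (-1 * (t^-1 * t^-1)).
Proof.
move=> t0; have := @is_deriveV R id t 1 1 t0 (is_derive_id _ _).
by move=> h; apply: (is_derive_eq h); rewrite -[_ *: _]/(_ * _) /=; field.
Qed.

Lemma so_inv O f : open O -> smooth_on O f -> (forall x, O x -> f x != 0) -> smooth_on O (fun x => (f x)^-1).
Proof.
move=> oO hf f0; have oD : open [set t : R | t != 0].
  exact: open_neq.
apply: (so_uni oO oD _ hf) => //.
apply: (@uni_smooth _ [set fun t => t^-1] oD) => // _ ->; exists (fun t => -1 * (t^-1 * t^-1)); last by move=> t; exact: invd.
by rewrite /uni; apply: gen_mul; [exact: gen_cst|apply: gen_mul; apply: gen_base; exists (fun t => t^-1)].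
Qed.

Lemma so_ln O f : open O -> smooth_on O f -> (forall x, O x -> 0 < f x) -> smooth_on O (fun x => ln (f x)).
Proof.
move=> oO hf f0; have oD : open [set t : R | 0 < t] by exact: open_gt.
apply: (so_uni oO oD _ hf) => //.
apply: (@uni_smooth _ [set phi | phi = (fun t => t^-1) \/ phi = @ln R] oD); last by right.
move=> phi [->|->]; [exists (fun t => -1 * (t^-1 * t^-1))|exists (fun t => t^-1)].
- by rewrite /uni; apply: gen_mul; [exact: gen_cst|apply: gen_mul; apply: gen_base; exists (fun t => t^-1) => //; left].
- by move=> t t0; apply: invd; rewrite gt_eqF.
- by apply: gen_base; exists (fun t => t^-1) => //; left.
- by move=> t t0; exact: is_derive1_ln.
Qed.
End Comp.

(** The powers of 1/t in front of exp(-1/t) make the family closed under differentiation; only k = 0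
    is used afterwards. *)
Definition flat (k : nat) t : R := if 0 < t then (t^-1) ^+ k * expR (- t^-1) else 0.

(** From exp(1/t) = exp(1/(m t))^m >= (m t)^(-m) with m = k + 2. The two surplus powers of t give
    the derivative 0 at the origin. *)
Lemma flat_le k t : 0 < t -> flat k t <= k.+2%:R ^+ k.+2 * (t * t).
Proof.
move=> t0; rewrite /flat t0; set m := k.+2.
have h1 : (m%:R * t)^-1 ^+ m <= expR (t^-1).
  rewrite (_ : t^-1 = (m%:R * t)^-1 *+ m); last first.
    by rewrite -[RHS]mulr_natl; field; rewrite !gt_eqF.
  rewrite -[(m%:R * t)^-1 *+ m]mulr_natl expRM_natl; apply: lerXn2r; rewrite ?nnegrE ?expR_ge0 //.
    by rewrite invr_ge0 mulr_ge0 // ltW.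
  by apply: le_trans (expR_ge1Dx _); rewrite lerDr.
have e0 := expR_gt0 (t^-1).
rewrite expRN ler_pdivrMr //.
have -> : t^-1 ^+ k = m%:R ^+ m * (t * t) * (m%:R * t)^-1 ^+ m.
  rewrite /m !exprVn exprMn !exprS; field.
  by rewrite expf_neq0 ?gt_eqF // expf_neq0 ?gt_eqF.
apply: ler_wpM2l h1.
by rewrite mulr_ge0 ?exprn_ge0 // ?mulr_ge0 // ltW.
Qed.

Lemma flat_ge0 k t : 0 <= flat k t.
Proof. by rewrite /flat; case: ifP => // t0; rewrite mulr_ge0 ?expR_ge0 // exprn_ge0 // invr_ge0 ltW. Qed.

Lemma is_derive_flat k t : is_derive t 1 (flat k) (- k%:R * flat k.+1 t + flat k.+2 t).
Proof.
have [t0|t0|t0] := ltgtP t 0.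
- rewrite /flat !ltNge (ltW t0) /= mulr0 addr0.
  have H : is_derive t 1 (fun _ : R => 0 : R) 0 by exact: is_derive_cst.
  apply: near_eq_is_derive H.
  have : \forall x \near t, x < 0 by apply: open_nbhs_nbhs; split; [exact: open_lt|].
  by apply: filterS => x x0; rewrite ltNge (ltW x0).
- apply: (@near_eq_is_derive _ _ _ (fun t => (t^-1) ^+ k * expR (- t^-1))).
    have : \forall x \near t, 0 < x by apply: open_nbhs_nbhs; split; [exact: open_gt|].
    by apply: filterS => x x0; rewrite /flat x0.
  have di : is_derive t 1 (fun t => t^-1) (- (t^-1 * t^-1)).
    have := @is_deriveV R id t 1 1 (lt0r_neq0 t0) (is_derive_id _ _).
    by move=> h; apply: (is_derive_eq h); rewrite -[_ *: _]/(_ * _) /=; field; rewrite gt_eqF.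
  have dX := is_deriveX k di.
  have dE : is_derive t 1 (fun t => expR (- t^-1)) (expR (- t^-1) * (t^-1 * t^-1)).
    have dN : is_derive t 1 (fun t => - t^-1) (t^-1 * t^-1) by have := is_deriveN di; rewrite opprK.
    have H := @is_derive1_comp R expR (fun t => - t^-1) t _ _ (is_derive_expR (- t^-1)) dN.
    by apply/is_deriveP; move/is_deriveP: H.
  have pX s j : (((fun t => t^-1) : R -> R) ^+ j) s = s^-1 ^+ j.
    by elim: j => [|j IH]; rewrite ?expr0 // !exprS -IH.
  have := is_deriveM dX dE; set F := _ * _ => H.
  have eF : F = fun t => (t^-1) ^+ k * expR (- t^-1) by apply/funext => s; rewrite -pX.
  rewrite eF in H; apply: (is_derive_eq H).
  rewrite /flat t0 -![_ *: _]/(_ * _) pX !exprS.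
  case: k {dX H F eF} => [|k] /=; first by rewrite !expr0; ring.
  by rewrite !exprS -natr1; ring.
- rewrite t0 /flat ltxx mulr0 addr0; apply/is_deriveP => e e0.
  pose C : R := k.+2%:R ^+ k.+2; have C0 : 0 < C by rewrite exprn_gt0 // ltr0n.
  exists (e / C) => [|h hh]; first by rewrite divr_gt0.
  rewrite mulr0 subr0 addr0 -[h *: (1 : R)]/(h * 1) mulr1 -/(flat k h) ltxx subr0 (ger0_norm (flat_ge0 _ _)).
  have [h0|h0] := leP h 0; first by rewrite /flat ltNge h0 /= mulr_ge0 // ltW.
  apply: le_trans (flat_le k h0) _; rewrite gtr0_norm //.
  move: hh; rewrite gtr0_norm // ltr_pdivlMr // -/C mulrA => hh.
  by apply: ler_wpM2r; [exact: ltW|rewrite mulrC ltW].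
Qed.

Lemma so_flat (n : nat) (O : set 'rV[R]_n.+1) f : open O -> smooth_on O f -> smooth_on O (fun x => flat 0 (f x)).
Proof.
move=> oO hf; apply: (so_uni oO openT _ hf) => //.
apply: (@uni_smooth setT [set phi | exists k, phi = flat k] openT); last by exists 0%N.
move=> _ [k ->]; exists (fun t => - k%:R * flat k.+1 t + flat k.+2 t) => [|t _]; last exact: is_derive_flat.
rewrite /uni; apply: gen_add; last by apply: gen_base; exists (flat k.+2) => //; exists k.+2.
by apply: gen_mul; [exact: gen_cst|apply: gen_base; exists (flat k.+1) => //; exists k.+1].
Qed.
End OneVariable.

(** * Integrals over the unit interval *)

Section Integral.
Context {R : realType}.
Notation I01 := (`[0%R, 1%R]%classic : set R).
Definition int01 (phi : R -> R) : R := (\int[lebesgue_measure]_(t in I01) phi t)%R.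
Definition c01 (phi : R -> R) := {within I01, continuous phi}.
Implicit Types (phi psi : R -> R).

Let mI : @measurable _ (measurableTypeR R) I01. Proof. exact: measurable_itv. Qed.

Lemma c01_at phi : (forall t : R, 0 <= t <= 1 -> {for t, continuous phi}) -> c01 phi.
Proof.
by move=> h; apply: continuous_in_subspaceT => t; rewrite inE /= in_itv /=; exact: h.
Qed.

Lemma c01_int phi : c01 phi -> lebesgue_measure.-integrable I01 (EFin \o phi).
Proof. by move=> h; apply: continuous_compact_integrable => //; exact: segment_compact. Qed.

Lemma int01_lin (a : R) phi psi : c01 phi -> c01 psi -> int01 (fun t => a * phi t + psi t) = a * int01 phi + int01 psi.
Proof.
move=> h1 h2; have i1 := c01_int h1; have i2 := c01_int h2.
rewrite /int01 RintegralD // ?RintegralZl //.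
by have := integrableZl mI a i1; apply: eq_integrable.
Qed.

Lemma int01_bound phi (e : R) : c01 phi -> (forall t : R, 0 <= t <= 1 -> `|phi t| <= e) -> `|int01 phi| <= e.
Proof.
move=> h he; have i1 := c01_int h.
apply: le_trans (le_normr_Rintegral mI i1) _.
have <- : \int[lebesgue_measure]_(t in I01) e = e.
  have E : lebesgue_measure I01 = (1 : R)%:E by rewrite lebesgue_measure_itv /= lte_fin ltr01 oppr0 adde0.
  by rewrite Rintegral_cst // -[RHS]mulr1 -[1]/(fine 1%:E); congr (_ * fine _); exact: E.
apply: le_Rintegral => //.
- exact: (integrable_norm i1).
- by apply: c01_int; apply: c01_at => t _; exact: cst_continuous.
Qed.

Lemma int01_ftc (phi psi : R -> R) : (forall t : R, 0 <= t <= 1 -> {for t, continuous psi}) ->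
  (forall t : R, 0 <= t <= 1 -> is_derive t 1 phi (psi t)) -> int01 psi = phi 1 - phi 0.
Proof.
move=> hc hd; rewrite /int01 /Rintegral.
have cphi (t : R) : 0 <= t <= 1 -> {for t, continuous phi}.
  by move=> /hd [d _]; apply: differentiable_continuous; apply/derivable1_diffP.
rewrite (@continuous_FTC2 R psi phi 0 1 ltr01 (c01_at hc)) //.
- split.
  + by move=> t; rewrite in_itv /= => /andP [t0 t1]; have [] := hd t; rewrite ?ltW.
  + by apply: cvg_at_right_filter; apply: cphi; rewrite lexx ler01.
  + by apply: cvg_at_left_filter; apply: cphi; rewrite lexx ler01.
- move=> t; rewrite in_itv /= => /andP [t0 t1]; rewrite derive1E; have [|_ ->//] := hd t; by rewrite !ltW.
Qed.
End Integral.

(** * Averages along rays, Hadamard's lemma *)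

Section Star.
Context {R : realType} {n : nat}.
Notation V := 'rV[R]_n.+1.
Variables (D : pred 'I_n.+1) (O : set V).
Hypothesis oO : open O.
(** Contracts only the coordinates selected by D: all of them for Taylor's formula, the first one
    alone for integration in the normal direction. *)
Definition Sc (t : R) (x : V) : V := \row_i (if D i then t * x ord0 i else x ord0 i).
Hypothesis sO : forall x t, O x -> 0 <= t <= 1 -> O (Sc t x).
Implicit Types (h f : V -> R) (x y v : V) (i : 'I_n.+1) (t : R) (m : nat).
Notation "'e_ i" := (delta_mx ord0 i : V) (at level 8, i at level 2, format "''e_' i").

Lemma Sc_box x t0 (d : R) : 0 < d -> exists2 d', 0 < d' & forall t, `|t - t0| < d' -> box (Sc t0 x) d (Sc t x).
Proof.
move=> d0; have M0 : 0 < 1 + \sum_i `|x ord0 i| by rewrite ltr_pwDl // sumr_ge0.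
exists (d / (1 + \sum_i `|x ord0 i|)) => [|t ht i]; first by rewrite divr_gt0.
rewrite !mxE; case: ifP => _; last by rewrite subrr normr0.
rewrite -mulrBl normrM; move: ht; rewrite ltr_pdivlMr // => ht; apply: le_lt_trans ht.
by apply: ler_wpM2l => //; rewrite (bigD1 i) //= addrCA lerDl addr_ge0 // sumr_ge0.
Qed.

(** Uniform continuity around the compact segment of the points Sc t x, as needed to differentiate
    under the integral sign. *)
Lemma tube h x : (forall y, O y -> {for y, continuous h}) -> O x -> forall e : R, 0 < e ->
  exists2 d : R, 0 < d & forall t, 0 <= t <= 1 -> forall z, box (Sc t x) d z -> O z /\ `|h z - h (Sc t x)| <= e.
Proof.
move=> hc Ox e e0.
pose P v t := O (Sc t x + v) /\ `|h (Sc t x + v) - h (Sc t x)| <= e.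
have /compact_near_coveringP nc : compact (`[0%R, 1%R]%classic : set R) by exact: segment_compact.
have hP : forall t0, (`[0%R, 1%R]%classic : set R) t0 -> \forall t \near t0 & v \near nbhs (0 : V), P v t.
  move=> t0 /= ht0.
  have {}ht0 : 0 <= t0 <= 1 by move: ht0; rewrite in_itv.
  have Ot := sO Ox ht0; have e20 : 0 < e / 2 by lra.
  have [d1 d10 hd1] := open_box oO Ot; have /continuousP /(_ _ e20) [d2 d20 hd2] := hc _ Ot.
  pose d := Num.min d1 d2 / 2; have d0 : 0 < d by rewrite divr_gt0 // lt_min d10.
  have dd1 : d + d <= d1 by rewrite -splitr ge_min lexx.
  have dd2 : d + d <= d2 by rewrite -splitr ge_min lexx orbT.
  have [d' d'0 hd'] := Sc_box x t0 d0.
  exists ([set t | `|t - t0| < d'], [set v : V | box 0 d v]).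
    split=> /=; first by apply/nbhs_ballP; exists d' => //= t; rewrite /ball /= distrC.
    by apply/nbhs_box; exists d.
  move=> [t v] /= [ht hv]; have hS := hd' t ht.
  have b1 : box (Sc t0 x) (d + d) (Sc t x + v).
    move=> i; have := hS i; have := hv i; rewrite mxE [(Sc t x + v) ord0 i]mxE subr0.
    have := ler_normD (Sc t x ord0 i - Sc t0 x ord0 i) (v ord0 i).
    by rewrite addrAC; lra.
  have b2 : box (Sc t0 x) (d + d) (Sc t x) by move=> i; have := hS i; lra.
  split; first by apply: hd1 => i; exact: lt_le_trans (b1 i) dd1.
  have h1 := hd2 _ (fun i => lt_le_trans (b1 i) dd2); have h2 := hd2 _ (fun i => lt_le_trans (b2 i) dd2).
  have := ler_normB (h (Sc t x + v) - h (Sc t0 x)) (h (Sc t x) - h (Sc t0 x)).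
  by rewrite opprB addrA subrK; lra.
have /nbhs_box [d d0 hd] := nc V (nbhs (0 : V)) P (nbhs_filter _) hP.
exists d => // t ht z hz.
have bz : box 0 d (z - Sc t x).
  by move=> i; have := hz i; rewrite !mxE subr0.
have /= := hd _ bz t; rewrite in_itv /= => /(_ ht); rewrite /P.
by have -> : Sc t x + (z - Sc t x) = z by rewrite addrC subrK.
Qed.

(** The power t^m is there because a derivative in a contracted direction produces one more factor
    t; with all m the family is closed under partial derivatives. *)
Definition Iop m h x := int01 (fun t => t ^+ m * h (Sc t x)).

Lemma Sc_cont h x t : (forall y, O y -> {for y, continuous h}) -> O x -> 0 <= t <= 1 ->
  {for t, continuous (fun t => h (Sc t x))}.
Proof.
move=> hc Ox ht U /nbhs_ballP [e /= e0 hU]; have e20 : 0 < e / 2 by lra.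
have /continuousP /(_ _ e20) [d d0 hd] := hc _ (sO Ox ht); have [d' d'0 hd'] := Sc_box x t d0.
apply/nbhs_ballP; exists d' => //= s hs; apply: hU.
have := hd _ (hd' s _); rewrite /ball /= in hs *; rewrite distrC => /(_ hs).
by rewrite distrC; lra.
Qed.
Lemma Iop_cont m h x t : (forall y, O y -> {for y, continuous h}) -> O x -> 0 <= t <= 1 ->
  {for t, continuous (fun t => t ^+ m * h (Sc t x))}.
Proof.
move=> hc Ox ht; apply: continuousM; last exact: Sc_cont.
by apply: exprn_continuous.
Qed.
Lemma Iop_c01 m h x : (forall y, O y -> {for y, continuous h}) -> O x -> c01 (fun t => t ^+ m * h (Sc t x)).
Proof. by move=> hc Ox; apply: c01_at => t; exact: Iop_cont. Qed.

Lemma Sc_add t x i (r : R) : Sc t (r *: 'e_i + x) = Sc t x + (r * (if D i then t else 1)) *: 'e_i.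
Proof.
apply/rowP => j; rewrite !mxE eqxx /=; have [->|ij] := eqVneq j i; first by case: ifP => _; ring.
by rewrite !mulr0 add0r addr0.
Qed.

Lemma Iop_der m h x i : smooth_on O h -> O x ->
  is_derive x 'e_i (Iop m h) (Iop (m + D i) (partial i h) x).
Proof.
move=> sh Ox; apply/is_deriveP => e e0.
have ch y : O y -> {for y, continuous h} by exact: so_cont.
have cp y : O y -> {for y, continuous (partial i h)} by exact: (so_cont (so_partial i sh)).
have [d d0 hd] := tube cp Ox e0; have [d1 d10 hd1] := open_box oO Ox.
exists (Num.min d d1) => [|r]; first by rewrite lt_min d0.
rewrite lt_min => /andP [rd rd1].
have Or : O (r *: 'e_i + x).
  apply: hd1 => j; rewrite !mxE eqxx /= addrK normrM; apply: le_lt_trans rd1.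
  by rewrite -[X in _ <= X]mulr1; apply: ler_wpM2l => //; case: (j == i); rewrite ?normr1 ?normr0.
have c1 := @Iop_c01 m _ _ ch Or; have c2 := @Iop_c01 m _ _ ch Ox; have c3 := @Iop_c01 (m + D i) _ _ cp Ox.
rewrite /Iop -[_ - r * _](_ : - r * int01 (fun t => t ^+ (m + D i) * partial i h (Sc t x)) + (-1 * int01 (fun t => t ^+ m * h (Sc t x)) + int01 (fun t => t ^+ m * h (Sc t (r *: 'e_i + x)))) = _); last by ring.
have c4 : c01 (fun t => -1 * (t ^+ m * h (Sc t x)) + t ^+ m * h (Sc t (r *: 'e_i + x))).
  apply: c01_at => t ht; apply: continuousD; last exact: Iop_cont.
  by apply: continuousM; [exact: cst_continuous|exact: Iop_cont].
rewrite -(int01_lin _ c2 c1) -(int01_lin _ c3 c4); apply: int01_bound => [|t ht].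
  apply: c01_at => t ht; apply: continuousD; first by apply: continuousM; [exact: cst_continuous|exact: Iop_cont].
  apply: continuousD; last exact: Iop_cont.
  by apply: continuousM; [exact: cst_continuous|exact: Iop_cont].
have /andP [t0 t1] := ht; set b := if D i then t else 1.
have hb : `|r * b| <= `|r|.
  rewrite normrM -[X in _ <= X]mulr1; apply: ler_wpM2l => //.
  by rewrite /b; case: ifP => _; rewrite ?normr1 // ger0_norm.
have bx s : `|s| <= `|r * b| -> box (Sc t x) d (Sc t x + s *: 'e_i).
  move=> hs j; rewrite (_ : _ - _ = s * (j == i)%:R) ?normrM; last by rewrite !mxE eqxx /=; ring.
  apply: le_lt_trans rd; apply: le_trans (le_trans hs hb); rewrite -[X in _ <= X]mulr1.
  by apply: ler_wpM2l => //; case: (j == i); rewrite ?normr1 ?normr0.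
have [|s hs E] := @mvt_dir R n h (partial i h) i (Sc t x) (r * b).
  by move=> s /bx hs; have [Oz _] := hd t ht _ hs; exact: (so_der i sh Oz).
have tb : t ^+ (m + D i) = t ^+ m * b by rewrite exprD /b; case: (D i).
rewrite Sc_add -/b tb.
have -> : - r * (t ^+ m * b * partial i h (Sc t x)) + (-1 * (t ^+ m * h (Sc t x)) + t ^+ m * h (Sc t x + (r * b) *: 'e_i))
   = t ^+ m * ((h (Sc t x + (r * b) *: 'e_i) - h (Sc t x)) - (r * b) * partial i h (Sc t x)) by ring.
rewrite E -mulrBr !normrM; have [_ hp] := hd t ht _ (bx s hs).
have tm : `|t ^+ m| <= 1 by rewrite normrX ger0_norm // exprn_ile1.
rewrite -normrM mulrC; apply: le_trans (_ : (`|r| * e) * 1 <= _); last by rewrite mulr1 mulrC.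
by apply: ler_pM tm; rewrite ?mulr_ge0 ?normr_ge0 //; apply: ler_pM.
Qed.

Lemma Iop_smooth m h : smooth_on O h -> smooth_on O (Iop m h).
Proof.
move=> sh; apply: (@so_coind _ _ O [set f | exists m h, smooth_on O h /\ f = Iop m h] oO); last by exists m, h.
  move=> _ [{}m [{}h [{}sh ->]]] x Ox; apply/continuousP => e e0.
  have ch y : O y -> {for y, continuous h} by exact: so_cont.
  have [d d0 hd] := tube ch Ox e0; exists d => // y hy.
  have bS t : 0 <= t <= 1 -> box (Sc t x) d (Sc t y).
    move=> /andP [t0 t1] i; rewrite !mxE; case: ifP => _; last exact: hy.
    rewrite -mulrBr normrM (ger0_norm t0); apply: le_lt_trans (hy i).
    by rewrite -[X in _ <= X]mul1r; apply: ler_wpM2r.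
  have Oy : O y.
    have := hd 1; rewrite ler01 lexx => /(_ isT y) [|//] i.
    by rewrite !mxE mul1r; case: ifP => _; exact: hy.
  have c1 := @Iop_c01 m _ _ ch Oy; have c2 := @Iop_c01 m _ _ ch Ox.
  rewrite /Iop addrC -mulN1r -(int01_lin _ c2 c1); apply: int01_bound => [|t ht].
    apply: c01_at => t ht; apply: continuousD; last exact: Iop_cont.
    by apply: continuousM; [exact: cst_continuous|exact: Iop_cont].
  rewrite mulN1r addrC -mulrBr normrM; have [_ hp] := hd t ht _ (bS t ht).
  have /andP [t0 t1] := ht; rewrite -[X in _ <= X]mul1r; apply: ler_pM => //.
  by rewrite normrX ger0_norm // exprn_ile1.
move=> _ i [{}m [{}h [{}sh ->]]]; exists (Iop (m + D i) (partial i h)).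
  by exists (m + D i)%N, (partial i h); split; first exact: so_partial.
by move=> x Ox; exact: Iop_der.
Qed.

Lemma Sc_chain h x t : smooth_on O h -> O x -> 0 <= t <= 1 ->
  is_derive t 1 (fun t => h (Sc t x)) (\sum_(i | D i) x ord0 i * partial i h (Sc t x)).
Proof.
move=> sh Ox ht; apply/is_deriveP => e e0; have Ot := sO Ox ht.
have M0 : 0 < 1 + \sum_i `|x ord0 i| by rewrite ltr_pwDl // sumr_ge0.
have e1 : 0 < e / (1 + \sum_i `|x ord0 i|) by rewrite divr_gt0.
have [d d0 hd] := C1_approx oO sh Ot e1; have [d' d'0 hd'] := Sc_box x t d0.
exists d' => // r hr; rewrite -[r *: (1 : R)]/(r * 1) mulr1.
have := hd _ (hd' (r + t) _); rewrite addrK => /(_ hr).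
have dS i : Sc (r + t) x ord0 i - Sc t x ord0 i = r * (if D i then x ord0 i else 0).
  by rewrite !mxE; case: ifP => _; ring.
rewrite (eq_bigr (fun i => r * (if D i then x ord0 i * partial i h (Sc t x) else 0))); last first.
  by move=> i _; rewrite dS; case: ifP => _; ring.
rewrite -mulr_sumr -big_mkcond /= => H; apply: (le_trans H).
have -> : e * `|r| = e / (1 + \sum_i `|x ord0 i|) * ((1 + \sum_i `|x ord0 i|) * `|r|) by field; rewrite gt_eqF.
apply: ler_wpM2l; first exact: ltW.
rewrite mulrDl mul1r mulr_suml -[X in X <= _]add0r; apply: lerD => //; apply: ler_sum => i _.
by rewrite dS normrM mulrC; apply: ler_wpM2r => //; case: ifP => _; rewrite ?normr0.
Qed.

(** Fundamental theorem of calculus for t -> h (Sc t x) on [0, 1]. *)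
Lemma hadamard h x : smooth_on O h -> O x ->
  h x - h (Sc 0 x) = \sum_(i | D i) x ord0 i * Iop 0 (partial i h) x.
Proof.
move=> sh Ox; have S1 : Sc 1 x = x by apply/rowP => i; rewrite mxE mul1r; case: ifP.
have cp i y : O y -> {for y, continuous (partial i h)} by exact: (so_cont (so_partial i sh)).
have cs (r : seq 'I_n.+1) t : 0 <= t <= 1 -> {for t, continuous (fun t => \sum_(i <- r | D i) x ord0 i * partial i h (Sc t x))}.
  move=> ht; elim: r => [|i r IH].
    by rewrite (_ : (fun t => _) = fun=> 0); [exact: cst_continuous|apply/funext => s; rewrite big_nil].
  rewrite (_ : (fun t => _) = fun t => (if D i then x ord0 i * partial i h (Sc t x) else 0) + \sum_(i <- r | D i) x ord0 i * partial i h (Sc t x)).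
    apply: continuousD => //; case: (D i); last exact: cst_continuous.
    by apply: continuousM; [exact: cst_continuous|exact: (Sc_cont (cp i))].
  by apply/funext => s; rewrite big_cons; case: (D i); rewrite ?add0r.
have E : int01 (fun t => \sum_(i | D i) x ord0 i * partial i h (Sc t x)) = h (Sc 1 x) - h (Sc 0 x).
  by apply: (@int01_ftc R (fun t => h (Sc t x))) => t; [exact: cs|exact: Sc_chain].
rewrite S1 in E; rewrite -E.
have c0 i := @Iop_c01 0 _ _ (cp i) Ox.
have : forall r : seq 'I_n.+1, int01 (fun t => \sum_(i <- r | D i) x ord0 i * partial i h (Sc t x)) = \sum_(i <- r | D i) x ord0 i * Iop 0 (partial i h) x.
    elim=> [|i r IH].
      rewrite big_nil (_ : (fun t => _) = fun t => -1 * 0 + 0); last by apply/funext => t; rewrite big_nil mulr0 addr0.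
      by rewrite int01_lin ?mulN1r ?addNr //; apply: c01_at => t _; exact: cst_continuous.
    rewrite big_cons -IH; case: ifP => Di; last by congr int01; apply/funext => t; rewrite big_cons Di.
    rewrite /Iop -int01_lin //; last by apply: c01_at => t; exact: cs.
    by congr int01; apply/funext => t; rewrite big_cons Di expr0 mul1r.
exact.
Qed.

(** Fundamental theorem of calculus for t -> t h (Sc t x). For D reduced to one coordinate it says
    that x_0 times the average of h is a primitive of h. *)
Lemma Iop_euler h x : smooth_on O h -> O x ->
  h x = Iop 0 h x + \sum_(i | D i) x ord0 i * Iop 1 (partial i h) x.
Proof.
move=> sh Ox; have S1 : Sc 1 x = x by apply/rowP => i; rewrite mxE mul1r; case: ifP.
have ch y : O y -> {for y, continuous h} by exact: so_cont.
have cp i y : O y -> {for y, continuous (partial i h)} by exact: (so_cont (so_partial i sh)).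
pose psi t := 1 * (t ^+ 0 * h (Sc t x)) + \sum_(i | D i) x ord0 i * (t ^+ 1 * partial i h (Sc t x)).
have cs (r : seq 'I_n.+1) t : 0 <= t <= 1 -> {for t, continuous (fun t => \sum_(i <- r | D i) x ord0 i * (t ^+ 1 * partial i h (Sc t x)))}.
  move=> ht; elim: r => [|i r IH].
    by rewrite (_ : (fun t => _) = fun=> 0); [exact: cst_continuous|apply/funext => s; rewrite big_nil].
  rewrite (_ : (fun t => _) = fun t => (if D i then x ord0 i * (t ^+ 1 * partial i h (Sc t x)) else 0) + \sum_(i <- r | D i) x ord0 i * (t ^+ 1 * partial i h (Sc t x))).
    apply: continuousD => //; case: (D i); last exact: cst_continuous.
    by apply: continuousM; [exact: cst_continuous|exact: (@Iop_cont 1 _ _ _ (cp i) Ox ht)].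
  by apply/funext => s; rewrite big_cons; case: (D i); rewrite ?add0r.
have E : int01 psi = 1 * h (Sc 1 x) - 0 * h (Sc 0 x).
  apply: (@int01_ftc R (fun t => t * h (Sc t x)) psi) => t ht.
    apply: continuousD; last exact: cs.
    by apply: continuousM; [exact: cst_continuous|exact: Iop_cont].
  have h1 := @is_deriveM R R id (fun t => h (Sc t x)) t 1 _ _ (is_derive_id _ _) (Sc_chain sh Ox ht).
  apply: (is_derive_eq h1); rewrite /psi -![_ *: _]/(_ * _) /= expr0 mulr_sumr mulr1 mul1r addrC.
  by rewrite mul1r; congr (_ + _); apply: eq_bigr => i _; rewrite expr1; ring.
rewrite mul0r subr0 mul1r S1 in E; rewrite -E.
have : forall r : seq 'I_n.+1, int01 (fun t => 1 * (t ^+ 0 * h (Sc t x)) + \sum_(i <- r | D i) x ord0 i * (t ^+ 1 * partial i h (Sc t x)))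
   = Iop 0 h x + \sum_(i <- r | D i) x ord0 i * Iop 1 (partial i h) x; last exact.
have cc r : c01 (fun t => 1 * (t ^+ 0 * h (Sc t x)) + \sum_(i <- r | D i) x ord0 i * (t ^+ 1 * partial i h (Sc t x))).
  apply: c01_at => t ht; apply: continuousD; last exact: cs.
  by apply: continuousM; [exact: cst_continuous|exact: Iop_cont].
elim=> [|i r IH]; first by rewrite big_nil addr0; congr int01; apply/funext => t; rewrite big_nil addr0 mul1r.
rewrite big_cons; case: ifP => Di; last by rewrite -IH; congr int01; apply/funext => t; rewrite big_cons Di.
rewrite addrCA -IH -(int01_lin (x ord0 i) (@Iop_c01 1 _ _ (cp i) Ox) (cc r)).
by congr int01; apply/funext => t; rewrite big_cons Di; ring.
Qed.
End Star.

Lemma partial_shift (R : realType) (n : nat) (F : 'rV[R]_n.+1 -> R) (c : 'rV[R]_n.+1) i y :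
  partial i (fun y => F (y + c)) y = partial i F (y + c).
Proof.
rewrite /partial /derive /shift /=.
by have -> : (fun h : R => h^-1 *: (F (h *: delta_mx ord0 i + y + c) - F (y + c))) =
  (fun h : R => h^-1 *: (F (h *: delta_mx ord0 i + (y + c)) - F (y + c))) by apply/funext => h; rewrite addrA.
Qed.

Lemma so_shift (R : realType) (n : nat) (O O' : set 'rV[R]_n.+1) (F : 'rV[R]_n.+1 -> R) (c : 'rV[R]_n.+1) :
  open O -> open O' -> smooth_on O F -> (forall y, O' y -> O (y + c)) -> smooth_on O' (fun y => F (y + c)).
Proof.
move=> oO oO' sF h; rewrite (_ : (fun y => _) = fun y : 'rV[R]_n.+1 => F (\row_j (y ord0 j + c ord0 j))); last first.
  by apply/funext => y; congr F; apply/rowP => j; rewrite !mxE.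
apply: (so_comp oO' oO sF) => [j|y Oy].
  by apply: so_add => //; [exact: so_coord|exact: smooth_on_cst].
by have := h y Oy; congr O; apply/rowP => j; rewrite !mxE.
Qed.

(** * Charts *)

Section Chart.
Context {R : realType} {S : smooth_space R} {m : nat}.
Hypothesis pr : preregular S.
Notation V := 'rV[R]_m.+1.
Implicit Types (phi : S -> V) (D : S -> Prop) (half : bool) (p q r : S) (O : set V) (F : V -> R) (f u : S -> R).
Implicit Types (X : vfield S) (i j : 'I_m.+1).

(** Properties shared by the half-space charts of M (half = true) and by the charts of its interior
    and boundary (half = false). The last clause of [ch_bump] is what makes an extension by zero
    outside D smooth. *)
Record is_chart phi D half : Prop := IsChart {
  ch_bump : forall q O, D q -> open O -> O (phi q) -> exists chi : S -> R,
    [/\ smooth chi, 0 < chi q, forall r, chi r != 0 -> D r /\ O (phi r) &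
        forall r, ~ D r -> nearby r (fun s => chi s = 0)];
  ch_rep : forall f q, smooth f -> D q -> exists O F,
    [/\ open O, O (phi q), smooth_on O F & forall r, D r -> O (phi r) -> f r = F (phi r)];
  ch_lift : forall q O F, D q -> open O -> O (phi q) -> smooth_on O F ->
    exists2 f, smooth f & nearby q (fun r => f r = F (phi r));
  ch_img : forall q, D q -> exists O, [/\ open O, O (phi q) &
    forall x, O x -> (half -> 0 <= x ord0 ord0) -> exists2 r, D r & phi r = x];
  ch_half : half -> forall q, D q -> 0 <= phi q ord0 ord0
}.

Variables (phi : S -> V) (D : S -> Prop) (half : bool).
Hypothesis hc : is_chart phi D half.

Lemma chart_near q O : D q -> open O -> O (phi q) -> nearby q (fun r => D r /\ O (phi r)).
Proof.
move=> Dq oO Oq; have [chi [sc c0 h _]] := ch_bump hc Dq oO Oq.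
by exists (exist _ chi sc); rewrite /sfun_val /= ?gt_eqF.
Qed.

Lemma nearby_chart q (P : S -> Prop) : D q -> nearby q P ->
  exists O, [/\ open O, O (phi q) & forall r, D r -> O (phi r) -> P r].
Proof.
move=> Dq [c c0 h]; have [ O [F [ oO Oq sF e]]] := ch_rep hc (sfun_sm c) Dq.
have /continuousP := so_cont sF Oq; rewrite -e // => /(_ (`|c q| / 2)).
have c1 : 0 < `|c q| by rewrite normr_gt0.
case=> [|d d0 hd]; first by lra.
exists (O `&` [set y | box (phi q) d y]); split.
- by apply: openI => //; exact: box_open.
- by split=> // i; rewrite subrr normr0.
move=> r Dr [Or br]; apply: h; rewrite e //; apply: contraTN isT => /eqP z.
have := hd _ br; rewrite z sub0r normrN; lra.
Qed.

(** At a boundary point of the half-space the two functions may differ on every neighbourhood. Their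
    derivatives agree at interior points, and x is approached from there by moving a little in
    direction 0. *)
Lemma partial_half O F1 F2 x i : open O -> smooth_on O F1 -> smooth_on O F2 -> O x -> (half -> 0 <= x ord0 ord0) ->
  (forall y, O y -> (half -> 0 <= y ord0 ord0) -> F1 y = F2 y) -> partial i F1 x = partial i F2 x.
Proof.
move=> oO s1 s2 Ox hx e.
have interior y : O y -> (half -> 0 < y ord0 ord0) -> partial i F1 y = partial i F2 y.
  move=> Oy hy; apply: near_eq_derive; apply/nbhs_box; have [d d0 hd] := open_box oO Oy.
  case: half hy e => hy e; last by exists d => // z /hd Oz; exact: e.
  have y0 := hy isT; exists (Num.min d (y ord0 ord0)); first by rewrite lt_min d0.
  move=> z hz; apply: e => [|_]; first by apply: hd => j; apply: lt_le_trans (hz j) _; rewrite ge_min lexx.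
  have := hz ord0; rewrite lt_min => /andP [_]; rewrite ltr_norml; lra.
have [/negP hf|hf] := boolP (~~ half); first by apply: interior => // h; case: hf.
rewrite negbK in hf; have x0 := hx hf.
apply/eqP; rewrite -subr_eq0 -normr_le0; apply/ler_addgt0Pl => e1 e10; rewrite addr0.
have e20 : 0 < e1 / 2 by lra.
have /continuousP /(_ _ e20) [d1 d10 h1] := so_cont (so_partial i s1) Ox.
have /continuousP /(_ _ e20) [d2 d20 h2] := so_cont (so_partial i s2) Ox.
have [d3 d30 h3] := open_box oO Ox.
pose d := Num.min d1 (Num.min d2 d3) / 2.
have dp : 0 < d by rewrite divr_gt0 // !lt_min d10 d20.
have [dd1 dd2 dd3] : [/\ d < d1, d < d2 & d < d3].
  have : 0 < Num.min d1 (Num.min d2 d3) by rewrite !lt_min d10 d20.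
  move=> M0; have : d < Num.min d1 (Num.min d2 d3) by rewrite /d; lra.
  by rewrite !lt_min => /and3P [].
pose y := x + d *: (delta_mx ord0 ord0 : V).
have by' j : `|y ord0 j - x ord0 j| <= d.
  rewrite (_ : y ord0 j - x ord0 j = d * (j == ord0)%:R); last by rewrite !mxE eqxx /=; ring.
  rewrite normrM (ger0_norm (ltW dp)) -[X in _ <= X]mulr1.
  by apply: ler_wpM2l; [exact: ltW|case: (j == _); rewrite ?normr1 ?normr0].
have ye : partial i F1 y = partial i F2 y.
  apply: interior => [|_]; first by apply: h3 => j; exact: le_lt_trans (by' j) dd3.
  by rewrite !mxE eqxx /= mulr1; lra.
have := h1 y (fun j => le_lt_trans (by' j) dd1); have := h2 y (fun j => le_lt_trans (by' j) dd2).
rewrite ye => k2 k1; have := ler_normB (partial i F2 y - partial i F2 x) (partial i F2 y - partial i F1 x).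
rewrite (_ : partial i F2 y - _ - _ = partial i F1 x - partial i F2 x); last by ring.
by lra.
Qed.

Definition reps f q O F := [/\ open O, O (phi q), smooth_on O F & nearby q (fun r => f r = F (phi r))].

Lemma ch_reps f q : smooth f -> D q -> exists O F, reps f q O F.
Proof.
move=> sf Dq; have [ O [F [ oO Oq sF e]]] := ch_rep hc sf Dq.
exists O, F; split=> //; apply: nearbyW (chart_near Dq oO Oq) => r [Dr Or]; exact: e.
Qed.

Lemma reps_unique f q O1 F1 O2 F2 i : D q -> reps f q O1 F1 -> reps f q O2 F2 ->
  partial i F1 (phi q) = partial i F2 (phi q).
Proof.
move=> Dq [ o1 q1 s1 e1] [ o2 q2 s2 e2].
have [ O3 [ o3 q3 e3]] := nearby_chart Dq (nearbyI pr e1 e2); have [ O4 [ o4 q4 e4]] := ch_img hc Dq.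
pose O := (O1 `&` O2) `&` (O3 `&` O4).
have oO : open O by do !apply: openI.
apply: (@partial_half O) => //.
- by apply: so_sub s1 => y [[]].
- by apply: so_sub s2 => y [[]].
- by move=> h; exact: (ch_half hc h Dq).
- move=> y [[y1 y2] [y3 y4]] hy; have [r Dr er] := e4 y y4 hy; rewrite -er in y3 *.
  by have [<- <-] := e3 r Dr y3.
Qed.

(** The i-th coordinate derivative; by [reps_unique] it does not depend on the local extension of f
    used to compute it. *)
Definition pd i f q : R := such_that 0 [set a | exists O F, reps f q O F /\ a = partial i F (phi q)].

Lemma pdE i f q O F : D q -> reps f q O F -> pd i f q = partial i F (phi q).
Proof.
move=> Dq h.
have [ O' [F' [h' ->]]] : [set a | exists O F, reps f q O F /\ a = partial i F (phi q)] (pd i f q).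
  by apply: such_thatP; exists (partial i F (phi q)), O, F.
exact: (reps_unique i Dq h' h).
Qed.

Lemma pd_near i f q O F : D q -> reps f q O F -> nearby q (fun r => D r /\ pd i f r = partial i F (phi r)).
Proof.
move=> Dq [ oO Oq sF e]; apply: nearbyW (nearbyI pr (chart_near Dq oO Oq) (nearby_nearby e)) => r [[Dr Or] er].
by split=> //; apply: (pdE i (O := O)).
Qed.

(** The field chi d/dx_i, extended by zero; the hypothesis at the points outside D is its smoothness
    there. *)
Lemma field_ex chi i : smooth chi -> (forall r, chi r != 0 -> D r) -> (forall r, ~ D r -> nearby r (fun s => chi s = 0)) ->
  exists X, forall f q, smooth f -> der X f q = chi q * pd i f q.
Proof.
move=> sc hD h0; suff [X hX] : exists X, forall u, smooth u -> der X u = fun q => chi q * pd i u q.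
  by exists X => f q sf; rewrite hX.
apply: (mkvf_ex (F := fun u q => chi q * pd i u q)).
- move=> u su; apply: (sm_local pr) => q; have [Dq|nD] := pselect (D q); last first.
    exists (fun=> 0); first exact: smooth_cst.
    by apply: nearbyW (h0 q nD) => r ->; rewrite mul0r.
  have [ O [F h]] := ch_reps su Dq; have [ oO Oq sF e] := h.
  have [g sg eg] := ch_lift hc Dq oO Oq (so_partial i sF).
  exists (fun r => chi r * g r); first exact: (smM pr).
  by apply: nearbyW (nearbyI pr eg (pd_near i Dq h)) => r [-> [_ ->]].
- move=> a f g q sf sg; have [->|cq] := eqVneq (chi q) 0; first by rewrite !mul0r mulr0 addr0.
  have Dq := hD q cq; have [ O1 [F1 h1]] := ch_reps sf Dq; have [ O2 [F2 h2]] := ch_reps sg Dq.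
  rewrite (pdE i Dq h1) (pdE i Dq h2); have [ o1 q1 s1 e1] := h1; have [ o2 q2 s2 e2] := h2.
  have oI := openI o1 o2; have t1 := so_sub (@subIsetl _ O1 O2) s1; have t2 := so_sub (@subIsetr _ O1 O2) s2.
  rewrite (pdE i Dq (O := O1 `&` O2) (F := fun y => a * F1 y + F2 y)); last first.
    split; [exact: oI|by split|exact: (so_add oI (so_mul oI (@smooth_on_cst R m (O1 `&` O2) a) t1) t2)|].
    by apply: nearbyW (nearbyI pr e1 e2) => r [-> ->].
  have d1 := so_der i s1 q1; have d2 := so_der i s2 q2.
  have dd := is_deriveD (is_deriveZ a d1) d2; have [_ E] := dd.
  rewrite (_ : partial i _ _ = a * partial i F1 (phi q) + partial i F2 (phi q)); first by ring.
  exact: E.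
- move=> f g q sf sg; have [->|cq] := eqVneq (chi q) 0; first by rewrite !mul0r mulr0 addr0.
  have Dq := hD q cq; have [ O1 [F1 h1]] := ch_reps sf Dq; have [ O2 [F2 h2]] := ch_reps sg Dq.
  rewrite (pdE i Dq h1) (pdE i Dq h2); have [ o1 q1 s1 e1] := h1; have [ o2 q2 s2 e2] := h2.
  have oI := openI o1 o2; have t1 := so_sub (@subIsetl _ O1 O2) s1; have t2 := so_sub (@subIsetr _ O1 O2) s2.
  rewrite (pdE i Dq (O := O1 `&` O2) (F := fun y => F1 y * F2 y)); last first.
    by split; [exact: oI|split|exact: (so_mul oI t1 t2)|apply: nearbyW (nearbyI pr e1 e2) => r [-> ->]].
  have [_ E] := is_deriveM (so_der i s1 q1) (so_der i s2 q2).
  rewrite (nearby_sub e1) (nearby_sub e2).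
  rewrite (_ : partial i _ _ = F1 (phi q) * partial i F2 (phi q) + F2 (phi q) * partial i F1 (phi q)); first by ring.
  exact: E.
Qed.

Lemma der_taylor X u p (x g : 'I_m.+1 -> S -> R) a : smooth u -> (forall i, smooth (x i)) -> (forall i, smooth (g i)) ->
  nearby p (fun r => u r = a + \sum_i (x i r - x i p) * g i r) -> der X u p = \sum_i der X (x i) p * g i p.
Proof.
move=> su sx sg e.
have st i : smooth (fun r => (x i r - x i p) * g i r).
  by apply: (smM pr) => //; apply: (smB pr) => //; exact: smooth_cst.
rewrite (der_near pr X su (v := fun r => a + \sum_i (x i r - x i p) * g i r)) //; last first.
  by apply: (smD pr); [exact: smooth_cst|exact: (sm_sum pr)].
rewrite (derD pr) ?(der_cst pr) ?add0r; [|exact: smooth_cst|exact: (sm_sum pr)].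
rewrite (der_sum pr) //; apply: eq_bigr => i _.
rewrite (derM pr) ?(derB pr) ?(der_cst pr) ?subrr ?mul0r ?add0r ?subr0 //; try exact: smooth_cst.
by apply: (smB pr) => //; exact: smooth_cst.
Qed.

Lemma box_star (d : R) (P : pred 'I_m.+1) x t : box (0 : V) d x -> 0 <= t <= 1 -> box (0 : V) d (Sc P t x).
Proof.
move=> h /andP [t0 t1] i; have := h i; rewrite !mxE !subr0; case: ifP => _ // hi.
rewrite normrM (ger0_norm t0); apply: le_lt_trans hi.
by rewrite -[X in _ <= X]mul1r; apply: ler_wpM2r.
Qed.

Lemma taylor u p O F (x : 'I_m.+1 -> S -> R) : smooth u -> D p -> reps u p O F ->
  (forall i, nearby p (fun r => x i r = phi r ord0 i)) -> exists g : 'I_m.+1 -> S -> R,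
  [/\ forall i, smooth (g i), forall i, g i p = partial i F (phi p) &
      nearby p (fun r => u r = u p + \sum_i (x i r - x i p) * g i r)].
Proof.
move=> su Dp [ oO Op sF e] ex; set c := phi p.
have [d d0 hd] := open_box oO Op.
pose B := [set y : V | box (0 : V) d y]; pose B' := [set y : V | box c d y].
have oB : open B by exact: box_open.
have oB' : open B' by exact: box_open.
have B0 : B 0 by move=> i; rewrite subrr normr0.
have B'c : B' c by move=> i; rewrite subrr normr0.
have BO y : B y -> O (y + c) by move=> h; apply: hd => i; have := h i; rewrite !mxE subr0 addrK.
have B'B y : B' y -> B (y - c) by move=> h i; have := h i; rewrite !mxE subr0.
pose F0 y := F (y + c); have sF0 : smooth_on B F0 by exact: so_shift sF BO.
have sB y t : B y -> 0 <= t <= 1 -> B (Sc predT t y) by exact: box_star.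
pose G i y := Iop predT 0 (partial i F0) (y - c).
have sG i : smooth_on B' (G i).
  exact: (so_shift oB oB' (Iop_smooth oB sB 0 (so_partial i sF0)) B'B).
have /choice [g hg] : forall i, exists g, smooth g /\ nearby p (fun r => g r = G i (phi r)).
  by move=> i; have [g ? ?] := ch_lift hc Dp oB' B'c (sG i); exists g.
exists g; split; first by move=> i; have [] := hg i.
- move=> i; rewrite (nearby_sub (hg i).2) /G subrr.
  have := Iop_euler oB sB (so_partial i sF0) B0; rewrite big1 ?addr0 => [<-|j _]; last by rewrite mxE mul0r.
  by rewrite partial_shift add0r.
- have := nearbyI pr (nearbyI pr (chart_near Dp oB' B'c) e) (nearbyI pr (nearby_fin pr (fun i => (hg i).2)) (nearby_fin pr ex)).
  apply: nearbyW => r [[[Dr Br] er] [gr xr]]; rewrite er.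
  have := hadamard oB sB sF0 (B'B _ Br); rewrite /F0 subrK.
  have -> : Sc predT 0 (phi r - c) + c = c by apply/rowP => i; rewrite !mxE mul0r add0r.
  move=> h; rewrite -[LHS](subrK (F c)) h addrC (nearby_sub e); congr (_ + _); apply: eq_bigr => i _.
  by rewrite gr /G xr (nearby_sub (ex i)) !mxE.
Qed.

(** Write u = u(p) + sum (x_i - x_i(p)) g_i with smooth g_i near p, by Hadamard's lemma: the Leibniz
    rule leaves only the terms X(x_i) g_i(p). Thus derivations are tangent vectors. *)
Lemma der_chart X u p O F (x : 'I_m.+1 -> S -> R) : smooth u -> D p -> reps u p O F -> (forall i, smooth (x i)) ->
  (forall i, nearby p (fun r => x i r = phi r ord0 i)) -> der X u p = \sum_i der X (x i) p * partial i F (phi p).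
Proof.
move=> su Dp h sx ex; have [g [sg gp e]] := taylor su Dp h ex.
by rewrite (der_taylor X su sx sg e); apply: eq_bigr => i _; rewrite gp.
Qed.

Lemma coords_ex p : D p -> exists x, (forall i, smooth (x i)) /\ forall i, nearby p (fun r => x i r = phi r ord0 i).
Proof.
move=> Dp; have /choice [x hx] : forall i, exists x, smooth x /\ nearby p (fun r => x r = phi r ord0 i).
  by move=> i; have [x ? ?] := ch_lift hc Dp openT I (so_coord i openT); exists x.
by exists x; split=> i; have [] := hx i.
Qed.

Lemma comp_local f p (psi : R -> R) : smooth f -> D p ->
  (forall O F, open O -> O (phi p) -> smooth_on O F -> F (phi p) = f p ->
     exists O', [/\ open O', O' (phi p) & smooth_on O' (fun y => psi (F y))]) ->
  exists2 h, smooth h & nearby p (fun r => h r = psi (f r)).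
Proof.
move=> sf Dp H; have [ O [F [ oO Op sF e]]] := ch_reps sf Dp.
have [ O' [ oO' O'p s]] := H O F oO Op sF (esym (nearby_sub e)).
have [h sh eh] := ch_lift hc Dp oO' O'p s; exists h => //.
by apply: nearbyW (nearbyI pr eh e) => r [-> ->].
Qed.
End Chart.

Section Atlas.
Context {R : realType} {S : smooth_space R} {m : nat}.
Definition atlas := preregular S /\ forall p : S, exists phi : S -> 'rV[R]_m.+1, exists D half, D p /\ is_chart phi D half.
Hypothesis at_ : atlas.
Let pr : preregular S := at_.1.

Lemma pos_open (O : set 'rV[R]_m.+1) F x : open O -> smooth_on O F -> O x -> 0 < F x ->
  exists O', [/\ open O', O' x, O' `<=` O & forall y, O' y -> 0 < F y].
Proof.
move=> oO sF Ox Fx; have F2 : 0 < F x / 2 by lra.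
have /continuousP /(_ _ F2) [d d0 hd] := so_cont sF Ox.
exists (O `&` [set y | box x d y]); split.
- by apply: openI => //; exact: box_open.
- by split=> // i; rewrite subrr normr0.
- by move=> y [].
- by move=> y [_ /hd]; rewrite ler_norml => /andP []; lra.
Qed.

Lemma exp_smooth (f : S -> R) : smooth f -> smooth (fun p => expR (f p)).
Proof.
move=> sf; apply: (sm_local pr) => p; have [phi [D [half [Dp hc]]]] := at_.2 p.
have [ O F oO Op sF _|h sh eh] := comp_local pr hc (psi := expR) sf Dp.
  by exists O; split; [exact: oO|exact: Op|exact: (so_exp oO sF)].
by exists h => //; apply: nearbyW eh => r ->.
Qed.

Lemma ln_near (f : S -> R) p : smooth f -> 0 < f p -> exists2 h, smooth h & nearby p (fun r => h r = ln (f r)).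
Proof.
move=> sf fp; have [phi [D [half [Dp hc]]]] := at_.2 p.
apply: (comp_local pr hc sf Dp) => O F oO Op sF e.
have [ O' [ oO' O'p sub h]] := pos_open oO sF Op (eq_ind_r (fun a => 0 < a) fp e).
by exists O'; split=> //; apply: so_ln => //; exact: so_sub sF.
Qed.

Lemma nearby_pos (f : S -> R) p : smooth f -> 0 < f p -> nearby p (fun r => 0 < f r).
Proof.
move=> sf fp; have [phi [D [half [Dp hc]]]] := at_.2 p.
have [ O [F [ oO Op sF e]]] := ch_reps hc sf Dp; have Fp : 0 < F (phi p) by rewrite -(nearby_sub e).
have [ O' [ oO' O'p sub h]] := pos_open oO sF Op Fp.
by apply: nearbyW (nearbyI pr e (chart_near hc Dp oO' O'p)) => r [-> [_ /h]].
Qed.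

Lemma der_exp X (f : S -> R) p : smooth f -> der X (fun q => expR (f q)) p = expR (f p) * der X f p.
Proof.
move=> sf; have [phi [D [half [Dp hc]]]] := at_.2 p; have [x [sx ex]] := coords_ex hc Dp.
have [ O [F [ oO Op sF e]]] := ch_reps hc sf Dp.
rewrite (der_chart pr hc X sf Dp (O := O) (F := F) (x := x)) //.
rewrite (der_chart pr hc X (exp_smooth sf) Dp (O := O) (F := fun y => expR (F y)) (x := x) _ sx ex); last first.
  by split; [exact: oO|exact: Op|exact: (so_exp oO sF)|apply: nearbyW e => r ->].
rewrite mulr_sumr; apply: eq_bigr => i _; rewrite mulrCA; congr (_ * _).
have /is_deriveP dF := so_der i sF Op.
have dE : is_derive (phi p) (delta_mx ord0 i) (fun y => expR (F y)) (expR (F (phi p)) * partial i F (phi p)).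
  have d1 : is_derive (0 : R) (1 : R) (fun t : R => F (t *: delta_mx ord0 i + phi p)) (partial i F (phi p)).
    apply/is_deriveP => e1 /dF [d d0 hd]; exists d => // h /hd.
    by rewrite scale0r add0r -[h *: (1 : R)]/(h * 1) mulr1 addr0.
  have := is_derive_expR (F (0 *: delta_mx ord0 i + phi p)) => d2.
  have /is_deriveP H := @is_derive1_comp R expR _ 0 _ _ d2 d1.
  apply/is_deriveP => e1 /H [d d0 hd]; exists d => // h /hd /=.
  by rewrite -[h *: (1 : R)]/(h * 1) mulr1 addr0 scale0r add0r.
by rewrite (nearby_sub e); have [_ E] := dE; exact: E.
Qed.

Lemma ln_smooth (f : S -> R) : smooth f -> (forall p, 0 < f p) -> smooth (fun p => ln (f p)).
Proof.
move=> sf f0; apply: (sm_local pr) => p; have [h sh eh] := ln_near sf (f0 p).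
by exists h => //; apply: nearbyW eh => r ->.
Qed.

Lemma atlas_log_closed : log_closed (S := S).
Proof.
move=> Om [sO O0]; have sl := ln_smooth sO O0; split=> // X p.
have {1}-> : Om = fun q => expR (ln (Om q)) by apply/funext => q; rewrite lnK // posrE.
by rewrite der_exp // lnK // posrE.
Qed.

(** f may vanish or change sign far from p, so its logarithm is first replaced by a global smooth
    function that equals it near p; the exponential is then positive everywhere. *)
Lemma atlas_hinv (f : S -> R) p : smooth f -> 0 < f p ->
  exists2 Om, positive_smooth Om & nearby p (fun q => Om q * f q = 1).
Proof.
move=> sf fp; have [h sh eh] := ln_near sf fp.
exists (fun q => expR (- h q)); first by split; [apply: exp_smooth; exact: (smN pr)|move=> q; exact: expR_gt0].
apply: nearbyW (nearbyI pr eh (nearby_pos sf fp)) => q [-> f0].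
by rewrite expRN lnK ?posrE // mulVf // gt_eqF.
Qed.

Lemma chart_coords p (phi : S -> 'rV[R]_m.+1) D half : D p -> is_chart phi D half -> exists x E,
  [/\ forall i, smooth (x i), forall i, nearby p (fun r => x i r = phi r ord0 i), nearby p (coords x E) &
      nearby p (fun q => forall i f, smooth f -> der (E i) f q = pd phi i f q)].
Proof.
move=> Dp hc; have [x [sx ex]] := coords_ex hc Dp.
have [chi [sc c0 hD h0]] := ch_bump hc Dp openT I.
(* om chi = 1 near p, so that the fields om chi d/dx_i are the coordinate fields there. *)
have [om pom eom] := atlas_hinv sc c0.
have so : smooth (fun q => om q * chi q) by apply: (smM pr) => //; case: pom.
have /choice [E hE] : forall i, exists X, forall f q, smooth f -> der X f q = om q * chi q * pd phi i f q.
  move=> i; apply: (field_ex pr hc i so).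
    by move=> r; rewrite mulf_eq0 negb_or => /andP [_ /hD []].
  by move=> r /h0; apply: nearbyW => s ->; rewrite mulr0.
exists x, E; split=> //; last first.
  by apply: nearbyW eom => q om1 i f sf; rewrite hE // om1 mul1r.
have nx : nearby p (fun q => D q /\ forall i, nearby q (fun r => x i r = phi r ord0 i)).
  apply: nearbyW (nearbyI pr (chart_near hc Dp openT I) (nearby_fin pr (fun i => nearby_nearby (ex i)))) => q [[Dq _] h].
  by split.
apply: nearbyW (nearbyI pr nx eom) => q [[Dq exq] om1].
have pdx i j : der (E i) (x j) q = (i == j)%:R.
  rewrite hE // om1 mul1r (pdE pr hc i Dq (O := setT) (F := fun y => y ord0 j)); last first.
    by split; [exact: openT| |exact: so_coord openT|exact: exq].
  have : is_derive (phi q) (delta_mx ord0 i) (fun y : 'rV[R]_m.+1 => y ord0 j) (i == j)%:R.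
    apply/is_deriveP => e e0; exists 1 => // h _; rewrite !mxE eqxx /= eq_sym (_ : _ - _ = 0) ?normr0; last by ring.
    by rewrite mulr_ge0 // ltW.
  by case.
split=> // X u; have [su|nu] := pselect (smooth u); last first.
  by rewrite (der_ns X nu) big1 // => i _; rewrite (der_ns (E i) nu) mulr0.
have [ O [F h]] := ch_reps hc su Dq; rewrite (der_chart pr hc X su Dq h sx exq).
apply: eq_bigr => i _; congr (_ * _); rewrite hE // om1 mul1r.
by rewrite (pdE pr hc i Dq h).
Qed.
Lemma atlas_regular : regular S m.+1.
Proof.
split; [exact: pr|exact: ln_smooth| |] => [f p sf fp|p].
  have [h sh eh] := ln_near sf fp; exists (fun q => expR (- 2^-1 * h q)).
    by apply: exp_smooth; apply: (smM pr) => //; exact: smooth_cst.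
  apply: nearbyW (nearbyI pr eh (nearby_pos sf fp)) => q [-> f0]; split; first exact: expR_gt0.
  rewrite -expRM_natl -{2}[f q]lnK ?posrE // -expRD (_ : _ + _ = 0) ?expR0 //; by field.
have [phi [D [half [Dp hc]]]] := at_.2 p; have [x [E [sx _ nE _]]] := chart_coords Dp hc.
by exists x, E.
Qed.
End Atlas.

(** * Bump functions *)

Section Bump.
Context {R : realType} {n : nat}.
Notation V := 'rV[R]_n.+1.
Implicit Types (c x y : V) (U : set V) (f F G : V -> R).

Lemma so_local U f : (forall x, U x -> exists U' F, [/\ open U', U' x, smooth_on U' F & forall y, U' y -> f y = F y]) ->
  smooth_on U f.
Proof.
move=> h s x Ux; have [U' [F [oU' U'x sF e]]] := h x Ux.
by apply: (so_eq oU' sF) => // y /e.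
Qed.

Definition step (t : R) := flat 0 t * (flat 0 t + flat 0 (1 - t))^-1.
Lemma flat_gt0 (t : R) : 0 < t -> 0 < flat 0 t.
Proof. by move=> t0; rewrite /flat t0 expr0 mul1r expR_gt0. Qed.
Lemma flat_le0 (t : R) : t <= 0 -> flat 0 t = 0.
Proof. by move=> t0; rewrite /flat ltNge t0. Qed.
Lemma step_den (t : R) : flat 0 t + flat 0 (1 - t) != 0.
Proof.
rewrite gt_eqF //; have [t0|t0] := ltP 0 t; first by rewrite ltr_pwDl ?flat_gt0 ?flat_ge0.
by rewrite ltr_wpDl ?flat_ge0 // flat_gt0 //; lra.
Qed.
Lemma step1 (t : R) : 1 <= t -> step t = 1.
Proof. by move=> t1; have := step_den t; rewrite /step (@flat_le0 (1 - t)) ?addr0; [exact: divff|lra]. Qed.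
Lemma step0 (t : R) : t <= 0 -> step t = 0.
Proof. by move=> t0; rewrite /step flat_le0 // mul0r. Qed.
Lemma so_step U f : open U -> smooth_on U f -> smooth_on U (fun x => step (f x)).
Proof.
move=> oU sf; have s1 : smooth_on U (fun x => 1 - f x).
  have sN := so_mul oU (@smooth_on_cst R n U (-1)) sf.
  by apply: (so_eq oU (so_add oU (@smooth_on_cst R n U 1) sN)) => x _; rewrite mulN1r.
have s2 := so_flat oU sf; have s3 := so_flat oU s1.
exact: (so_mul oU s2 (so_inv oU (so_add oU s2 s3) (fun x _ => step_den (f x)))).
Qed.

Lemma open_forall (I : finType) (Q : I -> V -> Prop) : (forall a, open [set y | Q a y]) -> open [set y | forall a, Q a y].
Proof.
move=> h; rewrite openE => y hy.
have h' a : exists d : R, 0 < d /\ forall z, box y d z -> Q a z.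
  by have [d d0 hd] := open_box (h a) (hy a); exists d; split=> // z /hd.
have [d hd] := choice h'; have [d' [d'0 _ hd']] := fin_min (@ltr01 R) (fun a => (hd a).1).
apply/nbhs_box; exists d' => // z hz a; apply: (hd a).2 => i; exact: lt_le_trans (hz i) (hd' a).
Qed.

Definition cbox c (d : R) y := forall i, `|y ord0 i - c ord0 i| <= d.

(** The argument 2 - 2 s^2 is at least 1 for |s| <= 1/2 and at most 0 for |s| >= 1; squaring keeps
    it smooth where an absolute value would not. *)
Definition plateau c (d : R) (y : V) := \prod_(i < n.+1) step (2 - 2 * ((y ord0 i - c ord0 i) / d) ^+ 2).

Lemma plateau_smooth c d : smooth_on setT (plateau c d).
Proof.
have oT : open (setT : set V) by exact: openT.
have h : forall s : seq 'I_n.+1, smooth_on setT (fun y : V => \prod_(i <- s) step (2 - 2 * ((y ord0 i - c ord0 i) / d) ^+ 2)).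
  elim=> [|i s IH]; first by apply: (so_eq oT (@smooth_on_cst R n setT 1)) => y _; rewrite big_nil.
  have s1 : smooth_on setT (fun y : V => (y ord0 i + - c ord0 i) * d^-1).
    exact: (so_mul oT (so_add oT (so_coord i oT) (@smooth_on_cst R n setT (- c ord0 i))) (@smooth_on_cst R n setT d^-1)).
  have s2 : smooth_on setT (fun y : V => step (2 + (-2) * (((y ord0 i + - c ord0 i) * d^-1) * ((y ord0 i + - c ord0 i) * d^-1)))).
    exact: (so_step oT (so_add oT (@smooth_on_cst R n setT 2) (so_mul oT (@smooth_on_cst R n setT (-2)) (so_mul oT s1 s1)))).
  apply: (so_eq oT (so_mul oT s2 IH)) => y _; rewrite big_cons; congr (step _ * _).
  by rewrite expr2; ring.
exact: h.
Qed.

Lemma plateau1 c d y : 0 < d -> box c (d / 2) y -> plateau c d y = 1.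
Proof.
move=> d0 h; apply: big1 => i _; apply: step1.
have := h i; set t := _ - _ => ht; have : `|t / d| <= 1 / 2.
  by rewrite normrM normfV (gtr0_norm d0) ler_pdivrMr //; lra.
by rewrite ler_norml expr2 => /andP []; nra.
Qed.

Lemma plateau0 c d y : 0 < d -> ~ cbox c d y -> plateau c d y = 0.
Proof.
move=> d0 /existsNP [i /negP]; rewrite -ltNge => h; rewrite /plateau (bigD1 i) //= step0 ?mul0r //.
set t := _ - _ in h *; have : 1 <= `|t / d|.
  by rewrite normrM normfV (gtr0_norm d0) ler_pdivlMr // mul1r ltW.
by rewrite ler_normr expr2 => /orP []; nra.
Qed.

Lemma cbox_closed c d : closed [set y | cbox c d y].
Proof.
rewrite -openC openE => y /existsNP [i /negP]; rewrite -ltNge => h.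
apply/nbhs_box; exists (`|y ord0 i - c ord0 i| - d) => [|z hz]; first by lra.
apply/existsNP; exists i; apply/negP; rewrite -ltNge; have := hz i.
have := ler_normD (y ord0 i - z ord0 i) (z ord0 i - c ord0 i); rewrite addrA subrK [`|y ord0 i - z ord0 i|]distrC; lra.
Qed.

Lemma bump c U G : open U -> U c -> smooth_on U G -> exists H (d : R),
  [/\ 0 < d, smooth_on setT H, forall y, box c (d / 2) y -> H y = G y,
      forall y, ~ cbox c d y -> H y = 0 & forall y, cbox c d y -> U y].
Proof.
move=> oU Uc sG; have [d' d'0 hd'] := open_box oU Uc.
pose d := d' / 2; have d0 : 0 < d by rewrite divr_gt0.
have cU y : cbox c d y -> U y by move=> h; apply: hd' => i; apply: le_lt_trans (h i) _; rewrite /d; lra.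
exists (fun y => if `[< cbox c d y >] then plateau c d y * G y else 0), d; split=> //.
- apply: so_local => x _; have [Ux|nU] := pselect (U x).
    exists U, (fun y => plateau c d y * G y); split=> //.
      exact: (so_mul oU (so_sub (@subsetT _ U) (plateau_smooth c d)) sG).
    by move=> y _; case: asboolP => // /(plateau0 d0) ->; rewrite mul0r.
  exists (~` [set y | cbox c d y]), (fun=> 0); split.
  + by rewrite openC; exact: cbox_closed.
  + by move=> /cU.
  + exact: smooth_on_cst.
  + by move=> y; case: asboolP.
- move=> y h; rewrite plateau1 // mul1r asboolT // => i; apply: ltW; apply: lt_le_trans (h i) _; lra.
- by move=> y h; rewrite asboolF.
Qed.
End Bump.

(** * The charts of a manifold with boundary *)

Section Manifold.
Context {R : realType} {n : nat} (M : bmanifold R n).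
Notation V := 'rV[R]_n.+1.
Implicit Types (i j : chart_index M) (p q r : M) (U : set V) (F G : V -> R) (f : M -> R).

Lemma chart_nbhd i (W : set M) q : open W -> W q -> dom i q ->
  exists U, [/\ open U, U (chart i q) & forall r, dom i r -> U (chart i r) -> W r].
Proof.
move=> oW Wq Dq; have [U oU e] := @chart_open _ _ M i (W `&` dom i) (openI oW (@dom_open _ _ M i)) (@subIsetr _ _ _).
exists U; split=> //.
  have : (chart i @` (W `&` dom i)) (chart i q) by exists q.
  by rewrite e => -[].
move=> r Dr Ur; have : (U `&` @half_space R n) (chart i r) by split=> //; exact: chart_half.
rewrite -e => -[r' [Wr' Dr'] /(@chart_inj _ _ M i r' r)]; rewrite !inE => <- //.
Qed.

Lemma smoothM_continuous f q : smooth (s := M) f -> forall (P : set R), open P -> P (f q) ->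
  exists2 W : set M, open W & W q /\ forall r, W r -> P (f r).
Proof.
move=> sf P oP Pf; have [i Dq] := @dom_cover _ _ M q; have [U [F [oU Uq sF e]]] := sf i q Dq.
have := so_cont sF Uq; rewrite /continuous_at => /(_ P) /=.
rewrite -(e q Dq Uq) => hP; have /nbhs_box [d d0 hd] := hP (open_nbhs_nbhs (conj oP Pf)).
have oB : open (U `&` [set y | box (chart i q) d y]) by apply: openI => //; exact: box_open.
exists (dom i `&` chart i @^-1` (U `&` [set y | box (chart i q) d y])); first exact: chart_continuous.
split; first by split=> //; split=> // j; rewrite subrr normr0.
by move=> r [Dr [Ur /hd]]; rewrite e.
Qed.

(** The part of a closed box in the half-space is a product of segments, hence compact; clusters are
    carried back to M because the chart is open onto its image in the half-space. *)
Lemma cboxM_compact i c (d : R) : (forall y, cbox c d y -> 0 <= y ord0 ord0 -> exists2 r, dom i r & chart i r = y) ->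
  compact [set r | dom i r /\ cbox c d (chart i r)].
Proof.
move=> him F PF FK.
pose lo (j : 'I_n.+1) := if j == ord0 then Num.max 0 (c ord0 j - d) else c ord0 j - d.
pose A (j : 'I_n.+1) : set R := `[lo j, c ord0 j + d]%classic.
have cA : compact [set v : V | forall j : 'I_n.+1, A j (v ord0 j)] by apply: rV_compact => j; exact: segment_compact.
have AE (y : V) : (forall j : 'I_n.+1, A j (y ord0 j)) <-> cbox c d y /\ 0 <= y ord0 ord0.
  split=> [h|[h h0] j].
    have h1 (j : 'I_n.+1) : lo j <= y ord0 j <= c ord0 j + d by have := h j; rewrite /A /= in_itv.
    split=> [j|]; last by have /andP [] := h1 ord0; rewrite /lo eqxx ge_max => /andP [].
    have /andP [a b] := h1 j; have {}a : c ord0 j - d <= y ord0 j.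
      by move: a; rewrite /lo; case: ifP => // _; rewrite ge_max => /andP [].
    by rewrite ler_norml; apply/andP; split; lra.
  have := h j; rewrite ler_norml => /andP [a b]; rewrite /A /= in_itv /= /lo.
  have a' : c ord0 j - d <= y ord0 j by lra.
  by case: ifP => [/eqP e|_]; rewrite ?ge_max ?a' ?andbT /=; [rewrite e h0 -e /=|]; lra.
have FA : (chart i @ F) [set v : V | forall j : 'I_n.+1, A j (v ord0 j)].
  suff h : [set r | dom i r /\ cbox c d (chart i r)] `<=` chart i @^-1` [set v : V | forall j : 'I_n.+1, A j (v ord0 j)] by exact: (filterS h FK).
  by move=> r [Dr br]; apply/AE; split=> //; exact: chart_half.
have [y [Ay cy]] := cA (chart i @ F) _ FA; have /AE [by' y0] := Ay.
have [p Dp ep] := him y by' y0; exists p; split; first by split=> //; rewrite ep.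
move=> B W FB; rewrite nbhsE => -[W' [oW' W'p] sW].
have [U [oU Up hU]] := chart_nbhd oW' W'p Dp.
have FBK : (chart i @ F) (chart i @` (B `&` [set r | dom i r /\ cbox c d (chart i r)])).
  have h : B `&` [set r | dom i r /\ cbox c d (chart i r)] `<=` chart i @^-1` (chart i @` (B `&` [set r | dom i r /\ cbox c d (chart i r)])) by move=> r h; exists r.
  exact: (filterS h (filterI FB FK)).
rewrite ep in Up; have [_ [[r [Br [Dr _]] <-] Ur]] := cy _ _ FBK (open_nbhs_nbhs (conj oU Up)).
by exists r; split=> //; apply: sW; exact: hU.
Qed.

(** The compact support K inside the chart is closed because M is Hausdorff, so the function
    extended by zero is smooth also at the limit points of the chart domain. *)
Lemma liftM i q U G : dom i q -> open U -> U (chart i q) -> smooth_on U G -> exists f (d : R) (K : set M),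
  [/\ smooth (s := M) f, 0 < d, forall r, dom i r -> box (chart i q) d (chart i r) -> f r = G (chart i r),
      [/\ compact K, closed K & forall r, K r -> dom i r /\ U (chart i r)] & forall r, ~ K r -> f r = 0].
Proof.
move=> Dq oU Uq sG.
have [U1 oU1 e1] := @chart_open _ _ M i (dom i) (@dom_open _ _ M i) (@subset_refl _ _).
have U1q : U1 (chart i q) by have : (chart i @` dom i) (chart i q) by [exists q]; rewrite e1 => -[].
have [H [d [d0 sH H1 H0 hU]]] := bump (openI oU oU1) (conj Uq U1q) (so_sub (@subIsetl _ U U1) sG).
set c := chart i q in H1 H0 hU.
have cK : compact [set r | dom i r /\ cbox c d (chart i r)].
  apply: cboxM_compact => y /hU [_ U1y] y0; have : (U1 `&` @half_space R n) y by [].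
  by rewrite -e1 => -[r Dr <-]; exists r.
have clK := compact_closed (@carrier_hausdorff _ _ M) cK.
exists (fun r => if `[< dom i r >] then H (chart i r) else 0), (d / 2), [set r | dom i r /\ cbox c d (chart i r)].
have z r : ~ (dom i r /\ cbox c d (chart i r)) -> (if `[< dom i r >] then H (chart i r) else 0) = 0.
  by case: asboolP => // Dr h; apply: H0 => b; apply: h.
split=> //; [|lra|by move=> r Dr /H1 <-; rewrite asboolT|]; last first.
  by split=> // r [Dr /hU []].
move=> j p Dp; have [Dip|nD] := pselect (dom i p); last first.
  have oW : open (~` [set r | dom i r /\ cbox c d (chart i r)]) by rewrite openC.
  have [U' [oU' U'p hU']] := chart_nbhd oW (fun h => nD h.1) Dp.
  exists U', (fun=> 0); split=> //; first exact: smooth_on_cst.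
  by move=> r Dr Ur; apply: z; exact: hU'.
have [U' [oU' U'p hU']] := chart_nbhd (@dom_open _ _ M i) Dip Dp.
have tr a : exists (OF : set V * (V -> R)), [/\ open OF.1, OF.1 (chart j p), smooth_on OF.1 OF.2 &
    forall r, dom j r -> dom i r -> OF.1 (chart j r) -> chart i r ord0 a = OF.2 (chart j r)].
  have [ O' [F [h1 h2 h3 h4]]] := @chart_transition _ _ M j i a p (conj Dp Dip).
  by exists (O', F); split=> // r Djr Dir; apply: h4.
have /choice [OF hOF] := tr.
pose W := U' `&` [set y | forall a, (OF a).1 y].
have oW : open W.
  apply: openI => //; apply: open_forall => a; by have [] := hOF a.
exists W, (fun y => H (\row_a (OF a).2 y)); split=> //.
- by split=> // a; have [] := hOF a.
- apply: (so_comp oW openT sH) => // a; have [_ _ s _] := hOF a.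
  by apply: so_sub s => y [_ /(_ a)].
- move=> r Dr [Ur hr]; have Dir := hU' r Dr Ur; rewrite asboolT //; congr H.
  by apply/rowP => a; rewrite mxE; have [_ _ _ ->] := hOF a => //; exact: hr.
Qed.

Lemma nearby_openM p (W : set M) : open W -> W p -> nearby (S := M) p W.
Proof.
move=> oW Wp; have [i Dp] := @dom_cover _ _ M p; have [U [oU Up hU]] := chart_nbhd oW Wp Dp.
have [f [d [K [sf d0 e [_ _ hK] z]]]] := liftM Dp oU Up (@smooth_on_cst R n U 1).
exists (exist _ f sf); rewrite /sfun_val /=.
  by rewrite (e p Dp) ?oner_neq0 // => j; rewrite subrr normr0.
move=> r fr; have [Kr|/z fr0] := pselect (K r); last by rewrite fr0 eqxx in fr.
by have [Dr Ur] := hK r Kr; exact: hU.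
Qed.

Lemma nearbyM_open p (P : M -> Prop) : nearby (S := M) p P -> exists W : set M, [/\ open W, W p & forall q, W q -> P q].
Proof.
move=> [chi c0 h]; have [W oW [Wp hW]] := @smoothM_continuous _ p (sfun_sm chi) [set x | x != 0] (@open_neq R 0) c0.
by exists W; split=> // q /hW /h.
Qed.

Lemma preregularM : preregular M.
Proof.
have bin (op : R -> R -> R) f g : (forall U F G, open U -> smooth_on U F -> smooth_on U G -> smooth_on U (fun x => op (F x) (G x))) ->
  smooth f -> smooth g -> smooth (fun p => op (f p) (g p)).
  move=> hop sf sg i p Dp; have [U [F [oU Up sF eF]]] := sf i p Dp; have [U' [G [oU' U'p sG eG]]] := sg i p Dp.
  have oI := openI oU oU'; exists (U `&` U'), (fun x => op (F x) (G x)); split=> //.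
    exact: (hop _ _ _ oI (so_sub (@subIsetl _ U U') sF) (so_sub (@subIsetr _ U U') sG)).
  by move=> q Dq [Uq U'q]; rewrite eF // eG.
split=> [f g|f g|f h].
- by apply: bin => U F G; exact: so_add.
- by apply: bin => U F G; exact: so_mul.
- move=> i p Dp; have [g sg] := h p; move=> /nearbyM_open [W [oW Wp hW]].
  have [U [F [oU Up sF eF]]] := sg i p Dp; have [U' [oU' U'p hU']] := chart_nbhd oW Wp Dp.
  exists (U `&` U'), F; split=> //; [exact: openI|exact: (so_sub (@subIsetl _ U U') sF)|].
  by move=> q Dq [Uq U'q]; rewrite (hW q (hU' q Dq U'q)) eF.
Qed.

Lemma chartM i : is_chart (S := M) (chart i) (dom i) true.
Proof.
split.
- move=> q U Dq oU Uq; have [f [d [K [sf d0 e [_ clK hK] z]]]] := liftM Dq oU Uq (@smooth_on_cst R n U 1).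
  exists f; split=> //.
  + by rewrite e // => j; rewrite subrr normr0.
  + by move=> r fr; apply: hK; apply: contrapT => /z fr0; rewrite fr0 eqxx in fr.
  + move=> r nD; apply: nearbyW (nearby_openM (W := ~` K) _ _) => [s /z //||/hK [] //].
    by rewrite openC.
- by move=> f q sf Dq; exact: (sf i q Dq).
- move=> q U F Dq oU Uq sF; have [f [d [K [sf d0 e _ _]]]] := liftM Dq oU Uq sF.
  exists f => //; apply: nearbyW (nearby_openM (W := dom i `&` chart i @^-1` [set y | box (chart i q) d y]) _ _).
  + by move=> r [Dr br]; exact: e.
  + by apply: chart_continuous; exact: box_open.
  + by split=> // j; rewrite /= subrr normr0.
- move=> q Dq; have [U1 oU1 e1] := @chart_open _ _ M i (dom i) (@dom_open _ _ M i) (@subset_refl _ _).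
  exists U1; split=> //; first by have : (chart i @` dom i) (chart i q) by [exists q]; rewrite e1 => -[].
  move=> x Ux /(_ isT) x0; have : (U1 `&` @half_space R n) x by [].
  by rewrite -e1 => -[r Dr <-]; exists r.
- by move=> _ q Dq; exact: chart_half.
Qed.

Lemma atlasM : atlas (S := M) (m := n).
Proof.
split=> [|p]; first exact: preregularM.
by have [i Dp] := @dom_cover _ _ M p; exists (chart i), (dom i), true; split=> //; exact: chartM.
Qed.
End Manifold.

(** * The interior and the boundary *)

Section SubSpace.
Context {R : realType} {n : nat} {M : bmanifold R n} {E : set M}.
Notation SE := (sub_space E).
Implicit Types (p q : SE) (X Y Z : vfield SE).

Lemma sub_restrict f : smooth (s := M) f -> smooth (s := SE) (fun p => f (sval p)).
Proof. by move=> sf p; exists setT, f; split=> //; exact: openT. Qed.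

Lemma nearby_restrict p (P : M -> Prop) : nearby (S := M) (sval p) P -> nearby p (fun q => P (sval q)).
Proof. by move=> [c c0 h]; exists (exist _ _ (sub_restrict (sfun_sm c))) => // q /h. Qed.

Lemma sub_nearby p (P : SE -> Prop) : nearby p P <-> nearby (S := M) (sval p) (fun r => forall h : E r, P (exist _ r h)).
Proof.
split=> [[c c0 h]|/nearby_restrict]; last first.
  by apply: nearbyW => -[r hr] /(_ hr).
have [W [F [oW Wp sF e]]] := sfun_sm c p; have Fp : F (sval p) != 0 by rewrite -e.
apply: nearbyW (nearbyI (preregularM M) (nearby_openM oW Wp) (nearby_neq0 sF Fp)) => r [Wr Fr] hr.
by apply: h; rewrite e.
Qed.

Lemma sub_ext f p : smooth (s := SE) f -> exists2 F, smooth (s := M) F & nearby p (fun q => f q = F (sval q)).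
Proof.
move=> sf; have [W [F [oW Wp sF e]]] := sf p; exists F => //.
by apply: nearbyW (nearby_restrict (nearby_openM oW Wp)) => q /e.
Qed.

Lemma sub_smoothP f : (forall p, exists2 F, smooth (s := M) F & nearby p (fun q => f q = F (sval q))) -> smooth (s := SE) f.
Proof.
move=> h p; have [F sF /sub_nearby /nearbyM_open [W [oW Wp e]]] := h p; exists W, F; split=> // -[r hr] /= Wr.
exact: (e r Wr hr).
Qed.

Lemma sub_nearbyI p (P Q : SE -> Prop) : nearby p P -> nearby p Q -> nearby p (fun q => P q /\ Q q).
Proof.
move=> /sub_nearby hP /sub_nearby hQ; apply/sub_nearby; apply: nearbyW (nearbyI (preregularM M) hP hQ) => r [h1 h2] h.
by split.
Qed.

Lemma preregular_sub : preregular SE.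
Proof.
split=> [f g sf sg|f g sf sg|f h]; apply: sub_smoothP => p.
- have [F sF eF] := sub_ext p sf; have [G sG eG] := sub_ext p sg; exists (fun r => F r + G r); first exact: (smD (preregularM M)).
  by apply: nearbyW (sub_nearbyI eF eG) => q [-> ->].
- have [F sF eF] := sub_ext p sf; have [G sG eG] := sub_ext p sg; exists (fun r => F r * G r); first exact: (smM (preregularM M)).
  by apply: nearbyW (sub_nearbyI eF eG) => q [-> ->].
- have [g sg e] := h p; have [F sF eF] := sub_ext p sg; exists F => //.
  by apply: nearbyW (sub_nearbyI e eF) => q [-> ->].
Qed.

(** Existence of the lifts chosen by [lift_at]: the values of X on the restricted coordinates are
    the coefficients of a field of M, and Taylor's formula shows that X is determined by them. *)
Lemma lift_atP p X f : smooth (s := M) f -> der X (fun q => f (sval q)) p = der (lift_at p X) f (sval p).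
Proof.
move=> sf; set Y := lift_at p X; have rg := atlas_regular (atlasM M).
suff h : forall (f : sfun M) (h : sfun SE), (forall q, h q = f (sval q)) -> X h p = Y f (sval p).
  have := h (exist _ f sf) (exist _ _ (sub_restrict sf)) (fun q => erefl).
  by rewrite !vfE /sfun_val.
apply: (@such_thatP _ (vf0 M) [set Y : vfield M | forall (f : sfun M) (h : sfun SE), (forall q, h q = f (sval q)) -> X h p = Y f (sval p)]).
have [i Dp] := @dom_cover _ _ M (sval p); have hc := chartM i; have pr := (preregularM M).
have [x [sx ex]] := coords_ex hc Dp; have [chi [sc c0 hD h0]] := ch_bump hc Dp openT I.
have /choice [Ei hE] : forall j, exists X : vfield M, forall f (q : M), smooth (s := M) f -> der X f q = chi q * pd (S := M) (chart i) j f q.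
  by move=> j; apply: (field_ex pr hc) => // r /hD [].
exists (vfsum (enum 'I_n.+1) (fun j _ => der X (fun q => x j (sval q)) p / chi (sval p)) Ei) => {sf}{}f h e.
have sf := sfun_sm f; have [ O [F hF]] := ch_reps hc sf Dp.
have [g [sg gp eg]] := taylor pr hc sf Dp hF ex.
rewrite !vfE (der_vfsum rg); last by move=> j; exact: smooth_cst.
rewrite (der_taylor (m := n) preregular_sub X (sfun_sm h) (x := fun j q => x j (sval q)) (p := p) (g := fun j q => g j (sval q)) (a := f (sval p))).
- rewrite big_enum /=; apply: eq_bigr => j _; rewrite hE // (pdE pr hc j Dp hF) gp.
  by field; rewrite gt_eqF.
- by move=> j; exact: sub_restrict.
- by move=> j; exact: sub_restrict.
- by apply: nearbyW (nearby_restrict eg) => q; rewrite e.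
Qed.

Section SubChart.
Variables (m : nat) (i : chart_index M) (ins : 'rV[R]_m.+1 -> 'rV[R]_n.+1) (pro : 'rV[R]_n.+1 -> 'rV[R]_m.+1) (Q : set 'rV[R]_m.+1).
Hypothesis s_ins : forall j, smooth_on setT (fun x => ins x ord0 j).
Hypothesis s_pro : forall j, smooth_on setT (fun x => pro x ord0 j).
Hypothesis insK : cancel ins pro.
Hypothesis oQ : open Q.
Hypothesis proK : forall r, E r -> dom i r -> ins (pro (chart i r)) = chart i r.
Hypothesis QE : forall r, E r -> dom i r -> Q (pro (chart i r)).
Hypothesis EQ : forall r x, dom i r -> Q x -> chart i r = ins x -> E r.
Hypothesis hQ : forall x, Q x -> 0 <= ins x ord0 ord0.

Lemma open_pull (a b : nat) (f : 'rV[R]_a.+1 -> 'rV[R]_b.+1) (O : set 'rV[R]_b.+1) :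
  (forall j, smooth_on setT (fun x => f x ord0 j)) -> open O -> open (f @^-1` O).
Proof.
move=> sf oO; rewrite openE => x Ox; have [d d0 hd] := open_box oO Ox; have d20 : 0 < d / 2 by rewrite divr_gt0.
have /choice [e he] : forall j, exists e : R, 0 < e /\ forall y, box x e y -> `|f y ord0 j - f x ord0 j| <= d / 2.
  by move=> j; have /continuousP /(_ _ d20) [e e0 h] := so_cont (sf j) (I : setT x); exists e.
have [e' [e'0 _ he']] := fin_min (@ltr01 R) (fun j => (he j).1).
apply/nbhs_box; exists e' => // y hy; apply: hd => j; apply: le_lt_trans (_ : d / 2 < d); last by lra.
by apply: (he j).2 => l; exact: lt_le_trans (hy l) (he' j).
Qed.

Lemma so_pull (a b : nat) (f : 'rV[R]_a.+1 -> 'rV[R]_b.+1) (O : set 'rV[R]_b.+1) F :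
  (forall j, smooth_on setT (fun x => f x ord0 j)) -> open O -> smooth_on O F -> smooth_on (f @^-1` O) (fun x => F (f x)).
Proof.
move=> sf oO sF; have oP := open_pull sf oO.
have e x : \row_j f x ord0 j = f x by apply/rowP => j; rewrite mxE.
apply: (so_eq oP (so_comp oP oO sF (g := fun j x => f x ord0 j) _ _)) => [j|x Ox|x _]; rewrite ?e //.
exact: so_sub (@subsetT _ _) (sf j).
Qed.

(** One argument for two cases: for the interior [ins] and [pro] are identities and Q is the open
    half-space; for the boundary [pro] drops the first coordinate, [ins] inserts 0, and Q is
    everything. *)
Lemma sub_chart : is_chart (S := SE) (fun r => pro (chart i (sval r))) (fun r => dom i (sval r)) false.
Proof.
have hc := chartM i; split=> //.
- move=> q O Dq oO Oq; have [chi [sc c0 hD h0]] := ch_bump hc Dq (open_pull s_pro oO) Oq.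
  exists (fun r => chi (sval r)); split=> //; first exact: sub_restrict.
    by move=> r /hD.
  by move=> r /h0 /nearby_restrict.
- move=> f q sf Dq; have [G sG /sub_nearby eG] := sub_ext q sf.
  have [ O1 [ oO1 O1q h1]] := nearby_chart hc Dq eG.
  have [ O2 [F [ oO2 O2q sF eF]]] := ch_rep hc sG Dq.
  exists (ins @^-1` (O1 `&` O2)), (fun x => F (ins x)); have oI := openI oO1 oO2; split.
  + exact: open_pull.
  + by rewrite /= proK //; exact: (svalP q).
  + exact: so_pull s_ins oI (so_sub (@subIsetr _ O1 O2) sF).
  + move=> [r hr] /= Dr; rewrite proK // => -[ O1r O2r].
    by rewrite (h1 r Dr O1r hr) eF.
- move=> q O F Dq oO Oq sF.
  have [f sf ef] := ch_lift hc Dq (open_pull s_pro oO) Oq (so_pull s_pro oO sF).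
  by exists (fun r => f (sval r)); [exact: sub_restrict|exact: (nearby_restrict ef)].
- move=> q Dq; have [U [oU Uq hU]] := ch_img hc Dq.
  exists ((ins @^-1` U) `&` Q); split.
  + by apply: openI => //; exact: open_pull.
  + by split; [rewrite /= proK //; exact: (svalP q)|exact: QE (svalP q) Dq].
  + move=> x [Ux Qx] _; have [r Dr er] := hU _ Ux (fun _ => hQ Qx).
    by exists (exist _ r (EQ Dr Qx er)) => //=; rewrite er insK.
Qed.
End SubChart.
End SubSpace.

Section Boundary.
Context {R : realType} {n : nat} {M : bmanifold R n}.
Variables (c : set (metric M)) (sigma : metric M -> M -> R) (g : metric M).
Hypothesis cg : c g.
Hypothesis PE : poincare_einstein c sigma.
Implicit Types (i : chart_index M) (p r : M).

Lemma sigma_smooth : smooth (s := M) (sigma g). Proof. by case: PE => _ [h _] _ _ _; exact: h. Qed.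
Lemma sigma_int p : ~ boundary M p -> 0 < sigma g p. Proof. by case: PE => _ _ h _ _; exact: h. Qed.
Lemma sigma_bdry p : boundary M p -> sigma g p = 0. Proof. by case: PE => _ _ _ h _ /(h _ _ cg) []. Qed.
Lemma sigma_ge0 p : 0 <= sigma g p.
Proof. by have [/sigma_bdry ->|/sigma_int /ltW] := pselect (boundary M p). Qed.
Lemma sigma_gt0 p : 0 < sigma g p <-> ~ boundary M p.
Proof. by split=> [h /sigma_bdry e|]; [rewrite e ltxx in h|exact: sigma_int]. Qed.

Lemma partial_min (O : set 'rV[R]_n.+1) (F : 'rV[R]_n.+1 -> R) x j : open O -> O x -> smooth_on O F ->
  (forall y, O y -> F x <= F y) -> partial j F x = 0.
Proof.
move=> oO Ox sF h; apply/eqP; apply: contraT => a0; have /is_deriveP := so_der j sF Ox; set a := partial j F x in a0 *.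
have a1 : 0 < `|a| / 2 by rewrite divr_gt0 ?normr_gt0.
move=> /(_ _ a1) [d d0 hd]; have [d' d'0 hd'] := open_box oO Ox.
pose t := Num.min d d' / 2; have t0 : 0 < t by rewrite divr_gt0 // lt_min d0.
have [td td'] : t < d /\ t < d' by split; have := t0; rewrite /t minEle; case: ifP; lra.
pose s := - Num.sg a * t.
have sn : `|s| = t by rewrite normrM normrN normr_sg a0 mul1r gtr0_norm.
have := hd s; rewrite sn => /(_ td); have Oy : O (s *: delta_mx ord0 j + x).
  apply: hd' => l; rewrite !mxE addrK; apply: le_lt_trans _ td'; rewrite normrM sn -[X in _ <= X]mulr1 ler_wpM2l ?(ltW t0) //.
  by rewrite eqxx /=; case: (_ == _); rewrite ?normr1 ?normr0.
have := h _ Oy; rewrite ler_norml => h1 /andP [_ h2].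
have e : s * a = - (`|a| * t) by rewrite /s normrEsg; ring.
have := mulr_gt0 a1 t0; rewrite e in h2; lra.
Qed.

(** The definition of the boundary asks for some chart; the defining function shows that any chart
    will do. At a boundary point sigma has its minimum 0, so if p were interior in the chart i, all
    derivatives of sigma would vanish at p, against d sigma <> 0. *)
Lemma boundaryP i p : dom i p -> boundary M p <-> chart i p ord0 ord0 = 0.
Proof.
move=> Dp; split=> [bp|e]; last by exists i.
apply/eqP; rewrite eq_le chart_half // andbT leNgt; apply/negP => x0.
have hc := chartM i; have pr := preregularM M; have [x [sx ex]] := coords_ex hc Dp.
have [ O [F hF]] := ch_reps hc sigma_smooth Dp; have [ oO Op sF eF] := hF.
have [U [oU Up hU]] := ch_img hc Dp; have [U' [oU' U'p hU']] := nearby_chart hc Dp eF.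
case: PE => _ _ _ /(_ g p cg bp) [_ [X +]] _.
rewrite (der_chart pr hc X sigma_smooth Dp hF sx ex) big1 ?eqxx // => j _.
pose O1 := O `&` U `&` U' `&` [set y : 'rV[R]_n.+1 | 0 < y ord0 ord0].
have oO1 : open O1.
  do ! apply: openI => //; apply: (@open_comp _ _ (fun y : 'rV[R]_n.+1 => y ord0 ord0) [set t | 0 < t]); last exact: open_gt.
  by move=> y _; exact: coord_continuous.
rewrite (@partial_min O1) ?mulr0 //; first by apply: so_sub sF => y [[[]]].
move=> y [[[Oy Uy] U'y] y0]; have [r Dr er] := hU y Uy (fun _ => ltW y0).
rewrite -er in U'y *; rewrite -(hU' r Dr U'y) -(nearby_sub eF) (sigma_bdry bp); exact: sigma_ge0.
Qed.

(** From a boundary point a small step in the coordinate direction 0 leads to points with sigma > 0,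
    where u vanishes; continuity does the rest. *)
Lemma density_int (u : M -> R) p : smooth (s := M) u -> nearby (S := M) p (fun q => 0 < sigma g q -> u q = 0) -> u p = 0.
Proof.
move=> su h; have [bp|/sigma_int sp] := pselect (boundary M p); last exact: (nearby_sub h).
have [i Dp] := @dom_cover _ _ M p; have hc := chartM i; have pr := preregularM M.
have [ O [F hF]] := ch_reps hc su Dp; have [ oO Op sF eF] := hF.
have [U [oU Up hU]] := ch_img hc Dp; have [U' [oU' U'p hU']] := nearby_chart hc Dp (nearbyI pr eF h).
rewrite (nearby_sub eF); apply/eqP; apply: contraT => F0; set x := chart i p in F0 *.
have F1 : 0 < `|F x| / 2 by rewrite divr_gt0 ?normr_gt0.
have [d d0 hd] := (continuousP F x).1 (so_cont sF Op) _ F1.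
have [d' d'0 hd'] := open_box (openI oU oU') (conj Up U'p).
pose t := Num.min d d' / 2; have t0 : 0 < t by rewrite divr_gt0 // lt_min d0.
have [td td'] : t < d /\ t < d' by split; have := t0; rewrite /t minEle; case: ifP; lra.
pose y := x + t *: delta_mx ord0 ord0.
have yx l : `|y ord0 l - x ord0 l| <= t.
  rewrite !mxE [_ + t * _]addrC addrK normrM gtr0_norm // -[X in _ <= X]mulr1 ler_wpM2l ?(ltW t0) //.
  by rewrite eqxx /=; case: (_ == _); rewrite ?normr1 ?normr0.
have y0 : y ord0 ord0 = t by rewrite !mxE ((boundaryP Dp).1 bp) add0r mulr1.
have [Uy U'y] : (U `&` U') y by apply: hd' => l; exact: le_lt_trans (yx l) td'.
have [r Dr er] := hU y Uy (fun _ => eq_ind_r (fun z => 0 <= z) (ltW t0) y0).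
rewrite -er in U'y; have [e1 e2] := hU' r Dr U'y.
have sr : 0 < sigma g r by apply/sigma_gt0 => /(boundaryP Dr).1; rewrite er y0 => e; rewrite e ltxx in t0.
have := hd y (fun l => le_lt_trans (yx l) td); rewrite -er -e1 e2 // sub0r normrN; have := F1; lra.
Qed.

Lemma atlas_interior : atlas (S := interior_space M) (m := n).
Proof.
split=> [|p]; first exact: preregular_sub.
have [i Dp] := @dom_cover _ _ M (sval (p : {p : M | (~` boundary M) p})); exists (fun r : interior_space M => chart i (sval r)), (fun r : interior_space M => dom i (sval r)), false; split=> //.
have oT : open [set: 'rV[R]_n.+1] by exact: openT.
apply: (@sub_chart _ _ _ _ n i id id [set y : 'rV[R]_n.+1 | 0 < y ord0 ord0]) => //.
- by move=> j; exact: so_coord.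
- by move=> j; exact: so_coord.
- apply: (@open_comp _ _ (fun y : 'rV[R]_n.+1 => y ord0 ord0) [set t | 0 < t]); last exact: open_gt.
  by move=> y _; exact: coord_continuous.
- move=> r br Dr /=; rewrite lt_def chart_half // andbT; apply/negP => /eqP /(boundaryP Dr).2; exact: br.
- by move=> r x Dr Qx er /(boundaryP Dr).1; rewrite er => e; rewrite /= e ltxx in Qx.
- by move=> x /ltW.
Qed.
End Boundary.

Section BoundaryAtlas.
Context {R : realType} {m : nat} {M : bmanifold R m.+1}.
Variables (c : set (metric M)) (sigma : metric M -> M -> R) (g : metric M).
Hypothesis cg : c g.
Hypothesis PE : poincare_einstein c sigma.

Lemma atlas_bdry : atlas (S := bdry M) (m := m).
Proof.
split=> [|p]; first exact: preregular_sub.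
have [i Dp] := @dom_cover _ _ M (sval p).
have oT k : open [set: 'rV[R]_k.+1] by exact: openT.
pose pro (x : 'rV[R]_m.+2) : 'rV[R]_m.+1 := \row_j x ord0 (lift ord0 j).
pose ins (x : 'rV[R]_m.+1) : 'rV[R]_m.+2 := \row_j if unlift ord0 j is Some l then x ord0 l else 0.
exists (fun r : bdry M => pro (chart i (sval r))), (fun r => dom i (sval r)), false; split=> //.
apply: (@sub_chart _ _ _ _ m i ins pro setT) => //.
- move=> j; have [l el|e] := unliftP ord0 j.
    by apply: (so_eq (oT _) (so_coord l (oT _))) => x _; rewrite mxE el liftK.
  by apply: (so_eq (oT _) (@smooth_on_cst R m setT 0)) => x _; rewrite mxE e unlift_none.
- by move=> j; apply: (so_eq (oT _) (so_coord (lift ord0 j) (oT _))) => x _; rewrite mxE.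
- by move=> x; apply/rowP => j; rewrite !mxE liftK.
- move=> r br Dr; apply/rowP => j; rewrite mxE; have [l ->|->] := unliftP ord0 j; first by rewrite mxE.
  by rewrite ((boundaryP cg PE Dr).1 br).
- by move=> r x Dr _ er; apply/(boundaryP cg PE Dr); rewrite er mxE unlift_none.
- by move=> x _; rewrite mxE unlift_none.
Qed.
End BoundaryAtlas.

(** * Geometry of the boundary *)

Section Related.
Context {R : realType} {n m : nat} {M : bmanifold R n} {E : set M}.
Notation SE := (sub_space E).
Let rgM : regular M n.+1 := atlas_regular (atlasM M).
Hypothesis rg : regular SE m.
Variable g : metric M.
Hypothesis mg : is_metric g.
Implicit Types (p q : SE) (Xt Yt Zt : vfield SE) (X Y Z : vfield M).

(** Relatedness at one point of a field of E and a field of M. Near a point every field of E is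
    related to a smooth field of M ([rel_ext]); lifts chosen point by point have no smoothness. *)
Definition rel p Xt X := forall u : M -> R, smooth (s := M) u -> der Xt (fun q => u (sval q)) p = der X u (sval p).

Lemma rel_lift p Xt : rel p Xt (lift_at p Xt). Proof. by move=> u; exact: lift_atP. Qed.

Lemma rel_eq p Xt X Y : rel p Xt X -> rel p Xt Y -> forall u, der X u (sval p) = der Y u (sval p).
Proof.
move=> hX hY u; have [su|nu] := pselect (smooth u); last by rewrite !der_ns.
by rewrite -hX // -hY.
Qed.

Lemma rel_ext p Xt : exists X, nearby p (fun q => rel q Xt X).
Proof.
have [x [F [sx nF]]] := has_coords rgM (sval p).
have /choice [C hC] : forall i, exists C, smooth (s := M) C /\ nearby p (fun q => der Xt (fun r => x i (sval r)) q = C (sval q)).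
  by move=> i; have [C sC eC] := sub_ext p (der_sm Xt (fun r : SE => x i (sval r))); exists C.
exists (vfsum (enum 'I_n.+1) C F).
apply: nearbyW (nearbyI rg (nearby_restrict nF) (nearby_fin rg (fun i => (hC i).2))) => q [[_ hx] e] u su.
rewrite (der_vfsum rgM) => [|i]; last by have [] := hC i.
rewrite lift_atP // hx big_enum /=; apply: eq_bigr => i _; by rewrite -e lift_atP.
Qed.

Lemma rel_restrict p Xt Yt X Y : rel p Xt X -> rel p Yt Y -> restrict_metric g Xt Yt p = g X Y (sval p).
Proof.
move=> hX hY; rewrite /restrict_metric.
rewrite (clin_at rgM (Y := X) (g_clinl mg _) (rel_eq (rel_lift p Xt) hX)).
by rewrite (clin_at rgM (Y := Y) (g_clinr mg _) (rel_eq (rel_lift p Yt) hY)).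
Qed.

Lemma restrict_is_metric : is_metric (restrict_metric (E := E) g).
Proof.
split.
- move=> Xt Yt; apply: (sm_local rg) => p; have [X nX] := rel_ext p Xt; have [Y nY] := rel_ext p Yt.
  exists (fun q => g X Y (sval q)); first exact: sub_restrict (g_sm mg X Y).
  by apply: nearbyW (nearbyI rg nX nY) => q [hX hY]; exact: rel_restrict.
- by move=> X Y p; rewrite /restrict_metric (g_sym mg).
- move=> f X Y Z W p h; rewrite /restrict_metric.
  apply: (clin_lin rgM (g_clinl mg _)) => u; have [su|nu] := pselect (smooth u); last by rewrite !der_ns ?mulr0 ?addr0.
  by rewrite -!lift_atP // (clin_app p (@clin_der _ _ _) h).
- move=> X p [f /eqP Xf]; have [F sF eF] := sub_ext p (sfun_sm f).
  apply: (g_pos mg (u := F)); rewrite -lift_atP // -(der_near rg X (sfun_sm f) (sub_restrict sF) eF) -vfE.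
  exact/eqP.
Qed.

Lemma rel_der p Xt X ut u : rel p Xt X -> smooth (s := SE) ut -> smooth (s := M) u ->
  nearby p (fun q => ut q = u (sval q)) -> der Xt ut p = der X u (sval p).
Proof. by move=> h sut su e; rewrite (der_near rg Xt sut (sub_restrict su) e) h. Qed.

Notation nrel p Xt X := (nearby p (fun q => rel q Xt X)).

Lemma rel_lie p Xt X Yt Y : nrel p Xt X -> nrel p Yt Y -> rel p (lie Xt Yt) (lie X Y).
Proof.
move=> nX nY u su; rewrite (der_lie rg) (der_lie rgM).
by rewrite (rel_der (nearby_sub nX) (der_sm _ _) (der_sm Y u)) ?(rel_der (nearby_sub nY) (der_sm _ _) (der_sm X u)) //;
  [apply: nearbyW nX|apply: nearbyW nY] => q; apply.
Qed.

Variable h : metric SE.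
Hypothesis mh : is_metric h.
(** [h] is not tied to the restricted metric: on the interior it is g^o, which agrees with g only
    where sigma = 1. *)
Definition agree q := forall Xt Yt, h Xt Yt q = restrict_metric g Xt Yt q.

Lemma rel_g p Xt Yt X Y : agree p -> rel p Xt X -> rel p Yt Y -> h Xt Yt p = g X Y (sval p).
Proof. by move=> -> hX hY; exact: rel_restrict. Qed.

Lemma rel_koszul p Xt X Yt Y Zt Z : nearby p agree -> nrel p Xt X -> nrel p Yt Y -> nrel p Zt Z ->
  koszul h Xt Yt Zt p = koszul g X Y Z (sval p).
Proof.
move=> na nX nY nZ; have a := nearby_sub na.
have dg At A Bt B Ct C : nrel p At A -> nrel p Bt B -> nrel p Ct C -> der At (h Bt Ct) p = der A (g B C) (sval p).
  move=> nA nB nC; apply: (rel_der (nearby_sub nA) (g_sm mh _ _) (g_sm mg _ _)).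
  by apply: nearbyW (nearbyI rg na (nearbyI rg nB nC)) => q [aq [hB hC]]; exact: rel_g.
have gl At A Bt B Ct C : nrel p At A -> nrel p Bt B -> nrel p Ct C -> h (lie At Bt) Ct p = g (lie A B) C (sval p).
  by move=> nA nB nC; apply: rel_g (rel_lie nA nB) (nearby_sub nC).
rewrite /koszul (dg _ X _ Y _ Z) // (dg _ Y _ X _ Z) // (dg _ Z _ X _ Y) //.
by rewrite (gl _ X _ Y _ Z) // (gl _ X _ Z _ Y) // (gl _ Y _ Z _ X).
Qed.

(** All terms of the Koszul formula are compatible with relatedness; on the boundary this identifies
    the tangential part of the connection of M. *)
Lemma rel_lc_tangent p Xt X Yt Y Zt Z : nearby p agree -> nrel p Xt X -> nrel p Yt Y -> rel p Zt Z ->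
  h (levi_civita h Xt Yt) Zt p = g (levi_civita g X Y) Z (sval p).
Proof.
move=> na nX nY hZ; have [Z' nZ] := rel_ext p Zt.
rewrite (lc_koszul rg mh) (rel_koszul na nX nY nZ) -(lc_koszul rgM mg).
exact: (clin_at rgM (g_clinr mg _) (rel_eq (nearby_sub nZ) hZ)).
Qed.

Lemma rel_onb p e et : agree p -> onb h et p -> (forall a : 'I_m, rel p (et a) (e a)) -> forall a b, g (e a) (e b) (sval p) = (a == b)%:R.
Proof. by move=> ap oe he a b; rewrite -(rel_g ap (he a) (he b)) oe. Qed.

Lemma rel_sum (I : finType) p (c : I -> R) et (e : I -> vfield M) X : (forall a, rel p (et a) (e a)) ->
  (forall u, der X u (sval p) = \sum_a c a * der (e a) u (sval p)) ->
  rel p (vfsum (enum I) (fun a _ => c a) et) X.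
Proof.
move=> he hX u su; rewrite (der_vfsum rg) => [|a]; last exact: smooth_cst.
by rewrite big_enum /= hX; apply: eq_bigr => a _; rewrite he.
Qed.
End Related.

Section Interior.
Context {R : realType} {n : nat} {M : bmanifold R n}.
Variables (c : set (metric M)) (sigma : metric M -> M -> R).
Hypothesis PE : poincare_einstein c sigma.
Notation SI := (interior_space M).
Let rgM : regular M n.+1 := atlas_regular (atlasM M).

Section Scale.
Variable g : metric M.
Hypothesis cg : c g.
Let mg : is_metric g. Proof. by case: PE => cc _ _ _ _; exact: (c_metric rgM cc cg). Qed.
Let rg : regular SI n.+1 := atlas_regular (atlas_interior cg PE).
Notation h := (interior_metric sigma g).

Let mh : is_metric h.
Proof.
have [h1 h2 h3 h4] := restrict_is_metric rg mg.
have sp (p : SI) : 0 < sigma g (sval p) by apply: (sigma_int cg PE); case: p.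
have ss := sub_restrict (E := ~` boundary M) (sigma_smooth cg PE).
have sn (p : SI) : sigma g (sval p) != 0 by rewrite gt_eqF.
split.
- move=> X Y; apply: (smM rg) (h1 X Y); apply: (smV rg) => [|p]; first exact: (smX rg).
  by rewrite expf_neq0.
- by move=> X Y p; rewrite /interior_metric h2.
- by move=> f X Y Z W p /(h3 f X Y Z W p) e; rewrite /interior_metric e; ring.
- by move=> X p /h4 e; rewrite /interior_metric mulr_gt0 // invr_gt0 exprn_gt0.
Qed.

Lemma interior_surj (p : SI) X : agree g h p -> exists Xt, rel p Xt X.
Proof.
move=> ap; have oe := frame_onb rg mh p; set et := frame_at h p in oe.
have oe' := rel_onb mg ap oe (fun a => rel_lift p (et a)).
exists (vfsum (enum 'I_n.+1) (fun a _ => g X (lift_at p (et a)) (sval p)) et).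
by apply: (rel_sum rg (e := fun a => lift_at p (et a))) => [a|u]; [exact: rel_lift|exact: (onb_complete rgM mg)].
Qed.

Lemma interior_lc (p : SI) Xt X Yt Y : nearby p (agree g h) -> nearby p (fun q => rel q Xt X) -> nearby p (fun q => rel q Yt Y) ->
  nearby p (fun q => rel q (levi_civita h Xt Yt) (levi_civita g X Y)).
Proof.
move=> na nX nY; have := nearbyI rg (nearby_nearby na) (nearbyI rg (nearby_nearby nX) (nearby_nearby nY)).
apply: nearbyW => q [{}na [{}nX {}nY]] u su.
rewrite (rel_lift q (levi_civita h Xt Yt) su); apply: (g_nondeg rgM mg) => V.
have [Vt hV] := interior_surj V (nearby_sub na).
by rewrite -(rel_lc_tangent rg mg mh na nX nY hV) (rel_g mg (nearby_sub na) (rel_lift q _) hV).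
Qed.

(** Near p the metrics g and g^o agree, and fields, brackets and connections of the interior are
    related to those of M; so the Einstein equation for g^o becomes one for g, with n = d - 1. *)
Lemma einstein_unit p : nearby (S := M) p (fun q => sigma g q = 1) ->
  forall X Y, ric n.+1 g X Y p = - (n.+1%:R - 1) * g X Y p.
Proof.
move=> n1 X Y; have ip : (~` boundary M) p by apply/(sigma_gt0 cg PE); rewrite (nearby_sub n1).
pose pt : SI := exist _ p ip.
have na : nearby pt (agree g h).
  by apply: nearbyW (nearby_restrict (p := pt) n1) => q e U V; rewrite /interior_metric e expr1n invr1 mul1r.
have ap := nearby_sub na.
have [Xt hX] := interior_surj X ap; have [Yt hY] := interior_surj Y ap.
have [X' nX] := rel_ext rg pt Xt; have [Y' nY] := rel_ext rg pt Yt.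
have eX := rel_eq hX (nearby_sub nX); have eY := rel_eq hY (nearby_sub nY).
rewrite (clin_at rgM (Y := X') ((ric_blin rgM mg).1 Y) eX) (clin_at rgM (Y := Y') ((ric_blin rgM mg).2 X') eY).
rewrite (clin_at rgM (Y := X') (g_clinl mg Y) eX) (clin_at rgM (Y := Y') (g_clinr mg X') eY).
have := (let: And5 _ _ _ _ h := PE in h) g Xt Yt pt cg.
rewrite (rel_g mg ap (nearby_sub nX) (nearby_sub nY)) /= => E.
rewrite (_ : - (n.+1%:R - 1) = - n%:R :> R); last by rewrite -natr1; ring.
rewrite -E; have oe := frame_onb rg mh pt; set et := frame_at h pt in oe.
have /choice [e he] : forall a, exists e, nearby pt (fun q => rel q (et a) e) by move=> a; exact: (rel_ext rg pt (et a)).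
have oe' : onb g e p := rel_onb mg ap oe (fun a => nearby_sub (he a)).
rewrite (ric_onb rgM mg _ _ oe') (ric_onb rg mh _ _ oe); apply: eq_bigr => a _; rewrite /riem.
have r Zt Z : rel pt Zt Z -> h Zt (et a) pt = g Z (e a) p by move=> hZ; apply: (rel_g mg ap hZ (nearby_sub (he a))).
rewrite -(r _ _ (nearby_sub (interior_lc na (he a) (interior_lc na nX nY)))).
rewrite -(r _ _ (nearby_sub (interior_lc na nX (interior_lc na (he a) nY)))).
have nl : nearby pt (fun q => rel q (lie (et a) Xt) (lie (e a) X')).
  have := nearbyI rg (nearby_nearby (he a)) (nearby_nearby nX); apply: nearbyW => q [h1 h2].
  exact: (rel_lie rg h1 h2).
by rewrite -(r _ _ (nearby_sub (interior_lc na nl nY))).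
Qed.
End Scale.
End Interior.

Section Pointwise.
Context {R : realType} {S : smooth_space R} {d : nat}.
Hypothesis rg : regular S d.
Implicit Types (X : vfield S) (s : seq (vfield S)) (A B : dform S).

Lemma form_span0 (I : finType) (f : I -> vfield S) k B q : is_form k B ->
  (forall X, exists c : I -> R, forall u, der X u q = \sum_i c i * der (f i) u q) ->
  (forall J : seq I, B (map f J) q = 0) -> forall s, B s q = 0.
Proof.
move=> hB hs h s; rewrite -[s]cats0 -[[::]]/(map f [::]).
suff {s} H : forall s J, B (s ++ map f J) q = 0 by exact: H.
elim/last_ind => [|s X IH] J; first exact: h.
have [c hc] := hs X; rewrite -cats1 -catA /= (clin_sum_at rg (form_clin s (map f J) hB) hc).
by rewrite big1 // => i _; rewrite (IH (i :: J)) mulr0.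
Qed.

Lemma form_eq_at (T : Type) (f h : T -> vfield S) k A q (l : seq T) : is_form k A ->
  (forall x u, der (f x) u q = der (h x) u q) -> A (map f l) q = A (map h l) q.
Proof.
move=> hA e; rewrite -[map f l]/([::] ++ map f l) -[RHS]/(A ([::] ++ map h l) q).
elim: l [::] => [//|x l IH] s /=.
by rewrite (clin_at rg (form_clin s (map f l) hA) (e x)) -cat_rcons IH cat_rcons.
Qed.

Lemma form_eq_at2 (T : Type) (f h : T -> vfield S) k A q (l1 l2 : seq T) V : is_form k A ->
  (forall x u, der (f x) u q = der (h x) u q) -> A (map f l1 ++ V :: map f l2) q = A (map h l1 ++ V :: map h l2) q.
Proof.
move=> hA e; pose F (f : T -> vfield S) x := if x is Some t then f t else V.
have m f' : map f' l1 ++ V :: map f' l2 = map (F f') (map some l1 ++ None :: map some l2).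
  by rewrite map_cat /= -!map_comp.
by rewrite !m; apply: (form_eq_at _ hA) => -[x|//]; exact: e.
Qed.

Lemma dact_nat Y Phi A s q : dact Phi A s q = \sum_(0 <= i < size s) A (replace s i (Phi (nth Y s i))) q.
Proof. by rewrite big_mkord; apply: eq_bigr => i _; rewrite (tnth_nth Y). Qed.
End Pointwise.

Section NormNu.
Context {R : realType} {S : smooth_space R} {d : nat}.
Hypothesis rg : regular S d.
Hypothesis d3 : (3 <= d)%N.
Hypothesis lgc : log_closed (S := S).
Variable c : set (metric S).
Hypothesis cc : conformal_class c.
Variable sigma : metric S -> S -> R.
Hypothesis ds : density_section c 1 sigma.
Hypothesis hE : forall g p, c g -> nearby p (fun q => sigma g q = 1) ->
  forall X Y, ric d g X Y p = - (d%:R - 1) * g X Y p.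
Hypothesis hinv : forall (f : S -> R) p, smooth f -> 0 < f p ->
  exists2 Om, positive_smooth Om & nearby p (fun q => Om q * f q = 1).
Hypothesis hdense : forall g p u, c g -> smooth u -> nearby p (fun q => 0 < sigma g q -> u q = 0) -> u p = 0.
Variable g : metric S.
Hypothesis cg : c g.
Let mg : is_metric g := c_metric rg cc cg.
Notation nu := (nu sigma g).

(** The statement that the scale tractor has length 1. In a scale with sigma = 1 it reads 0 = 1 - 2
    (1/2), with rho = 1/2 by the Einstein equation; it is carried to the scale g by the laws of nu
    and rho, and to the boundary by density. *)
Lemma norm_nu p : g nu nu p = 1 - 2 * rho d sigma g p * sigma g p.
Proof.
apply/eqP; rewrite -subr_eq0; apply/eqP.
have ssg := sigma_sm ds cg; have sr := rho_sm rg cc ds cg.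
apply: (hdense cg (u := fun p => g nu nu p - (1 - 2 * rho d sigma g p * sigma g p))).
  apply: (smB rg); first exact: (g_sm mg).
  apply: (smB rg); first exact: smooth_cst.
  by apply: (smM rg) => //; apply: (smM rg) => //; exact: smooth_cst.
apply: nearbyT => q sq; have [g' cg' n1] := unit_scale rg cc ds hinv cg sq.
have [Om pOm eg] := c_rel rg cc cg' cg.
have es r : sigma g r = Om r * sigma g' r by rewrite eg (sigma_rescale ds _ cg' pOm).
have [sO O0] := pOm; have O1 : Om q != 0 by rewrite gt_eqF.
have e1 : rho d sigma g q = rho d sigma (rescale Om g') q by rewrite -eg.
have e2 u : der nu u q = der (Defs.nu sigma (rescale Om g')) u q by rewrite -eg.
rewrite (g_grad rg mg) e1 e2 (rho_hat rg d3 lgc cc ds cg' pOm) (nu_hat rg lgc cc ds cg' pOm).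
rewrite (nearby_sub (unit_nu rg cc ds cg' n1)) (nearby_sub n1) (nearby_sub (unit_rho rg d3 cc ds hE cg' n1)).
rewrite es (nearby_sub n1) (nearby_sub (unit_der rg ds cg' n1)).
have [su dOm] := lgc pOm.
rewrite (der_near rg _ ssg sO); last by apply: nearbyW n1 => r e; rewrite es e mulr1.
by rewrite dOm; field.
Qed.

(** The Hessian of sigma is symmetric, so g(D_nu nu, V) is half of V(|nu|^2); by [norm_nu] this
    equals - rho V(sigma) where sigma = 0. *)
Lemma nabla_nu_nu p : sigma g p = 0 -> forall u, der (levi_civita g nu nu) u p = - rho d sigma g p * der nu u p.
Proof.
move=> s0 u; have sr := rho_sm rg cc ds cg; have ssg := sigma_sm ds cg.
have h V : g (levi_civita g nu nu) V p = - rho d sigma g p * g nu V p + 0 * g nu V p + 0 * g nu V p.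
  rewrite /Defs.nu (hess_sym rg mg) -/nu.
  have := lc_met rg mg V nu nu p; rewrite [g nu (levi_civita _ _ _) p](g_sym mg).
  rewrite (_ : g nu nu = fun p => 1 - (2 * rho d sigma g p) * sigma g p); last by apply/funext => q; rewrite norm_nu.
  have s2 : smooth (fun p => 2 * rho d sigma g p) by apply: (smM rg) => //; exact: smooth_cst.
  rewrite (derB rg _ _ (smooth_cst S 1) (smM rg s2 ssg)) (der_cst rg) (derM rg _ _ s2 ssg) s0 mulr0 addr0.
  rewrite (g_grad rg mg); set a := g (levi_civita _ _ _) _ _; set b := der _ _ _ => e.
  have -> : a = - (rho d sigma g p * b) by lra.
  by ring.
by rewrite (der_of_g rg mg h); ring.
Qed.
End NormNu.

(** * The codifferential along the boundary *)

Section Gauss.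
Context {R : realType} {n : nat} {M : bmanifold R n}.
Notation SB := (bdry M).
Let rgM : regular M n.+1 := atlas_regular (atlasM M).
Hypothesis rg : regular SB n.
Variables (sg : M -> R) (g : metric M).
Hypothesis ssg : smooth (s := M) sg.
Hypothesis mg : is_metric g.
Notation nu := (grad g sg).
Hypothesis sg0 : forall p, boundary M p -> sg p = 0.
Hypothesis nu1 : forall p, boundary M p -> g nu nu p = 1.
Hypothesis nunu : forall p, boundary M p -> exists a, forall u, der (levi_civita g nu nu) u p = a * der nu u p.
Notation h := (bdry_metric g).
Notation pull := (@pullback R n M (boundary M)).
Let mh : is_metric h := restrict_is_metric rg mg.
Implicit Types (p : SB) (A B : dform M).

Let ag p : nearby p (agree g h). Proof. by apply: nearbyT. Qed.

Lemma lift_tangent p X : g (lift_at p X) nu (sval p) = 0.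
Proof.
rewrite (g_sym mg) (g_grad rgM mg) -lift_atP // (_ : (fun q => _) = fun=> 0) ?(der_cst rg) //.
by apply/funext => -[q bq]; exact: sg0.
Qed.

Lemma pullback_form k A : is_form k A -> is_form k (pull A).
Proof.
move=> hA; split.
- move=> s; apply: (sm_local rg) => p.
  have /choice [E hE] : forall X, exists Y, nearby p (fun q => rel q X Y) by move=> X; exact: (rel_ext rg p X).
  exists (fun q => A (map E s) (sval q)); first exact: sub_restrict (form_sm _ hA).
  have : nearby p (fun q => forall i : 'I_(size s), rel q (tnth (in_tuple s) i) (E (tnth (in_tuple s) i))).
    by apply: (nearby_fin rg) => i; exact: hE.
  apply: nearbyW => q hq; rewrite /pullback.
  have -> : s = map (tnth (in_tuple s)) (enum 'I_(size s)).
    by have := map_tnth_enum (in_tuple s); rewrite /= => {1}<-.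
  rewrite -!map_comp; apply: (form_eq_at rgM _ hA) => i; exact: rel_eq (rel_lift q _) (hq i).
- by move=> s sk p; rewrite /pullback (form_deg _ hA) // size_map.
- by move=> s1 s2 s3 X p; rewrite /pullback !map_cat /= !map_cat /= (form_alt _ _ _ _ _ hA).
- move=> s1 s2 f X Y Z p hZ; rewrite /pullback !map_cat /=.
  apply: (clin_lin rgM (form_clin _ _ hA)) => u; have [su|nu'] := pselect (smooth u); last by rewrite !der_ns ?mulr0 ?addr0.
  by rewrite -!lift_atP // (clin_app p (@clin_der _ _ _) hZ).
Qed.

Section At.
Variables (p : SB) (E : vfield SB -> vfield M).
Hypothesis hE : forall X, nearby p (fun q => rel q X (E X)).

Lemma pull_near s k A : is_form k A -> nearby p (fun q : SB => pull A s q = A (map E s) (sval q)).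
Proof.
move=> hA; have : nearby p (fun q => forall i : 'I_(size s), rel q (tnth (in_tuple s) i) (E (tnth (in_tuple s) i))).
  by apply: (nearby_fin rg) => i; exact: hE.
apply: nearbyW => q hq; rewrite /pullback.
have -> : s = map (tnth (in_tuple s)) (enum 'I_(size s)).
  by have := map_tnth_enum (in_tuple s); rewrite /= => {1}<-.
by rewrite -!map_comp; apply: (form_eq_at rgM _ hA) => i; exact: rel_eq (rel_lift q _) (hq i).
Qed.

(** An orthonormal frame of M at p adapted to the boundary: nu at index 0, then extensions of a
    frame of the boundary. *)
Definition bframe (i : 'I_n.+1) : vfield M := if unlift ord0 i is Some a then E (frame_at h p a) else nu.

Lemma bframe_onb : onb g bframe (sval p).
Proof.
have oe := frame_onb rg mh p; have he (a : 'I_n) : rel p (frame_at h p a) (E (frame_at h p a)) := nearby_sub (hE _).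
have oe' := rel_onb mg (nearby_sub (ag p)) oe he.
have tn X : g (E X) nu (sval p) = 0.
  by rewrite -(lift_tangent p X); apply: (clin_at rgM (g_clinl mg _)); exact: rel_eq (nearby_sub (hE X)) (rel_lift p X).
move=> i j; rewrite /bframe; case: (unliftP ord0 i) => [a|] ->; case: (unliftP ord0 j) => [b|] ->.
- by rewrite oe' (inj_eq (@lift_inj _ ord0)).
- by rewrite tn.
- by rewrite (g_sym mg) tn.
- by rewrite nu1 //; exact: (svalP p).
Qed.

Lemma tangent_lc T X Y : clin T -> T nu (sval p) = 0 ->
  T (lift_at p (levi_civita h X Y)) (sval p) = T (levi_civita g (E X) (E Y)) (sval p).
Proof.
move=> hT T0; rewrite !(onb_lin rgM mg _ hT bframe_onb) !big_ord_recl /= (_ : bframe ord0 = nu) ?T0 ?mulr0 ?add0r; last by rewrite /bframe unlift_none.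
apply: eq_bigr => a _; congr (_ * _); rewrite /bframe liftK.
have he := nearby_sub (hE (frame_at h p a)).
rewrite -(rel_g mg (nearby_sub (ag p)) (rel_lift p _) he).
exact: (rel_lc_tangent rg mg mh (ag p) (hE X) (hE Y) he).
Qed.

Lemma nabla_rel k A X s : is_form k A -> (forall s, A (nu :: s) (sval p) = 0) ->
  nabla h X (pull A) s p = nabla g (E X) A (map E s) (sval p).
Proof.
move=> hA A0; rewrite !nablaE /gder; congr (_ - _).
  exact: (rel_der rg (nearby_sub (hE X)) (form_sm s (pullback_form hA)) (form_sm _ hA) (pull_near s hA)).
rewrite (dact_nat (vf0 SB)) (dact_nat (E (vf0 SB))) size_map; apply: eq_big_nat => i /andP [_ si].
rewrite (nth_map (vf0 SB)) // /pullback /replace map_cat /= -map_take -map_drop.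
rewrite (form_eq_at2 rgM (h := E) _ _ _ hA) => [|Y]; last exact: rel_eq (rel_lift p Y) (nearby_sub (hE Y)).
apply: (tangent_lc X _ (form_clin _ _ hA)).
by rewrite (form_move rgM _ _ _ _ hA) A0 mulr0.
Qed.

(** As iota(nu) A = 0 on the boundary, the normal part of the connection (the second fundamental
    form) drops out of the tangential terms. In the term of the frame vector nu, D_nu nu is a
    multiple of nu and drops out too. *)
Lemma gauss k A s : is_form k A -> (forall q s, boundary M q -> A (nu :: s) q = 0) ->
  fdelta n.+1 g A (map E s) (sval p) = fdelta n h (pull A) s p + nabla g nu (inter nu A) (map E s) (sval p).
Proof.
move=> hA A0; have bp : boundary M (sval p) by exact: (svalP p).
have A0p s' : A (nu :: s') (sval p) = 0 by exact: A0.
rewrite (fdelta_onb rgM mg _ hA bframe_onb) (fdelta_onb rg mh _ (pullback_form hA) (frame_onb rg mh p)).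
rewrite big_ord_recl /= addrC; congr (_ + _).
  apply: eq_bigr => a _; rewrite (nabla_rel _ _ hA A0p) /bframe liftK //.
rewrite /bframe unlift_none (nabla_cons g nu nu _ _ hA).
have [a ha] := nunu bp; rewrite (clin2 rgM (X := levi_civita g nu nu) (Y := nu) (Z := nu) (a := a) (b := 0) (form_clin0 _ hA)).
  by rewrite A0p; ring.
by move=> u; rewrite ha; ring.
Qed.

Lemma bdry_zero k B : is_form k B -> (forall s, B (nu :: s) (sval p) = 0) ->
  (forall s, B (map E s) (sval p) = 0) -> forall s, B s (sval p) = 0.
Proof.
move=> hB hn ht; apply: (form_span0 rgM (f := bframe) hB).
  by move=> X; exists (fun a => g X (bframe a) (sval p)); exact: (onb_complete rgM mg bframe_onb).
move=> J; have [/splitPr [J1 J2]|nJ] := boolP (ord0 \in J).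
  have b0 : bframe ord0 = nu by rewrite /bframe unlift_none.
  by rewrite map_cat /= (form_move rgM _ _ _ _ hB) b0 hn mulr0.
have -> : map bframe J = map E (map (fun i => if unlift ord0 i is Some a then frame_at h p a else vf0 SB) J).
  rewrite -map_comp; apply/eq_in_map => i iJ; rewrite /bframe /=.
  by case: (unliftP ord0 i) => [a //|e]; rewrite e in iJ; rewrite iJ in nJ.
exact: ht.
Qed.
End At.
End Gauss.

Lemma int01_eq (R : realType) (f h : R -> R) : (forall t, 0 <= t <= 1 -> f t = h t) -> int01 f = int01 h.
Proof. by move=> e; apply: eq_Rintegral => t; rewrite inE /= in_itv /= => /e. Qed.

Lemma partial_coordM (R : realType) (n : nat) (O : set 'rV[R]_n.+1) F x i j : open O -> smooth_on O F -> O x ->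
  partial i (fun y => y ord0 j * F y) x = (i == j)%:R * F x + x ord0 j * partial i F x.
Proof.
move=> oO sF Ox; have d1 : is_derive x (delta_mx ord0 i) (fun y : 'rV[R]_n.+1 => y ord0 j) (i == j)%:R.
  apply/is_deriveP => e e0; exists 1 => // h _; rewrite !mxE eqxx /= eq_sym (_ : _ - _ = 0) ?normr0; last by ring.
  by rewrite mulr_ge0 // ltW.
have d2 := so_der i sF Ox; have d3 := is_deriveM d1 d2.
transitivity (x ord0 j *: partial i F x + F x *: (i == j)%:R : R); first exact: (@derive_val _ _ _ _ _ _ _ d3).
by rewrite /GRing.scale /=; ring.
Qed.

(** * The divergence equation near the boundary *)

Section Tube.
Context {R : realType} {S : smooth_space R} {m : nat}.
Hypothesis pr : preregular S.
Notation V := 'rV[R]_m.+1.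
Variables (phi : S -> V) (D : S -> Prop).
Hypothesis hc : is_chart phi D true.
Variables (c : V) (d : R).
Hypothesis c0 : c ord0 ord0 = 0.
Hypothesis d0 : 0 < d.
Hypothesis hB : forall x, box c d x -> 0 <= x ord0 ord0 -> exists2 r, D r & phi r = x.
Implicit Types (p q r : S) (O : set V) (G F : V -> R) (f h : S -> R) (i : 'I_m.+1) (x y : V).
Notation P0 := (pred1 (ord0 : 'I_m.+1)).
Let inB q := D q /\ box c d (phi q).

(** A representative of f on a domain stable under contraction of the first coordinate, so that it
    can be integrated from the boundary up to q. *)
Definition cyl f q O G := [/\ open O, (forall x t, O x -> 0 <= t <= 1 -> O (Sc P0 t x)), O (phi q), smooth_on O G &
  forall r, D r -> O (phi r) -> f r = G (phi r)].

Let Sc0_box x t : box c d x -> 0 <= t <= 1 -> box c d (Sc P0 t x).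
Proof.
move=> h /andP [t0 t1] j; have := h j; rewrite mxE /=; case: eqP => // ->; rewrite c0 !subr0 normrM (ger0_norm t0).
by apply: le_lt_trans; rewrite ler_piMl.
Qed.
Let Sc0_half x t : 0 <= x ord0 ord0 -> 0 <= t <= 1 -> 0 <= Sc P0 t x ord0 ord0.
Proof. by move=> x0 /andP [t0 _]; rewrite mxE /= ?eqxx mulr_ge0. Qed.

Let sel_eq f r r' : smooth f -> D r -> D r' -> phi r = phi r' -> f r = f r'.
Proof.
move=> sf Dr Dr' e; have [ O [F [ oO Or _ h]]] := ch_rep hc sf Dr.
by rewrite (h r Dr Or) (h r' Dr') -e.
Qed.

Let oB : open [set y : V | box c d y]. Proof. exact: box_open. Qed.
Let o0 (a : R) : open [set y : V | a < y ord0 ord0].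
Proof.
apply: (@open_comp _ _ (fun y : V => y ord0 ord0) [set t | a < t]); last exact: open_gt.
by move=> y _; exact: coord_continuous.
Qed.

Lemma cyl_ex f q : smooth f -> inB q -> exists O G, cyl f q O G.
Proof.
move=> sf [Dq Bq]; have z01 : 0 <= (0 : R) <= 1 by rewrite lexx ler01.
have q0 := ch_half hc isT Dq; pose z := Sc P0 0 (phi q).
have z0 : z ord0 ord0 = 0 by rewrite mxE /= ?eqxx mul0r.
have [r0 Dr0 er0] := hB (Sc0_box Bq z01) (Sc0_half q0 z01).
have [ O0 [F0 [ oO0 Or0 sF0 eF0]]] := ch_rep hc sf Dr0; rewrite er0 -/z in Or0.
have [e e0 he] := open_box oO0 Or0.
pose sel y := such_that q [set r | D r /\ phi r = y].
have selP y : box c d y -> 0 <= y ord0 ord0 -> D (sel y) /\ phi (sel y) = y.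
  by move=> b y0; apply: (@such_thatP _ q [set r | D r /\ phi r = y]); have [r ? ?] := hB b y0; exists r.
pose O := [set y : V | box c d y] `&` [set y : V | - e < y ord0 ord0] `&` [set y : V | forall j, j != ord0 -> `|y ord0 j - z ord0 j| < e].
have oO : open O.
  apply: openI; first exact: openI.
  apply: open_forall => j; rewrite openE => y hy; apply/nbhs_box.
  have [j0|j0] := eqVneq j ord0; first by exists 1 => // x _; rewrite j0 eqxx.
  have yj : 0 < e - `|y ord0 j - z ord0 j| by rewrite subr_gt0 hy.
  exists (e - `|y ord0 j - z ord0 j|) => // x hx _; have := hx j.
  by have := ler_normD (x ord0 j - y ord0 j) (y ord0 j - z ord0 j); rewrite addrA subrK; lra.
have near0 y : O y -> y ord0 ord0 <= 0 -> box z e y.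
  move=> [[_ /= y1] h] y0 j; have [->|/h //] := eqVneq j ord0.
  by rewrite z0 subr0 ltr_norml y1 /=; lra.
(* The local extensions of f live near single points. [G] is f itself inside the half-space and one
   extension F0, at the foot z of q on the boundary, below it. [O] keeps the transverse coordinates
   within e of those of z, so that F0 is available wherever it is needed. *)
pose G y := if 0 < y ord0 ord0 then f (sel y) else F0 y.
have GF0 y : box c d y -> box z e y -> G y = F0 y.
  move=> by' bz; rewrite /G; case: ltP => // y0; have [Ds es] := selP y by' (ltW y0).
  by rewrite (eF0 _ Ds) es //; exact: he.
exists O, G; split=> //.
- move=> x t [[bx x0] hx] ht; split; first split; first exact: Sc0_box.
    have /andP [t0 t1] := ht; rewrite /= mxE /= ?eqxx; move: x0 => /= x0; have [x1|x1] := ltP (x ord0 ord0) 0; last by have := mulr_ge0 t0 x1; lra.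
    have t1' : 0 <= 1 - t by lra.
    have x1' : 0 <= - x ord0 ord0 by lra.
    have := mulr_ge0 t1' x1'; rewrite mulrBl mul1r mulrN; lra.
  by move=> j j0; rewrite mxE /= (negbTE j0); exact: hx.
- split; first by split=> //=; lra.
  by move=> j j0; rewrite mxE /= (negbTE j0) subrr normr0.
- apply: so_local => x Ox; have [x0|x0] := ltP 0 (x ord0 ord0).
    have [[bx _] _] := Ox; have [Ds es] := selP x bx (ltW x0).
    have [ O1 [F1 [ oO1 Or1 sF1 eF1]]] := ch_rep hc sf Ds; rewrite es in Or1.
    exists (O1 `&` ([set y : V | box c d y] `&` [set y : V | 0 < y ord0 ord0])), F1; split=> //.
    + by do ! apply: openI.
    + exact: so_sub sF1.
    + move=> y [ O1y [by' y0]]; have [Dy ey] := selP y by' (ltW y0).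
      by rewrite /G y0 (eF1 _ Dy) ey.
  exists ([set y : V | box c d y] `&` [set y : V | box z e y]), F0; split.
  + by apply: openI => //; exact: box_open.
  + by split; [case: Ox => -[]|exact: near0].
  + by apply: so_sub sF0 => y [_ /he].
  + by move=> y [h1 h2]; exact: GF0.
- move=> r Dr Or; have [[br _] _] := Or.
  have [r1|r1] := ltP 0 (phi r ord0 ord0).
    by rewrite /G r1; have [Ds es] := selP _ br (ltW r1); exact: sel_eq.
  by rewrite (GF0 _ br (near0 _ Or r1)) (eF0 r Dr) //; apply: he; exact: near0.
Qed.

Lemma cyl_int f h q O G O' G' : (forall r, inB r -> f r = h r) -> cyl f q O G -> cyl h q O' G' -> inB q ->
  Iop P0 0 G (phi q) = Iop P0 0 G' (phi q).
Proof.
move=> e [_ sO Oq _ eG] [_ sO' Oq' _ eG'] [Dq Bq]; apply: int01_eq => t ht; congr (_ * _).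
have bt := Sc0_box Bq ht; have [r Dr er] := hB bt (Sc0_half (ch_half hc isT Dq) ht).
by rewrite -er -eG ?er //; [rewrite e //; [rewrite eG' ?er //; exact: sO'|split=> //; rewrite er]|exact: sO].
Qed.

(* phi_0 times the integral of f over [0, phi_0] rescaled to [0, 1]: the primitive of
   f in the first coordinate which vanishes on the boundary. *)
Definition Tl f q := such_that 0 [set a | exists O G, cyl f q O G /\ a = phi q ord0 ord0 * Iop P0 0 G (phi q)].

Lemma TlE f q O G : cyl f q O G -> inB q -> Tl f q = phi q ord0 ord0 * Iop P0 0 G (phi q).
Proof.
move=> h Bq; have [ O' [G' [h' ->]]] : [set a | exists O G, cyl f q O G /\ a = phi q ord0 ord0 * Iop P0 0 G (phi q)] (Tl f q).
  by apply: such_thatP; eexists; exists O, G; split; [exact: h|].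
by congr (_ * _); exact: (cyl_int (fun _ _ => erefl) h' h Bq).
Qed.

Variable chi : S -> R.
Hypothesis schi : smooth chi.
Hypothesis chi_box : forall r, chi r != 0 -> D r /\ box c (d / 2) (phi r).
Hypothesis chi_out : forall r, ~ D r -> nearby r (fun s => chi s = 0).
(** The primitive [Tl] makes sense in the box only; the cut-off chi makes T f a smooth function on
    all of S. *)
Definition T f q := chi q * Tl f q.

Let chi_notin r : ~ inB r -> nearby r (fun s => chi s = 0).
Proof.
move=> nB; have [Dr|/chi_out //] := pselect (D r).
have /existsNP [j /negP] : ~ box c d (phi r) by move=> b; apply: nB.
rewrite -leNgt => hj.
have oO : open [set y : V | box (phi r) (d / 2) y] by exact: box_open.
have dd : 0 < d / 2 by rewrite divr_gt0.
apply: nearbyW (chart_near hc Dr oO _) => [s [Ds bs]|i]; last by rewrite subrr normr0.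
apply/eqP; apply: contraT => /chi_box [_ b]; have := b j; have := bs j.
have := ler_normD (phi s ord0 j - c ord0 j) (phi r ord0 j - phi s ord0 j).
have -> : phi s ord0 j - c ord0 j + (phi r ord0 j - phi s ord0 j) = phi r ord0 j - c ord0 j by ring.
by rewrite [`|phi r ord0 j - phi s _ _|]distrC; lra.
Qed.

Lemma cyl_near f q O G : cyl f q O G -> inB q -> nearby q (fun r => inB r /\ cyl f r O G).
Proof.
move=> h Bq; have [ oO sO Oq sG eG] := h; have [Dq bq] := Bq.
have oI : open (O `&` [set y : V | box c d y]) by exact: openI.
by apply: nearbyW (chart_near hc Dq oI (conj Oq bq)) => r [Dr [Or br]].
Qed.

Let Tl_rep f q O G : cyl f q O G -> inB q -> reps phi (Tl f) q O (fun y => y ord0 ord0 * Iop P0 0 G y).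
Proof.
move=> h Bq; have [ oO sO Oq sG eG] := h; split=> //.
  exact: (so_mul oO (so_coord ord0 oO) (Iop_smooth oO sO 0 sG)).
by apply: nearbyW (cyl_near h Bq) => r [Br hr]; exact: (TlE hr Br).
Qed.

Lemma T_sm f : smooth f -> smooth (T f).
Proof.
move=> sf; apply: (sm_local pr) => q; have [Bq|/chi_notin h] := pselect (inB q); last first.
  by exists (fun=> 0); [exact: smooth_cst|apply: nearbyW h => r; rewrite /T => ->; rewrite mul0r].
have [ O [G h]] := cyl_ex sf Bq; have [ oO Oq sF e] := Tl_rep h Bq.
have [u su eu] := ch_lift hc Bq.1 oO Oq sF.
exists (fun r => chi r * u r); first exact: (smM pr).
by apply: nearbyW (nearbyI pr e eu) => r [er ur]; rewrite /T er ur.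
Qed.

Definition good q := inB q /\ nearby q (fun r => chi r = 1).

Let T_rep f q O G : cyl f q O G -> good q -> reps phi (T f) q O (fun y => y ord0 ord0 * Iop P0 0 G y).
Proof.
move=> h [Bq c1]; have [ oO Oq sF e] := Tl_rep h Bq; split=> //.
by apply: nearbyW (nearbyI pr e c1) => r [er cr]; rewrite /T er cr mul1r.
Qed.

Lemma T_val f q O G : cyl f q O G -> good q -> T f q = phi q ord0 ord0 * Iop P0 0 G (phi q).
Proof. by move=> h [Bq /nearby_sub c1]; rewrite /T c1 mul1r (TlE h). Qed.

Let T_out f q : ~ inB q -> T f q = 0.
Proof.
move=> nB; rewrite /T; have [->|/chi_box [Dq b]] := eqVneq (chi q) 0; first by rewrite mul0r.
case: nB; split=> // j; have := b j; have := d0; lra.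
Qed.
Let T_in f q O G : cyl f q O G -> inB q -> T f q = chi q * (phi q ord0 ord0 * Iop P0 0 G (phi q)).
Proof. by move=> h Bq; rewrite /T (TlE h). Qed.

Lemma T_eq f h q : smooth f -> smooth h -> (forall r, inB r -> f r = h r) -> T f q = T h q.
Proof.
move=> sf sh e; have [Bq|nB] := pselect (inB q); last by rewrite !T_out.
have [ O [G h1]] := cyl_ex sf Bq; have [ O' [G' h2]] := cyl_ex sh Bq.
by rewrite (T_in h1 Bq) (T_in h2 Bq) (cyl_int e h1 h2 Bq).
Qed.

Lemma T_bdry f q : smooth f -> good q -> phi q ord0 ord0 = 0 -> T f q = 0.
Proof. by move=> sf gq q0; have [ O [G h]] := cyl_ex sf gq.1; rewrite (T_val h gq) q0 mul0r. Qed.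

Lemma T_add f h q : smooth f -> smooth h -> T (fun r => f r + h r) q = T f q + T h q.
Proof.
move=> sf sh; have [Bq|nB] := pselect (inB q); last by rewrite !T_out ?addr0.
have [ O [G h1]] := cyl_ex sf Bq; have [ O' [G' h2]] := cyl_ex sh Bq.
have [ oO sO Oq sG eG] := h1; have [ oO' sO' Oq' sG' eG'] := h2; have oI := openI oO oO'.
have h3 : cyl (fun r => f r + h r) q (O `&` O') (fun y => G y + G' y).
  split=> //.
  - by move=> x t [Ox Ox'] ht; split; [exact: sO|exact: sO'].
  - exact: (so_add oI (so_sub (@subIsetl _ O O') sG) (so_sub (@subIsetr _ O O') sG')).
  - by move=> r Dr [Or Or']; rewrite eG // eG'.
rewrite (T_in h1 Bq) (T_in h2 Bq) (T_in h3 Bq) -!mulrDr; do 2 congr (_ * _).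
rewrite /Iop -[int01 (fun t => t ^+ 0 * G _)]mul1r -int01_lin; first by apply: int01_eq => t _; ring.
  exact: (@Iop_c01 R m P0 O sO 0 G _ (fun y Oy => so_cont sG Oy) Oq).
exact: (@Iop_c01 R m P0 O' sO' 0 G' _ (fun y Oy => so_cont sG' Oy) Oq').
Qed.

Lemma T0 q : T (fun=> 0) q = 0.
Proof.
have s0 := smooth_cst S 0; have := T_add q s0 s0.
rewrite (_ : (fun r => 0 + 0) = fun=> 0); last by apply/funext => r; rewrite addr0.
by move=> h; apply: (@addrI _ (T (fun=> 0) q)); rewrite addr0.
Qed.

Lemma T_opp f q : smooth f -> T (fun r => - f r) q = - T f q.
Proof.
move=> sf; have := T_add q sf (smN pr sf).
rewrite (_ : (fun r => f r + _) = fun=> 0); last by apply/funext => r; rewrite subrr.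
by rewrite T0 => /esym /eqP; rewrite addrC addr_eq0 => /eqP.
Qed.

Lemma T_sum (I : Type) (l : seq I) (F : I -> S -> R) q : (forall j, smooth (F j)) ->
  T (fun r => \sum_(j <- l) F j r) q = \sum_(j <- l) T (F j) q.
Proof.
move=> sF; elim: l => [|j l IH].
  by rewrite big_nil -[RHS](T0 q); congr T; apply/funext => r; rewrite big_nil.
rewrite big_cons -IH -T_add //; last exact: (sm_sum pr).
by congr T; apply/funext => r; rewrite big_cons.
Qed.

(** The primitive starts at the boundary, so it vanishes near a boundary point around which f does.
    The neighbourhood is chosen before f, in order to serve all components of a form at once. *)
Lemma T_loc q (P : S -> Prop) : good q -> phi q ord0 ord0 = 0 -> nearby q P ->
  nearby q (fun r => forall f, (forall s, P s -> f s = 0) -> T f r = 0).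
Proof.
move=> gq q0 n0; have [[Dq Bq] _] := gq; have [U [oU Uq hU]] := nearby_chart hc Dq n0.
have [e e0 he] := open_box oU Uq.
have oE : open [set y : V | box (phi q) e y] by exact: box_open.
have h f : (forall s, P s -> f s = 0) -> cyl f q [set y : V | box (phi q) e y] (fun=> 0).
  move=> hf; split=> //; last by move=> r Dr br; apply: hf; apply: hU Dr _; exact: he.
  - move=> x t hx /andP [t0 t1] j; have := hx j; rewrite mxE /=; case: eqP => // ->; rewrite q0 !subr0 normrM (ger0_norm t0).
    by apply: le_lt_trans; rewrite ler_piMl.
  - by move=> j; rewrite subrr normr0.
  - exact: smooth_on_cst.
have oI := openI oE oB; have qI : ([set y : V | box (phi q) e y] `&` [set y : V | box c d y]) (phi q).
  by split=> // j; rewrite subrr normr0.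
apply: nearbyW (chart_near hc Dq oI qI) => r [Dr [er br]] f hf.
have [a1 a2 _ a4 a5] := h f hf; rewrite /T (TlE (O := [set y : V | box (phi q) e y]) (G := fun=> 0)) //.
have -> : Iop P0 0 (fun=> 0) (phi r) = 0.
  by rewrite /Iop; under eq_fun do rewrite mulr0; rewrite /int01 /Rintegral integral0.
by rewrite !mulr0.
Qed.

Variable E : 'I_m.+1 -> vfield S.
Hypothesis hE : forall q, inB q -> forall i f, smooth f -> der (E i) f q = pd phi i f q.

Let cyl_pd f q O G i : smooth f -> cyl f q O G -> inB q -> exists2 O', cyl (der (E i) f) q O' (partial i G) & O' `<=` O.
Proof.
move=> sf [ oO sO Oq sG eG] [Dq Bq]; exists (O `&` [set y : V | box c d y]); last by move=> y [].
split=> //.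
- exact: openI.
- by move=> x t [Ox bx] ht; split; [exact: sO|exact: Sc0_box].
- exact: (so_partial i (so_sub (@subIsetl _ O _) sG)).
- move=> r Dr [Or br]; rewrite hE // (pdE pr hc i Dr (O := O) (F := G)) //; split=> //.
  by apply: nearbyW (chart_near hc Dr oO Or) => s [Ds Os]; exact: eG.
Qed.

Lemma T_E0 f q : smooth f -> good q -> der (E ord0) (T f) q = f q.
Proof.
move=> sf gq; have [Bq _] := gq; have [Dq _] := Bq; have [ O [G h]] := cyl_ex sf Bq; have [ oO sO Oq sG eG] := h.
rewrite (hE Bq _ (T_sm sf)) (pdE pr hc ord0 Dq (T_rep h gq)) (partial_coordM _ _ oO (Iop_smooth oO sO 0 sG) Oq) eqxx mul1r.
rewrite /partial (@derive_val _ _ _ _ _ _ _ (Iop_der oO sO 0 ord0 sG Oq)) /= ?eqxx add0n (eG q Dq Oq) (Iop_euler oO sO sG Oq).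
by rewrite (big_pred1 ord0).
Qed.

Lemma T_Ei f q i : smooth f -> good q -> i != ord0 -> der (E i) (T f) q = T (der (E i) f) q.
Proof.
move=> sf gq i0; have [Bq _] := gq; have [Dq _] := Bq; have [ O [G h]] := cyl_ex sf Bq; have [ oO sO Oq sG eG] := h.
rewrite (hE Bq _ (T_sm sf)) (pdE pr hc i Dq (T_rep h gq)) (partial_coordM _ _ oO (Iop_smooth oO sO 0 sG) Oq).
rewrite (negbTE i0) mul0r add0r /partial (@derive_val _ _ _ _ _ _ _ (Iop_der oO sO 0 i sG Oq)) /= (negbTE i0) addn0.
by have [ O' h' _] := cyl_pd i sf h Bq; rewrite (T_val h' gq).
Qed.

(** Hadamard's lemma in the first coordinate; the boundary value f is what would be lost. *)
Lemma T_dE0 f q : smooth f -> good q -> (forall r, inB r -> phi r ord0 ord0 = 0 -> f r = 0) -> T (der (E ord0) f) q = f q.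
Proof.
move=> sf gq f0; have [Bq _] := gq; have [Dq bq] := Bq; have [ O [G h]] := cyl_ex sf Bq; have [ oO sO Oq sG eG] := h.
have [ O' h' _] := cyl_pd ord0 sf h Bq; rewrite (T_val h' gq).
have z01 : 0 <= (0 : R) <= 1 by rewrite lexx ler01.
have := hadamard oO sO sG Oq; rewrite (big_pred1 ord0) // => <-.
have bz := Sc0_box bq z01; have [r Dr er] := hB bz (Sc0_half (ch_half hc isT Dq) z01).
have Oz := sO _ _ Oq z01; rewrite (eG q Dq Oq) -er -(eG r Dr) ?er // f0 ?subr0 //; first by split=> //; rewrite er.
by rewrite er mxE /= ?eqxx mul0r.
Qed.
End Tube.

(** * Forms with given components relative to the gradients of coordinates *)

Section FormOfComponents.
Context {R : realType} {S : smooth_space R} {d : nat}.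
Hypothesis rg : regular S d.
Variable g : metric S.
Hypothesis mg : is_metric g.
Variables (x : 'I_d -> S -> R) (E : 'I_d -> vfield S).
Notation Z := (fun i => grad g (x i)).
Implicit Types (F : seq 'I_d -> S -> R) (s : seq (vfield S)) (J : seq 'I_d).

(** Expands every argument by the coefficients g(X, E_j), its components relative to the gradients
    grad x_j, and contracts with the components F. *)
Fixpoint mk s F : S -> R :=
  if s is X :: s' then mk s' (fun J q => \sum_j g X (E j) q * F (j :: J) q) else F [::].

Let alternating F := forall J1 i j J2 q, F (J1 ++ i :: j :: J2) q = - F (J1 ++ j :: i :: J2) q.

Lemma mk_lin s F1 F2 F3 (a : S -> R) q : (forall J, F3 J q = a q * F1 J q + F2 J q) ->
  mk s F3 q = a q * mk s F1 q + mk s F2 q.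
Proof.
elim: s F1 F2 F3 => [|X s IH] F1 F2 F3 h /=; first exact: h.
by apply: IH => J; rewrite mulr_sumr -big_split /=; apply: eq_bigr => j _; rewrite h; ring.
Qed.

Lemma mk_zero s F q : (forall J, F J q = 0) -> mk s F q = 0.
Proof. by move=> h; rewrite (@mk_lin s F F F (fun=> 0) q) ?mul0r ?add0r => [|J]; [elim: s F h => [|X s IH] F h /=; [exact: h|apply: IH => J; rewrite big1 // => j _; rewrite h mulr0]|rewrite h; ring]. Qed.

Lemma antisum0 (a : 'I_d -> R) (b : 'I_d -> 'I_d -> R) : (forall j l, b j l = - b l j) ->
  \sum_j a j * (\sum_l a l * b j l) = 0.
Proof.
move=> hb; set s := LHS; suff : s = - s by lra.
rewrite {1}/s; under eq_bigr do rewrite mulr_sumr.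
rewrite exchange_big /s -sumrN; apply: eq_bigr => j _; rewrite mulr_sumr -sumrN; apply: eq_bigr => l _.
by rewrite (hb l j); ring.
Qed.

Lemma mk_form k F : (forall J, smooth (F J)) -> (forall J, (size J)%:Z != k -> forall q, F J q = 0) ->
  alternating F -> is_form k (fun s q => mk s F q).
Proof.
move: k F; apply: degree_ind => [k k0|k IH] F sF dF aF.
  have z J q : F J q = 0 by apply: dF; apply: contraTneq k0 => <-; rewrite -leNgt.
  rewrite (_ : (fun s q => _) = 0); first exact: form0.
  by apply: dfP => s q; exact: mk_zero.
apply: (form_of_inter rg) => [X|s|X s p||].
- apply: IH => [J|J hJ q|J1 i j J2 q].
  + by apply: (sm_sum rg) => j; apply: (smM rg) => //; exact: (g_sm mg).
  + by rewrite big1 // => j _; rewrite dF ?mulr0 //=; apply: contra_neq hJ => <-; rewrite -addn1 PoszD; ring.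
  + by rewrite -sumrN; apply: eq_bigr => l _; rewrite (aF (l :: J1)); ring.
- move=> f X Y W p h /=; rewrite (@mk_lin s (fun J q => \sum_j g X (E j) q * F (j :: J) q) (fun J q => \sum_j g Y (E j) q * F (j :: J) q) _ (sfun_val f) p) // => J.
  rewrite mulr_sumr -big_split /=; apply: eq_bigr => j _.
  by rewrite (clin_app p (g_clinl mg _) h); ring.
- rewrite /=; apply: mk_zero => J; apply: (antisum0 (fun j => g X (E j) p) (b := fun j l => F [:: l, j & J] p)) => j l.
  exact: (aF [::]).
- exact: sF.
- by move=> k0 p; apply: dF; rewrite eq_sym.
Qed.

Lemma mk_grads J F q : coords x E q -> mk (map Z J) F q = F J q.
Proof.
move=> [hx _]; elim: J F => [//|i J IH] F /=; rewrite IH (bigD1 i) //= (g_grad rg mg) hx eqxx mul1r big1 ?addr0 // => j ji.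
by rewrite (g_grad rg mg) hx (negbTE ji) mul0r.
Qed.

Lemma exter_grads0 (theta : vfield S -> S -> R) i0 J B q : (forall i, i != i0 -> theta (Z i) q = 0) -> i0 \notin J ->
  exter theta B (map Z J) q = 0.
Proof.
move=> h; elim: J B => [|i J IH] B; first by rewrite exter_nil.
by rewrite inE negb_or eq_sym /= => /andP [i1 nJ]; rewrite exter_cons h // mul0r IH // subr0.
Qed.
End FormOfComponents.

Section Steps.
Context {R : realType} {n : nat} (M : bmanifold R n).
Lemma step_smooth (f : M -> R) : smooth (s := M) f -> smooth (s := M) (fun q => step (f q)).
Proof.
move=> sf i p Dp; have [ O [F [ oO Op sF e]]] := sf i p Dp.
by exists O, (fun y => step (F y)); split=> //; [exact: so_step|move=> q Dq Oq; rewrite e].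
Qed.
End Steps.

Section LocalSolve.
Context {R : realType} {n : nat} {M : bmanifold R n}.
Variables (c : set (metric M)) (sigma : metric M -> M -> R) (g : metric M).
Hypothesis cg : c g.
Hypothesis PE : poincare_einstein c sigma.
Let rg : regular M n.+1 := atlas_regular (atlasM M).
Hypothesis rgB : regular (bdry M) n.
Hypothesis mg : is_metric g.
Notation nu := (grad g (sigma g)).
Hypothesis nu1 : forall p, boundary M p -> g nu nu p = 1.

(** A function vanishing on the boundary has no tangential derivatives, so its gradient is
    normal. *)
Lemma normal_grad u p : smooth (s := M) u -> boundary M p -> nearby (S := M) p (fun r => boundary M r -> u r = 0) ->
  exists a, forall v, der (grad g u) v p = a * der nu v p.
Proof.
move=> su bp nu0; pose pt : bdry M := exist _ p bp.
have /choice [Ex hEx] : forall X, exists Y, nearby pt (fun q => rel q X Y) by move=> X; exact: (rel_ext rgB pt X).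
have sb := sigma_bdry cg PE; have ss := sigma_smooth cg PE.
have oe := bframe_onb rgB ss mg sb nu1 hEx; set f := bframe _ _ _ _ in oe.
exists (g (grad g u) nu p) => v; rewrite (onb_complete rg mg oe) big_ord_recl /= big1 ?addr0 => [|a _].
  by rewrite /f /bframe unlift_none.
rewrite /f /bframe liftK (g_grad rg mg) -(nearby_sub (hEx _) u su) (der_near0 rgB) ?mul0r //; first exact: sub_restrict.
by apply: nearbyW (nearby_restrict (p := pt) nu0) => -[r br] /(_ br).
Qed.

Lemma plateauM i p (U : set 'rV[R]_n.+1) : dom i p -> open U -> U (chart i p) -> exists chi : M -> R,
  [/\ smooth (s := M) chi, nearby (S := M) p (fun q => chi q = 1), forall r, chi r != 0 -> dom i r /\ U (chart i r) &
      forall r, ~ dom i r -> nearby (S := M) r (fun s => chi s = 0)].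
Proof.
move=> Dp oU Up; have [f [sf f0 h1 h2]] := ch_bump (chartM i) Dp oU Up.
have sf2 : smooth (fun q => 2 / f p * f q) by apply: (smM rg) => //; exact: smooth_cst.
(* The argument exceeds 1 where f > f(p) / 2, hence near p, and it is 0 where f is. *)
exists (fun q => step (2 / f p * f q)); split; first exact: step_smooth.
- have s3 : smooth (fun q => 2 / f p * f q - 1) by apply: (smB rg) => //; exact: smooth_cst.
  have := nearby_pos (atlasM M) (p := p) s3; rewrite divfK ?gt_eqF // => /(_ _) h.
  by apply: nearbyW (h _) => [q hq|]; [apply: step1; lra|lra].
- move=> r; have [->|fr] := eqVneq (f r) 0; last by move=> _; exact: h1.
  by rewrite mulr0 step0 ?eqxx.
- by move=> r /h2; apply: nearbyW => q ->; rewrite mulr0 step0.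
Qed.

(* eta is dx_0 wedge the form whose components, relative to the gradients of the
   coordinates, are mu^-1 times the primitives along x_0 of the components of mu e. *)
Lemma local_solve p : boundary M p -> exists W : set M, [/\ open W, W p & forall k (e : dform M), is_form k e ->
  (forall s q, fdelta n.+1 g e s q = 0) -> (forall s q, boundary M q -> e (nu :: s) q = 0) ->
  exists eta : dform M, [/\ is_form (k + 1) eta, forall s q, W q -> fdelta n.+1 g eta s q = e s q,
    forall s q, W q -> boundary M q -> eta s q = 0 &
    forall q, W q -> boundary M q -> nearby (S := M) q (fun r => forall s, e s r = 0) -> nearby (S := M) q (fun r => forall s, eta s r = 0)]].
Proof.
move=> bp; have [i Dp] := @dom_cover _ _ M p; have hc := chartM i; have pr := preregularM M.
have [x [E [sx ex nE nD]]] := chart_coords (atlasM M) Dp hc.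
have [fr nfr] := gram_schmidt rg mg sx nE.
have ad : nearby (S := M) p (adapted g x E fr) by apply: nearbyW (nearbyI rg nE nfr) => q [? []].
have [nv snv nnv] := mu_inv rg sx ad.
have nco := fdelta_coord rg mg ad.
set m := mu x fr in nnv nco; have sm : smooth m := mu_sm rg x fr.
pose Z i := grad g (x i).
have := nearbyI rg (nearbyI rg nE nD) (nearbyI rg (nearbyI rg (nearby_nearby nnv) nco) (ex ord0)).
move=> /(nearby_chart hc Dp) [U [oU Up hU]].
have [U1 [oU1 U1p hU1]] := ch_img hc Dp.
have [d d0 hd] := open_box (openI oU oU1) (conj Up U1p).
set c0 := chart i p in hd; have cc0 : c0 ord0 ord0 = 0 := (boundaryP cg PE Dp).1 bp.
have hB y : box c0 d y -> 0 <= y ord0 ord0 -> exists2 r, dom i r & chart i r = y.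
  by move=> b y0; apply: hU1 => //; case: (hd y b).
have b0 (a : R) : 0 < a -> box c0 a c0 by move=> a0 j; rewrite subrr normr0.
have d2 : 0 < d / 2 by rewrite divr_gt0.
have [chi [schi c1 hchi hout]] := plateauM Dp (@box_open R n c0 (d / 2)) (b0 _ d2).
pose inB q := dom i q /\ box c0 d (chart i q).
have inBU q : inB q -> _ := fun h => hU q h.1 (hd _ h.2).1.
have inBn q : inB q -> nearby (S := M) q inB by move=> [Dq bq]; exact: (chart_near hc Dq (@box_open R n c0 d) bq).
have inBb q : inB q -> boundary M q -> chart i q ord0 ord0 = 0 by move=> [Dq _] /(boundaryP cg PE Dq).
pose gd := good (S := M) (chart i) (dom i) c0 d chi.
have ngd : nearby (S := M) p gd.
  by apply: nearbyW (nearbyI rg (inBn p (conj Dp (b0 _ d0))) (nearby_nearby c1)) => q [].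
have [W [oW Wp hW]] := nearbyM_open ngd.
exists W; split=> // k e he de ne.
pose T := T (S := M) (chart i) (dom i) chi.
have hE q : inB q -> forall j f, smooth (s := M) f -> der (E j) f q = pd (S := M) (chart i) j f q.
  by move=> /inBU [[_ h] _].
have mn q : inB q -> nv q * m q = 1 by move=> /inBU [_ [[/nearby_sub]]].
have mn0 q : inB q -> nv q != 0 by move=> /mn h; apply/eqP => z; move: h; rewrite z mul0r => /esym /eqP; rewrite oner_eq0.
have co q : inB q -> coords x E q by move=> /inBU [[]].
have Tsm f : smooth f -> smooth (T f) by exact: (T_sm pr hc cc0 d0 hB schi hchi hout).
pose f J := fun q => nv q * e (map Z J) q.
have sf J : smooth (f J) by apply: (smM rg) => //; exact: (form_sm _ he).
pose F J := fun q => m q * T (f J) q.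
have sF J : smooth (F J) by apply: (smM rg) => //; exact: Tsm.
have dF J : (size J)%:Z != k -> forall q, F J q = 0.
  move=> hJ q; have f0 : f J = fun=> 0 by apply/funext => r; rewrite /f (form_deg _ he) ?mulr0 // size_map.
  by rewrite /F f0 /T (T0 hc cc0 d0 hB hchi) mulr0.
have aF J1 a b J2 q : F (J1 ++ a :: b :: J2) q = - F (J1 ++ b :: a :: J2) q.
  rewrite /F -mulrN -(T_opp pr hc cc0 d0 hB hchi) //; congr (_ * T _ _); apply/funext => r.
  by rewrite /f !map_cat /= (form_swap rg _ _ _ _ _ he) mulrN.
pose e' : dform M := fun s q => mk g E s F q.
have he' : is_form k e' by apply: (mk_form rg mg).
pose th X := g (E ord0) X.
have heta : is_form (k + 1) (exter th e').
  by apply: (exter_form rg _ _ he'); [exact: g_clinr|move=> X; exact: g_sm].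
have thZ q j : inB q -> th (Z j) q = (ord0 == j)%:R.
  by move=> /co [hx _]; rewrite /th /Z (g_sym mg) (g_grad rg mg) hx.
have e'Z q J : inB q -> e' (map Z J) q = F J q by move=> /co; exact: (mk_grads rg mg).
have ext0 q J B : inB q -> ord0 \notin J -> exter th B (map Z J) q = 0.
  by move=> Bq; apply: exter_grads0 => j j0; rewrite thZ // eq_sym (negbTE j0).
have eta1 q j J : inB q -> ord0 \notin J -> exter th e' (Z j :: map Z J) q = (ord0 == j)%:R * F J q.
  by move=> Bq J0; rewrite exter_cons thZ // e'Z // ext0 // subr0.
have eta2 q j J : inB q -> ord0 \notin J ->
    exter th e' (Z j :: Z ord0 :: map Z J) q = (ord0 == j)%:R * F (ord0 :: J) q - F (j :: J) q.
  move=> Bq J0; rewrite exter_cons thZ // -[Z ord0 :: _]/(map Z (ord0 :: J)) e'Z //= exter_cons thZ // eqxx mul1r ext0 // subr0.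
  by rewrite /inter -[Z j :: _]/(map Z (j :: J)) e'Z.
have div A l J q : is_form l A -> inB q -> fdelta n.+1 g A (map Z J) q = m q * \sum_j der (E j) (fun r => nv r * A (Z j :: map Z J) r) q.
  by move=> hA /inBU [_ [[h1 h2] _]]; exact: (h2 l).
have mF q J : inB q -> nv q * F J q = T (f J) q by move=> /mn h; rewrite /F mulrA h mul1r.
have sA A l s : is_form l A -> smooth (fun r => nv r * A s r).
  by move=> hA; apply: (smM rg) => //; exact: (form_sm _ hA).
have sTs J j : smooth (fun r => - T (f (j :: J)) r) by apply: (smN rg); exact: Tsm.
(* grad x_0 is normal to the boundary, so the tangential form e vanishes there with this
   argument. *)
have Z0 q s : inB q -> boundary M q -> e (Z ord0 :: s) q = 0.
  move=> Bq bq; have nb : nearby (S := M) q (fun r => boundary M r -> x ord0 r = 0).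
    by apply: nearbyW (inBn q Bq) => r Br br; have [_ [_ ->]] := inBU r Br; exact: inBb.
  have [a ha] := normal_grad (sx ord0) bq nb.
  rewrite (clin2 rg (X := Z ord0) (Y := nu) (Z := nu) (a := a) (b := 0) (form_clin0 s he)); first by rewrite ne //; ring.
  by move=> u; rewrite ha; ring.
(* Components without the index 0: only the derivative in direction 0 of the primitive survives in
   the divergence. *)
have D1 q J : gd q -> ord0 \notin J -> fdelta n.+1 g (exter th e') (map Z J) q = e (map Z J) q.
  move=> gq J0; have Bq := gq.1; rewrite (div _ _ _ _ heta Bq) (bigD1 ord0) //= big1 ?addr0 => [|j j0].
    rewrite (der_near rg _ (sA _ _ _ heta) (Tsm _ (sf J))); last first.
      by apply: nearbyW (inBn q Bq) => r Br; rewrite eta1 // eqxx mul1r mF.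
    by rewrite (T_E0 pr hc cc0 d0 hB schi hchi hout hE) // /f mulrA [m q * _]mulrC mn // mul1r.
  apply: (der_near0 rg); first exact: (sA _ _ _ heta).
  by apply: nearbyW (inBn q Bq) => r Br; rewrite eta1 // eq_sym (negbTE j0) mul0r mulr0.
(* Components with the index 0: the divergence is - sum_{j <> 0} T (d_j f_{jJ}). As delta e = 0, it
   equals T (d_0 f_{0J}), and this is f_{0J} because f_{0J} vanishes on the boundary. *)
have D2 q J : gd q -> ord0 \notin J -> fdelta n.+1 g (exter th e') (map Z (ord0 :: J)) q = e (map Z (ord0 :: J)) q.
  move=> gq J0; have Bq := gq.1; rewrite (div _ _ _ _ heta Bq) (bigD1 ord0) //= [X in X + _](_ : _ = 0) ?add0r; last first.
    apply: (der_near0 rg); first exact: (sA _ _ _ heta).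
    by apply: nearbyW (inBn q Bq) => r Br; rewrite eta2 // eqxx mul1r subrr mulr0.
  have s1 j : smooth (der (E j) (f (j :: J))) by exact: der_sm.
  rewrite (eq_bigr (fun j => - T (der (E j) (f (j :: J))) q)) => [|j j0]; last first.
    rewrite (der_near rg _ (sA _ _ _ heta) (sTs J j)); last first.
      by apply: nearbyW (inBn q Bq) => r Br; rewrite eta2 // eq_sym (negbTE j0) mul0r sub0r mulrN mF.
    by rewrite (derN rg _ _ (Tsm _ (sf _))) (T_Ei pr hc cc0 d0 hB schi hchi hout hE).
  have := T_sum pr hc cc0 d0 hB hchi (index_enum 'I_n.+1) q s1.
  rewrite (T_eq hc cc0 d0 hB hchi (h := fun=> 0)) ?(T0 hc cc0 d0 hB hchi) //; last first.
  - move=> r Br; have := de (map Z J) r; rewrite (div _ _ _ _ he Br) => /eqP; rewrite mulf_eq0 => /orP [/eqP m0|/eqP //].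
    by have := mn r Br; rewrite m0 mulr0 => /esym /eqP; rewrite oner_eq0.
  - exact: smooth_cst.
  - exact: (sm_sum rg).
  rewrite (bigD1 ord0) //= => /esym /eqP; rewrite addr_eq0 => /eqP E0.
  rewrite sumrN -E0 (T_dE0 pr hc cc0 hB hE (sf _) gq) => [|r Br r0].
    by rewrite /f mulrA [m q * _]mulrC mn // mul1r.
  by rewrite /f /= Z0 ?mulr0 //; apply/(boundaryP cg PE Br.1).
exists (exter th e'); split=> //.
- move=> s q Wq; have gq := hW q Wq; have Bq := gq.1.
  pose C : dform M := fdelta n.+1 g (exter th e') - e.
  have hd' : is_form k (fdelta n.+1 g (exter th e')) by have := fdelta_form rg mg heta; rewrite addrK.
  have hC : is_form k C by exact: (formB rg).
  apply/eqP; rewrite -subr_eq0; apply/eqP; apply: (form_grads0 rg mg hC (co q Bq)) => J.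
  have [/splitPr [J1 J2]|J0] := boolP (ord0 \in J); last first.
    by rewrite -[LHS]/(fdelta n.+1 g (exter th e') (map Z J) q - e (map Z J) q) D1 // subrr.
  rewrite map_cat /= (form_move rg _ _ _ _ hC) -map_cat; have [J0|J0] := boolP (ord0 \in J1 ++ J2).
    by case/splitPr: J0 => J3 J4; rewrite map_cat /= (form_alt [::] _ _ _ _ hC) mulr0.
  have := D2 q _ gq J0; rewrite /= -[C _ q]/(fdelta n.+1 g (exter th e') (Z ord0 :: map Z (J1 ++ J2)) q - e (Z ord0 :: map Z (J1 ++ J2)) q) => ->.
  by rewrite subrr mulr0.
- move=> s q Wq bq; have gq := hW q Wq; have Bq := gq.1.
  have z : forall s, e' s q = 0.
    apply: (form_grads0 rg mg he' (co q Bq)) => J; rewrite e'Z // /F /T (T_bdry hc cc0 hB (sf J) gq) ?mulr0 //; exact: inBb.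
  by rewrite (@exter_lin _ _ th 0 0 e' e' e') ?mul0r ?addr0 // => s'; rewrite z; ring.
- move=> q Wq bq nq; have gq := hW q Wq; have Bq := gq.1.
  have := T_loc hc cc0 hB gq (inBb q Bq bq) nq; move=> h; apply: nearbyW (nearbyI rg h (inBn q Bq)) => r [{}h Br] s.
  have z : forall s, e' s r = 0.
    apply: (form_grads0 rg mg he' (co r Br)) => J; rewrite e'Z // /F /T h ?mulr0 // => t et; by rewrite /f et mulr0.
  by rewrite (@exter_lin _ _ th 0 0 e' e' e') ?mul0r ?addr0 // => s'; rewrite z; ring.
Qed.
End LocalSolve.

(** * Division by sigma *)

Section Division.
Context {R : realType} {n : nat} {M : bmanifold R n}.
Variables (c : set (metric M)) (sigma : metric M -> M -> R) (g : metric M).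
Hypothesis cg : c g.
Hypothesis PE : poincare_einstein c sigma.
Let rg : regular M n.+1 := atlas_regular (atlasM M).
Let sg := sigma g.
Let ssg : smooth (s := M) sg := sigma_smooth cg PE.
Implicit Types (p q : M) (u v a b : M -> R).

Lemma coord_div p : boundary M p -> exists x0 : M -> R, [/\ smooth (s := M) x0, x0 p = 0 &
  forall u, smooth (s := M) u -> (forall q, boundary M q -> u q = 0) ->
  exists2 a, smooth (s := M) a & nearby (S := M) p (fun q => u q = x0 q * a q)].
Proof.
move=> bp; have [i Dp] := @dom_cover _ _ M p; have hc := chartM i; have pr := preregularM M.
have [x [sx ex]] := coords_ex hc Dp; have p0 := (boundaryP cg PE Dp).1 bp.
exists (x ord0); split=> [||u su u0]; [exact: sx|by rewrite (nearby_sub (ex ord0))|].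
have [ O [F [ oO Op sF eF]]] := ch_rep hc su Dp; have [U [oU Up hU]] := ch_img hc Dp.
have [d d0 hd] := open_box (openI oO oU) (conj Op Up).
pose B := [set y | box (chart i p) d y]; have oB : open B by exact: box_open.
have Bp : B (chart i p) by move=> j; rewrite subrr normr0.
have sB y t : B y -> 0 <= t <= 1 -> B (Sc (pred1 ord0) t y).
  move=> h /andP [t0 t1] j; have := h j; rewrite mxE /=; case: eqP => // ->; rewrite p0 !subr0 normrM (ger0_norm t0).
  by apply: le_lt_trans; rewrite ler_piMl.
have sF' : smooth_on B F by apply: so_sub sF => y /hd [].
have [a sa ea] := ch_lift hc Dp oB Bp (Iop_smooth oB sB 0 (so_partial ord0 sF')).
exists a => //; apply: nearbyW (nearbyI pr (nearbyI pr (chart_near hc Dp oB Bp) ea) (ex ord0)) => q [[[Dq Bq] aq] xq].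
have z01 : 0 <= (0 : R) <= 1 by rewrite lexx ler01.
have Bz := sB _ 0 Bq z01; have z0 : Sc (pred1 ord0) 0 (chart i q) ord0 ord0 = 0 by rewrite mxE /= ?eqxx mul0r.
have [Oz Uz] := hd _ Bz; have [r Dr er] : exists2 r, dom i r & chart i r = Sc (pred1 ord0) 0 (chart i q).
  by apply: hU => // _; rewrite z0.
have Fz : F (Sc (pred1 ord0) 0 (chart i q)) = 0.
  by rewrite -er -(eF r Dr) ?er // u0 //; apply/(boundaryP cg PE Dr); rewrite er.
have := hadamard oB sB sF' Bq; rewrite (big_pred1 ord0) // Fz subr0 => h.
by rewrite (eF q Dq (hd _ Bq).1) h xq aq.
Qed.

Lemma sigma_cancel a b p : smooth (s := M) a -> smooth (s := M) b ->
  nearby (S := M) p (fun q => sg q * a q = sg q * b q) -> a p = b p.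
Proof.
move=> sa sb h; apply/eqP; rewrite -subr_eq0; apply/eqP.
apply: (density_int cg PE (smB rg sa sb)); apply: nearbyW h => q hq sq; apply/eqP; rewrite subr_eq0; apply/eqP.
by apply: (mulfI _ hq); rewrite gt_eqF.
Qed.

(** Near a boundary point u = x_0 a and sigma = x_0 s, where s does not vanish because d sigma <> 0;
    so a / s is a quotient. Local quotients agree by density of the interior, and hence they are one
    smooth function. *)
Lemma div_ex u : smooth (s := M) u -> (forall q, boundary M q -> u q = 0) -> exists2 v, smooth (s := M) v & forall q, u q = sg q * v q.
Proof.
move=> su u0.
have /choice [v hv] : forall p, exists v, smooth v /\ nearby p (fun q => u q = sg q * v q).
  move=> p; have [bp|ip] := pselect (boundary M p); last first.
    have sp : sg p != 0 by rewrite gt_eqF // (sigma_int cg PE).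
    have [h sh eh] := nearby_inv rg ssg sp; exists (fun q => u q * h q); split; first exact: (smM rg).
    by apply: nearbyW eh => q [s0 ->]; field.
  have [x0 [sx xp hx]] := coord_div bp; have [a sa ea] := hx u su u0.
  have [s ss es] := hx sg ssg (sigma_bdry cg PE).
  have sp : s p != 0.
    case: PE => _ _ _ /(_ g p cg bp) [_ [X]] + _; apply: contra_neq => sp.
    by rewrite (der_near rg X ssg (smM rg sx ss) es) (derM rg) // xp sp; ring.
  have [h sh eh] := nearby_inv rg ss sp; exists (fun q => a q * h q); split; first exact: (smM rg).
  by apply: nearbyW (nearbyI rg ea (nearbyI rg es eh)) => q [-> [-> [s0 ->]]]; field.
exists (fun p => v p p); last by move=> q; exact: (nearby_sub (hv q).2).
apply: (sm_local rg) => p; exists (v p); first by case: (hv p).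
have [svp np] := hv p; apply: nearbyW (nearby_nearby np) => q nq; have [svq nq'] := hv q.
by apply: sigma_cancel => //; apply: nearbyW (nearbyI rg nq nq') => r [<- <-].
Qed.

(** The quotients are chosen separately for each list of arguments; degree, alternation and
    multilinearity are inherited from A because sigma can be cancelled. *)
Lemma form_div k (A : dform M) : is_form k A -> (forall s q, boundary M q -> A s q = 0) ->
  exists2 B : dform M, is_form k B & forall s q, A s q = sg q * B s q.
Proof.
move=> hA A0; have /choice [B hB] : forall s, exists v, smooth v /\ forall q, A s q = sg q * v q.
  by move=> s; have [v ? ?] := div_ex (form_sm s hA) (A0 s); exists v.
have sB s : smooth (B s) by case: (hB s).
have eB s q : A s q = sg q * B s q by case: (hB s).
exists B => //; have z u q : smooth u -> (forall r, sg r * u r = 0) -> u q = 0.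
  by move=> su h; apply: (sigma_cancel su (smooth_cst M 0)); apply: nearbyT => r; rewrite h mulr0.
split=> //.
- by move=> s sk p; apply: z => // r; rewrite -eB (form_deg _ hA).
- by move=> s1 s2 s3 X p; apply: z => // r; rewrite -eB (form_alt _ _ _ _ _ hA).
- move=> s1 s2 f X Y Z p h.
  have sf := sfun_sm f; apply: (sigma_cancel (sB _) (b := fun q => sfun_val f q * B (s1 ++ X :: s2) q + B (s1 ++ Y :: s2) q)).
    by apply: (smD rg) => //; exact: (smM rg).
  by apply: nearbyT => r; rewrite mulrDr mulrCA -!eB (clin_app r (form_clin s1 s2 hA) h).
Qed.
End Division.

(** * Gluing local solutions of the divergence equation *)

Section Glue.
Context {R : realType} {n : nat} {M : bmanifold R n}.
Variables (c : set (metric M)) (sigma : metric M -> M -> R) (g : metric M).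
Hypothesis cg : c g.
Hypothesis PE : poincare_einstein c sigma.
Let rg : regular M n.+1 := atlas_regular (atlasM M).
Hypothesis rgB : regular (bdry M) n.
Hypothesis mg : is_metric g.
Notation nu := (grad g (sigma g)).
Hypothesis nu1 : forall p, boundary M p -> g nu nu p = 1.
Notation delta := (fdelta n.+1 g).
Notation near q P := (nearby (S := M) q (fun r => forall s, P s r)).
Implicit Types (p q r : M) (s : seq (vfield M)) (e w A B : dform M) (k : int) (V L : set M).
Let ssg : smooth (s := M) (sigma g) := sigma_smooth cg PE.

(** With A = sigma B one gets delta A = iota(nu) B + sigma delta B, and iota(nu) iota(nu) B = 0.
    Thus subtracting delta A from a right hand side keeps it tangential on the boundary. *)
Lemma inter_delta0 k A s q : is_form k A -> (forall s q, boundary M q -> A s q = 0) -> boundary M q -> delta A (nu :: s) q = 0.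
Proof.
move=> hA A0 bq; have [B hB eB] := form_div cg PE hA A0.
have -> : A = fmul (sigma g) B by apply: dfP.
by rewrite (fdelta_fmul rg mg _ _ ssg hB) (form_diag _ _ _ hB) (sigma_bdry cg PE bq); ring.
Qed.

(** What a correction must satisfy in order to be iterated. Vanishing on the boundary keeps the next
    error tangential; vanishing on L and for sigma >= d gives local finiteness near the boundary and
    in the interior; the last clause preserves what is already solved. *)
Definition stepper k V := forall e L (d : R), is_form k e -> (forall s q, delta e s q = 0) ->
  (forall s q, boundary M q -> e (nu :: s) q = 0) -> closed L -> (forall q, boundary M q -> L q -> near q (fun s r => e s r = 0)) -> 0 < d ->
  exists w, [/\ is_form (k + 1) w, forall s q, boundary M q -> w s q = 0,
    (forall s q, L q -> w s q = 0) /\ (forall s q, d <= sigma g q -> w s q = 0),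
    forall q, boundary M q -> V q -> near q (fun s r => delta w s r = e s r) &
    forall q, boundary M q -> near q (fun s r => e s r = 0) -> near q (fun s r => w s r = 0)].

(** The local solution is multiplied by a cut-off chi of the chart, equal to 1 on V, and by a
    cut-off [kap] in sigma. The closed set L inside V is a neighbourhood of p, so that countably
    many such sets can cover the boundary. *)
Lemma patch k p : boundary M p -> exists V L N, [/\ open V, stepper k V, closed L, L `<=` V & [/\ open N, N p & N `<=` L]].
Proof.
move=> bp; have [W [oW Wp hW]] := local_solve cg PE rgB mg nu1 bp.
have [i Dp] := @dom_cover _ _ M p; have [U [oU Up hU]] := chart_nbhd oW Wp Dp.
have [chi [d [K [schi d0 chi1 [cK clK hK] chi0]]]] := liftM Dp oU Up (@smooth_on_cst R n U 1).
have cp : box (chart i p) d (chart i p) by move=> j; rewrite subrr normr0.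
have [f [d' [L [sf d'0 f1 [_ clL hL] f0]]]] := liftM Dp (@box_open R n (chart i p) d) cp (@smooth_on_cst R n _ 1).
have fp : f p != 0 by rewrite (f1 p Dp) ?oner_eq0 // => j; rewrite subrr normr0.
have [N [oN Np hN]] := nearbyM_open (nearby_neq0 sf fp).
pose V := dom i `&` chart i @^-1` [set y | box (chart i p) d y].
have oV : open V by apply: chart_continuous; exact: box_open.
suff sV : stepper k V.
  exists V, L, N; split=> //; split=> // q /hN fq.
  by apply: contrapT => /f0 z; rewrite z eqxx in fq.
move=> e Lp dl he de ne cL hLp dl0; have [eta [heta deta eta0 leta]] := hW k e he de ne.
have KW q : K q -> W q by move=> /hK [Dq Uq]; exact: hU.
have VK q : V q -> K q.
  by move=> [Dq bq]; apply: contrapT => /chi0 z; have := chi1 q Dq bq; rewrite z => /eqP; rewrite eq_sym oner_eq0.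
(* Compactness of the intersection of K and Lp: near its boundary points eta vanishes, and near the
   others sigma is bounded below by a positive number. *)
have [d1 d10 hd1] : exists2 d1 : R, 0 < d1 & forall q, K q -> Lp q -> sigma g q < d1 -> forall s, eta s q = 0.
  have /compact_near_coveringP nc := compact_closedI cK cL.
  have [|N1 _ hN1] := nc nat \oo (fun m q => sigma g q < m.+1%:R^-1 -> forall s, eta s q = 0) _; last first.
    by exists (N1.+1%:R^-1) => [|q Kq Lq]; [rewrite invr_gt0 ltr0n|apply: (hN1 N1) => //=].
  move=> q [Kq Lq]; have [bq|iq] := pselect (boundary M q).
    have [Q [oQ Qq hQ]] := nearbyM_open (leta q (KW q Kq) bq (hLp q bq Lq)).
    by exists (Q, setT) => [|[r m] [Qr _] _]; [split=> //=; [exact: open_nbhs_nbhs|exact: filterT]|exact: hQ].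
  have sq := sigma_int cg PE iq; pose s2 := sigma g q / 2; have s20 : 0 < s2 by rewrite divr_gt0.
  have sm2 : smooth (fun r => sigma g r - s2) by apply: (smB rg) => //; exact: smooth_cst.
  have [|Q [oQ Qq hQ]] := nearbyM_open (nearby_pos (atlasM M) (p := q) sm2 _); first by rewrite /s2; lra.
  exists (Q, [set m | (Num.Def.archi_bound s2^-1 <= m)%N]).
    by split=> /=; [exact: open_nbhs_nbhs|exists (Num.Def.archi_bound s2^-1)].
  move=> [r m] [/hQ /= sr mb] sm; exfalso; have : s2^-1 < m.+1%:R.
    apply: lt_le_trans (archi_boundP _) _; first by rewrite invr_ge0 ltW.
    by rewrite ler_nat; exact: leq_trans mb (leqnSn m).
  move=> h; have : m.+1%:R^-1 < s2 by rewrite -[s2]invrK ltf_pV2 ?posrE ?invr_gt0 ?ltr0n.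
  by move=> h2; have := lt_trans sm h2; lra.
pose ep := Num.min d1 dl; have ep0 : 0 < ep by rewrite lt_min d10.
have [ep1 ep2] : ep <= d1 /\ ep <= dl by rewrite !ge_min !lexx orbT.
(* Equal to 1 for sigma <= ep / 2 and to 0 for sigma >= ep; the choice of ep makes the product
   vanish on Lp and where sigma >= dl. *)
pose kap q := step (2 - 2 / ep * sigma g q).
have skap : smooth kap.
  by apply: step_smooth; apply: (smB rg); [exact: smooth_cst|apply: (smM rg) => //; exact: smooth_cst].
have kap0 q : ep <= sigma g q -> kap q = 0.
  by move=> h; apply: step0; have : 1 <= ep^-1 * sigma g q; [rewrite mulrC ler_pdivlMr // mul1r|lra].
have su : smooth (fun q => chi q * kap q) by exact: (smM rg).
have hw : is_form (k + 1) (fmul (fun q => chi q * kap q) eta) by exact: (formM rg).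
exists (fmul (fun q => chi q * kap q) eta); split=> //.
- move=> s q bq; rewrite /fmul; have [/KW Wq|/chi0 ->] := pselect (K q); first by rewrite eta0 // mulr0.
  by rewrite !mul0r.
- split=> s q h; rewrite /fmul.
    have [Kq|/chi0 ->] := pselect (K q); last by rewrite !mul0r.
    have [lt|ge] := ltP (sigma g q) d1; first by rewrite (hd1 q Kq h lt) mulr0.
    by rewrite kap0 ?mulr0 ?mul0r //; exact: le_trans ep1 ge.
  by rewrite kap0 ?mulr0 ?mul0r //; exact: le_trans ep2 h.
- move=> q bq Vq; have nV : nearby q V := nearby_openM oV Vq.
  have s3 : smooth (fun r => ep / 2 - sigma g r) by apply: (smB rg) => //; exact: smooth_cst.
  have n3 := nearby_pos (atlasM M) (p := q) s3; rewrite (sigma_bdry cg PE bq) subr0 divr_gt0 // in n3.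
  have e1 : near q (fun s r => fmul (fun q => chi q * kap q) eta s r = eta s r).
    apply: nearbyW (nearbyI rg nV (n3 isT)) => r [[Dr br] sr] s; rewrite /fmul (chi1 r Dr br) mul1r /kap step1 ?mul1r //.
    by have : ep^-1 * sigma g r <= 1 / 2; [rewrite mulrC ler_pdivrMr //; lra|lra].
  apply: nearbyW (nearbyI rg (fdelta_near rg g hw heta e1) nV) => r [h Vr] s.
  by rewrite h deta //; apply: KW; exact: VK.
- move=> q bq nq; have [/KW Wq|nK] := pselect (K q).
    by apply: nearbyW (leta q Wq bq nq) => r h s; rewrite /fmul h mulr0.
  have oK : open (~` K) by rewrite openC.
  by apply: nearbyW (nearby_openM oK nK) => r /chi0 z s; rewrite /fmul z !mul0r.
Qed.

Lemma stepper0 k : stepper k set0.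
Proof. by move=> e L d _ _ _ _ _ _; exists 0; split=> //; [exact: form0|move=> q _ _; apply: nearbyT]. Qed.

(** A countable base is numbered by [code]. The m-th entry is a patch around the basic set of number
    m if there is such a patch, and it is empty otherwise. *)
Lemma cover_ex k : exists V L B : nat -> set M, [/\ forall m, [/\ open (V m), stepper k (V m), closed (L m) & L m `<=` V m],
  forall m, open (B m) /\ B m `<=` L m & forall p, boundary M p -> exists m, B m p].
Proof.
have [Bs /countable_injP [code inj] [oBs hBs]] := @carrier_second_countable _ _ M.
pose P (m : nat) (D : set M * set M * set M) := [/\ open D.1.1, stepper k D.1.1, closed D.1.2, D.1.2 `<=` D.1.1 & open D.2 /\ D.2 `<=` D.1.2].
have h m : exists D, P m D /\ ((exists D', P m D' /\ (Bs D'.2 /\ code D'.2 = m)) -> Bs D.2 /\ code D.2 = m).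
  have [[D [hD eD]]|no] := pselect (exists D', P m D' /\ (Bs D'.2 /\ code D'.2 = m)); first by exists D.
  exists (set0, set0, set0); split; last by move=> h; case: no.
  by split=> //=; [exact: open0|exact: stepper0|exact: closed0|split=> //; exact: open0].
have [D hD] := choice h.
exists (fun m => (D m).1.1), (fun m => (D m).1.2), (fun m => (D m).2); split=> [m|m|p bp].
- by have [[]] := hD m.
- by have [[_ _ _ _ hm] _] := hD m.
have [V [L [N [oV sV cL LV [oN Np NL]]]]] := patch k bp.
have [B [BB Bp] BN] := hBs p N (open_nbhs_nbhs (conj oN Np)).
exists (code B); have [_ [|BD cD]] := hD (code B).
  by exists (V, L, B); split=> //; split=> //; split; [exact: oBs|move=> q /BN /NL].
by have -> : (D (code B)).2 = B by apply: inj; rewrite ?inE.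
Qed.

Lemma near_delta0 k w q : is_form k w -> near q (fun s r => w s r = 0) -> near q (fun s r => delta w s r = 0).
Proof.
move=> hw h; have h0 : is_form k (0 : dform M) by exact: form0.
apply: nearbyW (fdelta_near rg g hw h0 h) => r e s; rewrite e.
by rewrite (@fdelta_lin _ _ _ rg g k 0 0 0 0 0) ?mul0r ?addr0 // => s' r'; rewrite !mul0r addr0.
Qed.

(* Countably many local solutions are corrected one after the other: the cut-off of the
   m-th one is supported in sigma < 1 / (m + 1) and avoids the earlier plateaus, so that
   the sum is locally finite and the equations already solved stay solved. *)
Lemma glue k b : is_form k b -> (forall s q, delta b s q = 0) -> (forall s q, boundary M q -> b (nu :: s) q = 0) ->
  exists w, [/\ is_form (k + 1) w, forall s q, boundary M q -> w s q = 0 &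
    forall q, boundary M q -> near q (fun s r => delta w s r = b s r)].
Proof.
move=> hb db nb; have [V [L [B [hV hB hcov]]]] := cover_ex k.
pose Lp m : set M := [set q | exists2 i, (i < m)%N & L i q].
pose Q m e w := [/\ is_form (k + 1) w, forall s q, boundary M q -> w s q = 0,
    (forall s q, Lp m q -> w s q = 0) /\ (forall s q, m.+1%:R^-1 <= sigma g q -> w s q = 0),
    forall q, boundary M q -> V m q -> near q (fun s r => delta w s r = e s r) &
    forall q, boundary M q -> near q (fun s r => e s r = 0) -> near q (fun s r => w s r = 0)].
pose wf m e := such_that 0 [set w | Q m e w].
(* [est m] is the error b - delta (w_0 + ... + w_{m-1}) left after m corrections. *)
pose est := fix est m := if m is m'.+1 then est m' - delta (wf m' (est m')) else b.
pose w m := wf m (est m).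
have cLp m : closed (Lp m).
  elim: m => [|m IH]; first by rewrite (_ : Lp 0%N = set0); [exact: closed0|apply/seteqP; split=> // q []].
  rewrite (_ : Lp m.+1 = Lp m `|` L m); first by apply: closedU => //; have [] := hV m.
  apply/seteqP; split=> [q [i im Li]|q [[i im Li]|Lq]]; [|by exists i => //; exact: ltnW|by exists m].
  by move: im; rewrite ltnS leq_eqVlt => /orP [/eqP <-|im]; [right|left; exists i].
(* The error remains an admissible right hand side, and it vanishes near the boundary points of the
   patches already treated. *)
pose I m := [/\ is_form k (est m), forall s q, delta (est m) s q = 0, forall s q, boundary M q -> est m (nu :: s) q = 0 &
  forall i q, (i < m)%N -> boundary M q -> V i q -> near q (fun s r => est m s r = 0)].
have IQ m : I m -> Q m (est m) (w m).
  move=> [h1 h2 h3 h4]; apply: (@such_thatP _ 0 [set w | Q m (est m) w]); have [_ sV _ _] := hV m.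
  apply: (sV (est m) (Lp m) m.+1%:R^-1 h1 h2 h3 (cLp m)); last by rewrite invr_gt0 ltr0n.
  by move=> q bq [i im Li]; apply: (h4 i) => //; have [_ _ _ LV] := hV i; exact: LV.
have IS m : I m.
  elim: m => [|m Im]; first by split.
  have [h1 h2 h3 h4] := Im; have [w1 w2 _ w4 w5] := IQ m Im.
  have hd : is_form k (delta (w m)) by have := fdelta_form rg mg w1; rewrite addrK.
  have est1 s q : est m.+1 s q = est m s q - delta (w m) s q by [].
  split.
  - exact: (formB rg).
  - move=> s q; rewrite (@fdelta_lin _ _ _ rg g k 1 (-1) (est m) (delta (w m))) //.
      by rewrite h2 (fdelta_fdelta rg mg w1); rewrite -[(0 : dform M) s q]/(0 : R); ring.
    by move=> s' q'; rewrite est1; ring.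
  - by move=> s q bq; rewrite est1 h3 // (inter_delta0 _ w1) // subr0.
  - move=> i q; rewrite ltnS leq_eqVlt => /orP [/eqP -> bq Vq|im bq Vq].
      by apply: nearbyW (w4 q bq Vq) => r e s; rewrite est1 e subrr.
    have n1 := h4 i q im bq Vq; have := nearbyI rg n1 (near_delta0 w1 (w5 q bq n1)).
    by apply: nearbyW => r [e1 e2] s; rewrite est1 e1 e2 subrr.
have hw m : is_form (k + 1) (w m) by have [] := IQ m (IS m).
pose G N : dform M := fun s q => \sum_(m < N) w m s q.
have GS N s q : G N.+1 s q = G N s q + w N s q by rewrite /G big_ord_recr.
have hG N : is_form (k + 1) (G N).
  elim: N => [|N IH]; first by rewrite (_ : G 0%N = 0); [exact: form0|apply: dfP => s q; rewrite /G big_ord0].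
  by rewrite (_ : G N.+1 = G N + w N); [exact: (formD rg)|apply: dfP => s q; rewrite GS].
have dG N s q : delta (G N) s q = b s q - est N s q.
  elim: N s q => [|N IH] s q.
    rewrite subrr (@fdelta_lin _ _ _ rg g (k + 1) 0 0 (w 0%N) (w 0%N)) ?mul0r ?addr0 // => s' q'.
    by rewrite /G big_ord0; ring.
  rewrite (@fdelta_lin _ _ _ rg g (k + 1) 1 1 (G N) (w N)) // => [|s' q']; last by rewrite GS; ring.
  by rewrite IH mul1r -[est N.+1 s q]/(est N s q - delta (w N) s q); ring.
pose tail N q := forall m s, (N <= m)%N -> w m s q = 0.
have Gtail N N' s q : tail N q -> tail N' q -> G N s q = G N' s q.
  wlog le : N N' / (N <= N')%N => [H t t'|t _].
    by case/orP: (leq_total N N') => le; [exact: H|rewrite (H _ _ le)].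
  have -> : N' = (N + (N' - N))%N by rewrite subnKC.
  by elim: (N' - N)%N => [|j IH]; [rewrite addn0|rewrite addnS GS t ?addr0 // leq_addr].
have tail_cover m p : B m p -> nearby p (tail m.+1).
  have [oB BL] := hB m; move=> Bp; apply: nearbyW (nearby_openM oB Bp) => q Bq m' s mm.
  by have [_ _ [h _] _ _] := IQ m' (IS m'); apply: h; exists m => //; exact: BL.
have tail_ex p : exists N, nearby p (tail N).
  have [bp|ip] := pselect (boundary M p); first by have [m Bp] := hcov p bp; exists m.+1; exact: tail_cover.
  have sp := sigma_int cg PE ip; pose s2 := sigma g p / 2; have s20 : 0 < s2 by rewrite divr_gt0.
  have sm2 : smooth (fun r => sigma g r - s2) by apply: (smB rg) => //; exact: smooth_cst.
  exists (Num.Def.archi_bound s2^-1).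
  apply: nearbyW (nearby_pos (atlasM M) (p := p) sm2 _) => [q sq m s mb|]; last by rewrite /s2; lra.
  have [_ _ [_ h] _ _] := IQ m (IS m); apply: h; apply: le_trans (_ : s2 <= _); last by lra.
  rewrite -[s2]invrK lef_pV2 ?posrE ?invr_gt0 ?ltr0n //; apply: le_trans (ltW (archi_boundP _)) _.
    by rewrite invr_ge0 ltW.
  by rewrite ler_nat; exact: leq_trans mb (leqnSn m).
have [N hN] := choice tail_ex.
(* The infinite sum, stopped at q where all later terms vanish near q; near each point it agrees
   with a finite sum of forms. *)
pose ga : dform M := fun s q => G (N q) s q.
have gaG m p : nearby p (tail m) -> near p (fun s r => ga s r = G m s r).
  by apply: nearbyW => q t s; apply: Gtail => //; exact: (nearby_sub (hN q)).
have hga : is_form (k + 1) ga.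
  split=> [s|s sk p|s1 s2 s3 X p|s1 s2 f X Y Z p h]; rewrite /ga.
  - apply: (sm_local rg) => p; exists (G (N p) s); first exact: form_sm (hG _).
    by apply: nearbyW (gaG _ _ (hN p)) => q h; exact: h.
  - exact: form_deg (hG _) sk.
  - exact: form_alt (hG _).
  - exact: (clin_app p (form_clin s1 s2 (hG _)) h).
exists ga; split=> // [s q bq|q bq].
  by rewrite /ga /G big1 // => m _; have [_ h _ _ _] := IQ m (IS m); exact: h.
have [m Bq] := hcov q bq; have [_ _ _ h4] := IS m.+1.
have Vq : V m q by have [_ _ _ LV] := hV m; apply: LV; apply: (hB m).2.
have := nearbyI rg (fdelta_near rg g hga (hG m.+1) (gaG _ _ (tail_cover m q Bq))) (h4 m q (ltnSn m) bq Vq).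
by apply: nearbyW => r [e1 e2] s; rewrite e1 dG e2 subr0.
Qed.
End Glue.

(** * Solutions of the tractor Proca problem *)

Section Truncations.
Context {R : realType} {S : smooth_space R} {d : nat}.
Hypothesis rg : regular S d.
Hypothesis d3 : (3 <= d)%N.
Hypothesis lgc : log_closed (S := S).
Variable c : set (metric S).
Hypothesis cc : conformal_class c.
Variable sigma : metric S -> S -> R.
Hypothesis ds : density_section c 1 sigma.
Implicit Types (k w : int) (F G : tractor S) (p : S) (g : metric S).
Notation x := (xop sigma).
Notation K h l k w := (Ktrunc d sigma h l k w).

Lemma ypow_eq g j k w F G : F g = G g -> ypow d sigma j k w F g = ypow d sigma j k w G g.
Proof. by move=> e; elim: j => [|j IH] //=; exact: yop_eq. Qed.

Lemma K_eq g (h : R) l k w F G : F g = G g -> K h l k w F g = K h l k w G g.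
Proof.
move=> e; rewrite /Ktrunc; apply: eq_bigr => j _; congr (tmul _ _); apply: xpow_eq; exact: ypow_eq.
Qed.

Lemma ypow_tadd g j k w (a : R) F G : tractor_section c k w F -> tractor_section c k w G -> c g ->
  ypow d sigma j k w (tadd a F G) g = tadd a (ypow d sigma j k w F) (ypow d sigma j k w G) g.
Proof.
move=> hF hG cg; elim: j => [|j IH] //=.
rewrite (yop_eq _ _ _ IH) (yop_lin rg cc ds) //; first exact: (ts_sf (ts_ypow rg d3 lgc cc ds j hF)).
exact: (ts_sf (ts_ypow rg d3 lgc cc ds j hG)).
Qed.

Lemma K_tadd g (h : R) l k w (a : R) F G : tractor_section c k w F -> tractor_section c k w G -> c g ->
  K h l k w (tadd a F G) g = sadd a (K h l k w F g) (K h l k w G g).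
Proof.
move=> hF hG cg; elim: l => [|l IH]; first by rewrite !Ktrunc0.
rewrite !KtruncS IH (xpow_eq _ _ (ypow_tadd l.+1 a hF hG cg)) xpow_tadd.
set P := iter _ _ _ _; set Q := iter _ _ _ _; set P' := K _ _ _ _ F g; set Q' := K _ _ _ _ G g; set e := Kcoef _ _.
apply: slots_eqP => s p; have [-> -> -> ->] := saddE e (sadd a P Q) (sadd a P' Q') s p.
have [-> -> -> ->] := saddE a (sadd e P P') (sadd e Q Q') s p.
have [-> -> -> ->] := saddE a P Q s p; have [-> -> -> ->] := saddE a P' Q' s p.
by have [-> -> -> ->] := saddE e P P' s p; have [-> -> -> ->] := saddE e Q Q' s p; split; ring.
Qed.

Lemma xpow_cst g j (a : R) F : iter j x (fun g => tmul (fun=> a) (F g)) g = tmul (fun=> a) (iter j x F g).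
Proof.
elim: j => //= j IH; rewrite {1}/xop IH; apply: slots_eqP => s p.
have [-> -> -> ->] := tmulE (sigma g) (tmul (fun=> a) (iter j x F g)) s p.
have [-> -> -> ->] := tmulE (fun=> a) (iter j x F g) s p.
have [-> -> -> ->] := tmulE (fun=> a) (x (iter j x F) g) s p.
by rewrite /xop; have [-> -> -> ->] := tmulE (sigma g) (iter j x F g) s p; split; ring.
Qed.

Lemma rescale_inj g f h : is_metric g -> (0 < d)%N -> positive_smooth f -> positive_smooth h -> rescale f g = rescale h g -> f = h.
Proof.
move=> mg d0 [_ f0] [_ h0] e; apply/funext => p; have [fr /nearby_sub ofr] := onb_ex rg mg p.
have := congr1 (fun g' : metric S => g' (fr (Ordinal d0)) (fr (Ordinal d0)) p) e.
by rewrite /rescale ofr eqxx !mulr1 => /eqP; rewrite eqrXn2 ?ltW // => /eqP ->.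
Qed.

(** A form given in one scale spreads to all of c by its weight; the conformal factor relating two
    metrics is unique by [rescale_inj], so the law holds. *)
Lemma form_ext g k w (B : dform S) : c g -> is_form k B -> exists2 A, form_section c k w A & A g = B.
Proof.
move=> cg hB; have mg := c_metric rg cc cg; have d0 : (0 < d)%N by exact: leq_trans d3.
pose om g' := such_that (fun=> 1 : R) [set Om : S -> R | positive_smooth Om /\ g' = rescale Om g].
have omP g' : c g' -> positive_smooth (om g') /\ g' = rescale (om g') g.
  move=> cg'; apply: (@such_thatP _ (fun=> 1 : R) [set Om : S -> R | positive_smooth Om /\ g' = rescale Om g]).
  by have [Om ? ?] := c_rel rg cc cg cg'; exists Om.
have omE g' Om : c g' -> positive_smooth Om -> g' = rescale Om g -> om g' = Om.
  by move=> cg' pOm e; have [p1 e1] := omP g' cg'; apply: (rescale_inj mg d0 p1 pOm); rewrite -e1.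
exists (fun g' => fmul (fun p => om g' p ^ w) B).
  split=> [g' cg'|g' Om cg' pOm].
    have [[so o0] _] := omP g' cg'; apply: (formM rg) => //; apply: (smXz rg) => // p; by rewrite gt_eqF.
  have [p1 e1] := omP g' cg'; rewrite (omE _ (fun p => Om p * om g' p)) ?(c_rescale rg cc) //.
  - by apply: dfP => s p; rewrite /fmul expfzMl mulrA.
  - exact: (c_rescale rg cc).
  - exact: (posM rg).
  - by rewrite {1}e1 rescaleM.
have g1 : g = rescale (fun=> 1) g by apply/funext => X; apply/funext => Y; apply/funext => p; rewrite /rescale expr1n mul1r.
rewrite (omE g (fun=> 1)) //; last by split; [exact: smooth_cst|move=> p; exact: ltr01].
by apply: dfP => s p; rewrite /fmul exp1rz mul1r.
Qed.

(** delta A changes by (d + w - k) iota(Ups) A; after division by d + w - k this is the term -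
    iota(Ups) of the west slot in the law of the south slot. *)
Lemma qW_section k w A : d%:Z + w - k != 0 -> form_section c k (w + k) A -> tractor_section c k w (qW d k w A).
Proof.
move=> dw [hA lA]; apply/tsP; split=> [g cg|g Om cg pOm].
  split; [exact: form0|exact: hA|exact: form0|].
  apply: (formN rg); apply: (formM rg); first exact: smooth_cst.
  exact: (fdelta_form rg (c_metric rg cc cg) (hA g cg)).
have [su dOm] := lgc pOm; have mg := c_metric rg cc cg; have hAg := hA g cg.
apply: slots_eqP => s p; have [-> -> -> ->] := lawE Om g k w (qW d k w A g) s p.
have e0 th (B : dform S) s' : (forall s, B s p = 0) -> exter th B s' p = 0 by exact: exter0.
have z s' : (0 : dform S) s' p = 0 by [].
rewrite /qW /north /west /east /south /= lA // !e0 //; split; rewrite ?z; try ring; first by rewrite /fmul addr0.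
rewrite (_ : (- fmul _ _) s p = - ((d%:Z + w - k)%:~R^-1 * fdelta d (rescale Om g) (fmul (fun p => Om p ^ (w + k)) (A g)) s p)) //.
rewrite (deltaW rg mg pOm dOm _ hAg) /fmul mul1r.
rewrite (_ : (- fmul _ _) s p = - ((d%:Z + w - k)%:~R^-1 * fdelta d g (A g) s p)) //.
have -> : d%:R + (w + k)%:~R - 2 * k%:~R = (d%:Z + w - k)%:~R :> R by rewrite intrB !intrD; ring.
have c0 : (d%:Z + w - k)%:~R != 0 :> R by rewrite intr_eq0.
set i := (X in - (X * _)); set e := (X in _ + X * inter _ _ _ _).
have ie : i * e = 1 by exact: mulVf.
rewrite /inter; have -> (o f a : R) : i * (o * (f + e * a)) = o * (i * f) + o * (i * e * a) by ring.
rewrite ie mul1r; transitivity (Om p ^ (w + k - 2) * (- (i * fdelta d g (A g) s p) - A g (grad g (fun p => ln (Om p)) :: s) p)); first by ring.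
by rewrite mulr0 !subr0 addr0.
Qed.

Lemma law_form g Om k w (F : slots S) : c g -> positive_smooth Om -> sform k F -> sform k (law Om g k w F).
Proof.
move=> cg pOm [hN hW hE hS]; have [su dOm] := lgc pOm; have O0 p : Om p != 0 by rewrite gt_eqF //; case: pOm.
have sO z : smooth (fun p => Om p ^ z) by apply: (smXz rg) => //; case: pOm.
have ex l (B : dform S) : is_form l B -> is_form (l + 1) (exter (fun X => der X (fun p => ln (Om p))) B).
  by move=> hB; apply: (exter_form rg) => //; [exact: clin_der|move=> X; exact: der_sm].
have e1 : k - 1 - 1 = k - 2 by ring.
have e2 : k - 2 + 1 = k - 1 by ring.
have hiN := form_inter (grad g (fun p => ln (Om p))) hN; rewrite e1 in hiN.
split; rewrite /law /north /west /east /south /=; apply: (formM rg) => //.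
- by apply: (formD rg) => //; have := ex _ _ hN; rewrite subrK.
- by apply: (formB rg).
- apply: (formB rg); last by have := ex _ _ hE; rewrite e2.
  apply: (formB rg); last exact: form_inter.
  apply: (formD rg) => //; apply: (formM rg); first exact: smooth_cst.
  apply: (formB rg); first by have := ex _ _ hiN; rewrite e2.
  by have := form_inter (grad g (fun p => ln (Om p))) (ex _ _ hN); rewrite subrK.
Qed.
End Truncations.

Section TractorDivision.
Context {R : realType} {n : nat} {M : bmanifold R n}.
Variables (c : set (metric M)) (sigma : metric M -> M -> R).
Hypothesis PE : poincare_einstein c sigma.
Let rg : regular M n.+1 := atlas_regular (atlasM M).
Let lgc := atlas_log_closed (atlasM M).

(** The slots are divided in each scale by [form_div]; the transformation law of the quotient
    follows by cancelling sigma. *)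
Lemma tractor_div k w (D : tractor M) : tractor_section c k w D ->
  (forall g p, c g -> boundary M p -> svan (D g) p) ->
  exists2 C, tractor_section c k (w - 1) C & forall g, c g -> D g = xop sigma C g.
Proof.
have [cc ds _ _ _] := PE; move=> hD D0; have /tsP [sD lD] := hD.
pose P g (C : slots M) := sform k C /\ D g = tmul (sigma g) C.
have ex g : c g -> exists C, P g C.
  move=> cg; have [hN hW hE hS] := sD g cg.
  have [N ? eN] := form_div cg PE hN (fun s q bq => let: And4 a _ _ _ := D0 g q cg bq s in a).
  have [W ? eW] := form_div cg PE hW (fun s q bq => let: And4 _ a _ _ := D0 g q cg bq s in a).
  have [E ? eE] := form_div cg PE hE (fun s q bq => let: And4 _ _ a _ := D0 g q cg bq s in a).
  have [T ? eT] := form_div cg PE hS (fun s q bq => let: And4 _ _ _ a := D0 g q cg bq s in a).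
  by exists (N, W, E, T); split=> //; apply: slots_eqP => s p; split.
pose C g := such_that 0 [set C : slots M | P g C].
have CP g : c g -> P g (C g) by move=> /ex h; exact: (@such_thatP _ 0 [set C : slots M | P g C]).
exists C; last by move=> g /CP [].
apply/tsP; split=> [g /CP [] //|g Om cg pOm].
have cg' := c_rescale rg cc cg pOm; have [hC eC] := CP _ cg; have [hC' eC'] := CP _ cg'.
have [h1 h2 h3 h4] := hC'; have [l1 l2 l3 l4] := law_form rg lgc (w - 1) cg pOm hC.
have [sO O0] := pOm; have On p : Om p != 0 by rewrite gt_eqF.
have key s r : [/\ sigma (rescale Om g) r * north (C (rescale Om g)) s r = sigma (rescale Om g) r * north (law Om g k (w - 1) (C g)) s r,
    sigma (rescale Om g) r * west (C (rescale Om g)) s r = sigma (rescale Om g) r * west (law Om g k (w - 1) (C g)) s r,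
    sigma (rescale Om g) r * east (C (rescale Om g)) s r = sigma (rescale Om g) r * east (law Om g k (w - 1) (C g)) s r &
    sigma (rescale Om g) r * south (C (rescale Om g)) s r = sigma (rescale Om g) r * south (law Om g k (w - 1) (C g)) s r].
  have [<- <- <- <-] := tmulE (sigma (rescale Om g)) (C (rescale Om g)) s r.
  rewrite -eC' lD // eC.
  have [-> -> -> ->] := lawE Om g k (w - 1) (C g) s r; have [-> -> -> ->] := lawE Om g k w (tmul (sigma g) (C g)) s r.
  have [-> -> -> ->] := tmulE (sigma g) (C g) s r.
  have [-> -> _ _] := tmulE (sigma g) (C g) (grad g (fun p => ln (Om p)) :: s) r.
  have L A B s' : (forall s, B s r = sigma g r * A s r) ->
      exter (fun X => der X (fun p => ln (Om p))) B s' r = sigma g r * exter (fun X => der X (fun p => ln (Om p))) A s' r.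
    by move=> e; rewrite (@exter_lin _ _ _ (sigma g r) 0 A A) ?mul0r ?addr0 // => t; rewrite e mul0r addr0.
  rewrite (L (north (C g)) (north (tmul (sigma g) (C g)))) //.
  rewrite (L (east (C g)) (east (tmul (sigma g) (C g)))) //.
  rewrite (L (inter (grad g (fun p => ln (Om p))) (north (C g))) (inter (grad g (fun p => ln (Om p))) (north (tmul (sigma g) (C g))))) //.
  rewrite (sigma_rescale ds _ cg pOm).
  have -> : Om r ^ (w + k) = Om r * Om r ^ (w - 1 + k).
    by rewrite -{2}[Om r]expr1z -expfzDr //; congr (_ ^ _); ring.
  have -> : Om r ^ (w + k - 2) = Om r * Om r ^ (w - 1 + k - 2).
    by rewrite -{2}[Om r]expr1z -expfzDr //; congr (_ ^ _); ring.
  by split; ring.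
have cn := sigma_cancel cg' PE.
apply: slots_eqP => s p; split.
- by apply: cn; [exact: form_sm h1|exact: form_sm l1|apply: nearbyT => r; have [] := key s r].
- by apply: cn; [exact: form_sm h2|exact: form_sm l2|apply: nearbyT => r; have [] := key s r].
- by apply: cn; [exact: form_sm h3|exact: form_sm l3|apply: nearbyT => r; have [] := key s r].
- by apply: cn; [exact: form_sm h4|exact: form_sm l4|apply: nearbyT => r; have [] := key s r].
Qed.
End TractorDivision.

(** * Existence of gamma *)

Section Correction.
Context {R : realType} {n : nat} {M : bmanifold R n}.
Variables (c : set (metric M)) (sigma : metric M -> M -> R) (g : metric M).
Hypothesis n2 : (2 <= n)%N.
Hypothesis cg : c g.
Hypothesis PE : poincare_einstein c sigma.
Let rg : regular M n.+1 := atlas_regular (atlasM M).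
Hypothesis rgB : regular (bdry M) n.
Let lgc := atlas_log_closed (atlasM M).
Let hinv := atlas_hinv (atlasM M).
Let hE g p cg := @einstein_unit R n M c sigma PE g cg p.
Let hdense g p u := fun cg => @density_int R n M c sigma g cg PE u p.
Let cc : conformal_class c. Proof. by case: PE. Qed.
Let ds : density_section c 1 sigma. Proof. by case: PE. Qed.
Let mg : is_metric g := c_metric rg cc cg.
Let sg := sigma g.
Let ssg : smooth (s := M) sg := sigma_smooth cg PE.
Let sg0 p : boundary M p -> sg p = 0. Proof. exact: (sigma_bdry cg PE). Qed.
Notation nu := (grad g sg).
Notation delta := (fdelta n.+1 g).
Notation h := (bdry_metric g).
Notation pull := (@pullback R n M (boundary M)).
Implicit Types (p q : M) (s : seq (vfield M)) (A B : dform M).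

Let d3 : (3 <= n.+1)%N. Proof. by []. Qed.

Let nu1 p : boundary M p -> g nu nu p = 1.
Proof. by move=> bp; rewrite (norm_nu rg d3 lgc cc ds hE hinv hdense cg) (sigma_bdry cg PE) //; ring. Qed.

Let nunu p : boundary M p -> exists a, forall u, der (levi_civita g nu nu) u p = a * der nu u p.
Proof. by move=> bp; eexists; exact: (nabla_nu_nu rg d3 lgc cc ds hE hinv hdense cg (sg0 bp)). Qed.

Let delta_nu k A s p : is_form k A -> delta A (nu :: s) p = - delta (inter nu A) s p.
Proof. by move=> hA; rewrite (fdelta_inter rg mg _ _ hA) ?opprK // => X Y q; exact: (hess_sym rg mg). Qed.

Let bext (pt : bdry M) : exists E : vfield (bdry M) -> vfield M, forall X, nearby pt (fun z => rel z X (E X)).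
Proof.
have /choice [E ?] : forall X : vfield (bdry M), exists Y, nearby pt (fun z => rel z X Y) by move=> X; exact: (rel_ext rgB).
by exists E.
Qed.

Variables (k : int) (A0 B0 : dform M) (ASigma phi : dform (bdry M)).
Hypothesis hA0 : is_form k A0.
Hypothesis hphi : is_form (k - 1) phi.
Hypothesis dA : fdelta n h ASigma = 0.
Hypothesis dphi : fdelta n h phi = 0.
Hypothesis dir : restricts_to nu A0 ASigma.
Hypothesis neu : restricts_to nu (nabla g nu (inter nu A0)) (- phi).
Hypothesis hB0 : is_form (k - 1) B0.
Hypothesis eB0 : forall s q, A0 (nu :: s) q = sg q * B0 s q.

Let iA0 : inter nu A0 = fmul (S := M) sg B0. Proof. by apply: dfP. Qed.

Let nuB0 s q : B0 (nu :: s) q = 0.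
Proof.
apply: (sigma_cancel cg PE (form_sm _ hB0) (smooth_cst M 0)); apply: nearbyT => r.
by rewrite -eB0 (form_diag _ _ _ hA0) mulr0.
Qed.

Let dA0nu s q : delta A0 (nu :: s) q = - (sg q * delta B0 s q).
Proof. by rewrite (delta_nu _ _ hA0) iA0 (fdelta_fmul rg mg _ _ ssg hB0) nuB0 add0r. Qed.

Let zero_delta s q : delta (inter nu B0) s q = 0.
Proof.
have hi := form_inter nu hB0; rewrite (@fdelta_lin _ _ _ rg g _ 0 0 _ _ _ s q hi hi) ?mul0r ?addr0 // => t r.
by rewrite /inter nuB0; ring.
Qed.

(** Since iota(nu) A0 = sigma B0 and nu(sigma) = 1 on the boundary. The Neumann condition therefore
    says that B0 restricts to - phi there. *)
Let dnB0 s q : boundary M q -> nabla g nu (inter nu A0) s q = B0 s q.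
Proof.
move=> bq; rewrite iA0 (nabla_fmul rg _ _ _ _ ssg hB0) sg0 // mul0r addr0.
by rewrite -(g_grad rg mg) nu1 // mul1r.
Qed.

(** In the normal direction both sides vanish. On tangential arguments the Gauss formula leaves
    delta_Sigma A_Sigma = 0 and the normal derivative of iota(nu) A0, which is B0. *)
Let delta_A0 s p : boundary M p -> delta A0 s p = B0 s p.
Proof.
move=> bp; pose pt : bdry M := exist _ p bp; apply/eqP; rewrite -subr_eq0; apply/eqP; have [E hEx] := bext pt.
have hC : is_form (k - 1) (delta A0 - B0) by apply: (formB rg) => //; exact: (fdelta_form rg mg).
apply: (bdry_zero rgB ssg mg sg0 nu1 hEx hC) => [t|t] /=; rewrite -[(_ - _) _ _]/(delta A0 _ _ - B0 _ _).
  by rewrite dA0nu nuB0 sg0 // mul0r oppr0 addr0.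
have An q s' : boundary M q -> A0 (nu :: s') q = 0 by move=> bq; exact: (dir.2).
rewrite (gauss rgB ssg mg sg0 nu1 nunu hEx _ hA0 An) dir.1 dA /= dnB0 // -[(0 : dform (bdry M)) _ _]/(0 : R).
by rewrite add0r subrr.
Qed.

(** The Gauss formula for B0: iota(nu) B0 = 0 everywhere, and B0 restricts to - phi, which is
    divergence-free. *)
Let delta_B0 s p : boundary M p -> delta B0 s p = 0.
Proof.
move=> bp; pose pt : bdry M := exist _ p bp; have [E hEx] := bext pt; have hC := fdelta_form rg mg hB0.
apply: (bdry_zero rgB ssg mg sg0 nu1 hEx hC) => [t|t] /=.
  by rewrite (delta_nu _ _ hB0) zero_delta oppr0.
rewrite (gauss rgB ssg mg sg0 nu1 nunu hEx _ hB0 (fun q s' _ => nuB0 s' q)) /=.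
have -> : nabla g nu (inter nu B0) (map E t) p = 0.
  rewrite (_ : inter nu B0 = fun s q => 0 * (0 : dform M) s q + 0 * (0 : dform M) s q).
    by rewrite (nabla_lin rg) ?mul0r ?addr0 //; exact: smooth_cst.
  by apply: dfP => u r; rewrite /inter nuB0 !mul0r addr0.
have -> : pull B0 = - phi.
  by rewrite -neu.1; apply: dfP => u r; rewrite /pullback dnB0 //; exact: (svalP r).
rewrite (@fdelta_lin _ _ _ rgB h _ (-1) 0 phi phi _ t _ hphi hphi) => [|u r]; last by rewrite mul0r addr0 mulN1r.
by rewrite dphi -[(0 : dform (bdry M)) _ _]/(0 : R); ring.
Qed.

(* B0 = iota(nu) A0 / sigma.  The boundary conditions give delta A0 = B0 and
   delta B0 = 0 on the boundary, and ga is obtained by solving delta ga = b near the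
   boundary with b = (delta A0 - B0) / sigma, which is divergence-free. *)
Lemma correction : exists ga : dform M, [/\ is_form k ga, forall s q, boundary M q -> ga s q = 0 &
  forall q, boundary M q -> nearby (S := M) q (fun r => forall s, delta (A0 - fmul (S := M) sg ga) s r = B0 s r - ga (nu :: s) r)].
Proof.
have hd := fdelta_form rg mg hA0.
have [be hbe ebe] : exists2 be : dform M, is_form (k - 1) be & forall s q, (delta A0 - B0) s q = sg q * be s q.
  apply: (form_div cg PE); first exact: (formB rg).
  by move=> s q bq; rewrite -[(_ - _) _ _]/(delta A0 s q - B0 s q) delta_A0 // subrr.
have ebe' s q : delta A0 s q = sg q * be s q + B0 s q.
  by rewrite -ebe -[(_ - _) _ _]/(delta A0 s q - B0 s q) subrK.
have benu s q : be (nu :: s) q = - delta B0 s q.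
  apply: (sigma_cancel cg PE (b := fun r => - delta B0 s r) (form_sm _ hbe)); first by apply: (smN rg); exact: form_sm (fdelta_form rg mg hB0).
  by apply: nearbyT => r; have := ebe' (nu :: s) r; rewrite dA0nu nuB0 addr0 => <-; rewrite mulrN.
(* 0 = delta delta A0 = iota(nu) be + sigma delta be + delta B0, and the first and last terms cancel
   by [benu]. *)
have dbe s q : delta be s q = 0.
  apply: (sigma_cancel cg PE (form_sm _ (fdelta_form rg mg hbe)) (smooth_cst M 0)); apply: nearbyT => r.
  have := fdelta_lin rg g s r (formM rg ssg hbe) hB0 (C := delta A0) (a := 1) (b := 1) (fun t u => _).
  rewrite (fdelta_fdelta rg mg hA0) (fdelta_fmul rg mg _ _ ssg hbe) benu !mul1r -[(0 : dform M) s r]/(0 : R) => e.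
  rewrite mulr0; have := e (fun t u => etrans (ebe' t u) (congr2 +%R (esym (mul1r _)) (esym (mul1r _)))).
  by rewrite -/sg; lra.
have [ga [hga ga0 dga]] := glue cg PE rgB mg nu1 hbe dbe (fun s q bq => etrans (benu s q) (etrans (congr1 -%R (delta_B0 s bq)) (oppr0 _))).
rewrite subrK in hga; exists ga; split=> // q bq; apply: nearbyW (dga q bq) => r e s.
rewrite (@fdelta_lin _ _ _ rg g k 1 (-1) A0 (fmul sg ga)) //; last first.
- by move=> t u; rewrite mul1r mulN1r.
- exact: (formM rg).
by rewrite (fdelta_fmul rg mg _ _ ssg hga) e ebe'; ring.
Qed.
End Correction.

Section Proca.
Context {R : realType} {n : nat} {M : bmanifold R n}.
Variables (c : set (metric M)) (sigma : metric M -> M -> R).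
Hypothesis n2 : (2 <= n)%N.
Hypothesis PE : poincare_einstein c sigma.
Let rg : regular M n.+1 := atlas_regular (atlasM M).
Let lgc := atlas_log_closed (atlasM M).
Let d3 : (3 <= n.+1)%N. Proof. by []. Qed.
Let cc : conformal_class c. Proof. by case: PE. Qed.
Let ds : density_section c 1 sigma. Proof. by case: PE. Qed.
Let hinv := atlas_hinv (atlasM M).
Let hE g p cg := @einstein_unit R n M c sigma PE g cg p.
Let hdense g (p : M) u := fun cg => @density_int R n M c sigma g cg PE u p.
Implicit Types (k w : int) (F G : tractor M) (g : metric M) (p : M).
Notation x := (xop sigma).
Notation K h l k w := (Ktrunc n.+1 sigma h l k w).
Notation delta g := (fdelta n.+1 g).

(** For w = k - n the coefficient d + w - k is 1, and the constraints reduce to iota(nu) A = sigma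
    delta A and iota(nu) delta A = 0. Applying delta to the first gives - iota(nu) delta A =
    iota(nu) delta A, hence the second. *)
Lemma qW_constr g k w (A : metric M -> dform M) p : c g -> is_form k (A g) -> w = k - n%:Z ->
  nearby (S := M) p (fun r => forall s, A g (nu sigma g :: s) r = sigma g r * delta g (A g) s r) ->
  constr (d := n.+1) sigma k w (qW n.+1 k w A) g p.
Proof.
move=> cg hA ew h; have mg := c_metric rg cc cg; have ssg := sigma_smooth cg PE.
have e1 : (n.+1%:Z + w - k)%:~R = 1 :> R by rewrite ew (_ : _ - k = 1) //; lia.
have e1' : n.+1%:R + w%:~R - k%:~R = 1 :> R by move: e1; rewrite rmorphB rmorphD.
have hd := fdelta_form rg mg hA.
have eS s r : south (qW n.+1 k w A g) s r = - delta g (A g) s r.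
  by rewrite -[LHS]/(- ((n.+1%:Z + w - k)%:~R^-1 * delta g (A g) s r)) e1 invr1 mul1r.
have dnu : nearby p (fun r => forall s, delta g (A g) (nu sigma g :: s) r = 0).
  have hi := form_inter (nu sigma g) hA.
  have h' : nearby p (fun r => forall s, inter (nu sigma g) (A g) s r = fmul (sigma g) (delta g (A g)) s r) by [].
  have := fdelta_near rg g hi (formM rg ssg hd) h'; apply: nearbyW => r hr s.
  have := fdelta_inter rg mg s r hA (fun X Y q => hess_sym rg mg (sigma g) X Y q).
  rewrite hr (fdelta_fmul rg mg _ _ ssg hd).
  by rewrite (fdelta_fdelta rg mg hA) -/(nu sigma g) -[(0 : dform M) s r]/(0 : R); lra.
apply: nearbyW (nearbyI rg h dnu) => r [{}h {}dnu]; split=> s.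
  split.
  - by rewrite -[LHS]/(- 0 - sigma g r * 0); ring.
  - rewrite -[LHS]/(rho n.+1 sigma g r * 0 + A g (nu sigma g :: s) r + sigma g r * south (qW n.+1 k w A g) s r).
    by rewrite eS h; ring.
  - by [].
  - by rewrite -[LHS]/(rho n.+1 sigma g r * 0 - south (qW n.+1 k w A g) (nu sigma g :: s) r) eS dnu; ring.
split=> //.
  by rewrite e1' mul1r eS -[west _]/(A g) subrr.
have hS : is_form (k - 1) (south (qW n.+1 k w A g)) by apply: (formN rg); apply: (formM rg) => //; exact: smooth_cst.
rewrite (@fdelta_lin _ _ _ rg g _ (-1) 0 (delta g (A g)) (delta g (A g)) _ s r hd hd) => [|t u]; last by rewrite eS; ring.
by rewrite (fdelta_fdelta rg mg hA) -[(0 : dform M) s r]/(0 : R); ring.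
Qed.

(** G = F + sigma C by [tractor_div], and the truncation of sigma C is sigma^(l+1) times a section
    by [K_x]. *)
Lemma K_agree k w F G l : tractor_section c k w F -> tractor_section c k w G ->
  (forall i, (2 <= i)%N -> n.+1%:R + 2 * w%:~R - i%:R != 0 :> R) ->
  (forall g p, c g -> boundary M p -> svan (tadd (-1) F G g) p) ->
  let h : R := n.+1%:R + 2 * w%:~R in bigO_sigma sigma c k w l.+1 (K h l k w G - K h l k w F).
Proof.
move=> hF hG hh hb h; have hD := ts_add rg (-1) hF hG.
have [C hC eC] := tractor_div PE hD hb.
have hx : tractor_section c k w (x C) by have := ts_x rg ds hC; rewrite subrK.
exists (fun g => tmul (fun=> Kcoef h l) (ypow n.+1 sigma l k (w - 1) C g)).
  rewrite (_ : w - l.+1%:Z = w - 1 - l%:Z); last by lia.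
  exact: (ts_cst rg _ (ts_ypow rg d3 lgc cc ds l hC)).
move=> g cg; rewrite xpow_cst.
have eG : G g = tadd 1 (x C) F g.
  apply: slots_eqP => s p; have [-> -> -> ->] := saddE 1 (x C g) (F g) s p.
  by rewrite -eC //; have [-> -> -> ->] := saddE (-1) (F g) (G g) s p; split; ring.
rewrite -[LHS]/(K h l k w G g - K h l k w F g) (K_eq _ _ _ _ _ eG) (K_tadd rg d3 lgc cc ds) // (K_x rg d3 lgc cc ds hE hinv hdense _ hC) //.
apply: slots_eqP => s p; set P := tmul _ _; set Q := K _ _ _ _ F g.
have [-> -> -> ->] := slotsD (sadd 1 P Q) (- Q) s p; have [-> -> -> ->] := slotsN Q s p.
by have [-> -> -> ->] := saddE 1 P Q s p; split; ring.
Qed.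
Lemma K_constraints h l k w F g p : tractor_section c k w F -> c g -> constr (d := n.+1) sigma k w F g p ->
  let A := K h l k w F in
  forall g' s, c g' -> let: (N, W, E, T) := A g' in
  [/\ svan (Istar n.+1 sigma A g') p, N s p = 0, E s p = 0, delta g' W s p + (n.+1%:R + w%:~R - k%:~R) * T s p = 0 & delta g' T s p = 0].
Proof.
move=> hF cg hc A g' s cg'; have [h1 h2] := K_vanish rg d3 lgc cc ds hE hinv hdense h l hF cg cg' hc.
by have := h2 s; rewrite -/A; move: h1; rewrite -/A; case: (A g') => -[[N W] E] T h1 [? ? ? ?]; split.
Qed.

Lemma K_solution k w F g l : tractor_section c k w F -> c g ->
  (forall i, (2 <= i)%N -> n.+1%:R + 2 * w%:~R - i%:R != 0 :> R) ->
  let h : R := n.+1%:R + 2 * w%:~R in let A := K h l k w F in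
  bigO_sigma sigma c k (w - 1) l (yop n.+1 sigma k w A) /\
  forall g', c g' ->
    [/\ vanishes_on [set p | constr (d := n.+1) sigma k w F g p] (Istar n.+1 sigma A g'),
        vanishes_on [set p | constr (d := n.+1) sigma k w F g p] (Dhatstar n.+1 k w A g') &
        vanishes_on [set p | constr (d := n.+1) sigma k w F g p] (Xstar A g')].
Proof.
move=> hF cg hh h A; split.
  exists (fun g => tmul (fun=> Kcoef h l) (ypow n.+1 sigma l.+1 k w F g)) => [|g' cg'].
    rewrite (_ : w - 1 - l%:Z = w - l.+1%:Z); last by lia.
    exact: (ts_cst rg _ (ts_ypow rg d3 lgc cc ds l.+1 hF)).
  by rewrite xpow_cst (y_K rg d3 lgc cc ds hE hinv hdense).
move=> g' cg'.
have e : (n.+1%:Z + w - k)%:~R = n.+1%:R + w%:~R - k%:~R :> R by rewrite rmorphB rmorphD.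
split=> s p hp; have := @K_constraints h l k w F g p hF cg hp g' s cg'; rewrite -/A /Dhatstar /Xstar.
- by case: (A g') => -[[N W] E] T [h1 _ _ _ _]; exact: h1.
- case: (A g') => -[[N W] E] T [_ _ _ h1 h2]; split=> //.
    rewrite -[LHS]/(delta g' W s p + (T *~ (n.+1%:Z + w - k)) s p) dfMzE.
    by rewrite -mulrzr e mulrC.
  by rewrite -[LHS]/(- delta g' T s p) h2 oppr0.
- by case: (A g') => -[[N W] E] T [_ ? ? _ _]; split.
Qed.
End Proca.

Lemma boundary_regular (R : realType) n (M : bmanifold R n) (c : set (metric M)) sigma g :
  c g -> poincare_einstein c sigma -> (0 < n)%N -> regular (bdry M) n.
Proof. by case: n M c sigma g => // n M c sigma g cg PE _; exact: atlas_regular (atlas_bdry cg PE). Qed.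

Unset Implicit Arguments.
Theorem theorem5p28 (R : realType) (n k : nat) (hn : (2 <= n)%N)
    (hk : (k <= n.-1./2)%N)
    (M : bmanifold R n) (c : set (metric M)) (sigma : metric M -> M -> R)
    (PE : poincare_einstein c sigma)
    (ASigma phiSigma : metric (bdry M) -> dform (bdry M))
    (hA : form_section (bdry_class c) k%:Z (2 * k%:Z - n%:Z) ASigma)
    (hphi : form_section (bdry_class c) (k%:Z - 1) (2 * k%:Z - n%:Z - 2) phiSigma)
    (g : metric M) (hg : c g)
    (deltaA : fdelta n (bdry_metric g) (ASigma (bdry_metric g)) = 0)
    (deltaphi : fdelta n (bdry_metric g) (phiSigma (bdry_metric g)) = 0)
    (A0 : metric M -> dform M)
    (hA0 : form_section c k%:Z (2 * k%:Z - n%:Z) A0)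
    (dirichlet : restricts_to (nu sigma g) (A0 g) (ASigma (bdry_metric g)))
    (neumann : restricts_to (nu sigma g)
       (nabla g (nu sigma g) (inter (nu sigma g) (A0 g)))
       (- phiSigma (bdry_metric g))) :
  let w : int := k%:Z - n%:Z in
  let h0 : R := (2 * k%:Z - n%:Z + 1)%:~R in
  let q : tractor M := qW n.+1 k%:Z w A0 in
  exists (U : set M) (Ai : nat -> tractor M),
    [/\ open U, boundary M `<=` U,
        forall g', c g' -> Ai 0%N g' = q g',
        forall i : nat, tractor_section c k%:Z (w - i%:Z) (Ai i) &
    forall l : nat, exists Al : tractor M,
    [/\ tractor_section c k%:Z w Al,
        bigO_sigma sigma c k%:Z w l.+1
          (Al - \sum_(i < l.+1) iter i (xop sigma) (Ai i)),
        bigO_sigma sigma c k%:Z w l.+1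
          (Al - Ktrunc n.+1 sigma h0 l k%:Z w q),
        bigO_sigma sigma c k%:Z (w - 1) l
          (yop n.+1 sigma k%:Z w Al) &
        forall g', c g' ->
          [/\ vanishes_on U (Istar n.+1 sigma Al g'),
              vanishes_on U (Dhatstar n.+1 k%:Z w Al g') &
              vanishes_on U (Xstar Al g')]]].
Proof.
move=> w h0 q.
have rg : regular M n.+1 := atlas_regular (atlasM M); have lgc := atlas_log_closed (atlasM M).
have d3 : (3 <= n.+1)%N by [].
have [cc ds _ _ _] := PE; have mg := c_metric rg cc hg; have ssg := sigma_smooth hg PE.
have rgB := boundary_regular hg PE (ltnW hn).
have hAg := hA0.1 g hg; have hphig := hphi.1 _ (imageP _ hg).
have [B0 hB0 eB0] := form_div hg PE (form_inter (nu sigma g) hAg) (fun s p bp => dirichlet.2 s p bp).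
have [ga [hga ga0 dga]] := correction hn hg PE rgB hAg hphig deltaA deltaphi dirichlet neumann hB0 eB0.
have sga := formM rg ssg hga.
have ew : w + k%:Z = 2 * k%:Z - n%:Z by rewrite /w; lia.
(* sigma gamma is built in the scale g only; [G] is the weighted section with this value in g. *)
have [G hG eG] := form_ext rg d3 cc (2 * k%:Z - n%:Z) hg sga.
pose A' g' : dform M := A0 g' - G g'.
have eA' : A' g = A0 g - fmul (sigma g) ga by rewrite /A' eG.
have hA' : form_section c k%:Z (w + k%:Z) A'.
  rewrite ew; split=> [g' cg'|g' Om cg' pOm]; first by apply: (formB rg); [exact: hA0.1|exact: hG.1].
  rewrite /A' hA0.2 // hG.2 //; apply: dfP => s p.
  by rewrite -[LHS]/(Om p ^ _ * A0 g' s p - Om p ^ _ * G g' s p) -mulrBr.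
have dw : n.+1%:Z + w - k%:Z != 0 by rewrite /w; lia.
have tq : tractor_section c k%:Z w q by apply: (qW_section rg lgc cc) => //; rewrite ew.
pose q' := qW n.+1 k%:Z w A'.
have tq' : tractor_section c k%:Z w q' by exact: (qW_section rg lgc cc).
(* d + 2w = 2k - n + 1 is at most 0 by the bound on k, so no denominator of the series vanishes. *)
have hh i : (2 <= i)%N -> n.+1%:R + 2 * w%:~R - i%:R != 0 :> R.
  move=> i2; have -> : n.+1%:R + 2 * w%:~R - i%:R = (n.+1%:Z + 2 * w - i%:Z)%:~R :> R by rewrite intrB intrD intrM.
  by rewrite intr_eq0 /w; lia.
have -> : h0 = n.+1%:R + 2 * w%:~R.
  have -> : h0 = (n.+1%:Z + 2 * w)%:~R by rewrite /h0; congr (_%:~R); rewrite /w; lia.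
  by rewrite intrD intrM.
(* In the south slot delta(sigma ga) = iota(nu) ga + sigma delta ga vanishes on the boundary,
   because ga and sigma do. *)
have eqq g' p : c g' -> boundary M p -> svan (tadd (-1) q q' g') p.
  move=> cg' bp; apply: (svan_all rg cc (ts_add rg (-1) tq tq') hg cg') => s.
  have [-> -> -> ->] := saddE (-1) (q g) (q' g) s p; have s0 := sigma_bdry hg PE bp.
  rewrite -[west _]/(A0 g) -[west (q' g)]/(A' g) eA' -[(_ - fmul _ _) s p]/(A0 g s p - sigma g p * ga s p) s0.
  rewrite -[south (q g) s p]/(- (_^-1 * fdelta n.+1 g (A0 g) s p)) -[south (q' g) s p]/(- (_^-1 * fdelta n.+1 g (A' g) s p)).
  have -> : fdelta n.+1 g (A' g) s p = fdelta n.+1 g (A0 g) s p.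
    rewrite (@fdelta_lin _ _ _ rg g k%:Z 1 (-1) (A0 g) (fmul (sigma g) ga)) //; last first.
      by move=> t r; rewrite eA' mul1r mulN1r.
    by rewrite (fdelta_fmul rg mg _ _ ssg hga) s0 ga0 //; ring.
  by split; rewrite -?[north _ s p]/(0 : R) -?[east _ s p]/(0 : R); ring.
(* One neighbourhood for all orders l: it is where q' satisfies the constraints, and the truncations
   inherit them pointwise. *)
pose U := [set p : M | constr (d := n.+1) sigma k%:Z w q' g p].
pose h := n.+1%:R + 2 * w%:~R : R.
pose Ai i : tractor M := fun g' => tmul (fun=> Kcoef h i) (ypow n.+1 sigma i k%:Z w q g').
have eK l : \sum_(i < l.+1) iter i (xop sigma) (Ai i) = Ktrunc n.+1 sigma h l k%:Z w q.
  by apply/funext => g'; rewrite fct_sumE; apply: eq_bigr => i _; rewrite xpow_cst.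
exists U, Ai; split.
- rewrite openE => p Up; have [W [oW Wp hW]] := nearbyM_open (nearby_nearby Up).
  by apply: (filterS (P := W)) => //; exact: open_nbhs_nbhs.
- move=> p bp; apply: (qW_constr hn PE hg (hA'.1 g hg)) => //.
  apply: nearbyW (dga p bp) => r e s; rewrite eA' e.
  rewrite -[LHS]/(A0 g (nu sigma g :: s) r - sigma g r * ga (nu sigma g :: s) r).
  by rewrite -[A0 _ _ _]/(inter (nu sigma g) (A0 g) s r) eB0 mulrBr.
- move=> g' cg'; apply: slots_eqP => s p; rewrite /Ai /Kcoef big_geq // fact0 mulr1 invr1.
  by have [-> -> -> ->] := tmulE (fun=> 1) (ypow n.+1 sigma 0 k%:Z w q g') s p; rewrite !mul1r.
- by move=> i; exact: (ts_cst rg _ (ts_ypow rg d3 lgc cc ds i tq)).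
(* The solution is the truncation applied to q', which satisfies the constraints; the expansion is
   that of the truncation applied to q, and [ag] compares the two. *)
move=> l; exists (Ktrunc n.+1 sigma h l k%:Z w q').
have [y0 cs] := K_solution hn PE l tq' hg hh.
have ag := K_agree hn PE l tq tq' hh eqq.
by split=> //; [exact: (ts_K rg d3 lgc cc ds)|rewrite eK].
Qed.
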